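(* Let $T>0$, $\gamma>0$, $\beta\in(0,1]$, and let $X=(X_t,\mathcal G(I),\mathbb P_{r,\mu})$ be the superprocess with one-particle motion $Z$, $K(ds)=\gamma\,ds$ and $\psi(s,y,\xi)=\xi^{1+\beta}$. Let $J_A$ be the $J$-functional of $X$ associated with a given $A\in\mathcal A_T^1$. For fixed $r\le T$ and $z\in S$, define the finite nonnegative Borel measure $\alpha_{r,z}(ds)$ on $[r,T]$ by $$\int f(s)\,\alpha_{r,z}(ds)=E_{r,z}\Bigl[\int_{[r,T]}f(s)\,A(ds)\Bigr]\qquad\text{for bounded measurable }f:[r,T]\to\mathbb R.$$ Then the conditional expectation of $J_A$ given the evolution of the total mass process $(\langle1,X_t\rangle)_{r\le t\le T}$ is $$\mathbb E_{r,\delta_z}\bigl[J_A\,\big|\,\langle1,X_t\rangle,\ r\le t\le T\bigr]=\int_{[r,T]}\langle1,X_t\rangle\,\alpha_{r,z}(dt).$$ Moreover, $$\mathbb E_{r,\delta_z}\bigl[e^{-J_A}\bigr]\ge\mathbb E_{r,\delta_z}\Bigl[e^{-\int_{[r,T]}\langle1,X_t\rangle\,\alpha_{r,z}(dt)}\Bigr].$$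
   Context: Markov process: $Z=(Z_t,\mathcal F(I),P_{r,z})$ is a time-inhomogeneous right (Markov) process with sample space $(\Omega,\mathcal F)$ and state space $(S,\mathcal B)$, where $S$ is a metrizable Luzin space with Borel field $\mathcal B$. The $\sigma$-algebra $\mathcal F(I)\subset\mathcal F$ contains the events observable during the time interval $I\subset[0,\infty)$. $P_{r,\mu}$ is the measure under which $Z$ starts at time $r\ge0$ with initial distribution $\mu$; $P_{r,z}=P_{r,\delta_z}$. ''Right process'' means that $t\mapsto Z_t(\omega)$ is càdlàg and that for $r<t$, measurable $f:S\to\mathbb R_+$ and probability measures $\mu$, the process $s\mapsto E_{s,Z_s}[f(Z_t)]$ is $P_{r,\mu}$-a.s. right-continuous on $[r,t)$. Additive functionals: a nonnegative additive functional $A$ of $Z$ is a random measure $A(dt)$ on $[0,\infty)$ such that $A(I)$ depends only on events in (the completion of) $\mathcal F(I)$ for every interval $I$. $\mathcal A_{(1)}$: those of the form $A[s,u]=\sum_{s\le t_i\le u}f_i(Z_{t_i})$ with finitely many times $t_1<\dots<t_n$ and bounded measurable $f_i\ge0$. $\mathcal A_{(2)}$: those $A$ for which there are $A_n\in\mathcal A_{(1)}$ with $A_n[r,\infty)\to A[r,\infty)$ $P_{r,z}$-a.s. for all $(r,z)$, with $A_n[T',\infty)=0$ for all $n$ for some $T'>0$, and $\sup_{\omega,n}A_n[0,T'](\omega)<\infty$. $\mathcal A$: all nonnegative additive functionals $A$ for which there are $A_n\in\mathcal A_{(2)}$ with $A_n(B)\nearrow A(B)$ for all measurable $B\subset\mathbb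 R_+$. $\mathcal A_T^1:=\{A\in\mathcal A: E_{r,z}[A[r,T]]<\infty$ and $A(T,\infty)=0$ $P_{r,z}$-a.s. for all $(r,z)\in[0,T]\times S\}$. Superprocess: with $\langle f,\nu\rangle=\int f\,d\nu$, $X$ is the time-inhomogeneous Markov process on the space $\mathcal M$ of finite nonnegative Borel measures on $S$ with $\mathbb E_{r,\mu}[e^{-\langle f,X_t\rangle}]=e^{-\langle u(r,\cdot),\mu\rangle}$ for bounded measurable $f\ge0$ and $r\le t$, where $u$ is the unique nonnegative solution of $u(s,y)=E_{s,y}[f(Z_t)]-\gamma E_{s,y}[\int_s^t u(\tau,Z_\tau)^{1+\beta}\,d\tau]$, $r\le s\le t$. Convention: $X_t=0$ $\mathbb P_{r,\mu}$-a.s. for $t<r$. $J$-functionals: for $A\in\mathcal A_{(1)}$ given by $A[s,u]=\sum_{s\le t_i\le u}f_i(Z_{t_i})$ with finitely many times $t_1<\dots<t_n$ and bounded measurable $f_i\ge0$, $J_A:=\sum_i\langle f_i,X_{t_i}\rangle$; for general $A\in\mathcal A$, $J_A$ is obtained by passing to the limit along approximating sequences as in the definitions of $\mathcal A_{(2)}$ and $\mathcal A$ (Dynkin). $J_A$ is additive in $A$; for $A\in\mathcal A_T^1$ one has $\mathbb E_{r,\mu}[e^{-J_A}]=e^{-\langle v(r,\cdot),\mu\rangle}$, where $v$ solves $v(r,y)=E_{r,y}[A[r,T]]-\gamma E_{r,y}[\int_r^T v(s,Z_s)^{1+\beta}\,ds]$, $0\le r\le T$. For a deterministic finite Borel measure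 $\nu$ on $[0,T]$, regarded as an additive functional, $J_\nu=\int\langle1,X_t\rangle\,\nu(dt)$. *)

(* Defs.v *)
From HB Require Import structures.
From mathcomp Require Import all_boot all_order all_algebra.
From mathcomp Require Import all_classical all_reals all_analysis.
From mathcomp Require Import measurable_realfun.

Set Implicit Arguments.
Unset Strict Implicit.
Unset Printing Implicit Defensive.

Import Order.TTheory GRing.Theory Num.Theory.
Import numFieldNormedType.Exports.

Local Open Scope classical_set_scope.
Local Open Scope ring_scope.
Local Open Scope ereal_scope.

Notation borel S := (g_sigma_algebraType (@open S)).

(* Homeomorphic to a Borel subset of a compact metric space. *)
Definition metrizable_luzin (R : realType) (S : topologicalType) : Prop :=
  exists (K : metricType R) (i : S -> K),
    [/\ compact [set: K], injective i,
        (forall U : set S,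
           open U <-> exists2 V : set K, open V & U = i @^-1` V) &
        <<s (@open K) >> (range i)].

Section finite_measures.
Context d (T : measurableType d) (R : realType).

Definition finmeas : Type := {finite_measure set T -> \bar R}.

HB.instance Definition _ := gen_eqMixin finmeas.
HB.instance Definition _ := gen_choiceMixin finmeas.
HB.instance Definition _ := isPointed.Build finmeas mzero.

Definition finmeas_eval (B : set T) (mu : finmeas) : \bar R := mu B.

(* The sigma-algebra generated by the evaluations mu |-> mu B, B measurable. *)
Definition finmeas_measurable : set (set finmeas) :=
  <<s \bigcup_(B in measurable)
        preimage_set_system [set: finmeas] (finmeas_eval B) measurable >>.

Let finmeas_measurable0 : finmeas_measurable set0.
Proof. exact: sigma_algebra0. Qed.

Let finmeas_measurableC (U : set finmeas) :
  finmeas_measurable U -> finmeas_measurable (~` U).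
Proof. exact: sigma_algebraC. Qed.

Let finmeas_measurableU (U : (set finmeas)^nat) :
  (forall i, finmeas_measurable (U i)) -> finmeas_measurable (\bigcup_i U i).
Proof. exact: sigma_algebra_bigcup. Qed.

Definition finmeas_display : measure_display.
Proof. by constructor. Qed.

HB.instance Definition _ :=
  @isMeasurable.Build finmeas_display finmeas finmeas_measurable
    finmeas_measurable0 finmeas_measurableC finmeas_measurableU.

End finite_measures.

Section markov.
Context {R : realType} {d dE : measure_display}.
Context {Omega : measurableType d} {E : measurableType dE}.

Definition time_interval (I : set R) : Prop :=
  is_interval I /\ I `<=` `[0%R, +oo[.

(* [P r mu] is the law of the process started at time r with initial
   distribution mu; the usual P_{r,z} is [P r \d_z]. *)
Record markov_process (Z : R -> Omega -> E) (F : set R -> set (set Omega))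
    (P : R -> probability E R -> probability Omega R) : Prop := MarkovProcess {
  markov_sigma : forall I, time_interval I -> sigma_algebra [set: Omega] (F I) ;
  markov_sub : forall I, time_interval I -> F I `<=` measurable ;
  markov_mono : forall I I', time_interval I -> time_interval I' ->
    I `<=` I' -> F I `<=` F I' ;
  markov_adapted : forall I (t : R), time_interval I -> I t ->
    forall B, measurable B -> F I (Z t @^-1` B) ;
  markov_measurable : forall (r : R) C, (0 <= r)%R -> F `[r, +oo[%classic C ->
    measurable_fun [set: E] (fun z => P r \d_z C) ;
  markov_mixture : forall (r : R) mu C, (0 <= r)%R -> F `[r, +oo[%classic C ->
    P r mu C = \int[mu]_z P r \d_z C ;
  markov_initial : forall (r : R) mu B, (0 <= r)%R -> measurable B ->
    P r mu (Z r @^-1` B) = mu B ;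
  markov_property : forall (r t : R) mu B C, (0 <= r <= t)%R ->
    F `[r, t]%classic B -> F `[t, +oo[%classic C ->
    P r mu (B `&` C) = \int[P r mu]_(w in B) P t \d_(Z t w) C }.

End markov.

Section additive_functionals.
Context {R : realType} {d : measure_display}.
Context {Omega : measurableType d} {S : ptopologicalType}.
Variables (Z : R -> Omega -> S) (F : set R -> set (set Omega)).
Variable P : R -> probability (borel S) R -> probability Omega R.

Definition right_process : Prop :=
  [/\ (forall w (t : R), (0 <= t)%R -> Z s w @[s --> t^'+] --> Z t w),
      (forall w (t : R), (0 < t)%R -> cvg (Z s w @[s --> t^'-])) &
      forall (r t : R) (f : borel S -> R) mu, (0 <= r < t)%R ->
        measurable_fun setT f -> (forall y, 0 <= f y)%R ->
        {ae P r mu, forall w, forall s : R, (r <= s < t)%R ->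
          \int[P s' \d_(Z s' w : borel S)]_w' (f (Z t w'))%:E @[s' --> s^'+] -->
          \int[P s \d_(Z s w : borel S)]_w' (f (Z t w'))%:E}].

Definition completion (Q : set Omega -> \bar R) (H : set (set Omega)) :
    set (set Omega) :=
  [set C | exists B N,
     [/\ H B, H N, Q N = 0 & (C `\` B) `|` (B `\` C) `<=` N]].

(* A random measure is a kernel from Omega to the line; only its values on
   subsets of [0, +oo[ are ever used. Completing F(I) makes sense for the laws
   P_{r,mu} of the processes started before I. *)
Definition additive_functional (A : R.-ker Omega ~> R) : Prop :=
  forall I (r : R) mu, time_interval I -> (0 <= r)%R -> I `<=` `[r, +oo[ ->
  forall B : set (\bar R), measurable B ->
    completion (P r mu) (F I) ((fun w => A w I) @^-1` B).

(* Admissible data (t_i, f_i) for the functionals sum_i f_i(Z_{t_i}). *)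
Record simple_data n (t : 'I_n -> R) (f : 'I_n -> borel S -> R) : Prop :=
  SimpleData {
  simple_time_ge0 : forall i, (0 <= t i)%R ;
  simple_time_lt : forall i j : 'I_n, (i < j)%N -> (t i < t j)%R ;
  simple_measurable : forall i, measurable_fun setT (f i) ;
  simple_ge0 : forall i y, (0 <= f i y)%R ;
  simple_bounded : forall i, exists M : R, forall y, (f i y <= M)%R }.

Definition simple_repr (A : R.-ker Omega ~> R) n (t : 'I_n -> R)
    (f : 'I_n -> borel S -> R) : Prop :=
  simple_data t f /\
  forall w (s u : R), (0 <= s <= u)%R ->
    A w `[s, u]%classic = \sum_(i < n | (s <= t i <= u)%R) (f i (Z (t i) w))%:E.

Definition calA1 (A : R.-ker Omega ~> R) : Prop :=
  additive_functional A /\ exists n t f, @simple_repr A n t f.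

Definition calA2_approx (An : nat -> R.-ker Omega ~> R)
    (A : R.-ker Omega ~> R) : Prop :=
  [/\ (forall n, calA1 (An n)),
      (forall (r : R) z, (0 <= r)%R ->
        {ae P r \d_z, forall w,
          An n w `[r, +oo[%classic @[n --> \oo] --> A w `[r, +oo[%classic}) &
      exists T' : R, [/\ (0 < T')%R,
        (forall n w, An n w `[T', +oo[%classic = 0) &
        exists M : R, forall n w, An n w `[0%R, T']%classic <= M%:E]].

Definition calA2 (A : R.-ker Omega ~> R) : Prop :=
  additive_functional A /\ exists An, calA2_approx An A.

Definition calA_approx (An : nat -> R.-ker Omega ~> R)
    (A : R.-ker Omega ~> R) : Prop :=
  (forall n, calA2 (An n)) /\
  forall B : set R, measurable B -> B `<=` `[0%R, +oo[ -> forall w,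
    nondecreasing_seq (fun n => An n w B) /\
    An n w B @[n --> \oo] --> A w B.

Definition calA (A : R.-ker Omega ~> R) : Prop :=
  additive_functional A /\ exists An, calA_approx An A.

Definition calAT1 (T : R) (A : R.-ker Omega ~> R) : Prop :=
  calA A /\
  forall (r : R) z, (0 <= r <= T)%R ->
    \int[P r \d_z]_w A w `[r, T]%classic < +oo /\
    {ae P r \d_z, forall w, A w `]T, +oo[%classic = 0}.

End additive_functionals.

Section superprocess.
Context {R : realType} {d d' : measure_display}.
Context {Omega : measurableType d} {Omega' : measurableType d'}.
Context {S : ptopologicalType}.
Variables (Z : R -> Omega -> S).
Variable P : R -> probability (borel S) R -> probability Omega R.
Variables (gamma beta : R).

(* No joint measurability of u is demanded: [cumulant_path] is what gives a
   meaning to the integral of u(tau, Z_tau) over time and over Omega. *)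
Record cumulant_solution (t : R) (f : borel S -> R) (u : R -> borel S -> R) :
    Prop := CumulantSolution {
  cumulant_ge0 : forall (s : R) y, (0 <= s <= t)%R -> (0 <= u s y)%R ;
  cumulant_measurable : forall s : R, (0 <= s <= t)%R -> measurable_fun setT (u s) ;
  cumulant_path : forall (r : R) mu, (0 <= r <= t)%R ->
    exists2 U : R * Omega -> R, measurable_fun setT U &
      {ae P r mu, forall w, forall s : R, (r <= s <= t)%R -> u s (Z s w) = U (s, w)} ;
  cumulant_eq : forall (s : R) y, (0 <= s <= t)%R ->
    (u s y)%:E = \int[P s \d_y]_w (f (Z t w))%:E -
      gamma%:E * \int[P s \d_y]_w
        \int[lebesgue_measure]_(tau in `[s, t])
          ((u tau (Z tau w)) `^ (1 + beta))%:E }.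

Variables (X : R -> Omega' -> finmeas (borel S) R).
Variable G : set R -> set (set Omega').
Variable PX : R -> probability (finmeas (borel S) R) R -> probability Omega' R.

Definition total_mass (t : R) (w : Omega') : \bar R := X t w [set: S].

(* The law of X started at time r from the finite measure mu is [PX r \d_mu].
   Joint measurability of the total mass is what makes its time integrals
   random variables. *)
Record superprocess : Prop := Superprocess {
  super_markov : markov_process X G PX ;
  super_null : forall (r : R) mu (t : R), (0 <= t < r)%R ->
    {ae PX r \d_mu, forall w, total_mass t w = 0} ;
  super_mass_measurable :
    measurable_fun ([set s : R | 0 <= s]%R `*` [set: Omega'])
      (fun tw : R * Omega' => total_mass tw.1 tw.2) ;
  super_laplace : forall (t : R) (f : borel S -> R), (0 <= t)%R ->
    measurable_fun setT f -> (forall y, 0 <= f y)%R ->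
    (exists M : R, forall y, f y <= M)%R ->
    exists2 u, cumulant_solution t f u &
      forall (r : R) mu, (0 <= r <= t)%R ->
        \int[PX r \d_mu]_w expeR (- \int[X t w]_y (f y)%:E) =
        expeR (- \int[mu]_y (u r y)%:E) }.

(* Convergence in probability of [0, +oo]-valued variables, for the metric of
   \bar R (infinite limits are allowed). *)
Definition cvg_probability (Q : probability Omega' R)
    (Jn : nat -> Omega' -> \bar R) (J : Omega' -> \bar R) : Prop :=
  forall e : R, (0 < e)%R ->
    Q [set w | ~ ball (J w) e (Jn n w)] @[n --> \oo] --> 0.

Variable F : set R -> set (set Omega).

(* [J_functional Q A J]: J is a version of J_A under Q; J_A is constructed by
   limits in Q-probability and hence determined up to Q-null sets. *)
Definition J_functional1 (A : R.-ker Omega ~> R) (J : Omega' -> \bar R) :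
    Prop :=
  exists n t f, @simple_repr _ _ Omega S Z A n t f /\
    forall w, J w = \sum_(i < n) \int[X (t i) w]_y (f i y)%:E.

Definition J_functional2 (Q : probability Omega' R) (A : R.-ker Omega ~> R)
    (J : Omega' -> \bar R) : Prop :=
  measurable_fun setT J /\
  exists An Jn, [/\ calA2_approx Z F P An A,
    (forall n, J_functional1 (An n) (Jn n)) & cvg_probability Q Jn J].

Definition J_functional (Q : probability Omega' R) (A : R.-ker Omega ~> R)
    (J : Omega' -> \bar R) : Prop :=
  measurable_fun setT J /\
  exists An Jn, [/\ calA_approx Z F P An A,
    (forall n, J_functional2 Q (An n) (Jn n)) & cvg_probability Q Jn J].

Definition mass_sigma_algebra (r T : R) : set (set Omega') :=
  <<s [set C | exists (t : R) (B : set (\bar R)),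
         [/\ (r <= t <= T)%R, measurable B & C = total_mass t @^-1` B]] >>.

(* Y = E_Q[J | H] almost surely. *)
Definition is_cond_exp (Q : probability Omega' R) (H : set (set Omega'))
    (J Y : Omega' -> \bar R) : Prop :=
  [/\ Q.-integrable setT J,
      (exists2 Y' : Omega' -> \bar R,
         forall B, measurable B -> H (Y' @^-1` B) &
         {ae Q, forall w, Y w = Y' w}) &
      forall C, H C -> \int[Q]_(w in C) Y w = \int[Q]_(w in C) J w].

End superprocess.

Definition is_mean_measure {R : realType} {d : measure_display}
    {Omega : measurableType d} (Q : probability Omega R)
    (A : R.-ker Omega ~> R) (r T : R) (alpha : {finite_measure set R -> \bar R}) :
    Prop :=
  forall f : R -> R, measurable_fun `[r, T] f ->
    (exists M : R, forall s : R, (r <= s <= T)%R -> `|f s| <= M)%R ->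
    \int[alpha]_(s in `[r, T]) (f s)%:E =
    \int[Q]_w \int[A w]_(s in `[r, T]) (f s)%:E.

(* Main.v *)
Require Import Defs.
From mathcomp Require Import all_boot all_order all_algebra.
From mathcomp Require Import all_classical all_reals all_analysis.
From mathcomp Require Import measurable_realfun ring lra.

Import Order.TTheory GRing.Theory Num.Theory.
Import numFieldNormedType.Exports.

Local Open Scope classical_set_scope.
Local Open Scope ring_scope.
Local Open Scope ereal_scope.

(** The log-Laplace functional of the superprocess, minus the logarithm of the
transform of a pairing, solves the cumulant equation. Since every particle
branches at the same rate, the cumulant of a constant terminal value is
constant in space (logl_cst), and around it the equation linearizes with a
coefficient that depends on time only (logl_first_order). Consequently tilting
by exp (- c M_t), where M is the total mass, multiplies the mean measure of
X_t by a constant (mean_pairing_exp_mass). Iterating with the Markov property,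
for every nonnegative combination N of total masses at finitely many times and
every test function f, the mean of the pairing of f with X_t, weighted by exp
(- N), is phi_N(t) E_{r,z} f(Z_t), where phi_N(t) is the mean of M_t exp (-
N): this is weighted_mean.

So both J_A and the averaged mass Y, the integral of M_t against alpha, have
the same mean after multiplication by exp (- N): for either of them it is the
Stieltjes integral of phi_N against the decreasing function s |-> E_{r,z} A[s,
+oo[ (mean_functional, mean_spec_averaged_mass, stieltjes_unique). Uniqueness
uses that phi_N is uniformly continuous, which comes from the continuity in
mean of the total mass (mass_L1_continuous).

For a simple functional the identity is a finite sum. In the two passages to
the limit the point is that no mean may be lost, so that weighted means
converge as well (scheffe). The mean of the limit is bounded below through its
Laplace transform at small arguments (mean_lower), and these transforms are
compared for A <= A' (laplace_lower) by moving atoms to the nodes of a fine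
grid: this changes cumulants by a factor close to 1 (logl_add_bounds,
grid_comparison) and leaves a functional of the conditional means of cells,
which are monotone in A and determined by A alone. The almost sure convergence
of tails holds by assumption for processes started when the tail begins;
additive_functional_transfer extends it to earlier starting times.

Weights exp (- N) generate indicators of events given by finitely many
conditions M_t > theta (cvg_threshold), so J_A and Y have the same integral
over every event of the mass sigma-algebra (agree_threshold_sets). As Y is an
almost sure limit of Riemann sums of masses (averaged_mass_approx), it is
measurable with respect to that sigma-algebra up to null sets, hence is the
conditional expectation. The inequality is Jensen's, obtained from the tangent
bound exp (- J) >= exp (- Y) (1 + Y - J) and the equality of the means of J
exp (- Y) and Y exp (- Y). *)

Set Implicit Arguments.
Unset Strict Implicit.

(** * Induction on nonnegative measurable functions *)

(** The point is q = +oo, where multiplication is not continuous. *)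
Lemma lim_mule_ndr (R : realType) (u : nat -> \bar R) (q : \bar R) :
  nondecreasing_seq u -> (forall n, 0 <= u n) -> 0 <= q ->
  limn (fun n => u n * q) = limn u * q.
Proof.
move=> ndu u0 q0; have cu := ereal_nondecreasing_is_cvgn ndu.
have ub n : u n <= limn u.
  rewrite (cvg_lim _ (ereal_nondecreasing_cvgn ndu))//.
  by apply: ereal_sup_ubound; exists n.
case: q q0 => [q q0|_|//].
  by apply: limeMr.
have [lu0|lu0] := eqVneq (limn u) 0.
  rewrite lu0 mul0e.
  have -> : (fun n => u n * +oo) = cst 0.
    apply/funext => n; have -> : u n = 0; last by rewrite mul0e.
    by apply/eqP; rewrite eq_le u0 andbT -lu0; exact: ub.
  exact: lim_cst.
have {}lu0 : 0 < limn u by rewrite lt0e lu0 lime_ge//; exact: nearW.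
rewrite gt0_muley//; have [n un] : exists n, 0 < u n.
  apply: contrapT => /forallNP h; move: lu0; rewrite ltNge => /negP; apply.
  by apply: lime_le => //; apply: nearW => n; rewrite leNgt; exact/negP.
apply/cvg_lim => //; apply: cvg_near_cst.
by exists n => // m /= nm; rewrite gt0_muley//; exact: (lt_le_trans un (ndu _ _ nm)).
Qed.

Lemma integral_indicM d (T : measurableType d) (R : realType)
    (m : {measure set T -> \bar R}) (B : set T) (g : T -> \bar R) :
  \int[m]_w ((EFin \o \1_B) w * g w) = \int[m]_(w in B) g w.
Proof.
rewrite [RHS]integral_mkcond; apply: eq_integral => w _.
by rewrite epatch_indic muleC.
Qed.

Section measurable_induction.
Context {d : measure_display} {T : measurableType d} {R : realType}.
Import HBNNSimple.

(** Induction along the approximation by simple functions, used to extend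
identities from indicators to nonnegative measurable functions. *)
Lemma ge0_measurable_fun_ind (Pr : (T -> \bar R) -> Prop) :
  (forall U, measurable U -> Pr (EFin \o \1_U)) ->
  (forall (k : R) f, (0 <= k)%R -> measurable_fun setT f ->
    (forall x, 0 <= f x) -> Pr f -> Pr (fun x => k%:E * f x)) ->
  (forall f g, measurable_fun setT f -> measurable_fun setT g ->
    (forall x, 0 <= f x) -> (forall x, 0 <= g x) ->
    Pr f -> Pr g -> Pr (fun x => f x + g x)) ->
  (forall f_ : nat -> T -> \bar R, (forall n, measurable_fun setT (f_ n)) ->
    (forall n x, 0 <= f_ n x) ->
    (forall x, nondecreasing_seq (fun n => f_ n x)) ->
    (forall n, Pr (f_ n)) -> Pr (fun x => limn (fun n => f_ n x))) ->
  forall f, measurable_fun setT f -> (forall x, 0 <= f x) -> Pr f.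
Proof.
move=> Pind PZ PD Plim f mf f0.
pose f_ := nnsfun_approx measurableT mf.
have -> : f = fun x => limn (fun n => (f_ n x)%:E).
  by apply/funext => x; apply/esym/cvg_lim => //; exact: cvg_nnsfun_approx.
apply: Plim.
- by move=> n; exact/measurable_EFinP.
- by move=> n x; rewrite lee_fin.
- by move=> x a b ab; rewrite lee_fin; exact/lefP/nd_nnsfun_approx.
move=> n; move: (f_ n) => g.
pose h (r : R) := fun x => (Num.max r 0)%:E * (\1_(g @^-1` [set r]) x)%:E.
have h0 r x : 0 <= h r x by rewrite /h -EFinM lee_fin mulr_ge0// le_max lexx orbT.
have mh r : measurable_fun setT (h r).
  by apply: measurable_funeM; apply/measurable_EFinP.
have -> : (fun x => (g x)%:E) =
    fun x => \sum_(r <- finmap.enum_fset (fset_set (range g))) h r x.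
  apply/funext => x; rewrite fimfunE -fsumEFin// fsbig_finite//=.
  apply: eq_big_seq => r; rewrite in_fset_set// inE => -[y _ <-].
  by rewrite /h max_l// EFinM.
elim: (finmap.enum_fset _) => [|r s ih].
  have -> : (fun x => \sum_(r <- [::]) h r x) = EFin \o \1_(@set0 T).
    by apply/funext => x; rewrite big_nil /= indic0.
  exact: Pind.
have -> : (fun x => \sum_(i <- r :: s) h i x) =
    fun x => h r x + \sum_(i <- s) h i x.
  by apply/funext => x; rewrite big_cons.
apply: PD => //.
- exact: emeasurable_sum.
- by move=> x; apply: sume_ge0.
- apply: PZ => //.
  + by rewrite le_max lexx orbT.
  + exact/measurable_EFinP.
  + exact: (Pind (g @^-1` [set r]) (measurable_funPTI _ _)).
Qed.

End measurable_induction.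

(** * Markov processes in integral form *)

Section markov_theory.
Context {R : realType} {d dE : measure_display}.
Context {Omega : measurableType d} {E : measurableType dE}.
Variables (Z : R -> Omega -> E) (F : set R -> set (set Omega)).
Variable P : R -> probability E R -> probability Omega R.
Hypothesis hM : markov_process Z F P.

Local Notation FT I := (g_sigma_algebraType (F I)).

Lemma time_interval_cc (s t : R) : (0 <= s)%R -> time_interval `[s, t].
Proof.
move=> s0; split; first exact: interval_is_interval.
by move=> x /=; rewrite !in_itv/= => /andP[sx _]; rewrite (le_trans s0 sx).
Qed.

Lemma time_interval_cy (s : R) : (0 <= s)%R -> time_interval `[s, +oo[.
Proof.
move=> s0; split; first exact: interval_is_interval.
by move=> x /=; rewrite !in_itv/= !andbT => sx; rewrite (le_trans s0 sx).
Qed.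

Lemma adaptedE I : time_interval I -> (measurable : set (set (FT I))) = F I.
Proof. by move=> hI; exact: (sigma_algebra_id (markov_sigma hM hI)). Qed.

Lemma adapted_measurable dX (X : measurableType dX) I (g : Omega -> X) :
  time_interval I -> measurable_fun [set: FT I] g ->
  measurable_fun [set: Omega] g.
Proof.
move=> hI mg _ B mB; have := mg measurableT B mB.
by rewrite !setTI adaptedE// => /(markov_sub hM hI).
Qed.

Lemma adapted_process I (t : R) : time_interval I -> I t ->
  measurable_fun [set: FT I] (Z t).
Proof.
by move=> hI It _ B mB; rewrite setTI adaptedE//; exact: (markov_adapted hM).
Qed.

Lemma measurable_process (t : R) : (0 <= t)%R -> measurable_fun setT (Z t).
Proof.
move=> t0; apply: (adapted_measurable (time_interval_cc t t0)).
apply: adapted_process; first exact: time_interval_cc.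
by rewrite /= in_itv/= lexx.
Qed.

(** The kernel property is assumed for events of the future only; it extends
to functions by induction on measurable functions. *)
Lemma measurable_integral_future (t : R) (g : Omega -> \bar R) : (0 <= t)%R ->
  measurable_fun [set: FT `[t, +oo[] g -> (forall w, 0 <= g w) ->
  measurable_fun [set: E] (fun y => \int[P t \d_y]_w g w).
Proof.
move=> t0; have hI := time_interval_cy t0.
pose Pr (g : FT `[t, +oo[ -> \bar R) :=
  measurable_fun [set: E] (fun y => \int[P t \d_y]_w g w).
have mm (f : FT `[t, +oo[ -> \bar R) : measurable_fun setT f ->
  measurable_fun [set: Omega] f by exact: adapted_measurable.
move: g; apply: (@ge0_measurable_fun_ind _ _ _ Pr); rewrite /Pr.
- move=> U mU; have FU : F `[t, +oo[%classic U by rewrite -adaptedE.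
  have := markov_measurable hM t0 FU; apply: eq_measurable_fun => y _ /=.
  by rewrite integral_indic ?setIT//; exact: (markov_sub hM hI).
- move=> k f k0 mf f0 If.
  have -> : (fun y => \int[P t \d_y]_w (k%:E * f w)) =
      fun y => k%:E * \int[P t \d_y]_w f w.
    by apply/funext => y; rewrite ge0_integralZl//; exact: mm.
  exact: measurable_funeM.
- move=> f h mf mh f0 h0 If Ih.
  have -> : (fun y => \int[P t \d_y]_w (f w + h w)) =
      fun y => \int[P t \d_y]_w f w + \int[P t \d_y]_w h w.
    by apply/funext => y; rewrite ge0_integralD//; exact: mm.
  exact: emeasurable_funD.
- move=> f_ mf f0 ndf If.
  apply: (emeasurable_fun_cvg (fun n y => \int[P t \d_y]_w f_ n w)) => //.
  move=> y _; apply: cvg_monotone_convergence => //.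
  by move=> n; exact: mm.
Qed.

(** Both sides are additive and continuous from below in g, and for indicators
the identity is the Markov property for events. *)
Lemma markov_setE (r t : R) mu B (g : Omega -> \bar R) : (0 <= r <= t)%R ->
  F `[r, t] B -> measurable_fun [set: FT `[t, +oo[] g -> (forall w, 0 <= g w) ->
  \int[P r mu]_(w in B) g w =
  \int[P r mu]_(w in B) \int[P t \d_(Z t w)]_w' g w'.
Proof.
move=> /andP[r0 rt] FB; have t0 := le_trans r0 rt.
have hI := time_interval_cy t0; have hB := time_interval_cc t r0.
have mB := markov_sub hM hB FB.
have mm (f : FT `[t, +oo[ -> \bar R) : measurable_fun setT f ->
  measurable_fun [set: Omega] f by exact: adapted_measurable.
have mB' (f : FT `[t, +oo[ -> \bar R) : measurable_fun setT f ->
  measurable_fun B (f : Omega -> \bar R).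
  by move=> mf; apply: (measurable_funS measurableT) => //; exact: mm.
have mI (f : FT `[t, +oo[ -> \bar R) : measurable_fun setT f ->
    (forall x, 0 <= f x) ->
    measurable_fun B (fun w => \int[P t \d_(Z t w)]_w' f w').
  move=> mf f0; apply: (measurable_funS measurableT) => //.
  apply: (measurableT_comp (measurable_integral_future t0 mf f0)).
  exact: measurable_process.
have I0 (f : FT `[t, +oo[ -> \bar R) : (forall x, 0 <= f x) ->
    forall w, 0 <= \int[P t \d_(Z t w)]_w' f w'.
  by move=> f0 w; exact: integral_ge0.
pose Pr (g : FT `[t, +oo[ -> \bar R) :=
  \int[P r mu]_(w in B) g w =
  \int[P r mu]_(w in B) \int[P t \d_(Z t w)]_w' g w'.
move: g; apply: (@ge0_measurable_fun_ind _ _ _ Pr); rewrite /Pr.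
- move=> U mU; have FU : F `[t, +oo[%classic U by rewrite -adaptedE.
  have mU' := markov_sub hM hI FU.
  rewrite integral_indic//.
  have := markov_property hM (r := r) (t := t) mu (B := B) (C := U). rewrite r0 rt setIC => /(_ isT FB FU) H; apply: (etrans H).
  by apply: eq_integral => w _; rewrite integral_indic ?setIT.
- move=> k f k0 mf f0 If.
  rewrite ge0_integralZl//; last exact: mB'.
  rewrite If -ge0_integralZl//; last 2 first.
    exact: mI.
    by move=> w _; exact: I0.
  by apply: eq_integral => w _; rewrite ge0_integralZl//; exact: mm.
- move=> f h mf mh f0 h0 If Ih.
  rewrite ge0_integralD//; [|exact: mB'..].
  rewrite If Ih -ge0_integralD//; try (by move=> w _; exact: I0); try exact: mI.
  by apply: eq_integral => w _; rewrite ge0_integralD//; exact: mm.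
- move=> f_ mf f0 ndf If.
  rewrite monotone_convergence//; last by move=> n; exact: mB'.
  rewrite (_ : (fun n => _) = (fun n => \int[P r mu]_(w in B)
      \int[P t \d_(Z t w)]_w' f_ n w')); last by apply/funext.
  have nd w : nondecreasing_seq (fun n => \int[P t \d_(Z t w)]_w' f_ n w').
    move=> a b ab; apply: ge0_le_integral => //; [exact: mm|exact: mm|].
    by move=> x _; exact: ndf.
  rewrite -monotone_convergence//; [|by move=> n; exact: mI
    |by move=> n w _; exact: I0].
  apply: eq_integral => w _; rewrite monotone_convergence//.
  by move=> n; exact: mm.
Qed.

Lemma markovE (r t : R) mu (b g : Omega -> \bar R) : (0 <= r <= t)%R ->
  measurable_fun [set: FT `[r, t]] b -> (forall w, 0 <= b w) ->
  measurable_fun [set: FT `[t, +oo[] g -> (forall w, 0 <= g w) ->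
  \int[P r mu]_w (b w * g w) =
  \int[P r mu]_w (b w * \int[P t \d_(Z t w)]_w' g w').
Proof.
move=> rt mb b0 mg g0; have /andP[r0 rt'] := rt; have t0 := le_trans r0 rt'.
have hI := time_interval_cy t0; have hB := time_interval_cc t r0.
have mg' : measurable_fun [set: Omega] g by exact: adapted_measurable mg.
pose h w := \int[P t \d_(Z t w)]_w' g w'.
have mh : measurable_fun setT h.
  apply: (measurableT_comp (measurable_integral_future t0 mg g0)).
  exact: measurable_process.
have h0 w : 0 <= h w by exact: integral_ge0.
have mm (f : FT `[r, t] -> \bar R) : measurable_fun setT f ->
  measurable_fun [set: Omega] f by exact: adapted_measurable.
pose Pr (b : FT `[r, t] -> \bar R) :=
  \int[P r mu]_w (b w * g w) = \int[P r mu]_w (b w * h w).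
move: b mb b0; apply: (@ge0_measurable_fun_ind _ _ _ Pr); rewrite /Pr.
- move=> B mB; have FB : F `[r, t]%classic B by rewrite -adaptedE.
  by rewrite !integral_indicM; exact: markov_setE.
- move=> k f k0 mf f0 If.
  under eq_integral do rewrite -muleA.
  under [RHS]eq_integral do rewrite -muleA.
  rewrite ge0_integralZl//; [|by apply: emeasurable_funM => //; exact: mm
    |by move=> w _; exact: mule_ge0].
  rewrite If ge0_integralZl//; [by apply: emeasurable_funM => //; exact: mm
    |by move=> w _; exact: mule_ge0].
- move=> f k mf mk f0 k0 If Ik.
  under eq_integral do rewrite ge0_muleDl//.
  under [RHS]eq_integral do rewrite ge0_muleDl//.
  by rewrite !ge0_integralD ?If ?Ik//; try (by move=> w _; exact: mule_ge0);
    (apply: emeasurable_funM => //; exact: mm).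
- move=> f_ mf f0 ndf If.
  have E1 (q : Omega -> \bar R) : measurable_fun setT q -> (forall w, 0 <= q w) ->
      \int[P r mu]_w (limn (fun n => f_ n w) * q w) =
      limn (fun n => \int[P r mu]_w (f_ n w * q w)).
    move=> mq q0; rewrite -monotone_convergence//.
    + apply: eq_integral => w _.
      exact/esym/lim_mule_ndr.
    + by move=> n; apply: emeasurable_funM => //; exact: mm.
    + by move=> n w _; exact: mule_ge0.
    + by move=> w _ a c ac; apply: lee_wpmul2r => //; exact: ndf.
  by rewrite !E1//; congr (limn _); apply/funext => n; exact: If.
Qed.

End markov_theory.

(** * Real integrals of bounded functions *)

Section bounded_functions.
Context {d : measure_display} {T : measurableType d} {R : realType}.
Implicit Types (f g : T -> R).

Definition bounded_nneg f : Prop :=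
  [/\ measurable_fun setT f, (forall x, (0 <= f x)%R) &
      exists M : R, forall x, (f x <= M)%R].

Lemma bounded_nneg_cst (c : R) : (0 <= c)%R -> bounded_nneg (fun=> c).
Proof. by move=> c0; split => //; exists c. Qed.

Lemma bounded_nnegD f g :
  bounded_nneg f -> bounded_nneg g -> bounded_nneg (fun x => f x + g x)%R.
Proof.
move=> [mf f0 [M fM]] [mg g0 [N gN]]; split; first exact: measurable_funD.
  by move=> x; rewrite addr_ge0.
by exists (M + N)%R => x; rewrite lerD.
Qed.

Lemma bounded_nnegM f g :
  bounded_nneg f -> bounded_nneg g -> bounded_nneg (fun x => f x * g x)%R.
Proof.
move=> [mf f0 [M fM]] [mg g0 [N gN]]; split; first exact: measurable_funM.
  by move=> x; rewrite mulr_ge0.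
by exists (M * N)%R => x; rewrite ler_pM.
Qed.

Lemma bounded_nnegZ (c : R) f : (0 <= c)%R ->
  bounded_nneg f -> bounded_nneg (fun x => c * f x)%R.
Proof. by move=> c0; apply: bounded_nnegM; exact: bounded_nneg_cst. Qed.

Lemma bounded_nneg_expN f : measurable_fun setT f -> (forall x, (0 <= f x)%R) ->
  bounded_nneg (fun x => expR (- f x))%R.
Proof.
move=> mf f0; split; last first.
- by exists 1%R => x; rewrite -expR0 ler_expR oppr_le0.
- by move=> x; exact: expR_ge0.
- by apply: measurableT_comp => //; exact: measurableT_comp.
Qed.

Variable m : {finite_measure set T -> \bar R}.

(** Real-valued integrals keep the algebra of cumulants free of extended
reals; the default value 0 of fine is never met on bounded measurable
functions. *)
Definition rint f : R := fine (\int[m]_x (f x)%:E).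

Definition mass : R := fine (m setT).

Lemma massE : m setT = mass%:E.
Proof. by rewrite fineK// fin_num_measure. Qed.

Lemma mass_ge0 : (0 <= mass)%R.
Proof. exact: fine_ge0. Qed.

Lemma rint_ge0 f : (forall x, 0 <= f x)%R -> (0 <= rint f)%R.
Proof. by move=> f0; apply/fine_ge0/integral_ge0 => x _; rewrite lee_fin. Qed.

Lemma rint_cst c : rint (fun=> c) = (c * mass)%R.
Proof. by rewrite /rint integral_cst// fineM// fin_num_measure. Qed.

Lemma bounded_nneg_integrable f : bounded_nneg f ->
  m.-integrable setT (EFin \o f).
Proof.
move=> [mf f0 [M fM]]; apply: measurable_bounded_integrable => //.
  by have := ltry mass; rewrite -massE.
exists M; split; first exact: num_real.
move=> x Mx t _ /=; rewrite ger0_norm//; exact: le_trans (fM t) (ltW Mx).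
Qed.

Lemma rintE f : bounded_nneg f -> \int[m]_x (f x)%:E = (rint f)%:E.
Proof.
move=> bf; rewrite fineK//; apply: integrable_fin_num => //.
exact: bounded_nneg_integrable.
Qed.

Lemma rintD f g : bounded_nneg f -> bounded_nneg g ->
  rint (fun x => f x + g x)%R = (rint f + rint g)%R.
Proof.
move=> bf bg; apply: EFin_inj; rewrite -rintE; last exact: bounded_nnegD.
rewrite EFinD -!rintE//; case: bf bg => [mf f0 _] [mg g0 _].
by under eq_integral do rewrite EFinD; rewrite ge0_integralD//; try
  (by move=> x _; rewrite lee_fin); exact/measurable_EFinP.
Qed.

Lemma rintZ c f : (0 <= c)%R -> bounded_nneg f ->
  rint (fun x => c * f x)%R = (c * rint f)%R.
Proof.
move=> c0 bf; apply: EFin_inj; rewrite -rintE; last exact: bounded_nnegZ.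
rewrite EFinM -!rintE//; case: bf => [mf f0 _].
by under eq_integral do rewrite EFinM; rewrite ge0_integralZl//; try
  (by move=> x _; rewrite lee_fin); exact/measurable_EFinP.
Qed.

Lemma rint_le f g : bounded_nneg f -> bounded_nneg g ->
  (forall x, f x <= g x)%R -> (rint f <= rint g)%R.
Proof.
move=> bf bg fg; rewrite -lee_fin -!rintE//; case: bf bg => [mf f0 _] [mg g0 _].
by apply: ge0_le_integral => //; try (by move=> x _; rewrite lee_fin);
  exact/measurable_EFinP.
Qed.

Lemma rintB f g : bounded_nneg f -> bounded_nneg g ->
  (forall x, g x <= f x)%R -> rint (fun x => f x - g x)%R = (rint f - rint g)%R.
Proof.
move=> bf bg gf; apply/eqP; rewrite eq_sym subr_eq; apply/eqP.
rewrite -rintD//; first by congr rint; apply/funext => x; rewrite subrK.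
case: bf bg => [mf f0 [M fM]] [mg g0 _]; split.
- exact: measurable_funB.
- by move=> x; rewrite subr_ge0.
- exists M => x; apply: le_trans (fM x); rewrite lerBlDr lerDl; exact: g0.
Qed.

Lemma rint_cvg (f_ : nat -> T -> R) f (M : R) :
  (forall n, bounded_nneg (f_ n)) -> bounded_nneg f ->
  (forall n x, f_ n x <= M)%R ->
  {ae m, forall x, f_ n x @[n --> \oo] --> f x} ->
  rint (f_ n) @[n --> \oo] --> rint f.
Proof.
move=> bf_ bf fM cf.
apply: fine_cvg; rewrite -(rintE bf).
have mf n : measurable_fun setT (EFin \o f_ n).
  by apply/measurable_EFinP; case: (bf_ n).
have H := @dominated_convergence _ _ _ m setT measurableT
  (fun n x => (f_ n x)%:E) (fun x => (f x)%:E) (fun=> M%:E) mf.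
have [||||_ _ //] := H.
- by apply/measurable_EFinP; case: bf.
- by apply: filterS cf => x cf _; apply: cvg_EFin; [exact: nearW|exact: cf].
- by apply: finite_measure_integrable_cst.
- apply: aeW => x n _; rewrite /= lee_fin ger0_norm//.
  by case: (bf_ n).
Qed.

End bounded_functions.

Section probability_rint.
Context {d : measure_display} {T : measurableType d} {R : realType}.
Variable P : probability T R.

Lemma mass_probability : mass P = 1%R.
Proof. exact: (congr1 fine (probability_setT P)). Qed.

Lemma rint_bound (f : T -> R) (M : R) : bounded_nneg f ->
  (forall x, f x <= M)%R -> (rint P f <= M)%R.
Proof.
move=> bf fM; have M0 : (0 <= M)%R.
  by apply: le_trans (fM point); case: bf.
rewrite -[leRHS]mulr1 -mass_probability -rint_cst; apply: rint_le => //.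
exact: bounded_nneg_cst.
Qed.

End probability_rint.

Lemma rint_dirac d (T : measurableType d) (R : realType) (f : T -> R) (y : T) :
  measurable_fun setT f -> rint \d_y f = f y.
Proof.
by move=> mf; rewrite /rint integral_dirac ?diracT ?mul1e//; exact/measurable_EFinP.
Qed.

Lemma mass_dirac d (T : measurableType d) (R : realType) (y : T) :
  mass (\d_y : {finite_measure set T -> \bar R}) = 1%R.
Proof. exact: (congr1 fine (diracT R y)). Qed.

(** * Transition operators *)

Section markov_expectation.
Context {R : realType} {d dE : measure_display}.
Context {Omega : measurableType d} {E : measurableType dE}.
Variables (Z : R -> Omega -> E) (F : set R -> set (set Omega)).
Variable P : R -> probability E R -> probability Omega R.
Hypothesis hM : markov_process Z F P.

Local Notation FT I := (g_sigma_algebraType (F I)).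

Lemma adapted_comp dX (X : measurableType dX) I (t : R) (g : E -> X) :
  time_interval I -> I t -> measurable_fun setT g ->
  measurable_fun [set: FT I] (fun w => g (Z t w)).
Proof.
by move=> hI It mg; apply: measurableT_comp => //; exact: (adapted_process hM).
Qed.

Lemma markov_tower (r t : R) mu (g : Omega -> \bar R) : (0 <= r <= t)%R ->
  measurable_fun [set: FT `[t, +oo[] g -> (forall w, 0 <= g w) ->
  \int[P r mu]_w g w = \int[P r mu]_w \int[P t \d_(Z t w)]_w' g w'.
Proof.
move=> rt mg g0; have := @markovE _ _ _ _ _ _ _ _ hM r t mu (fun=> 1) g rt.
under eq_integral do rewrite mul1e; under [in RHS]eq_integral do rewrite mul1e.
by apply => //; exact: measurable_cst.
Qed.

Lemma initialE (r : R) mu (g : E -> \bar R) : (0 <= r)%R ->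
  measurable_fun setT g -> (forall y, 0 <= g y) ->
  \int[P r mu]_w g (Z r w) = \int[mu]_y g y.
Proof.
move=> r0 mg g0; have mZ := measurable_process hM r0.
have := ge0_integral_pushforward mZ (P r mu) measurableT mg.
rewrite preimage_setT => <- //; apply: eq_measure_integral => B mB _.
exact: (markov_initial hM).
Qed.

Lemma adapted_bounded I (g : Omega -> R) : time_interval I ->
  @bounded_nneg _ (FT I) R g -> @bounded_nneg _ Omega R g.
Proof. by move=> hI [mg g0 M]; split => //; exact: (adapted_measurable hM hI). Qed.

Lemma bounded_nneg_rint_future (t : R) (g : Omega -> R) : (0 <= t)%R ->
  @bounded_nneg _ (FT `[t, +oo[) R g ->
  bounded_nneg (fun y => rint (P t \d_y) g).
Proof.
move=> t0 bg; have hI := time_interval_cy t0.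
have bg' := adapted_bounded hI bg; have [mg g0 [M gM]] := bg; split.
- apply: measurableT_comp; first exact: fine_measurable.
  apply: (measurable_integral_future hM) => //; first exact/measurable_EFinP.
- by move=> y; exact: rint_ge0.
- by exists M => y; exact: rint_bound.
Qed.

Lemma rint_markov (r t : R) mu (b g : Omega -> R) : (0 <= r <= t)%R ->
  @bounded_nneg _ (FT `[r, t]) R b -> @bounded_nneg _ (FT `[t, +oo[) R g ->
  rint (P r mu) (fun w => b w * g w)%R =
  rint (P r mu) (fun w => b w * rint (P t \d_(Z t w)) g)%R.
Proof.
move=> rt bb bg; have /andP[r0 rt'] := rt; have t0 := le_trans r0 rt'.
have hI := time_interval_cy t0; have hB := time_interval_cc t r0.
have bg' := adapted_bounded hI bg.
rewrite /rint; congr fine; under eq_integral do rewrite EFinM.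
rewrite (markovE hM mu rt).
- by apply: eq_integral => w _; rewrite EFinM (rintE _ bg').
- by apply/measurable_EFinP; case: bb.
- by move=> w; rewrite lee_fin; case: bb.
- by apply/measurable_EFinP; case: bg.
- by move=> w; rewrite lee_fin; case: bg.
Qed.

Lemma rint_tower (r t : R) mu (g : Omega -> R) : (0 <= r <= t)%R ->
  @bounded_nneg _ (FT `[t, +oo[) R g ->
  rint (P r mu) g = rint (P r mu) (fun w => rint (P t \d_(Z t w)) g).
Proof.
move=> rt bg; have := rint_markov mu rt (bounded_nneg_cst ler01) bg.
by under eq_fun do rewrite mul1r; under [in RHS]eq_fun do rewrite mul1r.
Qed.

Lemma rint_initial (r : R) (y : E) (g : E -> R) : (0 <= r)%R ->
  bounded_nneg g -> rint (P r \d_y) (fun w => g (Z r w)) = g y.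
Proof.
move=> r0 [mg g0 _]; rewrite -[RHS](rint_dirac y mg) /rint.
have mg' : measurable_fun setT (EFin \o g) by exact/measurable_EFinP.
congr fine; apply: (@initialE r \d_y (EFin \o g)) => //.
Qed.

Definition transition (s t : R) (f : E -> R) (y : E) : R :=
  rint (P s \d_y) (fun w => f (Z t w)).

Lemma bounded_nneg_adapted I (t : R) (f : E -> R) : time_interval I -> I t ->
  bounded_nneg f -> @bounded_nneg _ (FT I) R (fun w => f (Z t w)).
Proof.
move=> hI It [mf f0 [M fM]]; split=> //; last by exists M.
exact: (adapted_comp hI It mf).
Qed.

Lemma bounded_nneg_future (s t : R) (f : E -> R) : (0 <= s <= t)%R ->
  bounded_nneg f -> @bounded_nneg _ (FT `[s, +oo[) R (fun w => f (Z t w)).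
Proof.
move=> /andP[s0 st]; apply: bounded_nneg_adapted.
  exact: time_interval_cy.
by rewrite /= in_itv/= st.
Qed.

Lemma bounded_nneg_comp (t : R) (f : E -> R) : (0 <= t)%R ->
  bounded_nneg f -> bounded_nneg (fun w => f (Z t w)).
Proof.
move=> t0 bf; apply: (adapted_bounded (time_interval_cy t0)).
by apply: bounded_nneg_future => //; rewrite t0 lexx.
Qed.

Lemma bounded_nneg_transition (s t : R) (f : E -> R) : (0 <= s <= t)%R ->
  bounded_nneg f -> bounded_nneg (transition s t f).
Proof.
move=> st bf; apply: bounded_nneg_rint_future.
- by case/andP: st.
- exact: bounded_nneg_future.
Qed.

Lemma transition_transition (s t u : R) (f : E -> R) y :
  (0 <= s)%R -> (s <= t)%R -> (t <= u)%R -> bounded_nneg f ->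
  transition s t (transition t u f) y = transition s u f y.
Proof.
move=> s0 st tu bf; rewrite [RHS]/transition (@rint_tower s t)//.
- by rewrite s0.
- by apply: bounded_nneg_future => //; rewrite (le_trans s0 st).
Qed.

Lemma transition_refl (s : R) f y : (0 <= s)%R -> bounded_nneg f ->
  transition s s f y = f y.
Proof. exact: rint_initial. Qed.

Section transition_linear.
Variables s t : R.
Hypothesis t0 : (0 <= t)%R.

Lemma transition_ge0 f y : (forall x, 0 <= f x)%R -> (0 <= transition s t f y)%R.
Proof. by move=> f0; exact: rint_ge0. Qed.

Lemma transitionD f g y : bounded_nneg f -> bounded_nneg g ->
  transition s t (fun x => f x + g x)%R y =
  (transition s t f y + transition s t g y)%R.
Proof. by move=> bf bg; rewrite /transition rintD//; exact: bounded_nneg_comp. Qed.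

Lemma transitionZ (c : R) f y : (0 <= c)%R -> bounded_nneg f ->
  transition s t (fun x => c * f x)%R y = (c * transition s t f y)%R.
Proof. by move=> c0 bf; rewrite /transition rintZ//; exact: bounded_nneg_comp. Qed.

Lemma transition_cst (c : R) y : transition s t (fun=> c) y = c.
Proof. by rewrite /transition rint_cst mass_probability mulr1. Qed.

Lemma transition_le f g y : bounded_nneg f -> bounded_nneg g ->
  (forall x, f x <= g x)%R -> (transition s t f y <= transition s t g y)%R.
Proof.
by move=> bf bg fg; apply: rint_le => //; exact: bounded_nneg_comp.
Qed.

Lemma transition_bound f (M : R) y : bounded_nneg f -> (forall x, f x <= M)%R ->
  (transition s t f y <= M)%R.
Proof.
by move=> bf fM; apply: rint_bound => //; exact: bounded_nneg_comp.
Qed.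

End transition_linear.

End markov_expectation.

(** * Random finite measures *)

Section finmeas_pairing.
Context {d : measure_display} {T : measurableType d} {R : realType}.

Lemma measurable_finmeas_eval (U : set T) : measurable U ->
  measurable_fun [set: finmeas T R] (fun mu : finmeas T R => mu U).
Proof.
move=> mU _ B mB; rewrite setTI; apply: sub_gen_smallest.
by exists U => //; exists B => //; rewrite setTI.
Qed.

Lemma measurable_finmeas_integral (f : T -> \bar R) : measurable_fun setT f ->
  (forall x, 0 <= f x) ->
  measurable_fun [set: finmeas T R] (fun mu : finmeas T R => \int[mu]_x f x).
Proof.
move=> mf f0.
apply: (measurable_fun_integral_kernel
  (l := fun mu : finmeas T R => (mu : {measure set T -> \bar R}))) => //.
by move=> U mU; exact: measurable_finmeas_eval.
Qed.

Lemma measurable_pairing (f : T -> R) : measurable_fun setT f ->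
  (forall x, 0 <= f x)%R ->
  measurable_fun [set: finmeas T R] (fun mu : finmeas T R => rint mu f).
Proof.
move=> mf f0; apply: measurableT_comp; first exact: fine_measurable.
by apply: measurable_finmeas_integral => //; exact/measurable_EFinP.
Qed.

End finmeas_pairing.

Section nonmeasurable_integrand.
Import HBNNSimple.

(** For nonnegative functions the integral is a supremum over simple functions
below the integrand, which makes sense for f without measurability. This is
needed because only a version of the integrand of the cumulant equation is
measurable. *)
Lemma ge0_ae_eq_integral_nonmeas d (T : measurableType d) (R : realType)
    (m : {measure set T -> \bar R}) (f g : T -> \bar R) :
  measurable_fun setT g -> (forall x, 0 <= f x) -> (forall x, 0 <= g x) ->
  {ae m, forall x, f x = g x} -> \int[m]_x f x = \int[m]_x g x.
Proof.
move=> mg f0 g0 [N [mN N0 fgN]].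
have fgE x : (~` N) x -> f x = g x.
  by move=> Nx; apply: contrapT => fg; apply: Nx; apply: fgN.
have negl h : measurable_fun setT h -> (forall x, 0 <= h x) ->
    \int[m]_x h x = \int[m]_(x in ~` N) h x.
  move=> mh h0; rewrite -setTD.
  by apply: ge0_negligible_integral.
apply/eqP; rewrite eq_le; apply/andP; split.
- rewrite [leLHS]ge0_integralTE//; apply: ub_ereal_sup => _ [h /= hf <-].
  have mh : measurable_fun setT (EFin \o h) by exact/measurable_EFinP.
  rewrite -integralT_nnsfun (negl _ mh)//; last by move=> x; rewrite /= lee_fin.
  rewrite [leRHS]negl//; apply: ge0_le_integral => //.
  + exact: measurableC.
  + by move=> x _; rewrite /= lee_fin.
  + by exact: measurable_funTS mh.
  + exact/measurable_funTS.
  + by move=> x Nx; rewrite -fgE//; exact: hf.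
- rewrite negl// (eq_integral f); last by move=> x /set_mem Nx; rewrite fgE.
  rewrite (integral_mkcond _ f).
  have fN0 x : 0 <= (f \_ (~` N)) x by rewrite patchE; case: ifP.
  rewrite [leLHS]ge0_integralTE// [leRHS]ge0_integralTE//.
  apply: le_ereal_sup => _ [h /= hf <-]; exists h => // x.
  by apply: le_trans (hf x) _; rewrite patchE; case: ifP.
Qed.

End nonmeasurable_integrand.

(** * Power inequalities and a Gronwall lemma *)

Section power_inequalities.
Local Open Scope ring_scope.
Context {R : realType}.
Variable beta : R.
Hypothesis hbeta : 0 < beta <= 1.

Let beta0 : 0 < beta. Proof. by case/andP: hbeta. Qed.
Let beta1 : beta <= 1. Proof. by case/andP: hbeta. Qed.

Lemma powR1D (b : R) : 0 <= b -> b `^ (1 + beta) = b * b `^ beta.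
Proof.
move=> b0; rewrite powRD ?powRr1//.
by apply/implyP => /eqP; have := beta0; lra.
Qed.

(** Convexity of the power 1 + beta: its graph lies above its tangent at b.
This is Young's inequality for the exponents 1 + beta and (1 + beta) / beta. *)
Lemma powR_tangent (a b : R) : 0 <= a -> 0 <= b ->
  b `^ (1 + beta) - a `^ (1 + beta) <= (1 + beta) * b `^ beta * (b - a).
Proof.
move=> a0 b0; have h1 : 0 < 1 + beta by have := beta0; lra.
have q0 : 0 < (1 + beta) / beta by rewrite divr_gt0.
have := conjugate_powR a0 (powR_ge0 b beta) h1 q0.
rewrite -powRrM (_ : beta * _ = 1 + beta); last first.
  by rewrite mulrC divfK// gt_eqF.
rewrite (powR1D b0) invf_div => H.
have /H{H} : (1 + beta)^-1 + beta / (1 + beta) = 1.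
  by field; rewrite gt_eqF//; have := beta0; lra.
set p := a `^ (1 + beta); set c := b `^ beta => H.
have {}H : (1 + beta) * (a * c) <= p + b * c * beta.
  rewrite mulrC -ler_pdivlMr//; apply: le_trans H _.
  by rewrite mulrDl mulrA.
have : (1 + beta) * c * (b - a) = (1 + beta) * (b * c) - (1 + beta) * (a * c).
  by ring.
move=> ->; lra.
Qed.

Lemma powR_tangent_ge (a b : R) : 0 <= a -> 0 <= b ->
  (1 + beta) * a `^ beta * (b - a) <= b `^ (1 + beta) - a `^ (1 + beta).
Proof.
move=> a0 b0; have := powR_tangent b0 a0.
by rewrite -(opprB b a) mulrN -(opprB (b `^ _)) lerN2.
Qed.

Lemma powR_subadditive (a x : R) : 0 <= a -> 0 <= x ->
  (a + x) `^ beta <= a `^ beta + x `^ beta.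
Proof.
move=> a0 x0; have [ax0|ax0] := eqVneq (a + x) 0.
  by rewrite ax0 powR0 ?gt_eqF// addr_ge0// powR_ge0.
have s0 : 0 < a + x by rewrite lt0r ax0 addr_ge0.
have part c : 0 <= c -> c <= a + x -> c / (a + x) * (a + x) `^ beta <= c `^ beta.
  move=> c0 cs; have [->|cn0] := eqVneq c 0; first by rewrite !mul0r powR_ge0.
  have q1 : 0 < c / (a + x) <= 1.
    have c1 : 0 < c by rewrite lt0r cn0.
    by rewrite divr_gt0//= ler_pdivrMr ?mul1r.
  rewrite -[leRHS]mul1r.
  have -> : c `^ beta = (c / (a + x)) `^ beta * (a + x) `^ beta.
    have q0 : 0 <= c / (a + x) by case/andP: q1 => /ltW.
    by rewrite -powRM ?divfK// ltW.
  by rewrite mul1r ler_wpM2r ?powR_ge0//; exact: ger1_powR.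
have := lerD (part a a0 _) (part x x0 _); rewrite -mulrDl -mulrDl divff// mul1r.
by apply; rewrite ?lerDl ?lerDr.
Qed.

(** Second-order behaviour of the power is replaced by order 1 + beta: the
remainder lies between 0 and x times the increment of the derivative, and the
power beta is subadditive. *)
Lemma powR_remainder (a x : R) : 0 <= a -> 0 <= x ->
  `|(a + x) `^ (1 + beta) - a `^ (1 + beta) - (1 + beta) * a `^ beta * x| <=
  (1 + beta) * x `^ (1 + beta).
Proof.
move=> a0 x0; have ax0 : 0 <= a + x by rewrite addr_ge0.
have := powR_tangent a0 ax0; have := powR_tangent_ge a0 ax0.
rewrite addrAC subrr add0r => lo up.
rewrite ger0_norm ?subr_ge0// lerBlDr; apply: le_trans up _.
have h1 : 0 <= 1 + beta by have := beta0; lra.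
rewrite (powR1D x0) -!mulrA -mulrDr ler_wpM2l// [x * _]mulrC -mulrDl.
by rewrite ler_wpM2r// addrC powR_subadditive.
Qed.

Lemma powR_lipschitz (C a b : R) : 0 <= a <= C -> 0 <= b <= C ->
  `|b `^ (1 + beta) - a `^ (1 + beta)| <= (1 + beta) * C `^ beta * `|b - a|.
Proof.
wlog ab : a b / a <= b.
  move=> H ha hb; have [|/ltW] := leP a b; first by move=> ?; exact: H.
  by move=> ba; rewrite distrC (distrC b); exact: H.
move=> /andP[a0 aC] /andP[b0 bC].
have mono : a `^ (1 + beta) <= b `^ (1 + beta).
  by apply: ge0_ler_powR => //; rewrite ?nnegrE//; have := beta0; lra.
rewrite !ger0_norm ?subr_ge0//; apply: le_trans (powR_tangent a0 b0) _.
rewrite ler_wpM2r ?subr_ge0// ler_wpM2l//; first by have := beta0; lra.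
by apply: ge0_ler_powR; rewrite ?nnegrE// ?(ltW beta0)// (le_trans b0).
Qed.

End power_inequalities.

Section time_integrals.
Local Open Scope ring_scope.
Context {R : realType}.
Implicit Types (s t : R) (e : R -> R).

Definition bounded_on s t e : Prop :=
  measurable_fun `[s, t] e /\
  exists M : R, forall x, s <= x <= t -> 0 <= e x <= M.

Definition tint s t e : R := \int[lebesgue_measure]_(x in `[s, t]) e x.

Lemma bounded_on_integrable s t e : bounded_on s t e ->
  lebesgue_measure.-integrable `[s, t] (EFin \o e).
Proof.
move=> [me [M eM]]; apply: measurable_bounded_integrable => //.
  rewrite [X in (X < _)%E]lebesgue_measure_itv /=.
  by case: ifPn => _; rewrite ?ltry// -EFinB ltry.
exists M; split; first exact: num_real.
move=> x Mx z; rewrite /= in_itv/= => /eM/andP[e0 eM'].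
by rewrite ger0_norm// (le_trans eM' (ltW Mx)).
Qed.

Lemma bounded_onD s t e1 e2 : bounded_on s t e1 -> bounded_on s t e2 ->
  bounded_on s t (fun x => e1 x + e2 x).
Proof.
move=> [m1 [M1 h1]] [m2 [M2 h2]]; split; first exact: measurable_funD.
exists (M1 + M2) => x sxt; have /andP[? ?] := h1 x sxt.
by have /andP[? ?] := h2 x sxt; rewrite addr_ge0// lerD.
Qed.

Lemma bounded_onZ s t c e : 0 <= c -> bounded_on s t e ->
  bounded_on s t (fun x => c * e x).
Proof.
move=> c0 [m1 [M1 h1]]; split; first exact: measurable_funM.
exists (c * M1) => x sxt; have /andP[? ?] := h1 x sxt.
by rewrite mulr_ge0// ler_wpM2l.
Qed.

Lemma bounded_on_cst s t c : 0 <= c -> bounded_on s t (fun=> c).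
Proof. by move=> c0; split => //; exists c => x _; rewrite c0/=. Qed.

Lemma tint_le s t e1 e2 : bounded_on s t e1 -> bounded_on s t e2 ->
  (forall x, s <= x <= t -> e1 x <= e2 x) -> tint s t e1 <= tint s t e2.
Proof.
move=> b1 b2 e12; apply: le_Rintegral => //; try exact: bounded_on_integrable.
Qed.

Lemma tintD s t e1 e2 : bounded_on s t e1 -> bounded_on s t e2 ->
  tint s t (fun x => e1 x + e2 x) = tint s t e1 + tint s t e2.
Proof.
by move=> b1 b2; rewrite /tint RintegralD//; exact: bounded_on_integrable.
Qed.

Lemma tintZ s t c e : bounded_on s t e ->
  tint s t (fun x => c * e x) = c * tint s t e.
Proof.
by move=> b1; rewrite /tint RintegralZl//; exact: bounded_on_integrable.
Qed.

Lemma tint_cst s t c : s <= t -> tint s t (fun=> c) = c * (t - s).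
Proof.
move=> st; rewrite /tint Rintegral_cst// [X in fine X]lebesgue_measure_itv /=.
rewrite lte_fin; move: st; rewrite le_eqVlt => /predU1P[->|->] //=.
by rewrite ltxx subrr.
Qed.

Lemma bounded_on_expR s t k : 0 <= k ->
  bounded_on s t (fun x => expR (k * (t - x))).
Proof.
move=> k0; split.
  apply: measurable_funTS; apply: measurableT_comp => //.
  by apply: measurable_funM => //; exact: measurable_funB.
exists (expR (k * (t - s))) => x /andP[sx xt].
by rewrite expR_ge0 ler_expR ler_wpM2l// lerB.
Qed.

Lemma tint_expR s t (k : R) : 0 < k -> s <= t ->
  tint s t (fun x => expR (k * (t - x))) <= expR (k * (t - s)) / k.
Proof.
move=> k0; rewrite le_eqVlt => /predU1P[->|st].
  rewrite /tint set_itv1 Rintegral_set1.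
  by apply: divr_ge0; [exact: expR_ge0|exact: ltW].
pose f x := expR (k * (t - x)); pose F x := - (f x / k).
have dF (x : R) : is_derive x 1 F (f x).
  rewrite /F /f; apply: is_derive_eq.
  rewrite /GRing.scale/= ; field.
  by rewrite gt_eqF.
have cF : continuous F.
  by move=> x; apply/differentiable_continuous/derivable1_diffP; exact: (ex_derive (is_derive := dF x)).
have cf : continuous f.
  move=> x; rewrite /f; apply: continuous_comp; last exact: continuous_expR.
  by apply: cvgM; [exact: cvg_cst|apply: cvgB; [exact: cvg_cst|exact: cvg_id]].
have := @continuous_FTC2 R f F s t st (continuous_subspaceT cf).
have dLR : derivable_oo_LRcontinuous F s t.
  split; first by move=> x _; exact: (ex_derive (is_derive := dF x)).
  + by apply: cvg_at_right_filter; exact: cF.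
  + by apply: cvg_at_left_filter; exact: cF.
move=> /(_ dLR) H.
have {}H := H (fun x _ => etrans (derive1E _ _) (derive_val (is_derive := dF x))).
rewrite /tint /Rintegral H /= /F /f subrr mulr0 expR0 opprK addrC lerBlDr.
by rewrite lerDl divr_ge0// ltW.
Qed.

(** Integration gains the factor 1 / k on the exponential term, so that a
Lipschitz bound becomes a contraction for large k. *)
Lemma tint_close s t e1 e2 (k m rho : R) : 0 < k -> 0 <= m -> 0 <= rho -> s <= t ->
  bounded_on s t e1 -> bounded_on s t e2 ->
  (forall x, s <= x <= t -> `|e1 x - e2 x| <= m * expR (k * (t - x)) + rho) ->
  `|tint s t e1 - tint s t e2| <= m / k * expR (k * (t - s)) + rho * (t - s).
Proof.
move=> k0 m0 rho0 st b1 b2 e12.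
have bE := bounded_on_expR s t (ltW k0).
have bm := bounded_onZ m0 bE; have br := bounded_on_cst s t rho0.
have half f1 f2 : bounded_on s t f1 -> bounded_on s t f2 ->
    (forall x, s <= x <= t -> `|f1 x - f2 x| <= m * expR (k * (t - x)) + rho) ->
    tint s t f1 - tint s t f2 <= m / k * expR (k * (t - s)) + rho * (t - s).
  move=> d1 d2 f12; rewrite lerBlDl.
  have bD := bounded_onD bm br.
  apply: (@le_trans _ _ (tint s t f2 +
      tint s t (fun x => m * expR (k * (t - x)) + rho))).
    rewrite -tintD//; apply: tint_le => //; first exact: bounded_onD.
    by move=> x /f12; rewrite ler_norml lerBlDl => /andP[].
  rewrite lerD2l tintD// tintZ// tint_cst// lerD2r -mulrA ler_wpM2l// mulrC.
  exact: tint_expR.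
rewrite ler_norml half// andbT lerNl opprB; apply: half => // x sxt.
by rewrite distrC e12.
Qed.

(** A bound m can be replaced by a + m / 2, hence by the fixed point 2 a in
the limit of the iteration. The space variable y ranges over an arbitrary type
since the hypothesis compares x (s, y) with bounds uniform in y. *)
Lemma gronwall (Y : Type) (x : R -> Y -> R) (t0 t a C k : R) : 0 <= a ->
  (forall s y, t0 <= s <= t -> 0 <= x s y <= C) -> 0 <= k ->
  (forall m, 0 <= m ->
    (forall s y, t0 <= s <= t -> x s y <= m * expR (k * (t - s))) ->
    forall s y, t0 <= s <= t -> x s y <= (a + m / 2) * expR (k * (t - s))) ->
  forall s y, t0 <= s <= t -> x s y <= 2 * a * expR (k * (t - s)).
Proof.
move=> a0 hx k0 H s y st.
have [C0|C0] := ltP C 0.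
  by have /andP[x0 xC] := hx s y st; have := lt_le_trans C0 x0; rewrite ltNge xC.
have iter n : forall s y, t0 <= s <= t ->
    x s y <= (2 * a + C / 2 ^+ n) * expR (k * (t - s)).
  elim: n => [|n ih] s' y' st'.
    have /andP[x0 xC] := hx s' y' st'; rewrite expr0 divr1.
    have e1 : 1 <= expR (k * (t - s')).
      by rewrite -expR0 ler_expR mulr_ge0// subr_ge0; case/andP: st'.
    apply: (le_trans xC); apply: le_trans (ler_wpM2r _ (_ : C <= _)).
    - by rewrite ler_peMr.
    - exact: expR_ge0.
    - by rewrite lerDr mulr_ge0.
  have m0 : 0 <= 2 * a + C / 2 ^+ n.
    by rewrite addr_ge0 ?mulr_ge0// invr_ge0 exprn_ge0.
  apply: le_trans (H _ m0 ih _ _ st') _.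
  rewrite ler_wpM2r ?expR_ge0// exprS invfM.
  by rewrite le_eqVlt; apply/orP; left; apply/eqP; field; rewrite expf_neq0.
have e0 := expR_ge0 (k * (t - s)).
apply/ler_addgt0Pr => eps eps0.
have e0' := expR_gt0 (k * (t - s)).
have [n nC] : exists n, C / 2 ^+ n * expR (k * (t - s)) <= eps.
  pose n := Num.bound (eps^-1 * (C * expR (k * (t - s)))).
  exists n; rewrite mulrAC ler_pdivrMr ?exprn_gt0// -ler_pdivrMl//.
  apply: (@le_trans _ _ n%:R).
    apply/ltW/archi_boundP; rewrite mulr_ge0 ?invr_ge0 ?(ltW eps0)// mulr_ge0//.
  by rewrite -natrX ler_nat ltnW// ltn_expl.
apply: le_trans (iter n s y st) _.
by rewrite mulrDl lerD2l.
Qed.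

End time_integrals.

(** * The log-Laplace functional *)

Section log_laplace.
Context {R : realType} {d d' : measure_display}.
Context {Omega : measurableType d} {Omega' : measurableType d'}.
Context {S : ptopologicalType}.
Variables (Z : R -> Omega -> S) (F : set R -> set (set Omega)).
Variable P : R -> probability (borel S) R -> probability Omega R.
Variables (gamma beta : R).
Variables (X : R -> Omega' -> finmeas (borel S) R).
Variable G : set R -> set (set Omega').
Variable PX : R -> probability (finmeas (borel S) R) R -> probability Omega' R.
Hypothesis hZ : @markov_process R d _ Omega (borel S) Z F P.
Hypothesis hX : superprocess Z P gamma beta X G PX.
Hypothesis hgamma : (0 < gamma)%R.
Hypothesis hbeta : (0 < beta <= 1)%R.

Local Notation FM := (finmeas (borel S) R).
Local Notation tr s t f := (@transition R d _ Omega (borel S) Z P s t f).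

Let hXm : markov_process X G PX := super_markov hX.

Definition pairing (t : R) (f : borel S -> R) (w : Omega') : R := rint (X t w) f.

Definition laplace (s : R) (mu : FM) (t : R) (f : borel S -> R) : R :=
  rint (PX s \d_mu) (fun w => expR (- pairing t f w))%R.

(** The cumulant is defined from the Dirac masses; laplace_logl recovers the
transform for every initial measure. *)
Definition logl (s t : R) (f : borel S -> R) (y : borel S) : R :=
  (- ln (laplace s (\d_y : FM) t f))%R.

Lemma pairing_ge0 t f w : (forall y, 0 <= f y)%R -> (0 <= pairing t f w)%R.
Proof. by move=> f0; exact: rint_ge0. Qed.

Lemma adapted_pairing I (t : R) (f : borel S -> R) : time_interval I -> I t ->
  measurable_fun setT f -> (forall y, 0 <= f y)%R ->
  measurable_fun [set: g_sigma_algebraType (G I)] (pairing t f).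
Proof.
move=> hI It mf f0; exact: (adapted_comp hXm hI It (measurable_pairing mf f0)).
Qed.

Lemma measurable_pairing_process (t : R) (f : borel S -> R) : (0 <= t)%R ->
  measurable_fun setT f -> (forall y, 0 <= f y)%R ->
  measurable_fun [set: Omega'] (pairing t f).
Proof.
move=> t0 mf f0; have hI := time_interval_cy t0.
have It : `[t, +oo[%classic t by rewrite /= in_itv/= lexx.
exact: (adapted_measurable hXm hI (adapted_pairing hI It mf f0)).
Qed.

Lemma bounded_nneg_exp_pairing I (t : R) (f : borel S -> R) :
  time_interval I -> I t -> bounded_nneg f ->
  @bounded_nneg _ (g_sigma_algebraType (G I)) R
    (fun w => expR (- pairing t f w))%R.
Proof.
move=> hI It [mf f0 _]; apply: bounded_nneg_expN.
- exact: adapted_pairing.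
- by move=> w; exact: pairing_ge0.
Qed.

Lemma bounded_nneg_exp_pairing_process (t : R) (f : borel S -> R) : (0 <= t)%R ->
  bounded_nneg f -> bounded_nneg (fun w => expR (- pairing t f w))%R.
Proof.
move=> t0 [mf f0 _]; apply: bounded_nneg_expN.
- exact: measurable_pairing_process.
- by move=> w; exact: pairing_ge0.
Qed.

Lemma integral_pairing t f w : bounded_nneg f ->
  \int[X t w]_y (f y)%:E = (pairing t f w)%:E.
Proof. by move=> bf; rewrite (rintE (X t w : {finite_measure set _ -> \bar R}) bf). Qed.

Lemma laplaceE (s : R) mu (t : R) f : (0 <= t)%R -> bounded_nneg f ->
  \int[PX s \d_mu]_w expeR (- \int[X t w]_y (f y)%:E) = (laplace s mu t f)%:E.
Proof.
move=> t0 bf; rewrite -rintE; last exact: bounded_nneg_exp_pairing_process.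
by apply: eq_integral => w _; rewrite integral_pairing.
Qed.

(** The solution u provided by the definition of the superprocess is a
cumulant; it lies below the transition operator because the branching term is
nonnegative, and this also shows that the branching term is finite. *)
Lemma cumulant_exists (t : R) f : (0 <= t)%R -> bounded_nneg f ->
  exists2 u, cumulant_solution Z P gamma beta t f u &
    forall s : R, (0 <= s <= t)%R -> [/\ bounded_nneg (u s),
      forall y, logl s t f y = u s y, forall y, (u s y <= tr s t f y)%R &
      forall mu, laplace s mu t f = expR (- rint mu (u s))%R].
Proof.
move=> t0 bf; have [mf f0 [M fM]] := bf.
have [u cu lu] := super_laplace hX t0 mf f0 (ex_intro _ M fM).
exists u => // s st; have /andP[s0 st'] := st.
have ule y : (u s y <= tr s t f y)%R.
  rewrite -lee_fin (cumulant_eq cu _ st) -rintE; last exact: (bounded_nneg_comp hZ).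
  rewrite leeBlDr; last first.
    rewrite ge0_fin_numE; last first.
      apply: mule_ge0; first by rewrite lee_fin ltW.
      by apply: integral_ge0 => w _; apply: integral_ge0 => x _; rewrite lee_fin powR_ge0.
    rewrite ltNge leye_eq; apply/negP => /eqP E; have := cumulant_eq cu y st.
    rewrite E (rintE _ (bounded_nneg_comp hZ t0 bf)).
    by [].
  rewrite leeDl//; apply: mule_ge0; first by rewrite lee_fin ltW.
  by apply: integral_ge0 => w _; apply: integral_ge0 => x _; rewrite lee_fin powR_ge0.
have bu : bounded_nneg (u s).
  split; first exact: (cumulant_measurable cu).
    by move=> y; exact: (cumulant_ge0 cu).
  exists M => y; apply: le_trans (ule y) _.
  exact: (transition_bound hZ).
have lE mu : laplace s mu t f = expR (- rint mu (u s))%R.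
  apply: EFin_inj; rewrite -laplaceE// lu//.
  by rewrite (rintE (mu : {finite_measure set _ -> \bar R}) bu).
split => // y; rewrite /logl lE expRK opprK rint_dirac//.
by case: bu.
Qed.

Section one_time.
Variables (t : R) (f : borel S -> R).
Hypotheses (t0 : (0 <= t)%R) (bf : bounded_nneg f).

Lemma bounded_nneg_logl (s : R) : (0 <= s <= t)%R -> bounded_nneg (logl s t f).
Proof.
move=> st; have [u _ /(_ s st)[bu uE _ _]] := cumulant_exists t0 bf.
by rewrite (_ : logl s t f = u s)//; exact/funext.
Qed.

Lemma logl_ge0 (s : R) y : (0 <= s <= t)%R -> (0 <= logl s t f y)%R.
Proof. by move=> /bounded_nneg_logl []. Qed.

Lemma laplace_logl (s : R) mu : (0 <= s <= t)%R ->
  laplace s mu t f = expR (- rint mu (logl s t f))%R.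
Proof.
move=> st; have [u _ /(_ s st)[bu uE _ uL]] := cumulant_exists t0 bf.
by rewrite (_ : logl s t f = u s)//; exact/funext.
Qed.

Lemma logl_le_transition (s : R) y : (0 <= s <= t)%R -> (logl s t f y <= tr s t f y)%R.
Proof.
by move=> st; have [u _ /(_ s st)[bu -> uT _]] := cumulant_exists t0 bf.
Qed.

Lemma logl_bound (s : R) y (M : R) : (0 <= s <= t)%R -> (forall x, f x <= M)%R ->
  (logl s t f y <= M)%R.
Proof.
move=> st fM; apply: le_trans (logl_le_transition y st) _.
exact: (transition_bound hZ).
Qed.

Lemma bounded_nneg_powR_logl (s : R) : (0 <= s <= t)%R ->
  bounded_nneg (fun x => logl s t f x `^ (1 + beta))%R.
Proof.
move=> st; have [mu u0 [M uM]] := bounded_nneg_logl st; split.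
- exact: (measurableT_comp (measurable_powR _) mu).
- by move=> x; exact: powR_ge0.
- exists (M `^ (1 + beta))%R => x; apply: ge0_ler_powR => //; rewrite ?nnegrE//.
    by case/andP: hbeta => h _; lra.
  exact: le_trans (u0 x) (uM x).
Qed.

(** Fubini's theorem turns the cumulant equation, in which the time integral is
taken along paths, into an equation between functions of time. *)
Lemma logl_equation (s : R) y : (0 <= s <= t)%R ->
  bounded_on s t (fun x => tr s x (fun q => logl x t f q `^ (1 + beta)) y)%R /\
  logl s t f y = (tr s t f y - gamma *
    tint s t (fun x => tr s x (fun q => logl x t f q `^ (1 + beta)) y))%R.
Proof.
move=> st; have /andP[s0 st'] := st.
have [u cu uE] := cumulant_exists t0 bf.
have uE' (x : R) : (s <= x <= t)%R -> logl x t f = u x.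
  move=> /andP[sx xt]; apply/funext => q.
  by have [|_ -> _ _] := uE x; rewrite ?(le_trans s0 sx).
have [U mU UE] := cumulant_path cu \d_y st.
have mUp : measurable_fun setT (fun z : R * Omega => ((U z) `^ (1 + beta))%:E).
  apply/measurable_EFinP; exact: (measurableT_comp (measurable_powR _) mU).
pose D : set R := `[s, t]%classic.
have mD : measurable D by exact: measurable_itv.
pose g (z : R * Omega) : \bar R := ((\1_D z.1)%:E * ((U z) `^ (1 + beta))%:E).
have mg : measurable_fun setT g.
  apply: emeasurable_funM => //; apply/measurable_EFinP.
  have m1 : measurable_fun [set: R * Omega] (fst : R * Omega -> R).
    exact: measurable_fst.
  have m2 : measurable_fun [set: R] (\1_D : R -> R) by exact: measurable_indic.
  exact: (measurableT_comp m2 m1).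
have g0 z : 0 <= g z by rewrite mule_ge0// lee_fin// powR_ge0.
pose e x := tr s x (fun q => logl x t f q `^ (1 + beta))%R y.
have eE (x : R) : (s <= x <= t)%R -> \int[P s \d_y]_w g (x, w) = (e x)%:E.
  move=> sxt; have x0 : (0 <= x)%R by case/andP: sxt => /(le_trans s0).
  have xt : (0 <= x <= t)%R by rewrite x0; case/andP: sxt.
  have bl := bounded_nneg_comp hZ x0 (bounded_nneg_powR_logl xt).
  rewrite -rintE//; apply: ae_eq_integral => //.
  - by apply: measurable_fun_pair2 mg.
  - by apply/measurable_EFinP; case: bl.
  apply: filterS UE => w Uw _; rewrite /g /= indicE mem_set ?mul1e; last first.
    by rewrite /D /= in_itv.
  by rewrite -Uw// uE'.
have mG : measurable_fun [set: R] (fun x => \int[P s \d_y]_w g (x, w)).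
  exact: measurable_fun_fubini_tonelli_F.
have be : bounded_on s t e.
  split.
    apply: (eq_measurable_fun (fun x => fine (\int[P s \d_y]_w g (x, w)))).
      by move=> x; rewrite inE /= in_itv/= => sxt; rewrite eE.
    by apply: measurable_funTS; apply: measurableT_comp => //; exact: fine_measurable.
  have [_ _ [M fM]] := bf; exists (M `^ (1 + beta))%R => x /andP[sx xt].
  have x0 := le_trans s0 sx.
  have xt' : (0 <= x <= t)%R by rewrite x0.
  rewrite (transition_ge0 _ _)/=; last by move=> q; exact: powR_ge0.
  apply: (transition_bound hZ) => //; first exact: bounded_nneg_powR_logl.
  move=> q; apply: ge0_ler_powR => //; rewrite ?nnegrE//.
  + by case/andP: hbeta => h _; lra.
  + exact: logl_ge0.
  + by apply: le_trans (logl_ge0 q xt') _; exact: logl_bound.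
  + exact: logl_bound.
split => //; have [_ -> _ _] := uE s st; apply: EFin_inj.
rewrite (cumulant_eq cu y st) EFinB -rintE; last exact: (bounded_nneg_comp hZ).
congr (_ - _); rewrite EFinM; congr (_ * _).
transitivity (\int[P s \d_y]_w \int[lebesgue_measure]_x g (x, w)).
  apply: ge0_ae_eq_integral_nonmeas.
  - exact: measurable_fun_fubini_tonelli_G.
  - by move=> w; apply: integral_ge0 => x _; rewrite lee_fin powR_ge0.
  - by move=> w; apply: integral_ge0.
  apply: filterS UE => w Uw.
  rewrite (integral_indicM lebesgue_measure D (fun x => ((U (x, w)) `^ (1 + beta))%:E)).
  by apply: eq_integral => x; rewrite inE /= in_itv/= => sxt; rewrite Uw.
transitivity (\int[lebesgue_measure]_x \int[P s \d_y]_w g (x, w)).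
  by symmetry; exact: fubini_tonelli.
transitivity (\int[lebesgue_measure]_(x in D) (e x)%:E).
  rewrite [RHS]integral_mkcond; apply: eq_integral => x _; rewrite epatch_indic.
  have [xD|xD] := boolP (x \in D).
    rewrite /= indicE xD mule1 eE//.
    by move: xD; rewrite inE /D /= in_itv.
  rewrite /= indicE (negbTE xD) mule0; apply: integral0_eq => w _.
  by rewrite /g /= indicE (negbTE xD) mul0e.
by rewrite /tint /Rintegral fineK//; apply/integrable_fin_num => //;
  exact: bounded_on_integrable.
Qed.

End one_time.

End log_laplace.

(** * Comparison of cumulants *)

Section cumulant_comparison.
Context {R : realType} {d d' : measure_display}.
Context {Omega : measurableType d} {Omega' : measurableType d'}.
Context {S : ptopologicalType}.
Variables (Z : R -> Omega -> S) (F : set R -> set (set Omega)).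
Variable P : R -> probability (borel S) R -> probability Omega R.
Variables (gamma beta : R).
Variables (X : R -> Omega' -> finmeas (borel S) R).
Variable G : set R -> set (set Omega').
Variable PX : R -> probability (finmeas (borel S) R) R -> probability Omega' R.
Hypothesis hZ : @markov_process R d _ Omega (borel S) Z F P.
Hypothesis hX : superprocess Z P gamma beta X G PX.
Hypothesis hgamma : (0 < gamma)%R.
Hypothesis hbeta : (0 < beta <= 1)%R.

Local Notation tr s t f := (@transition R d _ Omega (borel S) Z P s t f).
Local Notation pr t f w := (@pairing R d' Omega' S X t f w).
Local Notation tr_cst := (@transition_cst R d _ Omega (borel S) Z P).
Local Notation lap s mu t f := (@laplace R d' Omega' S X PX s mu t f).
Local Notation lg s t f := (@logl R d' Omega' S X PX s t f).

Let hXm : markov_process X G PX := super_markov hX.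

Let beta0 : (0 <= 1 + beta)%R. Proof. by case/andP: hbeta => ? _; lra. Qed.

Let powR_le (a b : R) : (0 <= a)%R -> (a <= b)%R ->
  (a `^ (1 + beta) <= b `^ (1 + beta))%R.
Proof.
by move=> a0 ab; apply: ge0_ler_powR; rewrite ?nnegrE// (le_trans a0 ab).
Qed.

Lemma transition_close (s t : R) (f g : borel S -> R) (c : R) y : (0 <= t)%R ->
  bounded_nneg f -> bounded_nneg g -> (forall q, `|f q - g q| <= c)%R ->
  (`|tr s t f y - tr s t g y| <= c)%R.
Proof.
move=> t0 bf bg fgc; have c0 : (0 <= c)%R := le_trans (normr_ge0 _) (fgc point).
have bc := bounded_nneg_cst (T := borel S) c0.
have half f1 f2 : bounded_nneg f1 -> bounded_nneg f2 ->
    (forall q, `|f1 q - f2 q| <= c)%R -> (tr s t f1 y <= tr s t f2 y + c)%R.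
  move=> b1 b2 f12; rewrite -[in leRHS](tr_cst s t c y).
  rewrite -(transitionD hZ s t0 y b2 bc); apply: (transition_le hZ) => //.
    exact: bounded_nnegD.
  by move=> q; move: (f12 q); rewrite ler_norml lerBlDl addrC => /andP[].
rewrite ler_norml lerBlDl half// andbT lerNl opprB lerBlDl half//.
by move=> q; rewrite distrC.
Qed.

(** Monotonicity is read off the Laplace transforms. *)
Lemma le_logl (s t : R) (f g : borel S -> R) y : (0 <= s <= t)%R ->
  bounded_nneg f -> bounded_nneg g -> (forall q, f q <= g q)%R ->
  (lg s t f y <= lg s t g y)%R.
Proof.
move=> st bf bg fg; have /andP[s0 st'] := st; have t0 := le_trans s0 st'.
have lE h : bounded_nneg h -> lap s \d_y t h = expR (- lg s t h y).
  move=> bh; rewrite (laplace_logl hZ hX hgamma t0 bh)// rint_dirac//.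
  by have [] := bounded_nneg_logl hZ hX hgamma t0 bh st.
have H : (lap s \d_y t g <= lap s \d_y t f)%R.
  rewrite /laplace; apply: rint_le.
  - exact: (bounded_nneg_exp_pairing_process hX t0 bg).
  - exact: (bounded_nneg_exp_pairing_process hX t0 bf).
  - by move=> w; rewrite ler_expR lerN2; exact: rint_le.
by rewrite (lE f bf) (lE g bg) ler_expR lerN2 in H.
Qed.

Lemma rint_exp_pairing (r s t : R) mu (b : Omega' -> R) (f : borel S -> R) :
  (0 <= r)%R -> (r <= s)%R -> (s <= t)%R ->
  @bounded_nneg _ (g_sigma_algebraType (G `[r, s])) R b -> bounded_nneg f ->
  rint (PX r mu) (fun w => b w * expR (- pr t f w))%R =
  rint (PX r mu) (fun w => b w * expR (- pr s (lg s t f) w))%R.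
Proof.
move=> r0 rs st bb bf; have s0 := le_trans r0 rs; have t0 := le_trans s0 st.
have rs' : (0 <= r <= s)%R by rewrite r0.
have It : `[s, +oo[%classic t by rewrite /= in_itv/= st.
have bg := bounded_nneg_exp_pairing hX (time_interval_cy s0) It bf.
have -> := rint_markov hXm mu rs' bb bg.
congr rint; apply/funext => w; congr (_ * _)%R.
by apply: (laplace_logl hZ hX hgamma t0 bf); rewrite s0.
Qed.

(** The Markov property at the intermediate time s, where the conditional
transform is again the transform of a pairing. *)
Lemma laplace_flow (r s t : R) mu (f : borel S -> R) :
  (0 <= r)%R -> (r <= s)%R -> (s <= t)%R -> bounded_nneg f ->
  lap r mu t f = lap r mu s (lg s t f).
Proof.
move=> r0 rs st bf.
have := rint_exp_pairing (dirac mu) r0 rs st (bounded_nneg_cst ler01) bf.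
by under eq_fun do rewrite mul1r; under [in RHS]eq_fun do rewrite mul1r.
Qed.

Lemma logl_flow (r s t : R) (f : borel S -> R) :
  (0 <= r)%R -> (r <= s)%R -> (s <= t)%R -> bounded_nneg f ->
  lg r t f = lg r s (lg s t f).
Proof.
by move=> r0 rs st bf; apply/funext => y; rewrite /logl (laplace_flow _ r0 rs st).
Qed.

Lemma logl_refl (t : R) (f : borel S -> R) : (0 <= t)%R -> bounded_nneg f ->
  lg t t f = f.
Proof.
move=> t0 bf; apply/funext => y; have tt : (0 <= t <= t)%R by rewrite t0 lexx.
have [_ ->] := logl_equation hZ hX hgamma hbeta t0 bf y tt.
by rewrite (transition_refl hZ)// /tint set_itv1 Rintegral_set1 mulr0 subr0.
Qed.

Local Opaque logl transition tint.

Let aux1 (w p a b : R) : (gamma * a <= gamma * b ->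
  w + p - gamma * b - (w - gamma * a) <= p)%R.
Proof. by lra. Qed.

Let aux2 (w p a b h : R) : (gamma * b <= gamma * (a + h) ->
  w - gamma * a + (p - gamma * h) <= w + p - gamma * b)%R.
Proof. by rewrite mulrDr; lra. Qed.

Let aux4 (a b c h : R) :
  (`|a - c| <= h -> `|b - c| <= h -> `|a - b| <= h + h)%R.
Proof.
rewrite !ler_norml => /andP[? ?] /andP[? ?]; apply/andP; split; lra.
Qed.

Let aux5 (K m : R) : (0 <= K -> 0 <= m ->
  gamma * (2 * (K * m) / (4 * gamma * K + 1)) <= m / 2)%R.
Proof.
move=> K0 m0; have k0 : (0 < 4 * gamma * K + 1)%R.
  by rewrite ltr_wpDl// mulr_ge0// mulr_ge0//; exact: ltW.
rewrite mulrA ler_pdivrMr//.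
have -> : (m / 2 * (4 * gamma * K + 1) = gamma * (2 * (K * m)) + m / 2)%R.
  by field.
by rewrite lerDl divr_ge0.
Qed.

Let aux3 (a b : R) : (0 <= a <= b -> forall c, 0 <= c <= b -> `|a - c| <= b)%R.
Proof. by move=> /andP[? ?] c /andP[? ?]; rewrite ler_norml; apply/andP; split; lra. Qed.

(** The branching term increases with the terminal value, which gives the
upper bound. By the mean value inequality its increment is at most (1 + beta)
C^beta times that of the cumulant, itself at most the mean of f; integrating
over [s, t] gives the lower bound. *)
Lemma logl_add_bounds (s t : R) (W f : borel S -> R) (C : R) y : (0 <= s <= t)%R ->
  bounded_nneg W -> bounded_nneg f -> (forall q, W q + f q <= C)%R ->
  (lg s t W y + (1 - gamma * (1 + beta) * C `^ beta * (t - s)) * tr s t f y <=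
     lg s t (fun q => W q + f q) y <= lg s t W y + tr s t f y)%R.
Proof.
move=> st bW bf WfC; have /andP[s0 st'] := st; have t0 := le_trans s0 st'.
have bWf := bounded_nnegD bW bf.
have WC q : (W q <= C)%R.
  by apply: le_trans (WfC q); rewrite lerDl; case: bf.
have bT x : (0 <= x <= t)%R -> bounded_nneg (tr x t f).
  by move=> xt; exact: (bounded_nneg_transition hZ xt bf).
pose u x := lg x t W; pose v x := lg x t (fun q => W q + f q)%R.
have uv x q : (0 <= x <= t)%R -> (u x q <= v x q)%R.
  by move=> xt; apply: le_logl => // q'; rewrite lerDl; case: bf.
have ux0 x q : (0 <= x <= t)%R -> (0 <= u x q)%R.
  by move=> xt; exact: (logl_ge0 hZ hX hgamma t0 bW).
have vC x q : (0 <= x <= t)%R -> (v x q <= C)%R.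
  by move=> xt; exact: (logl_bound hZ hX hgamma t0 bWf).
have bu x : (0 <= x <= t)%R -> bounded_nneg (fun q => u x q `^ (1 + beta))%R.
  exact: (bounded_nneg_powR_logl hZ hX hgamma hbeta t0 bW).
have bv x : (0 <= x <= t)%R -> bounded_nneg (fun q => v x q `^ (1 + beta))%R.
  exact: (bounded_nneg_powR_logl hZ hX hgamma hbeta t0 bWf).
pose eu x q x' := tr x x' (fun q => u x' q `^ (1 + beta))%R q.
pose ev x q x' := tr x x' (fun q => v x' q `^ (1 + beta))%R q.
have uE x q : (0 <= x <= t)%R -> bounded_on x t (eu x q) /\
    u x q = (tr x t W q - gamma * tint x t (eu x q))%R.
  exact: (logl_equation hZ hX hgamma hbeta t0 bW q).
have vE x q : (0 <= x <= t)%R -> bounded_on x t (ev x q) /\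
    v x q = (tr x t W q + tr x t f q - gamma * tint x t (ev x q))%R.
  move=> xt; rewrite -(transitionD hZ x t0 q bW bf).
  exact: (logl_equation hZ hX hgamma hbeta t0 bWf q xt).
rewrite -/(u s y) -/(v s y); clearbody u v.
have uvp x q : (0 <= x <= t)%R -> (u x q `^ (1 + beta) <= v x q `^ (1 + beta))%R.
  by move=> xt; apply: powR_le; [exact: ux0|exact: uv].
have le_tint_uv x q : (0 <= x <= t)%R ->
    (tint x t (eu x q) <= tint x t (ev x q))%R.
  move=> xt; have [b1 _] := uE x q xt; have [b2 _] := vE x q xt.
  apply: (tint_le b1 b2) => x' /andP[xx' x't]; have /andP[x0 _] := xt.
  have x't' : (0 <= x' <= t)%R by rewrite (le_trans x0 xx').
  have x'0 : (0 <= x')%R by case/andP: x't'.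
  apply: (transition_le hZ x x'0 q (bu x' x't') (bv x' x't')) => q'; exact: uvp.
have vu_le x q : (0 <= x <= t)%R -> (v x q - u x q <= tr x t f q)%R.
  move=> xt; have [_ ->] := uE x q xt; have [_ ->] := vE x q xt.
  apply: aux1; apply: ler_wpM2l; [exact: ltW|exact: le_tint_uv].
have [b1 uEs] := uE s y st; have [b2 vEs] := vE s y st.
pose K := ((1 + beta) * C `^ beta)%R.
have K0 : (0 <= K)%R by rewrite mulr_ge0// powR_ge0.
have T0 : (0 <= tr s t f y)%R by apply: transition_ge0; case: bf.
have le_vu : (tint s t (ev s y) <= tint s t (eu s y) + K * tr s t f y * (t - s))%R.
  have bKc := bounded_on_cst s t (mulr_ge0 K0 T0).
  rewrite -(tint_cst _ st') -(tintD b1 bKc).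
  apply: (tint_le b2 (bounded_onD b1 bKc)) => x /andP[sx xt'].
  have x0 := le_trans s0 sx; have xt : (0 <= x <= t)%R by rewrite x0.
  have bKT := bounded_nnegZ K0 (bT x xt).
  rewrite -(transition_transition hZ y s0 sx xt' bf) -(transitionZ hZ s x0 y K0 (bT x xt)).
  rewrite -(transitionD hZ s x0 y (bu x xt) bKT).
  apply: (transition_le hZ s x0 y (bv x xt) (bounded_nnegD (bu x xt) bKT)) => q.
  have uvx := uv x q xt; have vCx := vC x q xt; have u0x := ux0 x q xt.
  have hu : (0 <= u x q <= C)%R by rewrite u0x (le_trans uvx vCx).
  have hv : (0 <= v x q <= C)%R by rewrite (le_trans u0x uvx).
  rewrite -lerBlDl; apply: le_trans (ler_norm _) _.
  apply: le_trans (powR_lipschitz hbeta hu hv) _.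
  rewrite ger0_norm ?subr_ge0//; apply: ler_wpM2l; first exact: K0.
  exact: vu_le.
have gv := ler_wpM2l (ltW hgamma) le_vu.
have vu := vu_le s y st.
apply/andP; split; last by rewrite -lerBlDl.
rewrite uEs vEs; have -> : ((1 - gamma * (1 + beta) * C `^ beta * (t - s)) *
    tr s t f y = tr s t f y - gamma * (K * tr s t f y * (t - s)))%R.
  by rewrite /K; ring.
exact: aux2.
Qed.

(** All particles branch at the same rate, so the difference between the
values at two points satisfies a homogeneous Gronwall inequality. *)
Lemma logl_cst (t c : R) : (0 <= t)%R -> (0 <= c)%R ->
  forall (s : R) y y', (0 <= s <= t)%R -> lg s t (fun=> c) y = lg s t (fun=> c) y'.
Proof.
move=> t0 c0; pose u x := lg x t (fun=> c).
have bc := bounded_nneg_cst (T := borel S) c0.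
have bp x : (0 <= x <= t)%R -> bounded_nneg (fun q => u x q `^ (1 + beta))%R.
  exact: (bounded_nneg_powR_logl hZ hX hgamma hbeta t0 bc).
pose K := ((1 + beta) * c `^ beta)%R.
have K0 : (0 <= K)%R by rewrite mulr_ge0// powR_ge0.
have u0 x q : (0 <= x <= t)%R -> (0 <= u x q)%R.
  by move=> xt; exact: (logl_ge0 hZ hX hgamma t0 bc).
have uc x q : (0 <= x <= t)%R -> (u x q <= c)%R.
  by move=> xt; exact: (logl_bound hZ hX hgamma t0 bc).
pose k := (4 * gamma * K + 1)%R.
have k0 : (0 < k)%R.
  by rewrite /k ltr_wpDl// mulr_ge0// mulr_ge0//; exact: ltW.
pose e x q x' := tr x x' (fun q => u x' q `^ (1 + beta))%R q.
have uE x q : (0 <= x <= t)%R -> bounded_on x t (e x q) /\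
    u x q = (c - gamma * tint x t (e x q))%R.
  rewrite -[X in (X - _)%R](tr_cst x t c q).
  exact: (logl_equation hZ hX hgamma hbeta t0 bc q).
suff H : forall (s : R) (q : borel S * borel S), (0 <= s <= t)%R ->
    (`|u s q.1 - u s q.2| <= 2 * 0 * expR (k * (t - s)))%R.
  move=> s y y' st; have := H s (y, y') st; rewrite mulr0 mul0r normr_le0 subr_eq0.
  by move/eqP.
clearbody u.
apply: (@gronwall _ _ _ 0 t 0 c k) => //; last 2 first.
- exact: ltW.
- move=> m m0 um s [y y'] st /=; have /andP[s0 st'] := st.
  pose e1 := e s y; pose e2 := e s y'.
  have [by1 uy] := uE s y st; have [by2 uy'] := uE s y' st.
  rewrite uy uy'.
  have -> : (c - gamma * tint s t e1 - (c - gamma * tint s t e2) =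
    gamma * (tint s t e2 - tint s t e1))%R by ring.
  rewrite normrM (gtr0_norm hgamma) distrC add0r.
  have close : (forall x, s <= x <= t ->
      `|e1 x - e2 x| <= (2 * (K * m)) * expR (k * (t - x)) + 0)%R.
    move=> x /andP[sx xt]; have x0 := le_trans s0 sx.
    have xt' : (0 <= x <= t)%R by rewrite x0.
    have near y0 q :
        (`|e s y0 x - u x q `^ (1 + beta)| <= K * m * expR (k * (t - x)))%R.
      have cl q' : (`|u x q' `^ (1 + beta) - u x q `^ (1 + beta)| <=
          K * m * expR (k * (t - x)))%R.
        have hq q1 : (0 <= u x q1 <= c)%R.
          by apply/andP; split; [exact: u0|exact: uc].
        apply: le_trans (powR_lipschitz hbeta (hq q) (hq q')) _.
        rewrite -[leRHS]mulrA; apply: ler_wpM2l; first exact: K0.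
        exact: (um x (q', q)).
      rewrite -[X in (_ - X)%R](tr_cst s x _ y0).
      apply: transition_close => //; first exact: bp.
      by apply: bounded_nneg_cst; exact: powR_ge0.
    have n1 := near y y; have n2 := near y' y.
    have -> : (2 * (K * m) * expR (k * (t - x)) + 0 = K * m * expR (k * (t - x)) +
      K * m * expR (k * (t - x)))%R by ring.
    exact: aux4 n1 n2.
  have Km0 : (0 <= 2 * (K * m))%R.
    by apply: mulr_ge0 => //; exact: mulr_ge0.
  have := tint_close k0 Km0 (lexx 0%R) st' by1 by2 close.
  rewrite mul0r addr0 => /(ler_wpM2l (ltW hgamma)) H.
  apply: le_trans H _; rewrite [leLHS]mulrA; apply: ler_wpM2r; first exact: expR_ge0.
  exact: aux5.
- move=> s [y y'] st /=; rewrite normr_ge0 /=.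
  by apply: aux3; rewrite u0// uc.
Qed.

End cumulant_comparison.

(** * First-order expansion of the cumulant *)

Section first_order_expansion.
Context {R : realType} {d d' : measure_display}.
Context {Omega : measurableType d} {Omega' : measurableType d'}.
Context {S : ptopologicalType}.
Variables (Z : R -> Omega -> S) (F : set R -> set (set Omega)).
Variable P : R -> probability (borel S) R -> probability Omega R.
Variables (gamma beta : R).
Variables (X : R -> Omega' -> finmeas (borel S) R).
Variable G : set R -> set (set Omega').
Variable PX : R -> probability (finmeas (borel S) R) R -> probability Omega' R.
Hypothesis hZ : @markov_process R d _ Omega (borel S) Z F P.
Hypothesis hX : superprocess Z P gamma beta X G PX.
Hypothesis hgamma : (0 < gamma)%R.
Hypothesis hbeta : (0 < beta <= 1)%R.

Local Notation tr s t f := (@transition R d _ Omega (borel S) Z P s t f).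
Local Notation tr_cst := (@transition_cst R d _ Omega (borel S) Z P).
Local Notation lg s t f := (@logl R d' Omega' S X PX s t f).

Let beta0 : (0 <= 1 + beta)%R. Proof. by case/andP: hbeta => ? _; lra. Qed.

Local Opaque logl transition tint.

Let powR_le (a b : R) : (0 <= a)%R -> (a <= b)%R ->
  (a `^ (1 + beta) <= b `^ (1 + beta))%R.
Proof.
by move=> a0 ab; apply: ge0_ler_powR; rewrite ?nnegrE// (le_trans a0 ab).
Qed.

Let triangle (A B C D E1 E2 h L : R) : (0 <= h -> `|A - L * B| <= E1 ->
  `|C - L * D| <= E2 ->
  `|A - h * C| <= `|L * (B - h * D)| + (E1 + h * E2))%R.
Proof.
move=> h0 hA hC.
have -> : (A - h * C = L * (B - h * D) + ((A - L * B) - h * (C - L * D)))%R by ring.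
apply: le_trans (ler_normD _ _) _; rewrite lerD2l.
apply: le_trans (ler_normB _ _) _; apply: lerD => //.
by rewrite normrM (ger0_norm h0) ler_wpM2l.
Qed.

Let pointwise (u a k h B c eps : R) : (0 <= a -> a <= u -> a <= k -> a <= c ->
  0 <= h -> h <= B -> 0 <= eps -> u - a <= eps * B -> k - a <= eps ->
  `|(u `^ (1 + beta) - a `^ (1 + beta)) - h * (k `^ (1 + beta) - a `^ (1 + beta))|
  <= (1 + beta) * c `^ beta * `|(u - a) - h * (k - a)| +
     (1 + beta) * (B `^ (1 + beta) + B) * eps `^ (1 + beta))%R.
Proof.
move=> a0 au ak ac h0 hB e0 uB ke; have B0 := le_trans h0 hB.
have ua0 : (0 <= u - a)%R by rewrite subr_ge0.
have ka0 : (0 <= k - a)%R by rewrite subr_ge0.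
have := powR_remainder hbeta a0 ua0; have := powR_remainder hbeta a0 ka0.
rewrite !(addrC a) !subrK => rk ru.
apply: le_trans (triangle h0 ru rk) _; apply: lerD.
  rewrite normrM ler_wpM2r// ger0_norm ?mulr_ge0 ?powR_ge0// ler_wpM2l//.
  case/andP: hbeta => b0 _; apply: ge0_ler_powR; rewrite ?nnegrE ?(ltW b0)//.
  exact: le_trans ac.
have -> : ((1 + beta) * (B `^ (1 + beta) + B) * eps `^ (1 + beta) =
  (1 + beta) * (eps `^ (1 + beta) * B `^ (1 + beta)) +
  B * ((1 + beta) * eps `^ (1 + beta)))%R by ring.
apply: lerD.
  by rewrite ler_wpM2l// -powRM//; exact: powR_le.
apply: ler_pM => //; first by rewrite mulr_ge0// powR_ge0.
by rewrite ler_wpM2l//; exact: powR_le.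
Qed.

Let diff_eq (c e h Tu Ta Tk : R) :
  ((c + e * h - gamma * Tu) - (c - gamma * Ta) -
    h * ((c + e - gamma * Tk) - (c - gamma * Ta)) =
   - (gamma * ((Tu + h * Ta) - (Ta + h * Tk))))%R.
Proof. by ring. Qed.

Let absorb (L m a t' E : R) : (0 <= L -> 0 <= m -> 0 <= a -> 1 <= E ->
  gamma * (L * m / (2 * gamma * L + 1) * E + a * t') <=
  (gamma * (a * t') + m / 2) * E + gamma * (a * t') - gamma * (a * t') * E)%R.
Proof.
move=> L0 m0 a0 E1; have k0 : (0 < 2 * gamma * L + 1)%R.
  by rewrite ltr_wpDl// mulr_ge0// mulr_ge0//; exact: ltW.
have H : (gamma * (L * m / (2 * gamma * L + 1)) <= m / 2)%R.
  rewrite mulrA ler_pdivrMr//.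
  have -> : (m / 2 * (2 * gamma * L + 1) = gamma * (L * m) + m / 2)%R by field.
  by rewrite lerDl divr_ge0.
have := ler_wpM2r (le_trans ler01 E1) H; lra.
Qed.

(** Up to an error of order 1 + beta both increments solve the same linear
equation, whose coefficient depends on time only because the cumulant of a
constant is constant in space; Gronwall's inequality then bounds their
difference. *)
Lemma logl_first_order (t c B : R) (f : borel S -> R) : (0 <= t)%R ->
  (0 <= c)%R -> bounded_nneg f -> (forall q, f q <= B)%R ->
  exists2 C : R, (0 <= C)%R & forall (eps s : R) y, (0 <= eps)%R -> (0 <= s <= t)%R ->
    (`|(lg s t (fun q => c + eps * f q) y - lg s t (fun=> c) y) -
       tr s t f y * (lg s t (fun=> c + eps) y - lg s t (fun=> c) y)|
     <= C * eps `^ (1 + beta))%R.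
Proof.
move=> t0 c0 bf fB.
have B0 : (0 <= B)%R by apply: le_trans (fB point); case: bf.
pose L := ((1 + beta) * c `^ beta)%R.
have L0 : (0 <= L)%R by rewrite mulr_ge0// powR_ge0.
pose k0 := (2 * gamma * L + 1)%R.
have k0_gt0 : (0 < k0)%R.
  by rewrite /k0 ltr_wpDl// mulr_ge0// mulr_ge0//; exact: ltW.
pose rho0 := ((1 + beta) * (B `^ (1 + beta) + B))%R.
have rho00 : (0 <= rho0)%R by rewrite mulr_ge0// addr_ge0// powR_ge0.
pose C := (2 * (gamma * (rho0 * t)) * expR (k0 * t))%R.
have C0 : (0 <= C)%R.
  by rewrite mulr_ge0 ?expR_ge0// mulr_ge0// mulr_ge0 ?(ltW hgamma)// mulr_ge0.
exists C => // eps s y e0 st.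
pose h x q := tr x t f q.
have hB x q : (0 <= x <= t)%R -> (0 <= h x q <= B)%R.
  move=> xt; rewrite transition_ge0 ?(transition_bound hZ)//; last by case: bf.
have bh x : (0 <= x <= t)%R -> bounded_nneg (h x).
  by move=> xt; exact: (bounded_nneg_transition hZ xt bf).
have hh x x' q : (0 <= x)%R -> (x <= x')%R -> (x' <= t)%R ->
    tr x x' (h x') q = h x q.
  by move=> x0 xx' x't; exact: (transition_transition hZ).
have bc := bounded_nneg_cst (T := borel S) c0.
have bce := bounded_nneg_cst (T := borel S) (addr_ge0 c0 e0).
have bef := bounded_nnegZ e0 bf.
have bcf := bounded_nnegD bc bef.
pose u x q := lg x t (fun q => c + eps * f q)%R q.
pose a x := lg x t (fun=> c) y.
pose k x := lg x t (fun=> c + eps)%R y.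
have aq x q : (0 <= x <= t)%R -> lg x t (fun=> c) q = a x.
  by move=> xt; exact: (logl_cst hZ hX hgamma hbeta t0 c0).
have kq x q : (0 <= x <= t)%R -> lg x t (fun=> c + eps)%R q = k x.
  by move=> xt; exact: (logl_cst hZ hX hgamma hbeta t0 (addr_ge0 c0 e0)).
have a_ge0 x : (0 <= x <= t)%R -> (0 <= a x)%R.
  by move=> xt; exact: (logl_ge0 hZ hX hgamma t0 bc).
have a_le x : (0 <= x <= t)%R -> (a x <= c)%R.
  by move=> xt; exact: (logl_bound hZ hX hgamma t0 bc).
have au x q : (0 <= x <= t)%R -> (a x <= u x q)%R.
  move=> xt; rewrite -(aq x q xt); apply: (le_logl hZ hX hgamma) => // q'.
  by rewrite lerDl; case: bef.
have ak x : (0 <= x <= t)%R -> (a x <= k x)%R.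
  by move=> xt; apply: (le_logl hZ hX hgamma) => // q'; rewrite lerDl.
have uB x q : (0 <= x <= t)%R -> (u x q - a x <= eps * B)%R.
  move=> xt; rewrite -(aq x q xt) lerBlDl.
  have := @logl_add_bounds _ _ _ _ _ _ Z F P gamma beta X G PX hZ hX hgamma hbeta
    x t (fun=> c) (fun q => eps * f q)%R (c + eps * B)%R q xt bc bef.
  case/(_ _)/andP => [q'|_ H]; first by rewrite lerD2l ler_wpM2l.
  apply: le_trans H _; rewrite lerD2l (transitionZ hZ)//.
  by rewrite ler_wpM2l//; case/andP: (hB x q xt).
have ke x : (0 <= x <= t)%R -> (k x - a x <= eps)%R.
  move=> xt; rewrite lerBlDl.
  have := @logl_add_bounds _ _ _ _ _ _ Z F P gamma beta X G PX hZ hX hgamma hbeta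
    x t (fun=> c) (fun=> eps)%R (c + eps)%R y xt bc (bounded_nneg_cst e0).
  case/(_ _)/andP => [q'//|_ H].
  by apply: le_trans H _; rewrite lerD2l tr_cst.
have bu x : (0 <= x <= t)%R -> bounded_nneg (fun q => u x q `^ (1 + beta))%R.
  exact: (bounded_nneg_powR_logl hZ hX hgamma hbeta t0 bcf).
pose eu x q x' := tr x x' (fun q => u x' q `^ (1 + beta))%R q.
have uE x q : (0 <= x <= t)%R -> bounded_on x t (eu x q) /\
    u x q = (c + eps * h x q - gamma * tint x t (eu x q))%R.
  move=> xt; rewrite -(transitionZ hZ x t0 q e0 bf).
  rewrite -[X in (X + _ - _)%R](tr_cst x t c q) -(transitionD hZ x t0 q bc bef).
  exact: (logl_equation hZ hX hgamma hbeta t0 bcf q xt).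
have constE (c1 : R) (v : R -> R) : (0 <= c1)%R ->
    (forall x q, (0 <= x <= t)%R -> lg x t (fun=> c1) q = v x) ->
    forall x, (0 <= x <= t)%R -> bounded_on x t (fun x' => v x' `^ (1 + beta))%R /\
    v x = (c1 - gamma * tint x t (fun x' => v x' `^ (1 + beta)))%R.
  move=> c10 vE x xt; have bc1 := bounded_nneg_cst (T := borel S) c10.
  have [b1 E1] := logl_equation hZ hX hgamma hbeta t0 bc1 y xt.
  pose e1 x' := tr x x' (fun q => lg x' t (fun=> c1) q `^ (1 + beta))%R y.
  have eqv x' : (x <= x' <= t)%R -> e1 x' = (v x' `^ (1 + beta))%R.
    move=> /andP[xx' x't]; have x't' : (0 <= x' <= t)%R.
      by rewrite x't andbT; apply: le_trans xx'; case/andP: xt.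
    rewrite /e1 -[RHS](tr_cst x x' _ y); congr (tr x x' _ y).
    by apply/funext => q; rewrite vE.
  have bv : bounded_on x t (fun x' => v x' `^ (1 + beta))%R.
    case: b1 => [m1 [M1 h1]]; split.
      apply: eq_measurable_fun m1 => x'; rewrite inE /= in_itv/= => xx'.
      exact: eqv.
    by exists M1 => x' xx'; rewrite -eqv//; exact: h1.
  split => //; rewrite -(vE x y xt) E1 tr_cst; congr (_ - gamma * _)%R.
  apply/eqP; rewrite eq_le; apply/andP; split; apply: tint_le => // x' xx'.
    by rewrite -/(e1 x') eqv.
  by rewrite -/(e1 x') eqv.
have aE := constE c a c0 aq; have kE := constE (c + eps)%R k (addr_ge0 c0 e0) kq.
clear constE.
suff H : forall (s : R) q, (0 <= s <= t)%R ->
    (`|u s q - a s - h s q * (k s - a s)| <=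
     2 * (gamma * (rho0 * eps `^ (1 + beta) * t)) * expR (k0 * (t - s)))%R.
  apply: le_trans (H s y st) _.
  have -> : (2 * (gamma * (rho0 * eps `^ (1 + beta) * t)) * expR (k0 * (t - s)) =
     2 * (gamma * (rho0 * t)) * expR (k0 * (t - s)) * eps `^ (1 + beta))%R by ring.
  rewrite /C ler_wpM2r ?powR_ge0// ler_wpM2l//.
    by rewrite mulr_ge0// mulr_ge0 ?(ltW hgamma)// mulr_ge0.
  rewrite ler_expR ler_wpM2l ?(ltW k0_gt0)// lerBlDr lerDl; by case/andP: st.
clearbody u a k h; clear s y st.
apply: (@gronwall _ _ _ 0 t _ (eps * B + B * eps) k0) => //.
- by rewrite mulr_ge0 ?(ltW hgamma)// mulr_ge0// mulr_ge0// powR_ge0.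
- move=> s q st; rewrite normr_ge0 /=; have /andP[h0 hb] := hB s q st.
  apply: le_trans (ler_normB _ _) _; apply: lerD.
    by rewrite ger0_norm ?subr_ge0 ?au//; exact: uB.
  rewrite normrM (ger0_norm h0) ler_pM// ger0_norm ?subr_ge0 ?ak//; exact: ke.
- exact: ltW.
move=> m m0 um s q st; have /andP[s0 st'] := st; have /andP[h0 hb] := hB s q st.
have [bU ->] := uE s q st; have [bA ->] := aE s st; have [bK ->] := kE s st.
rewrite diff_eq normrN normrM (gtr0_norm hgamma).
rewrite -!(tintZ (h s q))// -!tintD; try exact: bounded_onZ; try by [].
have bl := bounded_onD bU (bounded_onZ h0 bA).
have br := bounded_onD bA (bounded_onZ h0 bK).
have rhoe : (0 <= rho0 * eps `^ (1 + beta))%R by rewrite mulr_ge0// powR_ge0.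
have close : (forall x, s <= x <= t ->
    `|(eu s q x + h s q * a x `^ (1 + beta)) -
      (a x `^ (1 + beta) + h s q * k x `^ (1 + beta))| <=
    L * m * expR (k0 * (t - x)) + rho0 * eps `^ (1 + beta))%R.
  move=> x /andP[sx xt]; have x0 := le_trans s0 sx.
  have xt' : (0 <= x <= t)%R by rewrite x0.
  pose ap := (a x `^ (1 + beta))%R; pose kp := (k x `^ (1 + beta))%R.
  have ap0 : (0 <= ap)%R by exact: powR_ge0.
  have kp0 : (0 <= kp)%R by exact: powR_ge0.
  have bha := bounded_nnegZ ap0 (bh x xt'); have bhk := bounded_nnegZ kp0 (bh x xt').
  have ba := bounded_nneg_cst (T := borel S) ap0.
  have -> : (eu s q x + h s q * ap = tr s x (fun q' => u x q' `^ (1 + beta) + ap * h x q') q)%R.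
    rewrite (transitionD hZ s x0 q (bu x xt') bha) (transitionZ hZ s x0 q ap0 (bh x xt')).
    by rewrite hh// mulrC.
  have -> : (ap + h s q * kp = tr s x (fun q' => ap + kp * h x q') q)%R.
    rewrite (transitionD hZ s x0 q ba bhk) (transitionZ hZ s x0 q kp0 (bh x xt')).
    by rewrite hh// tr_cst mulrC.
  apply: (transition_close hZ); [exact: x0|exact: (bounded_nnegD (bu x xt') bha)|exact: (bounded_nnegD ba bhk)|].
  move=> q'; have /andP[h0' hb'] := hB x q' xt'.
  have := pointwise (a_ge0 x xt') (au x q' xt') (ak x xt') (a_le x xt') h0' hb' e0
    (uB x q' xt') (ke x xt').
  rewrite -/ap -/kp => P1.
  have -> : (u x q' `^ (1 + beta) + ap * h x q' - (ap + kp * h x q') =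
    u x q' `^ (1 + beta) - ap - h x q' * (kp - ap))%R by ring.
  apply: le_trans P1 _; rewrite -/rho0 lerD2r -/L -mulrA ler_wpM2l//.
  exact: um.
have := tint_close k0_gt0 (mulr_ge0 L0 m0) rhoe st' bl br close.
move=> /(ler_wpM2l (ltW hgamma)) H; apply: le_trans H _.
have E1 : (1 <= expR (k0 * (t - s)))%R.
  by rewrite -expR0 ler_expR mulr_ge0 ?(ltW k0_gt0)// subr_ge0.
have ts : (rho0 * eps `^ (1 + beta) * (t - s) <= rho0 * eps `^ (1 + beta) * t)%R.
  by rewrite ler_wpM2l// lerBlDr lerDl.
have H1 := absorb t L0 m0 rhoe E1.
set A := (rho0 * eps `^ (1 + beta))%R in rhoe ts H1 *.
set E := expR (k0 * (t - s)) in E1 H1 *.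
have ga : (0 <= gamma * (A * t))%R by rewrite mulr_ge0 ?(ltW hgamma)// mulr_ge0.
have tsg := ler_wpM2l (ltW hgamma) ts.
have gE := ler_wpM2l ga E1.
apply: (@le_trans _ _ (gamma * (L * m / k0 * E + A * t))%R).
  by rewrite ler_wpM2l ?(ltW hgamma)// lerD2l.
apply: le_trans H1 _.
rewrite mulr1 in gE; rewrite -addrA gerDl subr_le0.
exact: gE.
Qed.

End first_order_expansion.

(** * Difference quotients of exponentials *)

Section cvg_from_below.
Context {d : measure_display} {T : measurableType d} {R : realType}.

Lemma cvg_einf_squeeze (u : nat -> \bar R) (l : \bar R) :
  (forall n, u n <= l) -> l <= limn_einf u -> u @ \oo --> l.
Proof.
move=> ul lu; rewrite -(oppeK l) -(_ : -%E \o (-%E \o u) = u); last first.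
  by apply/funext => n; rewrite /= oppeK.
apply: cvgeN; apply: limn_esup_le_cvg; first by rewrite limn_esupN leeN2.
by move=> n; rewrite /= leeN2.
Qed.

(** Fatou's lemma gives one inequality and the bound by f the other; unlike
dominated convergence this allows an infinite limit, and unlike monotone
convergence a sequence that is not monotone. *)
Lemma integral_cvg_below (m : {measure set T -> \bar R}) (f_ : nat -> T -> \bar R)
    (f : T -> \bar R) :
  (forall n, measurable_fun setT (f_ n)) -> measurable_fun setT f ->
  (forall n x, 0 <= f_ n x <= f x) -> (forall x, f_ n x @[n --> \oo] --> f x) ->
  \int[m]_x f_ n x @[n --> \oo] --> \int[m]_x f x.
Proof.
move=> mf_ mf f_f cf; apply: cvg_einf_squeeze => [n|].
  apply: ge0_le_integral => //; first by move=> x _; case/andP: (f_f n x).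
  by move=> x _; case/andP: (f_f n x).
apply: le_trans (fatou _ measurableT mf_ _); last first.
  by move=> n x _; case/andP: (f_f n x).
rewrite le_eqVlt; apply/orP; left; apply/eqP; apply: eq_integral => x _.
by rewrite (cvg_limn_einf_sup (cf x)).1.
Qed.

End cvg_from_below.

Section exponential_slopes.
Local Open Scope ring_scope.
Context {R : realType}.

Lemma expN_bounds (x : R) : 0 <= x -> x - x ^+ 2 <= 1 - expR (- x) <= x.
Proof.
move=> x0; apply/andP; split; last first.
  by rewrite lerBlDr -lerBlDl; have := expR_ge1Dx (- x).
have e1 : 1 + x <= expR x by exact: expR_ge1Dx.
have x1 : 0 < 1 + x by lra.
have : expR (- x) <= (1 + x)^-1.
  by rewrite expRN lef_pV2// posrE// expR_gt0.
have : (1 + x)^-1 <= 1 - x + x ^+ 2.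
  rewrite -[leLHS]mul1r ler_pdivrMr//.
  have -> : (1 - x + x ^+ 2) * (1 + x) = 1 + x ^+ 3 by ring.
  by rewrite lerDl exprn_ge0.
lra.
Qed.

Lemma harmonic_gt0 n : 0 < harmonic n :> R.
Proof. by rewrite invr_gt0 ltr0n. Qed.

Lemma cvg_harmonic_powR (b : R) : 0 < b -> (@harmonic R n) `^ b @[n --> \oo] --> 0.
Proof.
move=> b0; apply/cvgrPdist_le => e e0.
have eb0 : 0 < e `^ b^-1 by rewrite powR_gt0.
have /cvgrPdist_le/(_ _ eb0) := @cvg_harmonic R.
apply: filterS => n; rewrite !sub0r !normrN ger0_norm ?(ltW (harmonic_gt0 n))// => he.
rewrite ger0_norm ?powR_ge0//.
have -> : e = (e `^ b^-1) `^ b by rewrite -powRrM mulVf ?gt_eqF// powRr1// ltW.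
apply: ge0_ler_powR => //; rewrite ?nnegrE; [exact: ltW|exact/ltW/harmonic_gt0|].
exact: powR_ge0.
Qed.

Lemma cvg_dist_harmonic (u v : nat -> R) (C D b l : R) : 0 < b ->
  (forall n, `|u n - v n| <= C * harmonic n + D * harmonic n `^ b) ->
  v n @[n --> \oo] --> l -> u n @[n --> \oo] --> l.
Proof.
move=> b0 uv vl.
rewrite -[l]add0r -(_ : (fun n => (u n - v n) + v n) = u); last first.
  by apply/funext => n; rewrite subrK.
apply: cvgD => //; apply/norm_cvg0P.
have c0 : C * harmonic n + D * harmonic n `^ b @[n --> \oo] --> 0.
  rewrite -[X in _ --> X]addr0; apply: cvgD.
    rewrite -[X in _ --> X](mulr0 C).
    by apply: cvgM; [exact: cvg_cst|exact: cvg_harmonic].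
  rewrite -[X in _ --> X](mulr0 D).
  by apply: cvgM; [exact: cvg_cst|exact: cvg_harmonic_powR].
apply: (squeeze_cvgr _ (cvg_cst 0) c0).
by apply: nearW => n; rewrite uv andbT.
Qed.

Lemma slope_expN (x e : R) : 0 <= x -> 0 < e ->
  `|(1 - expR (- x)) / e - x / e| <= x ^+ 2 / e.
Proof.
move=> x0 e0; rewrite -mulrBl normrM (gtr0_norm (_ : 0 < e^-1)) ?invr_gt0//.
rewrite ler_wpM2r ?invr_ge0 ?(ltW e0)//.
by have := expN_bounds x0; rewrite ler_norml => /andP[? ?]; apply/andP; split; lra.
Qed.

(** To first order 1 - exp (- d) is d, which is k * H. *)
Lemma cvg_slope_expN (d k : nat -> R) (H C D b l : R) : 0 < b ->
  (forall n, 0 <= d n <= D * harmonic n) ->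
  (forall n, `|d n - k n * H| <= C * harmonic n `^ (1 + b)) ->
  k n / harmonic n @[n --> \oo] --> l ->
  (1 - expR (- d n)) / harmonic n @[n --> \oo] --> l * H.
Proof.
move=> b0 hd hk kl.
have kH : k n / harmonic n * H @[n --> \oo] --> l * H.
  by apply: cvgM => //; exact: cvg_cst.
apply: (cvg_dist_harmonic (C := D ^+ 2) (D := C) b0 _ kH) => n.
have h0 := harmonic_gt0 n; have /andP[d0 dD] := hd n.
set e : R := harmonic n in h0 dD *.
have -> : (1 - expR (- d n)) / e - k n / e * H =
  ((1 - expR (- d n)) / e - d n / e) + (d n - k n * H) / e by ring.
apply: le_trans (ler_normD _ _) _; apply: lerD.
  apply: le_trans (slope_expN d0 h0) _; rewrite ler_pdivrMr// -mulrA -expr2 -exprMn.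
  by rewrite ler_pXn2r// ?nnegrE//; apply: le_trans dD.
rewrite normrM (gtr0_norm (_ : 0 < e^-1)) ?invr_gt0// ler_pdivrMr//.
apply: le_trans (hk n) _; rewrite -/e powRD ?powRr1 ?(ltW h0)//; last first.
  by apply/implyP => /eqP; lra.
by rewrite [e * _]mulrC mulrA.
Qed.

(** Recovers the slope of the cumulant k from that of the transform, whose
convergence is obtained from convergence of integrals. *)
Lemma cvg_slope_inv (k : nat -> R) (l : R) :
  (forall n, 0 <= k n <= harmonic n) ->
  (1 - expR (- k n)) / harmonic n @[n --> \oo] --> l ->
  k n / harmonic n @[n --> \oo] --> l.
Proof.
move=> hk kl.
apply: (cvg_dist_harmonic (C := 1) (D := 0) ltr01 _ kl) => n.
have h0 := harmonic_gt0 n; have /andP[k0 ke] := hk n.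
rewrite distrC mul0r addr0 mul1r; apply: le_trans (slope_expN k0 h0) _.
by rewrite ler_pdivrMr// -expr2 ler_pXn2r// nnegrE// ltW.
Qed.

End exponential_slopes.

Lemma rint_close d (T : measurableType d) (R : realType)
    (m : {finite_measure set T -> \bar R}) (f g : T -> R) (c : R) :
  bounded_nneg f -> bounded_nneg g -> (forall x, `|f x - g x| <= c)%R ->
  (`|rint m f - rint m g| <= c * mass m)%R.
Proof.
move=> bf bg fgc; have c0 : (0 <= c)%R := le_trans (normr_ge0 _) (fgc point).
have bc := bounded_nneg_cst (T := T) c0.
have half f1 f2 : bounded_nneg f1 -> bounded_nneg f2 ->
    (forall x, `|f1 x - f2 x| <= c)%R -> (rint m f1 <= rint m f2 + c * mass m)%R.
  move=> b1 b2 f12; rewrite -rint_cst -(rintD m b2 bc).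
  apply: rint_le => //; first exact: bounded_nnegD.
  by move=> x; move: (f12 x); rewrite ler_norml lerBlDl addrC => /andP[].
rewrite ler_norml lerBlDl half// andbT lerNl opprB lerBlDl half//.
by move=> x; rewrite distrC.
Qed.

(** * Means tilted by the total mass at one time *)

Section mean_of_pairing.
Context {R : realType} {d d' : measure_display}.
Context {Omega : measurableType d} {Omega' : measurableType d'}.
Context {S : ptopologicalType}.
Variables (Z : R -> Omega -> S) (F : set R -> set (set Omega)).
Variable P : R -> probability (borel S) R -> probability Omega R.
Variables (gamma beta : R).
Variables (X : R -> Omega' -> finmeas (borel S) R).
Variable G : set R -> set (set Omega').
Variable PX : R -> probability (finmeas (borel S) R) R -> probability Omega' R.
Hypothesis hZ : @markov_process R d _ Omega (borel S) Z F P.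
Hypothesis hX : superprocess Z P gamma beta X G PX.
Hypothesis hgamma : (0 < gamma)%R.
Hypothesis hbeta : (0 < beta <= 1)%R.

Local Notation FM := (finmeas (borel S) R).
Local Notation tr s t f := (@transition R d _ Omega (borel S) Z P s t f).
Local Notation pr t f w := (@pairing R d' Omega' S X t f w).
Local Notation tr_cst := (@transition_cst R d _ Omega (borel S) Z P).
Local Notation lap s mu t f := (@laplace R d' Omega' S X PX s mu t f).
Local Notation lg s t f := (@logl R d' Omega' S X PX s t f).

Lemma pairing_affine (t c e : R) (f : borel S -> R) w : (0 <= c)%R -> (0 <= e)%R ->
  bounded_nneg f ->
  pr t (fun q => c + e * f q)%R w = (c * mass (X t w) + e * pr t f w)%R.
Proof.
move=> c0 e0 bf; rewrite /pairing rintD; last 2 first.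
- exact: bounded_nneg_cst.
- exact: bounded_nnegZ.
by rewrite rint_cst rintZ.
Qed.

Lemma measurable_mass_process (t : R) : (0 <= t)%R ->
  measurable_fun [set: Omega'] (fun w => mass (X t w)).
Proof.
move=> t0; have := measurable_pairing_process hX t0
  (measurable_cst (1%R : R)) (fun=> ler01).
by apply: eq_measurable_fun => w _; rewrite /pairing rint_cst mul1r.
Qed.

Local Opaque logl transition tint.

Section slope_limit.
Variables (s t c : R).
Hypotheses (st : (0 <= s <= t)%R) (c0 : (0 <= c)%R).

Let t0 : (0 <= t)%R. Proof. by case/andP: st; exact: le_trans. Qed.

Let bc : bounded_nneg (fun _ : borel S => c). Proof. exact: bounded_nneg_cst. Qed.

Let a := lg s t (fun=> c) point.

Let aE y : lg s t (fun=> c) y = a.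
Proof. exact: (logl_cst hZ hX hgamma hbeta t0 c0). Qed.

Let lap_cst mu : lap s mu t (fun=> c) = expR (- (a * mass mu))%R.
Proof.
rewrite (laplace_logl hZ hX hgamma t0 bc)// -rint_cst; congr (expR (- rint mu _))%R.
by apply/funext => y; rewrite aE.
Qed.

Let integrand (f : borel S -> R) (w : Omega') : R :=
  (pr t f w * expR (- (c * mass (X t w))))%R.

Let quotient (e : R) (f : borel S -> R) (w : Omega') : R :=
  ((expR (- (c * mass (X t w))) - expR (- pr t (fun q => c + e * f q) w)) / e)%R.

Let quotientE e f w : (0 < e)%R -> bounded_nneg f -> quotient e f w =
  (expR (- (c * mass (X t w))) * ((1 - expR (- (e * pr t f w))) / e))%R.
Proof.
by move=> e0 bf; rewrite /quotient pairing_affine ?(ltW e0)// opprD expRD; ring.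
Qed.

Let bounded_exp_mass : bounded_nneg (fun w => expR (- (c * mass (X t w))))%R.
Proof.
apply: bounded_nneg_expN.
- by apply: measurable_funM => //; exact: measurable_mass_process.
- by move=> w; rewrite mulr_ge0// mass_ge0.
Qed.

Let bcf e f : (0 <= e)%R -> bounded_nneg f ->
  bounded_nneg (fun q : borel S => c + e * f q)%R.
Proof. by move=> e0 bf; apply: bounded_nnegD => //; exact: bounded_nnegZ. Qed.

Let integral_quotient mu e f : (0 < e)%R -> bounded_nneg f ->
  \int[PX s \d_mu]_w (quotient e f w)%:E =
  (expR (- (a * mass mu)) *
    ((1 - expR (- (rint mu (lg s t (fun q => c + e * f q)) - a * mass mu))) / e))%:E%R.
Proof.
move=> e0 bf; have e0' := ltW e0; have e1 : (0 <= e^-1)%R by rewrite invr_ge0.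
have b1 := bounded_exp_mass.
have b2 := bounded_nneg_exp_pairing_process hX t0 (bcf e0' bf).
have le21 w : (expR (- pr t (fun q => c + e * f q) w) <=
    expR (- (c * mass (X t w))))%R.
  rewrite ler_expR lerN2 pairing_affine// lerDl mulr_ge0// pairing_ge0//.
  by case: bf.
have bq : bounded_nneg (fun w => expR (- (c * mass (X t w))) -
    expR (- pr t (fun q => c + e * f q) w))%R.
  case: b1 b2 => [m1 _ [M hM]] [m2 p2 _]; split; first exact: measurable_funB.
    by move=> w; rewrite subr_ge0.
  by exists M => w; apply: le_trans (hM w); rewrite gerBl.
under eq_integral do rewrite /quotient mulrC.
rewrite (rintE _ (bounded_nnegZ e1 bq)) rintZ// rintB//; congr EFin.
have -> : rint (PX s \d_mu) (fun w => expR (- (c * mass (X t w))))%R =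
    expR (- (a * mass mu))%R.
  rewrite -lap_cst /laplace; congr rint; apply/funext => w.
  by rewrite /pairing rint_cst.
have -> : rint (PX s \d_mu) (fun w => expR (- pr t (fun q => c + e * f q) w))%R =
    expR (- rint mu (lg s t (fun q => c + e * f q)%R))%R.
  exact: (laplace_logl hZ hX hgamma t0 (bcf e0' bf)).
rewrite [RHS]mulrA mulrC mulrBr mulr1 -expRD; congr ((_ - expR _) * _)%R; ring.
Qed.

Let cvg_quotient mu f : bounded_nneg f ->
  \int[PX s \d_mu]_w (quotient (harmonic n) f w)%:E @[n --> \oo] -->
  \int[PX s \d_mu]_w (integrand f w)%:E.
Proof.
move=> bf; have [mf f0 _] := bf.
have mp := measurable_pairing_process hX t0 mf f0.
have [mE E0 _] := bounded_exp_mass.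
apply: integral_cvg_below.
- move=> n; apply/measurable_EFinP; apply: measurable_funM => //.
  apply: measurable_funB => //.
  by have [] := bounded_nneg_exp_pairing_process hX t0 (bcf (ltW (harmonic_gt0 n)) bf).
- by apply/measurable_EFinP; exact: measurable_funM.
- move=> n w; have h0 := harmonic_gt0 (R := R) n; rewrite quotientE// !lee_fin.
  have p0 := pairing_ge0 X t w f0.
  have := expN_bounds (mulr_ge0 (ltW h0) p0) => /andP[_ up].
  rewrite /integrand; apply/andP; split.
    rewrite mulr_ge0// divr_ge0 ?(ltW h0)// subr_ge0 -expR0 ler_expR oppr_le0.
    by rewrite mulr_ge0// ltW.
  by rewrite [leRHS]mulrC ler_wpM2l// ler_pdivrMr// [leRHS]mulrC.
- move=> w; apply: cvg_EFin; first exact: nearW.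
  rewrite /integrand mulrC.
  rewrite [X in X @ _ --> _](_ : _ = (fun n => expR (- (c * mass (X t w))) *
      ((1 - expR (- (harmonic n * pr t f w))) / harmonic n))%R); last first.
    by apply/funext => n; rewrite /= quotientE// harmonic_gt0.
  apply: cvgM; first exact: cvg_cst.
  have p0 := pairing_ge0 X t w f0.
  apply: (cvg_dist_harmonic (C := pr t f w ^+ 2) (D := 0) ltr01 _ (cvg_cst _)) => n.
  have h0 := harmonic_gt0 (R := R) n; rewrite mul0r addr0.
  have := slope_expN (mulr_ge0 (ltW h0) p0) h0.
  have -> : (harmonic n * pr t f w / harmonic n = pr t f w)%R.
    by rewrite mulrAC mulfV ?gt_eqF// mul1r.
  move=> H; apply: le_trans H _.
  rewrite ler_pdivrMr// exprMn expr2 expr2.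
  by rewrite le_eqVlt; apply/orP; left; apply/eqP; ring.
Qed.

Let kn n := (lg s t (fun=> c + harmonic n) point - a)%R.

Let kn_bounds n : (0 <= kn n <= harmonic n)%R.
Proof.
have h0 := ltW (harmonic_gt0 (R := R) n).
have := @logl_add_bounds _ _ _ _ _ _ Z F P gamma beta X G PX hZ hX hgamma hbeta
  s t (fun=> c) (fun=> harmonic n)%R (c + harmonic n)%R point st bc
  (bounded_nneg_cst h0) (fun=> lexx _).
rewrite tr_cst -/a => /andP[_ up]; rewrite /kn lerBlDl up andbT subr_ge0.
by apply: (le_logl hZ hX hgamma) => //; [apply: bounded_nneg_cst; exact: addr_ge0|
  move=> q; rewrite lerDl].
Qed.

Let kn_lower n : (1 - gamma * (1 + beta) * (c + harmonic n) `^ beta * (t - s) <=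
  kn n / harmonic n)%R.
Proof.
have h0 := harmonic_gt0 (R := R) n.
have := @logl_add_bounds _ _ _ _ _ _ Z F P gamma beta X G PX hZ hX hgamma hbeta
  s t (fun=> c) (fun=> harmonic n)%R (c + harmonic n)%R point st bc
  (bounded_nneg_cst (ltW h0)) (fun=> lexx _).
by rewrite tr_cst -/a => /andP[lo _]; rewrite /kn ler_pdivlMr// lerBrDl.
Qed.

Let kn_cvg : exists k : R, (kn n / harmonic n)%R @[n --> \oo] --> k.
Proof.
have b1 := bounded_nneg_cst (T := borel S) (ler01 : (0 <= 1 :> R)%R).
have := @cvg_quotient (\d_(point : borel S) : FM) _ b1.
set I := (\int[_]_w _); rewrite (_ : (fun n => _) = (fun n => (expR (- a) *
    ((1 - expR (- kn n)) / harmonic n))%:E%R)); last first.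
  apply/funext => n; rewrite integral_quotient ?harmonic_gt0// mass_dirac mulr1.
  rewrite rint_dirac; last first.
    have [] // := bounded_nneg_logl hZ hX hgamma t0 (bcf (ltW (harmonic_gt0 n)) b1) st.
  by rewrite mulr1.
move=> cI.
have I0 : 0 <= I by apply: integral_ge0 => w _; rewrite lee_fin mulr_ge0 ?expR_ge0//; exact: rint_ge0.
have I1 : I <= (expR (- a))%:E.
  rewrite -(cvg_lim _ cI)//; apply: lime_le; first by apply/cvg_ex; exists I.
  apply: nearW => n; rewrite lee_fin ler_piMr ?expR_ge0// ler_pdivrMr ?harmonic_gt0// mul1r.
  have /andP[k0 kh] := kn_bounds n.
  by apply: le_trans kh; have /andP[] := expN_bounds k0.
have If : I \is a fin_num by rewrite ge0_fin_numE// (le_lt_trans I1)// ltry.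
exists (expR a * fine I)%R; apply: cvg_slope_inv; first exact: kn_bounds.
rewrite -(fineK If) in cI; move/fine_cvg: cI => /= cI.
rewrite [X in X @ _ --> _](_ : _ = (fun n => expR a * (expR (- a) *
    ((1 - expR (- kn n)) / harmonic n)))%R); last first.
  by apply/funext => n; rewrite mulrA -expRD subrr expR0 mul1r.
by apply: cvgM => //; exact: cvg_cst.
Qed.

Let combine (A B1 B2 K1 T0 a' k' M : R) : (B1 = a' -> B2 = a' -> K1 = k' + a' ->
  `|(A - B1) - T0 * (K1 - B2)| <= M -> `|A - (a' + k' * T0)| <= M)%R.
Proof.
move=> -> -> ->; rewrite addrK => H; apply: le_trans H.
by rewrite opprD addrA [(k' * T0)%R]mulrC.
Qed.

Let mean_cvg (k : R) mu f : (kn n / harmonic n)%R @[n --> \oo] --> k -> bounded_nneg f ->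
  \int[PX s \d_mu]_w (integrand f w)%:E =
  (k * expR (- (a * mass mu)) * rint mu (tr s t f))%:E%R.
Proof.
move=> ck bf; have [_ f0 [B fB]] := bf.
have [C C0 hC] := logl_first_order hZ hX hgamma hbeta t0 c0 bf fB.
have bT := bounded_nneg_transition hZ st bf.
pose dn n := (rint mu (lg s t (fun q => c + harmonic n * f q)) - a * mass mu)%R.
have bcst (x : R) : (0 <= x)%R -> bounded_nneg (fun _ : borel S => x).
  exact: bounded_nneg_cst.
have a0 : (0 <= a)%R by exact: (logl_ge0 hZ hX hgamma t0 bc).
have hdn n : (0 <= dn n <= B * mass mu * harmonic n)%R.
  have h0 := ltW (harmonic_gt0 (R := R) n).
  have bl := bounded_nneg_logl hZ hX hgamma t0 (bcf h0 bf) st.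
  have B0 : (0 <= B)%R := le_trans (f0 point) (fB point).
  rewrite /dn; apply/andP; split.
    rewrite subr_ge0 -(rint_cst mu a).
    apply: rint_le => //; first exact: bcst.
    move=> q; rewrite -(aE q); apply: (le_logl hZ hX hgamma) => //.
      exact: bcf.
    by move=> q'; rewrite lerDl mulr_ge0.
  have Bh0 : (0 <= B * harmonic n)%R by exact: mulr_ge0.
  rewrite lerBlDl [(B * mass mu * _)%R]mulrAC -(rint_cst mu (B * harmonic n)).
  rewrite -(rint_cst mu a) -(rintD mu (bcst _ a0) (bcst _ Bh0)).
  apply: rint_le => //.
    by apply: bcst; rewrite addr_ge0.
  move=> q; rewrite -(aE q).
  have fB' q' : (c + harmonic n * f q' <= c + harmonic n * B)%R.
    by rewrite lerD2l ler_wpM2l.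
  have /andP[_ H] := @logl_add_bounds _ _ _ _ _ _ Z F P gamma beta X G PX hZ hX
    hgamma hbeta s t (fun=> c) (fun q => harmonic n * f q)%R _ q st bc
    (bounded_nnegZ h0 bf) fB'.
  apply: le_trans H _; rewrite lerD2l (transitionZ hZ s t0 q h0 bf) mulrC.
  by rewrite ler_wpM2r//; exact: (transition_bound hZ).
have hk n : (`|dn n - kn n * rint mu (tr s t f)| <=
    C * mass mu * harmonic n `^ (1 + beta))%R.
  have h0 := ltW (harmonic_gt0 (R := R) n).
  have /andP[k0 _] := kn_bounds n.
  have bl := bounded_nneg_logl hZ hX hgamma t0 (bcf h0 bf) st.
  have E2 : (a * mass mu + kn n * rint mu (tr s t f))%R =
      rint mu (fun q => a + kn n * tr s t f q)%R.
    by rewrite (rintD mu (bcst _ a0) (bounded_nnegZ k0 bT)) rint_cst (rintZ mu k0 bT).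
  rewrite /dn -addrA -opprD E2 mulrAC.
  apply: rint_close => //.
    by apply: bounded_nnegD; [exact: bcst|exact: bounded_nnegZ].
  move=> q; apply: (combine (aE q) (aE q) _ (hC (harmonic n) s q h0 st)).
  rewrite /kn subrK; exact: (logl_cst hZ hX hgamma hbeta t0 (addr_ge0 c0 h0)).
have beta0 : (0 < beta)%R by case/andP: hbeta.
have c1 := cvg_slope_expN beta0 hdn hk ck.
have c2 := @cvg_quotient mu f bf.
rewrite (_ : (fun n => _) = (fun n => (expR (- (a * mass mu)) *
    ((1 - expR (- dn n)) / harmonic n))%:E%R)) in c2; last first.
  by apply/funext => n; rewrite integral_quotient// harmonic_gt0.
have c3 : (expR (- (a * mass mu)) * ((1 - expR (- dn n)) / harmonic n))%:E%R
    @[n --> \oo] --> (k * expR (- (a * mass mu)) * rint mu (tr s t f))%:E%R.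
  apply: cvg_EFin; first exact: nearW.
  rewrite (mulrC k) -mulrA; apply: cvgM; first exact: cvg_cst.
  exact: c1.
by rewrite -(cvg_lim _ c2)// (cvg_lim _ c3).
Qed.

(** Both sides of the last identity are derivatives at e = 0 of the transform
of the terminal value c + e * f. On the right the first-order expansion
identifies the derivative: k is the derivative in e of the cumulant of c + e.
*)
Lemma mean_pairing_exp_mass : exists a k : R,
  [/\ (0 <= a <= c)%R, (0 <= k)%R, c = 0%R -> k = 1%R,
      forall mu, lap s mu t (fun=> c) = expR (- (a * mass mu))%R &
      forall (mu : FM) f, bounded_nneg f ->
        \int[PX s \d_mu]_w (pr t f w * expR (- (c * mass (X t w))))%:E%R =
        (k * expR (- (a * mass mu)) * rint mu (tr s t f))%:E%R].
Proof.
have [k ck] := kn_cvg; exists a, k; split => //.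
- rewrite (logl_ge0 hZ hX hgamma t0 bc)//=.
  exact: (logl_bound hZ hX hgamma t0 bc).
- rewrite -(cvg_lim _ ck)//; apply: limr_ge; first by apply/cvg_ex; exists k.
  apply: nearW => n.
  by rewrite divr_ge0 ?(ltW (harmonic_gt0 n))//; case/andP: (kn_bounds n).
- move=> cE; suff h1 : (kn n / harmonic n)%R @[n --> \oo] --> (1 : R)%R.
    exact: (cvg_unique _ ck h1).
  have beta0 : (0 < beta)%R by case/andP: hbeta.
  have c1 : (fun _ : nat => 1 : R)%R @ \oo --> (1 : R)%R by exact: cvg_cst.
  pose D := (gamma * (1 + beta) * (t - s))%R.
  apply: (@cvg_dist_harmonic _ _ _ 0%R D _ _ beta0 _ c1) => n.
  have lo := kn_lower n; have /andP[_ up] := kn_bounds n.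
  rewrite mul0r add0r mulrAC ler_norml.
  have : (kn n / harmonic n <= 1)%R by rewrite ler_pdivrMr ?harmonic_gt0// mul1r.
  by move: lo; rewrite cE add0r => lo up1; apply/andP; split; lra.
- by move=> mu f bf; exact: mean_cvg.
Qed.

End slope_limit.

End mean_of_pairing.

(** * Means tilted by weighted sums of total masses *)

Section total_mass_functionals.
Context {R : realType} {d d' : measure_display}.
Context {Omega : measurableType d} {Omega' : measurableType d'}.
Context {S : ptopologicalType}.
Variables (Z : R -> Omega -> S) (F : set R -> set (set Omega)).
Variable P : R -> probability (borel S) R -> probability Omega R.
Variables (gamma beta : R).
Variables (X : R -> Omega' -> finmeas (borel S) R).
Variable G : set R -> set (set Omega').
Variable PX : R -> probability (finmeas (borel S) R) R -> probability Omega' R.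
Hypothesis hZ : @markov_process R d _ Omega (borel S) Z F P.
Hypothesis hX : superprocess Z P gamma beta X G PX.
Hypothesis hgamma : (0 < gamma)%R.
Hypothesis hbeta : (0 < beta <= 1)%R.

Local Notation FM := (finmeas (borel S) R).
Local Notation tr s t f := (@transition R d _ Omega (borel S) Z P s t f).
Local Notation pr t f w := (@pairing R d' Omega' S X t f w).
Local Notation lap s mu t f := (@laplace R d' Omega' S X PX s mu t f).

Let hXm : markov_process X G PX := super_markov hX.

Local Opaque logl transition tint.

(** Entries are pairs (time, weight). *)
Definition mass_sum (l : seq (R * R)) (w : Omega') : R :=
  (\sum_(p <- l) p.2 * mass (X p.1 w))%R.

Definition sorted_after (s : R) (l : seq (R * R)) : Prop :=
  path <=%R s (map fst l) /\ all (fun p => 0 <= p.2)%R l.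

Lemma mass_sum_cons p l w :
  mass_sum (p :: l) w = (p.2 * mass (X p.1 w) + mass_sum l w)%R.
Proof. by rewrite /mass_sum big_cons. Qed.

Lemma perm_mass_sum l l' w : perm_eq l l' -> mass_sum l w = mass_sum l' w.
Proof. exact: perm_big. Qed.

Lemma mass_sum_ge0 s l w : sorted_after s l -> (0 <= mass_sum l w)%R.
Proof.
move=> [_ /allP l0]; rewrite /mass_sum big_seq; apply: sumr_ge0 => p /l0 p0.
by rewrite mulr_ge0// mass_ge0.
Qed.

Lemma sorted_after_cons s p l : sorted_after s (p :: l) ->
  [/\ (s <= p.1)%R, (0 <= p.2)%R & sorted_after p.1 l].
Proof. by move=> [/= /andP[sp pl] /andP[p0 l0]]. Qed.

Lemma adapted_mass I (t : R) : time_interval I -> I t ->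
  measurable_fun [set: g_sigma_algebraType (G I)] (fun w => mass (X t w)).
Proof.
move=> hI It; have := adapted_pairing hX hI It (measurable_cst (1%R : R)) (fun=> ler01).
by apply: eq_measurable_fun => w _; rewrite /pairing rint_cst mul1r.
Qed.

Lemma adapted_mass_sum (s : R) l : (0 <= s)%R -> sorted_after s l ->
  measurable_fun [set: g_sigma_algebraType (G `[s, +oo[)] (mass_sum l).
Proof.
move=> s0 [pl _].
have hI := time_interval_cy s0.
have tl p : p \in l -> (s <= p.1)%R.
  move=> pl'; have /allP := order_path_min le_trans pl; apply.
  exact: map_f.
rewrite /mass_sum.
have -> : (fun w => \sum_(p <- l) p.2 * mass (X p.1 w))%R =
    (fun w => \sum_(i < size l) (nth (0, 0) l i).2 * mass (X (nth (0, 0) l i).1 w))%R.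
  by apply/funext => w; rewrite (big_nth (0, 0)%R) big_mkord.
apply: measurable_sum => i; apply: measurable_funM => //.
apply: adapted_mass => //; rewrite /= in_itv/= andbT; apply: tl.
exact: mem_nth.
Qed.

Lemma bounded_exp_mass_sum (s : R) l : (0 <= s)%R -> sorted_after s l ->
  @bounded_nneg _ (g_sigma_algebraType (G `[s, +oo[)) R
    (fun w => expR (- mass_sum l w))%R.
Proof.
move=> s0 hl; apply: bounded_nneg_expN; first exact: adapted_mass_sum.
by move=> w; exact: mass_sum_ge0 hl.
Qed.

Lemma bounded_exp_mass I (t c : R) : time_interval I -> I t -> (0 <= c)%R ->
  @bounded_nneg _ (g_sigma_algebraType (G I)) R
    (fun w => expR (- (c * mass (X t w))))%R.
Proof.
move=> hI It c0; apply: bounded_nneg_expN.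
  by apply: measurable_funM => //; exact: adapted_mass.
by move=> w; rewrite mulr_ge0// mass_ge0.
Qed.

Let itv_l (s t : R) : (s <= t)%R -> `[s, t]%classic t.
Proof. by move=> st; rewrite /= in_itv/= st lexx. Qed.

Let itv_s (s t : R) : (s <= t)%R -> `[s, +oo[%classic t.
Proof. by move=> st; rewrite /= in_itv/= st. Qed.

Lemma laplace_cst s mu t c : lap s mu t (fun=> c) =
  rint (PX s \d_mu) (fun w => expR (- (c * mass (X t w))))%R.
Proof. by congr rint; apply/funext => w; rewrite /pairing rint_cst. Qed.

Lemma laplace_mass_sum l : forall s : R, (0 <= s)%R -> sorted_after s l ->
  exists2 a : R, (0 <= a)%R & forall mu,
    rint (PX s \d_mu) (fun w => expR (- mass_sum l w))%R =
    expR (- (a * mass mu))%R.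
Proof.
elim: l => [|p l ih] s s0 hl.
  exists 0%R => // mu; rewrite mul0r oppr0 expR0.
  under eq_fun do rewrite /mass_sum big_nil oppr0 expR0.
  by rewrite rint_cst mul1r mass_probability.
have [sp p0 hl'] := sorted_after_cons hl.
have p10 := le_trans s0 sp.
have [a' a'0 Ea'] := ih _ p10 hl'.
have sp' : (0 <= s <= p.1)%R by rewrite s0.
have c0 := addr_ge0 p0 a'0.
have [a [_ [/andP[a0 _] _ _ Ea _]]] := mean_pairing_exp_mass hZ hX hgamma hbeta sp' c0.
exists a => // mu; rewrite -Ea laplace_cst.
under eq_fun do rewrite mass_sum_cons opprD expRD.
have b1 := bounded_exp_mass (time_interval_cc p.1 s0) (itv_l sp) p0.
have b2 := bounded_exp_mass_sum p10 hl'.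
have -> := rint_markov hXm (dirac mu) sp' b1 b2.
by congr rint; apply/funext => w; rewrite Ea' -expRD -opprD mulrDl.
Qed.

(** When all the times of the tilt follow t, the Markov property at t reduces
it to a tilt by the mass at t. Otherwise the Markov property is used at the
first time of the tilt: by induction the conditional mean is the pairing with
the transition of f, tilted by the mass at that time, and the two factors k
multiply. *)
Lemma mean_pairing_exp_sum (t : R) l : forall s : R,
  (0 <= s <= t)%R -> sorted_after s l -> exists a k : R,
  [/\ (0 <= a)%R, (0 <= k)%R, l = [::] -> a = 0%R /\ k = 1%R & forall (mu : FM) f,
    bounded_nneg f ->
    \int[PX s \d_mu]_w (pr t f w * expR (- mass_sum l w))%:E%R =
    (k * expR (- (a * mass mu)) * rint mu (tr s t f))%:E%R].
Proof.
elim: l => [|p l ih] s st hl; have /andP[s0 st'] := st; have t0 := le_trans s0 st'.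
  have [a [k [/andP[a0 ale0] k0 k1 _ H]]] :=
    mean_pairing_exp_mass hZ hX hgamma hbeta st (lexx 0%R).
  exists a, k; split; [exact: a0|exact: k0| |].
    by move=> _; split; [apply/eqP; rewrite eq_le ale0|exact: k1].
  move=> mu f bf; rewrite -(H mu f bf); apply: eq_integral => w _.
  by rewrite /mass_sum big_nil mul0r.
have [sp p0 hl'] := sorted_after_cons hl; have p10 := le_trans s0 sp.
have [tp|pt] := leP t p.1.
  (* all the times of the tilt come after t: it acts through the total mass at t *)
  have hlt : sorted_after t (p :: l).
    by have [/= /andP[_ pl] ?] := hl; split => //=; rewrite tp.
  have [c c0 Ec] := laplace_mass_sum t0 hlt.
  have [a [k [/andP[a0 _] k0 _ _ H]]] := mean_pairing_exp_mass hZ hX hgamma hbeta st c0.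
  exists a, k; split; [exact: a0|exact: k0|by []|move=> mu f bf].
  have [mf f0 _] := bf; rewrite -(H mu f bf).
  have bl := bounded_exp_mass_sum t0 hlt.
  under eq_integral do rewrite EFinM.
  rewrite (markovE hXm (dirac mu) st); last 4 first.
  - apply/measurable_EFinP; apply: (adapted_pairing hX) => //.
      exact: time_interval_cc.
    exact: itv_l.
  - by move=> w; rewrite lee_fin pairing_ge0.
  - by apply/measurable_EFinP; case: bl.
  - by move=> w; rewrite lee_fin expR_ge0.
  apply: eq_integral => w _; rewrite EFinM -Ec rintE//.
  exact: (adapted_bounded hXm (time_interval_cy t0) bl).
have sp' : (0 <= s <= p.1)%R by rewrite s0.
have pt' : (0 <= p.1 <= t)%R by rewrite p10 ltW.
have [a' [k' [a'0 k'0 _ H']]] := ih p.1 pt' hl'.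
have c0 := addr_ge0 p0 a'0.
have [a [k [/andP[a0 _] k0 _ _ H]]] := mean_pairing_exp_mass hZ hX hgamma hbeta sp' c0.
exists a, (k' * k)%R; split; [exact: a0|exact: mulr_ge0|by []|].
move=> mu f bf; have [mf f0 _] := bf.
have hI := time_interval_cy p10.
have bl := bounded_exp_mass_sum p10 hl'.
have bE := bounded_exp_mass (time_interval_cc p.1 s0) (itv_l sp) p0.
have bT := bounded_nneg_transition hZ pt' bf.
transitivity (\int[PX s \d_mu]_w ((expR (- (p.2 * mass (X p.1 w))))%:E *
    (pr t f w * expR (- mass_sum l w))%:E)).
  apply: eq_integral => w _; rewrite mass_sum_cons opprD expRD -EFinM.
  by congr EFin; rewrite mulrCA.
have mg : measurable_fun [set: g_sigma_algebraType (G `[p.1, +oo[)]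
    (fun w => (pr t f w * expR (- mass_sum l w))%:E).
  apply/measurable_EFinP; apply: measurable_funM; last by case: bl.
  by apply: (adapted_pairing hX) => //; apply: itv_s; exact: ltW.
rewrite (markovE hXm (dirac mu) sp'); last 4 first.
- by apply/measurable_EFinP; case: bE.
- by move=> w; rewrite lee_fin expR_ge0.
- exact: mg.
- by move=> w; rewrite lee_fin mulr_ge0 ?expR_ge0//; exact: pairing_ge0.
transitivity (\int[PX s \d_mu]_w (k'%:E *
    (pr p.1 (tr p.1 t f) w * expR (- ((p.2 + a') * mass (X p.1 w))))%:E)).
  apply: eq_integral => w _; rewrite H'// -!EFinM; congr EFin.
  rewrite mulrDl opprD expRD /pairing; ring.
have [mT T0 _] := bT.
have mi : measurable_fun setT (fun w =>
    (pr p.1 (tr p.1 t f) w * expR (- ((p.2 + a') * mass (X p.1 w))))%:E).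
  apply/measurable_EFinP; apply: measurable_funM.
    exact: (measurable_pairing_process hX).
  have [m1 _ _] := bounded_exp_mass (time_interval_cy p10) (itv_s (lexx p.1)) c0.
  exact: (adapted_measurable hXm hI m1).
have i0 w : 0 <= (pr p.1 (tr p.1 t f) w * expR (- ((p.2 + a') * mass (X p.1 w))))%:E.
  by rewrite lee_fin mulr_ge0 ?expR_ge0//; exact: pairing_ge0.
rewrite ge0_integralZl//.
rewrite (H mu _ bT) -EFinM; congr EFin; rewrite -!mulrA; do 2 congr (_ * _)%R.
congr (_ * rint mu _)%R; apply/funext => y.
exact: (transition_transition hZ y s0 sp (ltW pt) bf).
Qed.

End total_mass_functionals.

(** * Continuity in mean of the total mass *)

Lemma expN_lipschitz (R : realType) (p q : R) : (0 <= p)%R -> (p <= q)%R ->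
  (expR (- p) <= expR (- q) + (q - p))%R.
Proof.
move=> p0 pq; have qp : (0 <= q - p)%R by rewrite subr_ge0.
have /andP[_ up] := expN_bounds qp.
have -> : (expR (- q) = expR (- p) * expR (- (q - p)))%R.
  by rewrite -expRD; congr expR; ring.
have e1 : (expR (- p) <= 1)%R by rewrite -expR0 ler_expR oppr_le0.
have := ler_wpM2l (expR_ge0 (- p)) up.
have := ler_wpM2r qp e1; lra.
Qed.

Section nonnegative_integrals.
Context {d : measure_display} {T : measurableType d} {R : realType}.
Variable m : {measure set T -> \bar R}.
Implicit Types (f g : T -> \bar R).

Lemma integralD_ge0 f g : measurable_fun setT f -> (forall x, 0 <= f x) ->
  measurable_fun setT g -> (forall x, 0 <= g x) ->
  \int[m]_x (f x + g x) = \int[m]_x f x + \int[m]_x g x.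
Proof. by move=> mf f0 mg g0; rewrite ge0_integralD. Qed.

Lemma integral_le_ge0 f g : measurable_fun setT f -> (forall x, 0 <= f x) ->
  measurable_fun setT g -> (forall x, f x <= g x) ->
  \int[m]_x f x <= \int[m]_x g x.
Proof. by move=> mf f0 mg fg; apply: ge0_le_integral. Qed.

Lemma integralZ_ge0 (k : R) f : (0 <= k)%R -> measurable_fun setT f ->
  (forall x, 0 <= f x) -> \int[m]_x (k%:E * f x) = k%:E * \int[m]_x f x.
Proof. by move=> k0 mf f0; rewrite ge0_integralZl. Qed.

End nonnegative_integrals.

Lemma sqr_diff_le1 (R : realType) (a b : R) : (0 <= a <= 1)%R ->
  (0 <= b <= 1)%R -> ((a - b) ^+ 2 <= 1)%R.
Proof.
move=> /andP[? ?] /andP[? ?]; rewrite -subr_ge0.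
have -> : (1 - (a - b) ^+ 2 = (1 - (a - b)) * (1 + (a - b)))%R by ring.
by apply: mulr_ge0; lra.
Qed.

Section total_mass_continuity.
Context {R : realType} {d d' : measure_display}.
Context {Omega : measurableType d} {Omega' : measurableType d'}.
Context {S : ptopologicalType}.
Variables (Z : R -> Omega -> S) (F : set R -> set (set Omega)).
Variable P : R -> probability (borel S) R -> probability Omega R.
Variables (gamma beta : R).
Variables (X : R -> Omega' -> finmeas (borel S) R).
Variable G : set R -> set (set Omega').
Variable PX : R -> probability (finmeas (borel S) R) R -> probability Omega' R.
Hypothesis hZ : @markov_process R d _ Omega (borel S) Z F P.
Hypothesis hX : superprocess Z P gamma beta X G PX.
Hypothesis hgamma : (0 < gamma)%R.
Hypothesis hbeta : (0 < beta <= 1)%R.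

Local Notation FM := (finmeas (borel S) R).
Local Notation tr s t f := (@transition R d _ Omega (borel S) Z P s t f).
Local Notation pr t f w := (@pairing R d' Omega' S X t f w).
Local Notation tr_cst := (@transition_cst R d _ Omega (borel S) Z P).
Local Notation lap s mu t f := (@laplace R d' Omega' S X PX s mu t f).
Local Notation lg s t f := (@logl R d' Omega' S X PX s t f).

Local Opaque logl transition tint.

Let beta0 : (0 < beta)%R. Proof. by case/andP: hbeta. Qed.

Lemma mean_pairing (s t : R) (mu : FM) f : (0 <= s <= t)%R -> bounded_nneg f ->
  \int[PX s \d_mu]_w (pr t f w)%:E = (rint mu (tr s t f))%:E.
Proof.
move=> st bf; have hl : sorted_after s [::] by [].
have [a [k [_ _ /(_ erefl)[-> ->] H]]] :=
  mean_pairing_exp_sum hZ hX hgamma hbeta st hl.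
have := H mu f bf; rewrite mul0r oppr0 expR0 !mul1r => <-.
by apply: eq_integral => w _; rewrite /mass_sum big_nil oppr0 expR0 mulr1.
Qed.

Lemma mean_mass (s t : R) (mu : FM) : (0 <= s <= t)%R ->
  \int[PX s \d_mu]_w (mass (X t w))%:E = (mass mu)%:E.
Proof.
move=> st; have b1 : bounded_nneg (fun _ : borel S => 1%R : R).
  exact: bounded_nneg_cst.
transitivity (\int[PX s \d_mu]_w (pr t (fun=> 1%R) w)%:E).
  by apply: eq_integral => w _; rewrite /pairing rint_cst mul1r.
rewrite mean_pairing// (_ : tr s t (fun=> 1%R) = fun=> 1%R) ?rint_cst ?mul1r//.
by apply/funext => y; rewrite tr_cst.
Qed.

(** Over short times or for small c the cumulant of c is close to c: this is
logl_add_bounds with W = 0. *)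
Lemma logl_cst_bounds (s t c : R) y : (0 <= s <= t)%R -> (0 <= c)%R ->
  (c - gamma * (1 + beta) * c `^ beta * (t - s) * c <= lg s t (fun=> c) y <= c)%R.
Proof.
move=> st c0; have /andP[s0 st'] := st; have t0 := le_trans s0 st'.
have bc := bounded_nneg_cst (T := borel S) c0.
have b0 : bounded_nneg (fun _ : borel S => 0%R : R) by exact: bounded_nneg_cst.
apply/andP; split; last exact: (logl_bound hZ hX hgamma t0 bc).
have c0c (q : borel S) : (0 + c <= c)%R by rewrite add0r.
have := @logl_add_bounds _ _ _ _ _ _ Z F P gamma beta X G PX hZ hX hgamma hbeta
  s t (fun=> 0%R) (fun=> c) c y st b0 bc c0c.
rewrite tr_cst => /andP[lo _].
have -> : (fun=> c) = (fun _ : borel S => 0 + c)%R by apply/funext => q; rewrite add0r.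
apply: le_trans lo.
rewrite mulrBl mul1r lerDr; exact: (logl_ge0 hZ hX hgamma t0 b0).
Qed.

Let Mexp (c t : R) (w : Omega') : R := expR (- (c * mass (X t w))).

Let bMexp (c t : R) : (0 <= c)%R -> (0 <= t)%R -> bounded_nneg (Mexp c t).
Proof.
move=> c0 t0; apply: bounded_nneg_expN.
  apply: measurable_funM => //; exact: (measurable_mass_process hX).
by move=> w; rewrite mulr_ge0// mass_ge0.
Qed.

Let square_arith (a b e m1 m2 : R) : (a + 2 * b = m1 + e -> e <= b ->
  m1 <= e + m2 -> a <= m2)%R.
Proof. by lra. Qed.

(** Expanding the square leaves two transforms of the mass at a single time
and a cross term. The cross term is bounded by conditioning at s, and the
transform at t is compared with the one at s through the flow property. *)
Let square_increment (r s t c : R) (mu : FM) :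
  (0 <= r)%R -> (r <= s)%R -> (s <= t)%R -> (0 <= c)%R ->
  (rint (PX r \d_mu) (fun w => (Mexp c t w - Mexp c s w) ^+ 2) <=
   gamma * (1 + beta) * (2 * c) `^ beta * (t - s) * (2 * c) * mass mu)%R.
Proof.
move=> r0 rs st c0; have s0 := le_trans r0 rs; have t0 := le_trans s0 st.
have c20 : (0 <= 2 * c)%R by rewrite mulr_ge0.
have bt := bMexp c0 t0; have bs := bMexp c0 s0.
have rs' : (0 <= r <= s)%R by rewrite r0.
have st' : (0 <= s <= t)%R by rewrite s0.
have sq x w : (Mexp c x w ^+ 2 = Mexp (2 * c) x w)%R.
  by rewrite /Mexp expr2 -expRD; congr expR; ring.
have b2t := bMexp c20 t0; have b2s := bMexp c20 s0.
have bts := bounded_nnegM bt bs.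
have bsq : bounded_nneg (fun w => (Mexp c t w - Mexp c s w) ^+ 2)%R.
  split.
  - by apply: measurable_funX; apply: measurable_funB; [case: bt|case: bs].
  - by move=> w; exact: sqr_ge0.
  - exists 1%R => w; have e x : (0 <= Mexp c x w <= 1)%R.
      by rewrite expR_ge0 -expR0 ler_expR oppr_le0 mulr_ge0// mass_ge0.
    exact: sqr_diff_le1.
have sum_eq : (rint (PX r \d_mu) (fun w => (Mexp c t w - Mexp c s w) ^+ 2) +
     2 * rint (PX r \d_mu) (fun w => Mexp c t w * Mexp c s w) =
   rint (PX r \d_mu) (Mexp (2 * c) t) + rint (PX r \d_mu) (Mexp (2 * c) s))%R.
  have two0 : (0 <= 2 :> R)%R by [].
  rewrite -(rintZ _ two0 bts) -(rintD _ bsq (bounded_nnegZ two0 bts)).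
  rewrite -(rintD _ b2t b2s).
  congr rint; apply/funext => w; rewrite -!sq; ring.
have bc := bounded_nneg_cst (T := borel S) c0.
have bc2 := bounded_nneg_cst (T := borel S) c20.
(* products of tilts at two times dominate the tilt with doubled rate *)
have cross : (rint (PX r \d_mu) (Mexp (2 * c) s) <=
    rint (PX r \d_mu) (fun w => Mexp c t w * Mexp c s w))%R.
  have It : `[r, s]%classic s by rewrite /= in_itv/= rs lexx.
  have bb := bounded_exp_mass hX (time_interval_cc s r0) It c0.
  have E1 := rint_exp_pairing hZ hX hgamma (dirac mu) r0 rs st bb bc.
  have -> : rint (PX r \d_mu) (fun w => Mexp c t w * Mexp c s w)%R =
      rint (PX r \d_mu) (fun w => Mexp c s w * expR (- pr t (fun=> c) w))%R.
    congr rint; apply/funext => w; rewrite mulrC; congr (_ * expR (- _))%R.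
    by rewrite /pairing rint_cst.
  rewrite [leRHS]E1.
  have bl := bounded_nneg_logl hZ hX hgamma t0 bc st'.
  have bls := bounded_nneg_exp_pairing_process hX s0 bl.
  apply: (rint_le _ b2s (bounded_nnegM bs bls)) => w.
  rewrite -sq expr2; apply: ler_wpM2l; first exact: expR_ge0.
  rewrite /Mexp ler_expR lerN2 -rint_cst; apply: (rint_le _ bl bc) => y.
  by have /andP[] := logl_cst_bounds y st' c0.
pose K := (gamma * (1 + beta) * (2 * c) `^ beta * (t - s) * (2 * c))%R.
have K0 : (0 <= K)%R.
  rewrite /K mulr_ge0// mulr_ge0 ?subr_ge0// mulr_ge0 ?powR_ge0//.
  by rewrite mulr_ge0 ?(ltW hgamma)// addr_ge0// ltW.
have double : (rint (PX r \d_mu) (Mexp (2 * c) t) <=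
    rint (PX r \d_mu) (Mexp (2 * c) s) + K * mass mu)%R.
  have -> : rint (PX r \d_mu) (Mexp (2 * c) t) = lap r mu t (fun=> 2 * c)%R.
    by rewrite laplace_cst.
  rewrite (laplace_flow hZ hX hgamma mu r0 rs st bc2).
  have bl := bounded_nneg_logl hZ hX hgamma t0 bc2 st'.
  have bls := bounded_nneg_exp_pairing_process hX s0 bl.
  have mM := measurable_mass_process hX s0.
  have mM' : measurable_fun setT (fun w => (mass (X s w))%:E) by exact/measurable_EFinP.
  have M0 w : 0 <= (mass (X s w))%:E by rewrite lee_fin mass_ge0.
  have [ms ms0 _] := b2s.
  have KM0 w : 0 <= K%:E * (mass (X s w))%:E by rewrite mule_ge0// lee_fin.
  have mE : measurable_fun setT (fun w => (Mexp (2 * c) s w)%:E) by exact/measurable_EFinP.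
  have mKM : measurable_fun setT (fun w => K%:E * (mass (X s w))%:E).
    exact: measurable_funeM.
  have E0 w : 0 <= (Mexp (2 * c) s w)%:E by rewrite lee_fin.
  rewrite -lee_fin EFinD EFinM -(mean_mass mu rs') -(integralZ_ge0 _ K0 mM' M0).
  rewrite /laplace -(rintE _ bls) -(rintE _ b2s) -(integralD_ge0 _ mE E0 mKM KM0).
  apply: integral_le_ge0.
  - by apply/measurable_EFinP; case: bls.
  - by move=> w; rewrite lee_fin expR_ge0.
  - exact: emeasurable_funD.
  move=> w; rewrite -EFinM -EFinD lee_fin.
  have p0 : (0 <= pr s (lg s t (fun=> 2 * c)) w)%R by apply: pairing_ge0; case: bl.
  have pq : (pr s (lg s t (fun=> 2 * c)) w <= 2 * c * mass (X s w))%R.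
    rewrite -rint_cst; apply: (rint_le _ bl bc2) => y.
    by have /andP[] := logl_cst_bounds y st' c20.
  have qp : (2 * c * mass (X s w) <= pr s (lg s t (fun=> 2 * c)) w + K * mass (X s w))%R.
    have bK := bounded_nneg_cst (T := borel S) K0.
    rewrite -!rint_cst /pairing -(rintD _ bl bK).
    apply: (rint_le _ bc2 (bounded_nnegD bl bK)) => y.
    by have /andP[] := logl_cst_bounds y st' c20; rewrite lerBlDr.
  apply: le_trans (expN_lipschitz p0 pq) _.
  by rewrite lerD2l lerBlDl.
exact: square_arith sum_eq cross double.
Qed.

(** A bounded approximation of the mass from below, chosen so that its mean is
explicit in terms of cumulants. *)
Let trunc (c : R) (t : R) (w : Omega') : R := ((1 - Mexp c t w) / c)%R.

Let trunc_bounds c t w : (0 < c)%R -> (0 <= trunc c t w <= mass (X t w))%R.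
Proof.
move=> c0; have m0 := mulr_ge0 (ltW c0) (mass_ge0 (X t w)).
have /andP[_ up] := expN_bounds m0.
apply/andP; split.
  by rewrite divr_ge0 ?(ltW c0)// subr_ge0 -expR0 ler_expR oppr_le0.
by rewrite /trunc ler_pdivrMr// [leRHS]mulrC.
Qed.

Let bounded_trunc c t : (0 < c)%R -> (0 <= t)%R -> bounded_nneg (trunc c t).
Proof.
move=> c0 t0; have [m1 p1 _] := bMexp (ltW c0) t0; split.
- by apply: measurable_funM => //; exact: measurable_funB.
- by move=> w; have /andP[] := trunc_bounds t w c0.
- exists (c^-1)%R => w; rewrite /trunc ler_piMl ?invr_ge0 ?(ltW c0)//.
  by rewrite gerBl.
Qed.

Let trunc_arith (c k a x : R) : (0 < c -> 0 <= a -> c - k * c <= a -> a <= c ->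
  a - a ^+ 2 <= x -> 1 - x / c <= k + c)%R.
Proof.
move=> c0 a0 ca ac ax.
have a2 : (a ^+ 2 <= c ^+ 2)%R by rewrite ler_pXn2r// nnegrE// ltW.
have : ((1 - k - c) * c <= x)%R by apply: le_trans ax; rewrite expr2 in a2 *; lra.
by rewrite -ler_pdivlMr//; lra.
Qed.

(** The loss is the mass of mu minus the difference quotient of the transform,
which is close to it since the cumulant of c is close to c. The bound tends to
0 with c, uniformly on bounded time intervals: this is the uniform
integrability of the total mass. *)
Let mean_trunc_loss (r t c : R) (mu : FM) : (0 <= r <= t)%R -> (0 < c)%R ->
  mass mu = 1%R ->
  \int[PX r \d_mu]_w (mass (X t w) - trunc c t w)%:E <=
    (gamma * (1 + beta) * c `^ beta * (t - r) + c)%:E.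
Proof.
move=> rt c0 mu1; have /andP[r0 rt'] := rt; have t0 := le_trans r0 rt'.
have bT := bounded_trunc c0 t0; have mM := measurable_mass_process hX t0.
have D0 w : (0 <= mass (X t w) - trunc c t w)%R.
  by rewrite subr_ge0; have /andP[] := trunc_bounds t w c0.
have mT : measurable_fun setT (trunc c t) by case: bT.
have T0 w : (0 <= trunc c t w)%R by have /andP[] := trunc_bounds t w c0.
have E : \int[PX r \d_mu]_w (mass (X t w) - trunc c t w)%:E +
    (rint (PX r \d_mu) (trunc c t))%:E = 1.
  have mD : measurable_fun setT (fun w => (mass (X t w) - trunc c t w)%:E).
    by apply/measurable_EFinP; exact: measurable_funB.
  have mT' : measurable_fun setT (fun w => (trunc c t w)%:E) by exact/measurable_EFinP.
  rewrite -(rintE _ bT) -(integralD_ge0 _ mD _ mT'); last 2 first.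
  - by move=> w; rewrite lee_fin.
  - by move=> w; rewrite lee_fin.
  rewrite -[RHS](congr1 EFin mu1) -(mean_mass mu rt).
  by apply: eq_integral => w _; rewrite -EFinD subrK.
have bc := bounded_nneg_cst (T := borel S) (ltW c0).
pose a := rint mu (lg r t (fun=> c)).
have bl := bounded_nneg_logl hZ hX hgamma t0 bc rt.
pose k := (gamma * (1 + beta) * c `^ beta * (t - r))%R.
have k0 : (0 <= k)%R.
  rewrite /k mulr_ge0 ?subr_ge0// mulr_ge0 ?powR_ge0//.
  by rewrite mulr_ge0 ?(ltW hgamma)// addr_ge0// ltW.
have a0 : (0 <= a)%R by apply: rint_ge0; case: bl.
have ac : (a <= c)%R.
  rewrite -[leRHS]mulr1 -mu1 -rint_cst; apply: (rint_le _ bl bc) => y.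
  by have /andP[] := logl_cst_bounds y rt (ltW c0).
have ca : (c - k * c <= a)%R.
  rewrite lerBlDr; have bk := bounded_nneg_cst (T := borel S) (mulr_ge0 k0 (ltW c0)).
  rewrite -[leLHS]mulr1 -mu1 -rint_cst -[(k * c)%R]mulr1 -mu1 -rint_cst /a.
  rewrite -(rintD _ bl bk); apply: (rint_le _ bc (bounded_nnegD bl bk)) => y.
  by have /andP[] := logl_cst_bounds y rt (ltW c0); rewrite lerBlDr.
have lapE : rint (PX r \d_mu) (Mexp c t) = expR (- a)%R.
  by rewrite -(laplace_logl hZ hX hgamma t0 bc mu rt) laplace_cst.
have rT : rint (PX r \d_mu) (trunc c t) = ((1 - expR (- a)) / c)%R.
  have ci : (0 <= c^-1)%R by rewrite invr_ge0 ltW.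
  have b1 := bounded_nneg_cst (T := Omega') (ler01 : (0 <= 1 :> R)%R).
  have M1 w : (Mexp c t w <= 1)%R.
    by rewrite -expR0 ler_expR oppr_le0 mulr_ge0 ?(ltW c0)// mass_ge0.
  have bM := bMexp (ltW c0) t0.
  have bB : bounded_nneg (fun w => 1 - Mexp c t w)%R.
    case: bM => [m1 p1 _]; split; first exact: measurable_funB.
      by move=> w; rewrite subr_ge0.
    by exists 1%R => w; rewrite gerBl.
  rewrite mulrC -lapE -[in RHS](mul1r 1%R) -[X in (_ * X - _)%R](mass_probability (PX r \d_mu)).
  rewrite -rint_cst -(rintB _ b1 bM M1) -(rintZ _ ci bB).
  by congr rint; apply/funext => w; rewrite mulrC.
have If : \int[PX r \d_mu]_w (mass (X t w) - trunc c t w)%:E \is a fin_num.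
  rewrite ge0_fin_numE; last by apply: integral_ge0 => w _; rewrite lee_fin.
  apply: (@le_lt_trans _ _ 1); last exact: ltry.
  by rewrite -E leeDl// lee_fin rint_ge0.
have E' : (fine (\int[PX r \d_mu]_w (mass (X t w) - trunc c t w)%:E) +
    rint (PX r \d_mu) (trunc c t) = 1)%R.
  by apply: EFin_inj; rewrite EFinD (fineK If).
rewrite -(fineK If) lee_fin; rewrite rT in E'.
rewrite (_ : fine _ = 1 - (1 - expR (- a)) / c)%R; last first.
  by apply/eqP; rewrite eq_sym subr_eq E'.
have /andP[lo _] := expN_bounds a0.
exact: trunc_arith lo.
Qed.

Let L1_arith (c e Mt Ms Tt Ts zt zs : R) : (0 < c -> 0 < e ->
  Tt = (1 - zt) / c -> Ts = (1 - zs) / c -> Tt <= Mt -> Ts <= Ms ->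
  `|Mt - Ms| <= (Mt - Tt) + (Ms - Ts) + (e / c + (c * e)^-1 * (zt - zs) ^+ 2))%R.
Proof.
move=> c0 e0 Et Es hT hS.
have -> : (Mt - Ms = (Mt - Tt) - (Ms - Ts) + (Tt - Ts))%R by ring.
apply: le_trans (ler_normD _ _) _; apply: lerD.
  apply: le_trans (ler_normB _ _) _.
  by rewrite !ger0_norm ?subr_ge0.
rewrite Et Es -mulrBl normrM (gtr0_norm (_ : 0 < c^-1)%R) ?invr_gt0//.
have -> : (1 - zt - (1 - zs) = - (zt - zs))%R by ring.
rewrite normrN; set x := (zt - zs)%R.
have -> : (e / c + (c * e)^-1 * x ^+ 2 = (e + x ^+ 2 / e) / c)%R.
  by field; rewrite !gt_eqF.
rewrite ler_wpM2r ?invr_ge0 ?(ltW c0)//.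
have [xe|ex] := leP `|x|%R e.
  by apply: le_trans xe _; rewrite lerDl divr_ge0 ?sqr_ge0// ltW.
apply: (@le_trans _ _ (x ^+ 2 / e)%R); last by rewrite lerDr ltW.
by rewrite ler_pdivlMr// -real_normK ?num_real// expr2 ler_wpM2l// ltW.
Qed.

(** Up to truncation, which costs little in mean, the mass is a Lipschitz
function of exp (- c M), whose increments are small in mean square. *)
Lemma mass_L1_continuous (r B eta : R) (mu : FM) : (0 <= r)%R -> mass mu = 1%R ->
  (0 < eta)%R -> exists2 delta : R, (0 < delta)%R & forall s t : R,
    (r <= s)%R -> (s <= t)%R -> (t <= B)%R -> (t - s <= delta)%R ->
    \int[PX r \d_mu]_w (`|mass (X t w) - mass (X s w)|)%:E <= eta%:E.
Proof.
move=> r0 mu1 eta0.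
pose g c := (gamma * (1 + beta) * c `^ beta * (`|B - r|) + c)%R.
have [c c0 cg] : exists2 c : R, (0 < c)%R & (g c <= eta / 3)%R.
  have cg : g (harmonic n) @[n --> \oo] --> (0 : R)%R.
    have c1 : (fun _ : nat => 0 : R)%R @ \oo --> (0 : R)%R by exact: cvg_cst.
    apply: (@cvg_dist_harmonic _ _ _ 1%R (gamma * (1 + beta) * `|B - r|)%R _ _ beta0 _ c1) => n.
    rewrite subr0 /g ger0_norm; last first.
      rewrite addr_ge0 ?(ltW (harmonic_gt0 n))// mulr_ge0// mulr_ge0 ?powR_ge0//.
      by rewrite mulr_ge0 ?(ltW hgamma)// addr_ge0// ltW.
    by rewrite mul1r addrC lerD2l mulrAC.
  have e3 : (0 < eta / 3)%R by rewrite divr_gt0.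
  have /cvgrPdist_le/(_ _ e3)[n _ /(_ n (leqnn n))] := cg.
  rewrite sub0r normrN => H; exists (harmonic n); first exact: harmonic_gt0.
  exact: le_trans (ler_norm _) H.
(* e / c is eta / 6, and delta is such that the mean square, divided by c * e,
   contributes another eta / 6 *)
pose e := (c * eta / 6)%R.
have e0 : (0 < e)%R by rewrite divr_gt0// mulr_gt0.
pose K := (gamma * (1 + beta) * (2 * c) `^ beta * (2 * c) + 1)%R.
have K0 : (0 < K)%R.
  rewrite ltr_wpDl// mulr_ge0 ?mulr_ge0 ?powR_ge0 ?(ltW c0) ?(ltW hgamma)//.
  by rewrite addr_ge0// ltW.
exists (c * e * eta / (6 * K))%R.
  by rewrite divr_gt0 ?mulr_gt0.
move=> s t rs st tB ts; have s0 := le_trans r0 rs; have t0 := le_trans s0 st.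
have rs' : (0 <= r <= s)%R by rewrite r0.
have rt' : (0 <= r <= t)%R by rewrite r0 (le_trans rs).
have mMt := measurable_mass_process hX t0; have mMs := measurable_mass_process hX s0.
have [mTt _ _] := bounded_trunc c0 t0; have [mTs _ _] := bounded_trunc c0 s0.
have [mZt _ _] := bMexp (ltW c0) t0; have [mZs _ _] := bMexp (ltW c0) s0.
have Tt w := trunc_bounds t w c0; have Ts w := trunc_bounds s w c0.
pose f1 w := (mass (X t w) - trunc c t w)%R.
pose f2 w := (mass (X s w) - trunc c s w)%R.
pose f3 w := ((Mexp c t w - Mexp c s w) ^+ 2)%R.
have f10 w : (0 <= f1 w)%R by rewrite subr_ge0; case/andP: (Tt w).
have f20 w : (0 <= f2 w)%R by rewrite subr_ge0; case/andP: (Ts w).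
have f30 w : (0 <= f3 w)%R by exact: sqr_ge0.
have m1 : measurable_fun setT f1 by exact: measurable_funB.
have m2 : measurable_fun setT f2 by exact: measurable_funB.
have m3 : measurable_fun setT f3 by apply: measurable_funX; exact: measurable_funB.
have ce0 : (0 <= (c * e)^-1)%R by rewrite invr_ge0 mulr_ge0// ltW.
have b3 : bounded_nneg f3.
  split => //; exists 1%R => w; have h x : (0 <= Mexp c x w <= 1)%R.
    by rewrite expR_ge0 -expR0 ler_expR oppr_le0 mulr_ge0 ?(ltW c0)// mass_ge0.
  exact: sqr_diff_le1.
have ec0 : (0 <= e / c)%R by rewrite divr_ge0// ltW.
have bl : bounded_nneg (fun w => e / c + (c * e)^-1 * f3 w)%R.
  by apply: bounded_nnegD; [exact: bounded_nneg_cst|exact: bounded_nnegZ].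
have [ml l0 _] := bl.
have m1' : measurable_fun setT (fun w => (f1 w)%:E) by exact/measurable_EFinP.
have m2' : measurable_fun setT (fun w => (f2 w)%:E) by exact/measurable_EFinP.
have m12 : measurable_fun setT (fun w => (f1 w)%:E + (f2 w)%:E).
  exact: emeasurable_funD.
have ml' : measurable_fun setT (fun w => (e / c + (c * e)^-1 * f3 w)%:E).
  exact/measurable_EFinP.
apply: (@le_trans _ _ (\int[PX r \d_mu]_w
    ((f1 w)%:E + (f2 w)%:E + (e / c + (c * e)^-1 * f3 w)%:E))).
  apply: integral_le_ge0.
  - by apply/measurable_EFinP; apply: measurableT_comp => //; exact: measurable_funB.
  - by move=> w; rewrite lee_fin.
  - exact: emeasurable_funD.
  move=> w; rewrite -!EFinD lee_fin.
  by apply: L1_arith => //; [case/andP: (Tt w)|case/andP: (Ts w)].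
rewrite (integralD_ge0 _ m12 _ ml'); last 2 first.
- by move=> w; rewrite -EFinD lee_fin addr_ge0.
- by move=> w; rewrite lee_fin.
rewrite (integralD_ge0 _ m1' _ m2'); last 2 first.
- by move=> w; rewrite lee_fin.
- by move=> w; rewrite lee_fin.
rewrite (rintE _ bl) (rintD _ (bounded_nneg_cst ec0) (bounded_nnegZ ce0 b3)).
rewrite rint_cst mass_probability mulr1 (rintZ _ ce0 b3).
have gB x : (r <= x)%R -> (x <= B)%R ->
    (gamma * (1 + beta) * c `^ beta * (x - r) + c <= eta / 3)%R.
  move=> rx xB; apply: le_trans cg; rewrite /g lerD2r ler_wpM2l//.
    by rewrite mulr_ge0 ?powR_ge0// mulr_ge0 ?(ltW hgamma)// addr_ge0// ltW.
  by apply: le_trans (ler_norm _); rewrite lerD2r.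
have I1 : \int[PX r \d_mu]_w (f1 w)%:E <= (eta / 3)%:E.
  apply: le_trans (mean_trunc_loss rt' c0 mu1) _.
  by rewrite lee_fin; exact: gB (le_trans rs st) tB.
have I2 : \int[PX r \d_mu]_w (f2 w)%:E <= (eta / 3)%:E.
  apply: le_trans (mean_trunc_loss rs' c0 mu1) _.
  by rewrite lee_fin; exact: gB rs (le_trans st tB).
have I3 : (e / c + (c * e)^-1 * rint (PX r \d_mu) f3 <= eta / 3)%R.
  have q := square_increment mu r0 rs st (ltW c0).
  rewrite mu1 mulr1 in q.
  have q' : (rint (PX r \d_mu) f3 <= K * (t - s))%R.
    apply: le_trans q _; rewrite -[leLHS]mulrA mulrAC; rewrite /K [leRHS]mulrDl.
    rewrite mul1r -[leLHS]addr0 lerD ?subr_ge0//.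
    by rewrite le_eqVlt; apply/orP; left; apply/eqP; ring.
  have q2 : (K * (t - s) <= c * e * (eta / 6))%R.
    apply: le_trans (ler_wpM2l (ltW K0) ts) _.
    by rewrite le_eqVlt; apply/orP; left; apply/eqP; field; rewrite gt_eqF.
  have q3 := ler_wpM2l ce0 (le_trans q' q2).
  rewrite [leRHS]mulrA mulVf ?mul1r in q3; last by rewrite gt_eqF// mulr_gt0.
  have -> : (eta / 3 = eta / 6 + eta / 6)%R by field.
  apply: lerD => //; rewrite /e le_eqVlt; apply/orP; left; apply/eqP; field.
  by rewrite gt_eqF.
have -> : eta%:E = (eta / 3)%:E + (eta / 3)%:E + (eta / 3)%:E.
  by rewrite -!EFinD; congr EFin; field.
by rewrite leeD// ?lee_fin// leeD.
Qed.

End total_mass_continuity.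

(** * Cumulants of discrete functionals *)

Section discrete_functionals.
Context {R : realType} {d d' : measure_display}.
Context {Omega : measurableType d} {Omega' : measurableType d'}.
Context {S : ptopologicalType}.
Variables (Z : R -> Omega -> S) (F : set R -> set (set Omega)).
Variable P : R -> probability (borel S) R -> probability Omega R.
Variables (gamma beta : R).
Variables (X : R -> Omega' -> finmeas (borel S) R).
Variable G : set R -> set (set Omega').
Variable PX : R -> probability (finmeas (borel S) R) R -> probability Omega' R.
Hypothesis hZ : @markov_process R d _ Omega (borel S) Z F P.
Hypothesis hX : superprocess Z P gamma beta X G PX.
Hypothesis hgamma : (0 < gamma)%R.
Hypothesis hbeta : (0 < beta <= 1)%R.

Local Notation FM := (finmeas (borel S) R).
Local Notation tr s t f := (@transition R d _ Omega (borel S) Z P s t f).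
Local Notation pr t f w := (@pairing R d' Omega' S X t f w).
Local Notation tr_cst := (@transition_cst R d _ Omega (borel S) Z P).
Local Notation lg s t f := (@logl R d' Omega' S X PX s t f).

Let hXm : markov_process X G PX := super_markov hX.

Local Notation atoms := (seq (R * (borel S -> R))).

Fixpoint atoms_after (s : R) (l : atoms) : Prop :=
  if l is p :: l' then
    [/\ (s <= p.1)%R, bounded_nneg p.2 & atoms_after p.1 l']
  else True.

Definition pair_sum (l : atoms) (w : Omega') : R := (\sum_(p <- l) pr p.1 p.2 w)%R.

Definition path_sum (l : atoms) (w : Omega) : R := (\sum_(p <- l) p.2 (Z p.1 w))%R.

Definition mean_sum (s : R) (l : atoms) (y : borel S) : R :=
  (\sum_(p <- l) tr s p.1 p.2 y)%R.

(** The cumulant of a finite sum of pairings. *)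
Definition value (s : R) (l : atoms) (y : borel S) : R :=
  (- ln (rint (PX s \d_(\d_y : FM)) (fun w => expR (- pair_sum l w))))%R.

Lemma atoms_after_le s t l : (s <= t)%R -> atoms_after t l -> atoms_after s l.
Proof. by case: l => //= p l st [tp bp pl]; split => //; exact: le_trans tp. Qed.

Lemma pair_sum_cons p l w : pair_sum (p :: l) w = (pr p.1 p.2 w + pair_sum l w)%R.
Proof. by rewrite /pair_sum big_cons. Qed.

Lemma mean_sum_cons s p l y :
  mean_sum s (p :: l) y = (tr s p.1 p.2 y + mean_sum s l y)%R.
Proof. by rewrite /mean_sum big_cons. Qed.

Lemma path_sum_cons p l w : path_sum (p :: l) w = (p.2 (Z p.1 w) + path_sum l w)%R.
Proof. by rewrite /path_sum big_cons. Qed.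

Lemma pair_sum_nil : pair_sum [::] = fun=> 0%R.
Proof. by apply/funext => w; rewrite /pair_sum big_nil. Qed.

Lemma path_sum_nil : path_sum [::] = fun=> 0%R.
Proof. by apply/funext => w; rewrite /path_sum big_nil. Qed.

Lemma mean_sum_nil s : mean_sum s [::] = fun=> 0%R.
Proof. by apply/funext => y; rewrite /mean_sum big_nil. Qed.

Lemma pair_sum_ge0 l : forall s w, atoms_after s l -> (0 <= pair_sum l w)%R.
Proof.
elim: l => [|p l ih] s w /=; first by rewrite /pair_sum big_nil.
move=> [_ [_ f0 _] pl]; rewrite pair_sum_cons addr_ge0//; last exact: ih pl.
exact: pairing_ge0.
Qed.

Lemma bounded_path_sum l : forall s : R, (0 <= s)%R -> atoms_after s l ->
  bounded_nneg (path_sum l).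
Proof.
elim: l => [|p l ih] s s0 /=.
  by move=> _; rewrite path_sum_nil; exact: bounded_nneg_cst.
move=> [sp bp pl]; have p0 := le_trans s0 sp.
rewrite (_ : path_sum _ = fun w => p.2 (Z p.1 w) + path_sum l w)%R; last first.
  by apply/funext => w; rewrite path_sum_cons.
by apply: bounded_nnegD; [exact: (bounded_nneg_comp hZ)|exact: ih pl].
Qed.

Lemma mean_sumE l : forall s t : R, (0 <= s)%R -> (0 <= t)%R -> atoms_after t l ->
  forall y, mean_sum s l y = rint (P s \d_y) (path_sum l).
Proof.
elim: l => [|p l ih] s t s0 t0 /= hl y.
  by rewrite mean_sum_nil path_sum_nil rint_cst mul0r.
have [tp bp pl] := hl; have p0 := le_trans t0 tp.
rewrite mean_sum_cons (ih s p.1)//.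
rewrite /transition -rintD; first by congr rint; apply/funext => w; rewrite path_sum_cons.
- exact: (bounded_nneg_comp hZ).
- exact: bounded_path_sum pl.
Qed.

Lemma bounded_mean_sum l : forall s : R, (0 <= s)%R -> atoms_after s l ->
  bounded_nneg (mean_sum s l).
Proof.
move=> s s0; suff H : forall t : R, (s <= t)%R -> atoms_after t l ->
    bounded_nneg (mean_sum s l) by exact: H.
elim: l => [|p l ih] t st /=.
  by move=> _; rewrite mean_sum_nil; exact: bounded_nneg_cst.
move=> [tp bp pl]; have sp := le_trans st tp.
rewrite (_ : mean_sum _ _ = fun y => tr s p.1 p.2 y + mean_sum s l y)%R; last first.
  by apply/funext => y; rewrite mean_sum_cons.
apply: bounded_nnegD; last exact: ih pl.
by apply: (bounded_nneg_transition hZ) => //; rewrite s0.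
Qed.

Lemma mean_sum_bound (s t M : R) l y : (0 <= s)%R -> (0 <= t)%R -> atoms_after t l ->
  (forall w, path_sum l w <= M)%R -> (mean_sum s l y <= M)%R.
Proof.
move=> s0 t0 hl lM; rewrite (mean_sumE s0 t0 hl); apply: rint_bound => //.
exact: bounded_path_sum hl.
Qed.

Lemma transition_mean_sum (s t : R) l y : (0 <= s)%R -> (s <= t)%R ->
  atoms_after t l -> tr s t (mean_sum t l) y = mean_sum s l y.
Proof.
move=> s0 st; have t0 := le_trans s0 st.
suff H : forall u : R, (t <= u)%R -> atoms_after u l ->
    tr s t (mean_sum t l) y = mean_sum s l y by exact: H.
elim: l => [|p l ih] u tu /=.
  by move=> _; rewrite !mean_sum_nil tr_cst.
move=> [up bp pl]; have tp := le_trans tu up; have p0 := le_trans t0 tp.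
rewrite mean_sum_cons -(ih _ tp pl) -(transition_transition hZ y s0 st tp bp).
have b1 : bounded_nneg (tr t p.1 p.2).
  by apply: (bounded_nneg_transition hZ) => //; rewrite t0.
have b2 := bounded_mean_sum t0 (atoms_after_le tp pl).
rewrite -(transitionD hZ s t0 y b1 b2); congr (tr s t _ y).
by apply/funext => q; rewrite mean_sum_cons.
Qed.

Lemma adapted_pair_sum l : forall s t : R, (0 <= s)%R -> (s <= t)%R -> atoms_after t l ->
  measurable_fun [set: g_sigma_algebraType (G `[s, +oo[)] (pair_sum l).
Proof.
elim: l => [|p l ih] s t s0 st /=.
  by move=> _; rewrite pair_sum_nil; exact: measurable_cst.
move=> [tp [mf f0 _] pl]; have sp := le_trans st tp.
rewrite (_ : pair_sum _ = fun w => pr p.1 p.2 w + pair_sum l w)%R; last first.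
  by apply/funext => w; rewrite pair_sum_cons.
apply: measurable_funD; last exact: ih sp pl.
apply: (adapted_pairing hX) => //; first exact: time_interval_cy.
by rewrite /= in_itv/= sp.
Qed.

Lemma bounded_exp_pair_sum (s : R) l : (0 <= s)%R -> atoms_after s l ->
  @bounded_nneg _ (g_sigma_algebraType (G `[s, +oo[)) R
    (fun w => expR (- pair_sum l w))%R.
Proof.
move=> s0 hl; apply: bounded_nneg_expN.
  by apply: adapted_pair_sum hl.
by move=> w; exact: pair_sum_ge0 hl.
Qed.

(** Conditioning at the first time p.1 turns the later atoms into the pairing
with their value, so the value of p :: l is the cumulant with terminal value
p.2 + value p.1 l at time p.1. *)
Lemma value_spec l : forall s : R, (0 <= s)%R -> atoms_after s l ->
  [/\ bounded_nneg (value s l),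
      forall mu, rint (PX s \d_mu) (fun w => expR (- pair_sum l w))%R =
        expR (- rint mu (value s l))%R,
      (if l is p :: l' then value s l = lg s p.1 (fun q => p.2 q + value p.1 l' q)%R
       else forall y, value s l y = 0%R) &
      forall y, (value s l y <= mean_sum s l y)%R].
Proof.
move: l; have spec s l v : bounded_nneg v ->
    (forall mu, rint (PX s \d_mu) (fun w => expR (- pair_sum l w))%R =
      expR (- rint mu v)%R) -> value s l = v.
  move=> bv vE; apply/funext => y; rewrite /value vE expRK opprK rint_dirac//.
  by case: bv.
elim => [|p l ih] s s0 /=.
  move=> _; have b0 : bounded_nneg (fun _ : borel S => 0%R : R).
    exact: bounded_nneg_cst.
  have E mu : rint (PX s \d_mu) (fun w => expR (- pair_sum [::] w))%R =
      expR (- rint mu (fun=> 0))%R.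
    rewrite rint_cst mul0r oppr0 expR0 pair_sum_nil.
    under eq_fun do rewrite oppr0 expR0.
    by rewrite rint_cst mass_probability mulr1.
  by rewrite (spec s [::] _ b0 E) mean_sum_nil.
move=> [sp bp pl]; have p0 := le_trans s0 sp.
have [bv vE _ vm] := ih p.1 p0 pl.
have bpv := bounded_nnegD bp bv.
have sp' : (0 <= s <= p.1)%R by rewrite s0.
have bl := bounded_nneg_logl hZ hX hgamma p0 bpv sp'.
have E mu : rint (PX s \d_mu) (fun w => expR (- pair_sum (p :: l) w))%R =
    expR (- rint mu (lg s p.1 (fun q => p.2 q + value p.1 l q)))%R.
  rewrite -(laplace_logl hZ hX hgamma p0 bpv mu sp').
  under eq_fun do rewrite pair_sum_cons opprD expRD.
  have It : `[s, p.1]%classic p.1 by rewrite /= in_itv/= sp lexx.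
  have b1 := bounded_nneg_exp_pairing hX (time_interval_cc p.1 s0) It bp.
  have b2 := bounded_exp_pair_sum p0 pl.
  have -> := rint_markov hXm (dirac mu) sp' b1 b2.
  congr rint; apply/funext => w; rewrite vE -expRD -opprD; congr (expR (- _))%R.
  by rewrite /pairing -rintD.
rewrite (spec s (p :: l) _ bl E); split => // y.
apply: le_trans (logl_le_transition hZ hX hgamma p0 bpv y sp') _.
have bm := bounded_mean_sum p0 pl.
rewrite mean_sum_cons -(transition_mean_sum y s0 sp pl).
rewrite -(transitionD hZ s p0 y bp bm).
apply: (transition_le hZ s p0 y bpv (bounded_nnegD bp bm)) => q.
by rewrite lerD2l.
Qed.

Lemma value_flow (s t : R) l : (0 <= s)%R -> (s <= t)%R -> atoms_after t l ->
  value s l = lg s t (value t l).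
Proof.
move=> s0 st hl; have t0 := le_trans s0 st.
have [bv vE _ _] := value_spec t0 hl.
apply/funext => y; rewrite /value /logl; congr (- ln _)%R.
have st' : (0 <= s <= t)%R by rewrite s0.
rewrite (rint_tower hXm (dirac (\d_y : FM)) st' (bounded_exp_pair_sum t0 hl)).
by congr rint; apply/funext => w; rewrite vE.
Qed.

End discrete_functionals.

(** * Moving atoms to a grid *)

Section time_discretization.
Context {R : realType} {d d' : measure_display}.
Context {Omega : measurableType d} {Omega' : measurableType d'}.
Context {S : ptopologicalType}.
Variables (Z : R -> Omega -> S) (F : set R -> set (set Omega)).
Variable P : R -> probability (borel S) R -> probability Omega R.
Variables (gamma beta : R).
Variables (X : R -> Omega' -> finmeas (borel S) R).
Variable G : set R -> set (set Omega').
Variable PX : R -> probability (finmeas (borel S) R) R -> probability Omega' R.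
Hypothesis hZ : @markov_process R d _ Omega (borel S) Z F P.
Hypothesis hX : superprocess Z P gamma beta X G PX.
Hypothesis hgamma : (0 < gamma)%R.
Hypothesis hbeta : (0 < beta <= 1)%R.

Local Notation tr s t f := (@transition R d _ Omega (borel S) Z P s t f).
Local Notation lg s t f := (@logl R d' Omega' S X PX s t f).

Local Opaque logl transition tint value.
Local Notation atoms := (seq (R * (borel S -> R))).
Local Notation path_sum l w := (@path_sum R d Omega S Z l w).
Local Notation mean_sum s l := (@mean_sum R d Omega S Z P s l).
Local Notation value s l := (@value R d' Omega' S X PX s l).

Lemma atoms_after_filter (a : pred (R * (borel S -> R))) (l : atoms) : forall s : R,
  atoms_after s l -> atoms_after s [seq p <- l | a p].
Proof.
elim: l => [//|p l ih] s /= [sp bp pl]; case: ifP => _ /=.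
  by split => //; exact: ih.
by apply: atoms_after_le (ih _ pl).
Qed.

Lemma atoms_after_filter_ge (t : R) (l : atoms) : forall s : R, atoms_after s l ->
  atoms_after t [seq p <- l | (t <= p.1)%R].
Proof.
elim: l => [//|p l ih] s /= [sp bp pl]; case: ifP => tp /=.
  by split => //; exact: atoms_after_filter.
exact: ih pl.
Qed.

Lemma filter_before_nil (t : R) (l : atoms) : atoms_after t l ->
  forall s, [seq p <- l | (s <= p.1 < t)%R] = [::].
Proof.
move=> hl s; suff H : forall u : R, (t <= u)%R -> atoms_after u l ->
    [seq p <- l | (s <= p.1 < t)%R] = [::] by exact: H hl.
elim: l {hl} => [//|p l ih] u tu /= [up _ pl]; have tp := le_trans tu up.
by rewrite ltNge tp andbF; exact: ih pl.
Qed.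

Lemma filter_split (s t : R) (l : atoms) : (s <= t)%R -> forall u : R, atoms_after u l ->
  [seq p <- l | (s <= p.1)%R] =
  [seq p <- l | (s <= p.1 < t)%R] ++ [seq p <- l | (t <= p.1)%R].
Proof.
move=> st; elim: l => [//|p l ih] u /= [_ _ pl].
have [tp|pt] := leP t p.1.
  rewrite (le_trans st tp) /= (ih _ pl).
  by rewrite (filter_before_nil (atoms_after_le tp pl)).
by rewrite andbT; case: ifP => _ /=; rewrite (ih _ pl).
Qed.

Lemma path_sum_filter (a : pred (R * (borel S -> R))) (l : atoms) w : forall s : R,
  atoms_after s l -> (path_sum [seq p <- l | a p] w <= path_sum l w)%R.
Proof.
elim: l => [//|p l ih] s /= [_ [_ f0 _] pl]; have H := ih _ pl.
case: ifP => _; rewrite !path_sum_cons ?lerD2l//.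
by apply: le_trans H _; rewrite lerDr.
Qed.

Lemma path_sum_ge0 l w : forall s : R, atoms_after s l -> (0 <= path_sum l w)%R.
Proof.
elim: l => [|p l ih] s /=; first by rewrite path_sum_nil.
by move=> [_ [_ f0 _] pl]; rewrite path_sum_cons addr_ge0//; exact: ih pl.
Qed.

Lemma mean_sum_ge0 l y : forall s u : R, atoms_after u l -> (0 <= mean_sum s l y)%R.
Proof.
elim: l => [|p l ih] s u /=; first by rewrite mean_sum_nil.
move=> [_ [_ f0 _] pl]; rewrite mean_sum_cons addr_ge0//; last exact: ih pl.
exact: transition_ge0.
Qed.

Lemma atoms_after_cat (T0 : R) (l1 l2 : atoms) : atoms_after T0 l2 -> forall s : R,
  (s <= T0)%R -> atoms_after s l1 -> all (fun p => p.1 <= T0)%R l1 ->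
  atoms_after s (l1 ++ l2).
Proof.
move=> h2; elim: l1 => [|p l ih] s sT /=; first by move=> _ _; exact: atoms_after_le h2.
by move=> [sp bp pl] /andP[pT lT]; split => //; exact: ih.
Qed.

Let sandwich_arith (K a b m v1 v2 : R) : (0 <= m -> 0 <= K -> 0 <= a -> 0 <= b ->
  v1 + (1 - K * a) * ((1 - K * b) * m) <= v2 -> (1 - K * (a + b)) * m + v1 <= v2)%R.
Proof.
move=> m0 K0 a0 b0 H; apply: le_trans H; rewrite addrC lerD2l mulrA.
rewrite ler_wpM2r//.
have : (0 <= (K * a) * (K * b))%R by rewrite mulr_ge0// mulr_ge0.
by lra.
Qed.

(** The bounds of logl_add_bounds are applied atom by atom. The relative
errors are proportional to the lengths of successive intervals and add up to
at most K (T0 - s), so that their number does not matter. *)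
Lemma value_sandwich (T0 M1 M2 K : R) (l2 : atoms) :
  K = (gamma * (1 + beta) * (M1 + M2) `^ beta)%R ->
  atoms_after T0 l2 -> (forall q, value T0 l2 q <= M2)%R ->
  forall l1 (s : R) y, (0 <= s)%R -> (s <= T0)%R -> (K * (T0 - s) <= 1)%R ->
  atoms_after s l1 -> all (fun p => p.1 <= T0)%R l1 ->
  (forall w, path_sum l1 w <= M1)%R ->
  ((1 - K * (T0 - s)) * mean_sum s l1 y + lg s T0 (value T0 l2) y <=
   value s (l1 ++ l2) y <= mean_sum s l1 y + lg s T0 (value T0 l2) y)%R.
Proof.
move=> KE h2 vM2.
have b0 : (0 <= 1 + beta)%R by case/andP: hbeta => ? _; lra.
have K0 : (0 <= K)%R.
  by rewrite KE mulr_ge0 ?powR_ge0// mulr_ge0// ltW.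
elim => [|p l ih] s y s0 sT KT /=.
  move=> _ _ _; rewrite mean_sum_nil mulr0 !add0r.
  by rewrite (value_flow hZ hX hgamma s0 sT h2) lexx.
move=> [sp bp pl] /andP[pT lT] hM; have p0 := le_trans s0 sp.
have T0' := le_trans p0 pT.
have lM w : (path_sum l w <= M1)%R.
  by apply: le_trans (hM w); rewrite path_sum_cons lerDr; case: bp.
have KpT : (K * (T0 - p.1) <= 1)%R.
  by apply: le_trans KT; rewrite ler_wpM2l// lerD2l lerN2.
have hcat := atoms_after_cat h2 pT pl lT.
have {ih} ihl q := ih p.1 q p0 pT KpT pl lT lM.
have hs : atoms_after s (p :: (l ++ l2)) by split.
have [_ _ -> _] := value_spec hZ hX hgamma s0 hs.
have [bv _ _ _] := value_spec hZ hX hgamma p0 hcat.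
have [bv2 _ _ _] := value_spec hZ hX hgamma T0' h2.
have pT' : (0 <= p.1 <= T0)%R by rewrite p0.
have sp' : (0 <= s <= p.1)%R by rewrite s0.
have bW := bounded_nneg_logl hZ hX hgamma T0' bv2 pT'.
have bm := bounded_mean_sum hZ p0 pl.
have bf := bounded_nnegD bp bm.
have -> : lg s T0 (value T0 l2) = lg s p.1 (lg p.1 T0 (value T0 l2)).
  exact: (logl_flow hZ hX hgamma s0 sp pT bv2).
have mE : mean_sum s (p :: l) y = tr s p.1 (fun q => p.2 q + mean_sum p.1 l q)%R y.
  rewrite (transitionD hZ s p0 y bp bm) mean_sum_cons.
  by rewrite (transition_mean_sum hZ y s0 sp pl).
have fM q : (p.2 q + mean_sum p.1 l q <= M1)%R.
  have hp : atoms_after p.1 (p :: l) by split.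
  have := mean_sum_bound hZ q p0 p0 hp hM.
  by rewrite mean_sum_cons (transition_refl hZ q p0 bp).
have WM q : (lg p.1 T0 (value T0 l2) q <= M2)%R.
  exact: (logl_bound hZ hX hgamma T0' bv2).
pose W := lg p.1 T0 (value T0 l2); pose f q := (p.2 q + mean_sum p.1 l q)%R.
pose th := (1 - K * (T0 - p.1))%R.
have th0 : (0 <= th)%R by rewrite subr_ge0.
have th1 : (th <= 1)%R by rewrite gerBl mulr_ge0// subr_ge0.
have bpv := bounded_nnegD bp bv.
have f0 q : (0 <= f q)%R by case: bf => _ H _; exact: H.
have WfC q : (W q + f q <= M1 + M2)%R by rewrite addrC; apply: lerD; [exact: fM|exact: WM].
have WtfC q : (W q + th * f q <= M1 + M2)%R.
  by apply: le_trans (WfC q); rewrite lerD2l ler_piMl.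
have btf := bounded_nnegZ th0 bf.
have [up lo] : (forall q, p.2 q + value p.1 (l ++ l2) q <= W q + f q)%R /\
    (forall q, W q + th * f q <= p.2 q + value p.1 (l ++ l2) q)%R.
  split => q; have /andP[lo up] := ihl q; have p20 : (0 <= p.2 q)%R by case: bp.
    by rewrite /f [leRHS]addrC -addrA lerD2l.
  rewrite /f mulrDr addrC -addrA; apply: lerD; last exact: lo.
  by rewrite ler_piMl.
have /andP[_ H1] := @logl_add_bounds _ _ _ _ _ _ Z F P gamma beta X G PX hZ hX
  hgamma hbeta s p.1 W f (M1 + M2)%R y sp' bW bf WfC.
have /andP[H2 _] := @logl_add_bounds _ _ _ _ _ _ Z F P gamma beta X G PX hZ hX
  hgamma hbeta s p.1 W (fun q => th * f q)%R (M1 + M2)%R y sp' bW btf WtfC.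
have L1 := le_logl hZ hX hgamma y sp' bpv (bounded_nnegD bW bf) up.
have L2 := le_logl hZ hX hgamma y sp' (bounded_nnegD bW btf) bpv lo.
apply/andP; split; last first.
  by apply: (le_trans L1); rewrite mE addrC.
have -> : (T0 - s = (p.1 - s) + (T0 - p.1))%R by ring.
have a0 : (0 <= p.1 - s)%R by rewrite subr_ge0.
have c0 : (0 <= T0 - p.1)%R by rewrite subr_ge0.
have m0 : (0 <= mean_sum s (p :: l) y)%R.
  by apply: (@mean_sum_ge0 (p :: l) y s s); split.
apply: (sandwich_arith m0 K0 a0 c0).
apply: le_trans L2; apply: le_trans H2.
by rewrite -KE (transitionZ hZ s p0 y th0 bf) -mE.
Qed.

Fixpoint grid (delta : R) (c : R -> borel S -> R) (n : nat) (s : R) : atoms :=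
  if n is n'.+1 then (s, c s) :: grid delta c n' (s + delta)%R else [::].

Lemma grid_after (delta : R) c n : (0 <= delta)%R -> forall s : R,
  (forall t : R, (s <= t)%R -> bounded_nneg (c t)) -> atoms_after s (grid delta c n s).
Proof.
move=> d0; elim: n => [//|n ih] s hc /=; split => //; first exact: hc.
apply: (@atoms_after_le _ _ _ (s + delta)%R); first by rewrite lerDl.
by apply: ih => t st; apply: hc; apply: le_trans st; rewrite lerDl.
Qed.

Lemma value_grid (delta : R) c n (s : R) : (0 <= delta)%R -> (0 <= s)%R ->
  (forall t : R, (s <= t)%R -> bounded_nneg (c t)) ->
  value s (grid delta c n.+1 s) = (fun y => c s y +
    lg s (s + delta) (value (s + delta) (grid delta c n (s + delta))) y)%R.
Proof.
move=> d0 s0 hc; have ss : (s <= s + delta)%R by rewrite lerDl.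
have hg : atoms_after (s + delta)%R (grid delta c n (s + delta)).
  by apply: grid_after => // t st; apply: hc; exact: le_trans st.
have hs := @grid_after delta c n.+1 d0 s hc.
have hg' := atoms_after_le ss hg.
have [_ _ E _] := value_spec hZ hX hgamma s0 hs; rewrite [LHS]E /=.
have [bv _ _ _] := value_spec hZ hX hgamma s0 hg'.
rewrite (logl_refl hZ hX hgamma hbeta s0 (bounded_nnegD (hc s (lexx s)) bv)).
by rewrite (value_flow hZ hX hgamma s0 ss hg).
Qed.

Definition cell (delta : R) (l : atoms) (s : R) : borel S -> R :=
  mean_sum s [seq p <- l | (s <= p.1 < s + delta)%R].

Lemma cell_mean (delta : R) (l : atoms) (s : R) :
  cell delta l s = mean_sum s [seq p <- l | (s <= p.1 < s + delta)%R].
Proof. by []. Qed.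

Lemma bounded_cell (delta : R) (l : atoms) (s u : R) : (0 <= s)%R ->
  atoms_after u l -> bounded_nneg (cell delta l s).
Proof.
move=> s0 hl; apply: (bounded_mean_sum hZ) => //.
have -> : [seq p <- l | (s <= p.1 < s + delta)%R] =
    [seq p <- [seq p <- l | (s <= p.1)%R] | (p.1 < s + delta)%R].
  by rewrite -filter_predI; apply: eq_filter => p /=; rewrite andbC.
exact/atoms_after_filter/(atoms_after_filter_ge _ hl).
Qed.

(** The comparison of value_sandwich, cell by cell from the last one
backwards; monotonicity of the cumulant carries the bounds for the later cells
to earlier times. The grid functionals depend on l through the conditional
means of its cells only. *)
Lemma grid_comparison (s0 delta M K : R) (l : atoms) :
  K = (gamma * (1 + beta) * (M + M) `^ beta)%R -> (0 <= s0)%R ->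
  (0 <= delta)%R -> (K * delta <= 1)%R -> atoms_after s0 l ->
  (forall w, path_sum l w <= M)%R ->
  forall n (s : R) y, (s0 <= s)%R -> all (fun p => p.1 < s + n%:R * delta)%R l ->
  (value s (grid delta (fun t q => (1 - K * delta) * cell delta l t q) n s) y <=
   value s [seq p <- l | s <= p.1] y <=
   value s (grid delta (cell delta l) n s) y)%R.
Proof.
move=> KE s00 d0 Kd hl lM.
have th0 : (0 <= 1 - K * delta)%R by rewrite subr_ge0.
have bc t : (s0 <= t)%R -> bounded_nneg (cell delta l t).
  by move=> st; apply: bounded_cell hl; exact: le_trans st.
have btc t : (s0 <= t)%R -> bounded_nneg (fun q => (1 - K * delta) * cell delta l t q)%R.
  by move=> st; apply: bounded_nnegZ => //; exact: bc.
elim=> [|n ih] s y ss all_lt.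
  have -> : [seq p <- l | (s <= p.1)%R] = [::].
    elim: {hl lM bc btc} l all_lt => [//|p l ihl] /= /andP[ps al]; rewrite ihl//.
    by move: ps; rewrite mul0r addr0 ltNge => /negbTE ->.
  by rewrite /= !lexx.
have s_ge0 := le_trans s00 ss; have st : (s <= s + delta)%R by rewrite lerDl.
have ss' := le_trans ss st; have s_ge0' := le_trans s_ge0 st.
have hnext : all (fun p => p.1 < s + delta + n%:R * delta)%R l.
  by move: all_lt; rewrite -natr1 mulrDl mul1r addrCA addrC addrAC.
have ihn q := ih (s + delta)%R q ss' hnext.
rewrite (filter_split st hl).
set l1 := [seq p <- l | (s <= p.1 < s + delta)%R].
set l2 := [seq p <- l | (s + delta <= p.1)%R] in ihn *.
have h2 : atoms_after (s + delta)%R l2 by exact: atoms_after_filter_ge hl.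
have h1 : atoms_after s l1.
  rewrite /l1 (_ : [seq p <- l | _] = [seq p <- [seq p <- l | (s <= p.1)%R] | (p.1 < s + delta)%R]).
    exact/atoms_after_filter/(atoms_after_filter_ge _ hl).
  by rewrite -filter_predI; apply: eq_filter => p /=; rewrite andbC.
have l1T : all (fun p => p.1 <= s + delta)%R l1.
  by rewrite all_filter; elim: (l) => //= p l' ->; rewrite andbT; apply/implyP => /andP[_ /ltW].
have l1M w : (path_sum l1 w <= M)%R by apply: le_trans (lM w); exact: path_sum_filter hl.
have l2M w : (path_sum l2 w <= M)%R by apply: le_trans (lM w); exact: path_sum_filter hl.
have [bv2 _ _ v2m] := value_spec hZ hX hgamma s_ge0' h2.
have v2M q : (value (s + delta) l2 q <= M)%R.
  by apply: le_trans (v2m q) _; exact: (mean_sum_bound hZ q s_ge0' s_ge0' h2 l2M).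
have KsT : (K * (s + delta - s) <= 1)%R by rewrite addrAC subrr add0r.
have := value_sandwich KE h2 v2M y s_ge0 st KsT h1 l1T l1M.
rewrite [(s + delta - s)%R]addrAC subrr add0r => /andP[lo up].
have ts : (0 <= s <= s + delta)%R by rewrite s_ge0.
have cellE : mean_sum s l1 y = cell delta l s y by [].
have bct t : (s <= t)%R -> bounded_nneg (cell delta l t).
  by move=> st'; apply: bc; exact: le_trans st'.
have bcth t : (s <= t)%R -> bounded_nneg (fun q => (1 - K * delta) * cell delta l t q)%R.
  by move=> st'; apply: btc; exact: le_trans st'.
rewrite (value_grid n d0 s_ge0 bct) (value_grid n d0 s_ge0 bcth).
have g1 : atoms_after (s + delta)%R (grid delta (cell delta l) n (s + delta)).
  by apply: grid_after => // t t1; apply: bct; exact: le_trans t1.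
have g2 : atoms_after (s + delta)%R
    (grid delta (fun t q => (1 - K * delta) * cell delta l t q)%R n (s + delta)).
  by apply: grid_after => // t t1; apply: bcth; exact: le_trans t1.
have [bg1 _ _ _] := value_spec hZ hX hgamma s_ge0' g1.
have [bg2 _ _ _] := value_spec hZ hX hgamma s_ge0' g2.
apply/andP; split.
- apply: le_trans lo; rewrite -cellE lerD2l.
  by apply: (le_logl hZ hX hgamma y ts bg2 bv2) => q; case/andP: (ihn q).
- apply: (le_trans up); rewrite cellE lerD2l.
  by apply: (le_logl hZ hX hgamma y ts bv2 bg1) => q; case/andP: (ihn q).
Qed.

End time_discretization.

(** * Almost everywhere limits *)

Section almost_everywhere_limits.
Context {d} {T : measurableType d} {R : realType}.

Lemma measurable_contract (g : T -> \bar R) : measurable_fun setT g ->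
  measurable_fun setT (fun x => contract (g x)).
Proof.
move=> mg; apply: (measurability _ (RGenOInfty.measurableE R)) => _ [_ [a ->] <-].
rewrite setTI; have [a1|a1] := leP `|a|%R 1%R; last first.
  have [a0|a0] := leP 0%R a.
    rewrite (_ : _ @^-1` _ = set0)//; apply/seteqP; split => // x /=.
    rewrite in_itv/= andbT => xa; have := contract_le1 (g x).
    rewrite ler_norml => /andP[_]; rewrite leNgt (lt_trans _ xa)//.
    by move: a1; rewrite ger0_norm.
  rewrite (_ : _ @^-1` _ = setT)//; apply/seteqP; split => // x _ /=.
  rewrite in_itv/= andbT; have := contract_le1 (g x).
  rewrite ler_norml => /andP[H _]; apply: lt_le_trans H.
  by move: a1; rewrite ltr0_norm// ltrNr.
rewrite (_ : _ @^-1` _ = g @^-1` `]expand a, +oo[%classic); last first.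
  apply/seteqP; split => x /=; rewrite !in_itv/= !andbT.
    by rewrite -{1}(expandK (_ : a \in _)) ?inE// lt_contract.
  by move=> H; rewrite -(expandK (_ : a \in _)) ?inE// lt_contract.
by rewrite -[X in measurable X]setTI; apply: mg => //; exact: emeasurable_itv.
Qed.

Variable Q : probability T R.

(** Balls of the extended reals are defined through contract. *)
Lemma measurable_far (g h : T -> \bar R) (e : R) :
  measurable_fun setT g -> measurable_fun setT h ->
  measurable [set w | ~ ball (g w) e (h w)].
Proof.
move=> mg mh; rewrite (_ : [set w | _] = ~` [set w | ball (g w) e (h w)])//.
apply: measurableC.
rewrite (_ : [set w | _] =
  (fun w => `|contract (g w) - contract (h w)|)%R @^-1` `]-oo, e[%classic); last first.
  by apply/seteqP; split => w /=; rewrite in_itv.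
rewrite -[X in measurable X]setTI.
have H : measurable_fun setT (fun w => `|contract (g w) - contract (h w)|)%R.
  apply: measurableT_comp => //.
  by apply: measurable_funB; exact: measurable_contract.
exact: H.
Qed.

(** The Borel-Cantelli lemma, along indices where the probability of an error
above 2^-(k+1) is itself at most 2^-(k+1). *)
Lemma cvg_probability_subseq (g_ : nat -> T -> \bar R) (g : T -> \bar R) :
  (forall n, measurable_fun setT (g_ n)) -> measurable_fun setT g ->
  cvg_probability Q g_ g ->
  exists2 u : nat -> nat, (forall k, (k <= u k)%N) &
    {ae Q, forall w, g_ (u k) w @[k --> \oo] --> g w}.
Proof.
move=> mg_ mg cg.
pose half k := (1 / (2 ^ k.+1)%:R : R)%R.
have half0 k : (0 < half k)%R by rewrite divr_gt0// ltr0n expn_gt0.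
pose bad k n := [set w | ~ ball (g w) (half k) (g_ n w)].
have mbad k n : measurable (bad k n) by exact: measurable_far.
have /choice[u hu] k : exists n, (k <= n)%N /\ Q (bad k n) <= (half k)%:E.
  have /fine_cvgP[_ /cvgrPdist_le/(_ _ (half0 k))] := cg _ (half0 k).
  move=> [N _ H]; exists (maxn k N); split; first exact: leq_maxl.
  have := H (maxn k N) (leq_maxr _ _).
  rewrite sub0r normrN ger0_norm ?fine_ge0// => le.
  by rewrite -[X in X <= _]fineK ?fin_num_measure// lee_fin.
exists u => [k|]; first by case: (hu k).
have Q0 : Q (lim_sup_set (fun k => bad k (u k))) = 0.
  apply: lim_sup_set_cvg0 => [k|]; first exact: mbad.
  apply: (@le_lt_trans _ _ 1%:E); last exact: ltry.
  apply: le_trans (epsilon_trick0 xpredT (ler01 : (0 <= 1 :> R)%R)).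
  by apply: lee_nneseries => // k _; case: (hu k).
exists (lim_sup_set (fun k => bad k (u k))); split => //.
  by apply: bigcap_measurable => // n _; apply: bigcup_measurable => // k _; exact: mbad.
move=> w /= nc n _; apply: contrapT => H; apply: nc.
apply/cvg_ballP => e e0.
have [k0 hk0] : exists k0, forall k, (k0 <= k)%N -> (half k <= e)%R.
  have /cvgrPdist_le/(_ _ e0)[k0 _ hk] := @cvg_harmonic R.
  exists k0 => k /hk; rewrite sub0r normrN ger0_norm; last exact/ltW/harmonic_gt0.
  apply: le_trans; rewrite /half div1r lef_pV2 ?posrE ?ltr0n ?expn_gt0//.
  by rewrite ler_nat ltnW// ltn_expl.
exists (maxn n k0) => // k /=; rewrite geq_max => /andP[nk kk].
apply: (le_ball (hk0 k kk)); apply: contrapT => b; apply: H.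
by exists k.
Qed.

Lemma cvg_subseq (M : topologicalType) (v : nat -> M) (l : M) (u : nat -> nat) :
  (forall k, (k <= u k)%N) -> v k @[k --> \oo] --> l -> v (u k) @[k --> \oo] --> l.
Proof.
move=> hu; apply: cvg_comp => A [N _ hN]; exists N => // k /= Nk.
by apply: hN => /=; exact: leq_trans (hu k).
Qed.

Lemma limn_einf_ge0 (u : nat -> \bar R) : (forall n, 0 <= u n) -> 0 <= limn_einf u.
Proof.
move=> u0; rewrite limn_einf_lim; apply: lime_ge; first exact: is_cvg_einfs.
by apply: nearW => n; apply: le_ereal_inf_tmp => _ [m _ <-].
Qed.

(** This form makes it unnecessary to know beforehand that g is integrable. *)
Lemma fatou_ae (g_ : nat -> T -> \bar R) (g : T -> \bar R) (x : R) :
  (forall n, measurable_fun setT (g_ n)) -> measurable_fun setT g ->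
  (forall n w, 0 <= g_ n w) -> (forall w, 0 <= g w) ->
  {ae Q, forall w, g_ n w @[n --> \oo] --> g w} ->
  x%:E < \int[Q]_w g w -> exists N, forall n, (N <= n)%N -> x%:E <= \int[Q]_w g_ n w.
Proof.
move=> mg_ mg g_0 g0 cg xg.
have {xg} : x%:E < limn_einf (fun n => \int[Q]_w g_ n w).
  apply: lt_le_trans (fatou _ measurableT mg_ (fun n w _ => g_0 n w)).
  apply: (lt_le_trans xg); rewrite le_eqVlt; apply/orP; left; apply/eqP/esym.
  apply: ge0_ae_eq_integral_nonmeas => //; first by move=> w; exact: limn_einf_ge0.
  by apply: filterS cg => w cw; rewrite (cvg_limn_einf_sup cw).1.
rewrite limn_einf_lim (cvg_lim _ (ereal_nondecreasing_cvgn (nondecreasing_einfs _)))//.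
move=> /ereal_sup_gt[_ [N _ <-]] xN; exists N => n Nn.
by apply: le_trans (ltW xN) _; apply: ereal_inf_lbound; exists n.
Qed.

(** Scheffe's lemma, with a weight: when total masses converge nothing can be
lost, neither on the part weighted by b nor on the complementary one. *)
Lemma scheffe (g_ : nat -> T -> \bar R) (g : T -> \bar R) (b : T -> R) (c_ : nat -> R) (c : R) :
  (forall n, measurable_fun setT (g_ n)) -> measurable_fun setT g ->
  (forall n w, 0 <= g_ n w) -> (forall w, 0 <= g w) ->
  measurable_fun setT b -> (forall w, 0 <= b w <= 1)%R ->
  {ae Q, forall w, g_ n w @[n --> \oo] --> g w} ->
  (forall n, \int[Q]_w g_ n w = (c_ n)%:E) -> c_ n @[n --> \oo] --> c ->
  c%:E <= \int[Q]_w g w ->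
  \int[Q]_w g w = c%:E /\
  fine (\int[Q]_w (g_ n w * (b w)%:E)) @[n --> \oo] --> fine (\int[Q]_w (g w * (b w)%:E)).
Proof.
move=> mg_ mg g_0 g0 mb b01 cg Ec_ cc cE.
have gE : \int[Q]_w g w = c%:E.
  apply/eqP; rewrite eq_le cE andbT leNgt; apply/negP => cg'.
  have [x cx xg] : exists2 x : R, (c < x)%R & x%:E < \int[Q]_w g w.
    move: cg'; case: (\int[Q]_w g w) => [v| |//].
      by rewrite lte_fin => cv; exists ((c + v) / 2)%R; [|rewrite lte_fin]; lra.
    by move=> _; exists (c + 1)%R; [lra|exact: ltry].
  have [N hN] := fatou_ae mg_ mg g_0 g0 cg xg.
  have xc0 : (0 < (x - c) / 2)%R by lra.
  have /cvgrPdist_le/(_ _ xc0)[N' _ hN'] := cc.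
  have := hN _ (leq_maxl N N'); have := hN' _ (leq_maxr N N').
  by rewrite Ec_ lee_fin ler_norml => /andP[? ?] ?; clear cE cg' xg; lra.
clear cE; split => //.
pose w_ (k : T -> R) n := \int[Q]_w (g_ n w * (k w)%:E).
pose b' w := (1 - b w)%R.
have mb' : measurable_fun setT b' by exact: measurable_funB.
have b0 w : (0 <= b w)%R by case/andP: (b01 w).
have b'0 w : (0 <= b' w)%R by rewrite subr_ge0; case/andP: (b01 w).
have mk (k : T -> R) : measurable_fun setT k -> measurable_fun setT (EFin \o k).
  by move=> ?; exact/measurable_EFinP.
have split_ (h : T -> \bar R) : measurable_fun setT h -> (forall w, 0 <= h w) ->
    \int[Q]_w h w = \int[Q]_w (h w * (b w)%:E) + \int[Q]_w (h w * (b' w)%:E).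
  move=> mh h0; rewrite -integralD_ge0.
  - apply: eq_integral => w _; rewrite -ge0_muleDr ?lee_fin// -EFinD.
    by rewrite /b' addrC subrK mule1.
  - by apply: emeasurable_funM => //; exact: mk.
  - by move=> w; rewrite mule_ge0// lee_fin.
  - by apply: emeasurable_funM => //; exact: mk.
  - by move=> w; rewrite mule_ge0// lee_fin.
have fin (h : T -> \bar R) (k : T -> R) (v : R) : measurable_fun setT h ->
    (forall w, 0 <= h w) -> measurable_fun setT k -> (forall w, 0 <= k w <= 1)%R ->
    \int[Q]_w h w = v%:E -> \int[Q]_w (h w * (k w)%:E) =
      (fine (\int[Q]_w (h w * (k w)%:E)))%:E.
  move=> mh h0 mk' k01 hv; rewrite fineK// ge0_fin_numE; last first.
    by apply: integral_ge0 => w _; rewrite mule_ge0// lee_fin; case/andP: (k01 w).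
  apply: (@le_lt_trans _ _ (\int[Q]_w h w)); last by rewrite hv ltry.
  apply: integral_le_ge0 => //.
  - by apply: emeasurable_funM => //; exact: mk.
  - by move=> w; rewrite mule_ge0// lee_fin; case/andP: (k01 w).
  - move=> w; rewrite -[leRHS]mule1; apply: lee_wpmul2l => //.
    by rewrite lee_fin; case/andP: (k01 w).
have b'01 w : (0 <= b' w <= 1)%R by rewrite b'0 /= gerBl.
have fat (k : T -> R) (x : R) : measurable_fun setT k -> (forall w, 0 <= k w)%R ->
    x%:E < \int[Q]_w (g w * (k w)%:E) -> exists N, forall n, (N <= n)%N ->
      x%:E <= \int[Q]_w (g_ n w * (k w)%:E).
  move=> mk' k0; apply: fatou_ae.
  - by move=> n; apply: emeasurable_funM => //; exact: mk.
  - by apply: emeasurable_funM => //; exact: mk.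
  - by move=> n w; rewrite mule_ge0// lee_fin.
  - by move=> w; rewrite mule_ge0// lee_fin.
  - by apply: filterS cg => w cw; apply: cvgeZr.
apply/cvgrPdist_le => e e0.
have [N1 h1] := fat b (fine (\int[Q]_w (g w * (b w)%:E)) - e)%R mb b0 ltac:(
  rewrite [ltRHS](fin g b c) ?lte_fin//; lra).
have e2 : (0 < e / 2)%R by lra.
have [N2 h2] := fat b' (fine (\int[Q]_w (g w * (b' w)%:E)) - e / 2)%R mb' b'0 ltac:(
  rewrite [ltRHS](fin g b' c) ?lte_fin//; lra).
have /cvgrPdist_le/(_ _ e2)[N3 _ h3] := cc.
exists (maxn N1 (maxn N2 N3)) => // n /=; rewrite !geq_max => /and3P[n1 n2 n3].
have := h1 n n1; have := h2 n n2; have := h3 n n3.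
have := split_ _ (mg_ n) (g_0 n); have := split_ _ mg g0.
rewrite gE Ec_ (fin g b c)// (fin g b' c)//.
rewrite (fin (g_ n) b (c_ n))// (fin (g_ n) b' (c_ n))// -!EFinD.
move=> [E1] [E2]; rewrite !lee_fin !ler_norml => /andP[H1 H2] H3 H4.
by apply/andP; split; lra.
Qed.

End almost_everywhere_limits.

(** * Changing the starting time of an almost sure limit *)

Lemma cvg_einf_esup (R : realType) (u : nat -> \bar R) (l : \bar R) :
  limn_esup u <= l -> l <= limn_einf u -> u @ \oo --> l.
Proof.
move=> ul lu.
have El : limn_esup u = l.
  by apply/eqP; rewrite eq_le ul (le_trans lu)// limn_einf_sup.
have Eu : limn_einf u = l.
  by apply/eqP; rewrite eq_le lu (le_trans _ ul)// limn_einf_sup.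
apply: (squeeze_cvge (f := einfs u) (h := esups u)).
- apply: nearW => n; apply/andP; split.
    by apply: ereal_inf_lbound; exists n => /=.
  by apply: ereal_sup_ubound; exists n => /=.
- by rewrite -Eu limn_einf_lim; exact: is_cvg_einfs.
- by rewrite -El limn_esup_lim; exact: is_cvg_esups.
Qed.

Lemma measurable_limn_einf d (T : measurableType d) (R : realType)
    (f : nat -> T -> \bar R) : (forall n, measurable_fun setT (f n)) ->
  measurable_fun setT (fun x => limn_einf (f ^~ x)).
Proof.
move=> mf; rewrite (_ : (fun x => _) = fun x => - limn_esup (-%E \o (f ^~ x))); last first.
  by apply/funext => x; rewrite limn_esupN oppeK.
apply: measurableT_comp => //.
apply: (@measurable_fun_limn_esup _ _ _ _ (fun n x => - f n x)) => n.
exact: measurableT_comp.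
Qed.

(** An enumeration of the rationals by natural numbers, so that null sets
indexed by rational levels can be united by countable subadditivity. *)
Definition nth_rat (R : realType) (n : nat) : R := ratr (odflt 0%R (unpickle n : option rat)).

Lemma ereal_rat_between (R : realType) (x y : \bar R) : 0 <= x -> x < y ->
  exists n : nat, x < (nth_rat R n)%:E /\ (nth_rat R n)%:E < y.
Proof.
move=> x0 xy; suff [q [h1 h2]] : exists q : rat, x < (ratr q : R)%:E /\ (ratr q : R)%:E < y.
  by exists (pickle q); rewrite /nth_rat pickleK.
move: x0 xy; case: x => [x| |//] _; last by rewrite ltNge leey.
case: y => [y| |//].
  by rewrite lte_fin => /rat_in_itvoo[q]; rewrite in_itv/= => /andP[? ?]; exists q; rewrite !lte_fin.
move=> _; have /rat_in_itvoo[q] : (x < x + 1)%R by rewrite ltrDl.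
by rewrite in_itv/= => /andP[? _]; exists q; rewrite lte_fin ltry.
Qed.

Section transfer.
Context {R : realType} {d : measure_display}.
Context {Omega : measurableType d} {S : ptopologicalType}.
Variables (Z : R -> Omega -> S) (F : set R -> set (set Omega)).
Variable P : R -> probability (borel S) R -> probability Omega R.
Hypothesis hZ : @markov_process R d _ Omega (borel S) Z F P.

(** By the Markov property the probability of an event of the future of q is
the mean of its probability for the process restarted at q. The restarted
process almost surely does not charge N, and it never charges V outside N. *)
Lemma markov_null (s q : R) (y : borel S) (V N : set Omega) :
  (0 <= s)%R -> (s <= q)%R -> F `[q, +oo[%classic V -> F `[q, +oo[%classic N ->
  P s \d_y N = 0 -> (forall x : borel S, (P q \d_x).-negligible (V `\` N)) ->
  P s \d_y V = 0.
Proof.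
move=> s0 sq FV FN N0 VN; have q0 := le_trans s0 sq.
have hI := time_interval_cy q0.
have mF C : F `[q, +oo[%classic C -> measurable C := fun h => markov_sub hZ hI h.
have sq' : (0 <= s <= q)%R by rewrite s0.
have mI C : F `[q, +oo[%classic C ->
    measurable_fun [set: g_sigma_algebraType (F `[q, +oo[)] (EFin \o (\1_C : Omega -> R)).
  by move=> FC; apply/measurable_EFinP/measurable_indicP; rewrite (adaptedE hZ hI).
have tower C : F `[q, +oo[%classic C ->
    P s \d_y C = \int[P s \d_y]_w P q \d_(Z q w : borel S) C.
  move=> FC; have := markov_tower hZ \d_y sq' (mI C FC).
  rewrite integral_indic ?setIT; [|exact: measurableT|exact: mF].
  move=> -> //; last by move=> w; rewrite lee_fin.
  apply: eq_integral => w _; rewrite integral_indic ?setIT//; exact: mF.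
have meas C : F `[q, +oo[%classic C ->
    measurable_fun setT (fun w => P q \d_(Z q w : borel S) C).
  move=> FC; apply: (measurableT_comp (f := fun x : borel S => P q \d_x C)).
    exact: (markov_measurable hZ).
  exact: (measurable_process hZ).
have : {ae P s \d_y, forall w, P q \d_(Z q w : borel S) N = 0}.
  have := (ae_eq_integral_abs (P s \d_y) measurableT (meas N FN)).1.
  have -> : \int[P s \d_y]_w `|P q \d_(Z q w : borel S) N| = 0.
    rewrite -N0 (tower N FN); apply: eq_integral => w _.
    by rewrite gee0_abs.
  by move=> /(_ erefl); apply: filterS => w /(_ I).
move=> aeN; rewrite (tower V FV).
have -> : \int[P s \d_y]_w P q \d_(Z q w : borel S) V = \int[P s \d_y]_w 0.
  apply: ge0_ae_eq_integral => //; first exact: meas.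
  apply: filterS aeN => w Nw _; apply/eqP; rewrite eq_le measure_ge0 andbT.
  have [W [mW W0 VW]] := VN (Z q w).
  have VU : V `<=` N `|` W.
    by move=> x Vx; have [Nx|Nx] := pselect (N x); [left|right; apply: VW].
  apply: (@le_trans _ _ (P q \d_(Z q w : borel S) (N `|` W))).
    by apply: le_measure => //; rewrite inE; [exact: mF|apply: measurableU => //; exact: mF].
  apply: (le_trans (measureU2 _ _ _)) => //; first exact: mF.
  by rewrite -[leRHS]adde0; apply: leeD; rewrite le_eqVlt; apply/orP; left; apply/eqP; [exact: Nw|exact: W0].
by rewrite integral0.
Qed.

(** The event that convergence fails need not belong to the future of q, since
A is only measurable with respect to a completion that depends on the starting
law. For every rational level c the event A [q, +oo[ < c is therefore replaced
by an event B c of the future that differs from it by a null event N c;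
failure of convergence at w then means that some B c is inconsistent with the
lower or upper limit of a_ n w, and these inconsistencies form an event of the
future to which markov_null applies. *)
Lemma additive_functional_transfer (A : R.-ker Omega ~> R)
    (a_ : nat -> Omega -> \bar R) (s q : R) (y : borel S) :
  additive_functional F P A -> (0 <= s)%R -> (s <= q)%R ->
  (forall n, measurable_fun [set: g_sigma_algebraType (F `[q, +oo[)] (a_ n)) ->
  (forall n w, 0 <= a_ n w) ->
  (forall x : borel S,
    {ae P q \d_x, forall w, a_ n w @[n --> \oo] --> A w `[q, +oo[%classic}) ->
  {ae P s \d_y, forall w, a_ n w @[n --> \oo] --> A w `[q, +oo[%classic}.
Proof.
move=> hA s0 sq ma a0 aex; have q0 := le_trans s0 sq.
have hI := time_interval_cy q0.
pose I := `[q, +oo[%classic : set R.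
have sub : I `<=` `[s, +oo[.
  by move=> x; rewrite /I /= !in_itv/= !andbT => qx; exact: le_trans sq qx.
have /choice[B /choice[N hBN]] (c : nat) := hA I s \d_y hI s0 sub `]-oo, (nth_rat R c)%:E[%classic
  (emeasurable_itv _).
pose FI := F I.
have FE := adaptedE hZ hI.
have mS C : F I C -> @measurable _ (g_sigma_algebraType (F I)) C by rewrite FE.
pose Sup w := limn_esup (a_ ^~ w); pose Inf w := limn_einf (a_ ^~ w).
have mSup : measurable_fun [set: g_sigma_algebraType (F I)] Sup.
  exact: measurable_fun_limn_esup.
have mInf : measurable_fun [set: g_sigma_algebraType (F I)] Inf.
  exact: measurable_limn_einf.
pose CC c := B c `&` [set w | (nth_rat R c)%:E <= Sup w].
pose DD c := [set w | Inf w < (nth_rat R c)%:E] `\` B c.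
(* outside NN, failure of convergence to A [q, +oo[ means that a rational
   level c separates A [q, +oo[ from the upper or the lower limit *)
pose V := \bigcup_c (CC c `|` DD c).
pose NN := \bigcup_c N c.
have mB c : @measurable _ (g_sigma_algebraType (F I)) (B c) by apply: mS; case: (hBN c).
have FN : F I NN.
  rewrite -FE; apply: bigcupT_measurable => c; apply: mS; by case: (hBN c).
have FV : F I V.
  rewrite -FE; apply: bigcupT_measurable => c; apply: measurableU.
    apply: measurableI => //; rewrite -[X in measurable X]setTI.
    exact: emeasurable_fun_c_infty.
  apply: measurableD => //; rewrite -[X in measurable X]setTI.
  exact: emeasurable_fun_infty_o.
have N0 : P s \d_y NN = 0.
  apply/negligibleP; last apply: negligible_bigcup => c.
    exact: (markov_sub hZ hI).
  by apply/negligibleP; [apply: (markov_sub hZ hI)|]; case: (hBN c).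
have V0 : P s \d_y V = 0.
  apply: (markov_null s0 sq FV FN N0) => x.
  apply: negligibleS (aex x) => w [[c _ CD] nN] /= cvw.
  have nNc : ~ N c w by move=> Nc; apply: nN; exists c.
  have [lo hi] := cvg_limn_einf_sup cvw.
  have [_ _ _ diff] := hBN c.
  case: CD => [[Bw Sw]|[Iw Bw]].
    apply: nNc; apply: diff; right; split => //=.
    by rewrite in_itv/= => H; move: Sw; rewrite /= /Sup hi leNgt H.
  apply: nNc; apply: diff; left; split => //=.
  by rewrite in_itv/=; move: Iw; rewrite /= /Inf lo.
exists (V `|` NN); split.
- by apply: measurableU; exact: (markov_sub hZ hI).
- apply/eqP; rewrite eq_le measure_ge0 andbT.
  apply: (le_trans (measureU2 _ _ _)); [exact: (markov_sub hZ hI)|exact: (markov_sub hZ hI)|].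
  by rewrite -[leRHS]adde0; apply: leeD; rewrite le_eqVlt; apply/orP; left; apply/eqP; [exact: V0|exact: N0].
move=> w /= ncv; apply: contrapT => /not_orP[nV nN]; apply: ncv.
have out c : ~ N c w by move=> Nc; apply: nN; exists c.
have A0 : 0 <= A w I by exact: measure_ge0.
apply: cvg_einf_esup; rewrite leNgt; apply/negP => H.
- have [c [c1 c2]] := ereal_rat_between A0 H.
  apply: nV; exists c => //; left; split; last exact: ltW.
  apply: contrapT => nB; apply: (out c); have [_ _ _ diff] := hBN c; apply: diff; left.
  by split => //=; rewrite in_itv/=.
- have I0 : 0 <= limn_einf (a_ ^~ w) by exact: limn_einf_ge0.
  have [c [c1 c2]] := ereal_rat_between I0 H.
  apply: nV; exists c => //; right; split => // Bw.
  apply: (out c); have [_ _ _ diff] := hBN c; apply: diff; right; split => //=.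
  by rewrite in_itv/= => H'; have := lt_trans c2 H'; rewrite ltxx.
Qed.

End transfer.

(** * Simple additive functionals as lists of atoms *)

Section simple_functionals.
Context {R : realType} {d d' : measure_display}.
Context {Omega : measurableType d} {Omega' : measurableType d'}.
Context {S : ptopologicalType}.
Variables (Z : R -> Omega -> S) (F : set R -> set (set Omega)).
Variable P : R -> probability (borel S) R -> probability Omega R.
Variables (gamma beta : R).
Variables (X : R -> Omega' -> finmeas (borel S) R).
Variable G : set R -> set (set Omega').
Variable PX : R -> probability (finmeas (borel S) R) R -> probability Omega' R.
Hypothesis hZ : @markov_process R d _ Omega (borel S) Z F P.
Hypothesis hX : superprocess Z P gamma beta X G PX.
Hypothesis hgamma : (0 < gamma)%R.
Hypothesis hbeta : (0 < beta <= 1)%R.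

Local Notation FM := (finmeas (borel S) R).
Local Notation tr s t f := (@transition R d _ Omega (borel S) Z P s t f).
Local Notation pr t f w := (@pairing R d' Omega' S X t f w).

Local Notation atoms := (seq (R * (borel S -> R))).
Local Notation pair_sum l w := (@pair_sum R d' Omega' S X l w).
Local Notation path_sum l w := (@path_sum R d Omega S Z l w).

Lemma path_sumE l w : path_sum l w = (\sum_(p <- l) p.2 (Z p.1 w))%R.
Proof. by []. Qed.

Lemma pair_sumE l w : pair_sum l w = (\sum_(p <- l) pr p.1 p.2 w)%R.
Proof. by []. Qed.

Section data.
Variables (n : nat) (t : 'I_n -> R) (f : 'I_n -> borel S -> R).
Hypothesis tf : simple_data t f.

Definition atoms_of (a : pred 'I_n) : atoms := [seq (t i, f i) | i <- enum 'I_n & a i].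

Lemma bounded_data i : bounded_nneg (f i).
Proof.
have [_ _ m f0 b] := tf.
by split; [exact: m|exact: f0|exact: b].
Qed.

Lemma atoms_of_after (s : R) (a : pred 'I_n) : (forall i, a i -> (s <= t i)%R) ->
  atoms_after s (atoms_of a).
Proof.
move=> sa; rewrite /atoms_of.
have tr_lt : transitive (fun i j : 'I_n => (i < j)%N) by move=> ? ? ?; exact: ltn_trans.
have : sorted (fun i j : 'I_n => (i < j)%N) [seq i <- enum 'I_n | a i].
  apply: (sorted_filter tr_lt).
  by have := iota_ltn_sorted 0 n; rewrite -val_enum_ord sorted_map.
have : all a [seq i <- enum 'I_n | a i] by exact: filter_all.
elim: [seq i <- enum 'I_n | a i] s sa => [//|i e ih] s sa /= /andP[ai ae] pe.
split; [exact: sa|exact: bounded_data|].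
have te : all (fun j : 'I_n => (i < j)%N) e by exact: (order_path_min tr_lt pe).
have : all (fun j => t i <= t j)%R e.
  by apply: sub_all te => j ij; exact/ltW/(simple_time_lt tf).
move: (path_sorted pe) ae => {te ih sa ai pe}.
elim: e (t i) => [//|j e ih] u /= pe /andP[aj ae] /andP[uj ue].
split; [exact: uj|exact: bounded_data|apply: ih => //; first exact: path_sorted pe].
have te : all (fun k : 'I_n => (j < k)%N) e by exact: (order_path_min tr_lt pe).
by apply: sub_all te => k jk; exact/ltW/(simple_time_lt tf).
Qed.

Lemma big_atoms_of (V : nmodType) (a : pred 'I_n) (b : pred R)
    (g : R * (borel S -> R) -> V) :
  (\sum_(p <- [seq p <- atoms_of a | b p.1]) g p =
   \sum_(i < n | a i && b (t i)) g (t i, f i))%R.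
Proof.
by rewrite /atoms_of big_filter big_map big_filter_cond big_enum_cond.
Qed.

End data.

(** Formulas for a simple functional are given on bounded intervals only; the
tail is the value on an interval [q, u] with u past all the atoms and past T'.
*)
Lemma simple_tail (A : R.-ker Omega ~> R) n (t : 'I_n -> R) f (T' q : R) w :
  simple_repr Z A t f -> (0 <= q)%R -> A w `[T', +oo[%classic = 0 ->
  A w `[q, +oo[%classic = (\sum_(i < n | (q <= t i)%R) f i (Z (t i) w))%:E%R.
Proof.
move=> [tf AE] q0 AT.
pose u := (q + `|T'| + \sum_(i < n) `|t i|)%R.
have s0 : (0 <= \sum_(i < n) `|t i|)%R by apply: sumr_ge0 => i _.
have Tu : (T' <= u)%R by rewrite /u; have := ler_norm T'; lra.
have qu : (q <= u)%R by rewrite /u; have := normr_ge0 T'; lra.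
have tu i : (t i <= u)%R.
  rewrite /u (bigD1 i)//=; have := ler_norm (t i); have := normr_ge0 T'.
  have : (0 <= \sum_(j < n | j != i) `|t j|)%R by apply: sumr_ge0 => j _.
  by lra.
have -> : `[q, +oo[%classic = `[q, u]%classic `|` `]u, +oo[%classic :> set R.
  apply/seteqP; split => x /=; rewrite !in_itv/= !andbT.
    by move=> qx; have [xu|ux] := leP x u; [left; rewrite qx|right].
  by case=> [/andP[]//|ux]; apply: le_trans qu _; exact: ltW.
have E0 : A w `]u, +oo[%classic = 0.
  apply/eqP; rewrite eq_le measure_ge0 andbT -AT; apply: le_measure; rewrite ?inE//.
  by move=> x /=; rewrite !in_itv/= !andbT => ux; apply: le_trans Tu _; exact: ltW.
have disj : `[q, u]%classic `&` `]u, +oo[%classic = set0 :> set R.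
  apply/seteqP; split => x //= [] /=; rewrite !in_itv/= !andbT => /andP[_ xu] ux.
  by have := lt_le_trans ux xu; rewrite ltxx.
apply: (etrans (measureU (A w) _ _ disj)) => //.
apply: (etrans (congr1 (fun x => _ + x) E0)); rewrite adde0.
apply: (etrans (AE w q u _)); first by rewrite q0.
rewrite sumEFin; congr (_%:E)%R; apply: eq_bigl => i.
by rewrite tu andbT.
Qed.

(** What is kept of an approximating sequence of simple functionals: lists of
atoms in [r, T0[, uniformly bounded along paths, whose tails converge whatever
the starting time in [r, q]. *)
Record discretization (A : R.-ker Omega ~> R) (r T0 M : R) (l : nat -> atoms) : Prop :=
  Discretization {
  disc_after : forall k, atoms_after r (l k) ;
  disc_before : forall k, all (fun p => p.1 < T0)%R (l k) ;
  disc_bound : forall k w, (path_sum (l k) w <= M)%R ;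
  disc_cvg : forall (s q : R) (y : borel S), (r <= s)%R -> (s <= q)%R ->
    {ae P s \d_y, forall w,
      (path_sum [seq p <- l k | (q <= p.1)%R] w)%:E @[k --> \oo] -->
      A w `[q, +oo[%classic} }.

(** Two kinds of atoms are dropped: those before r, where X vanishes, and
those from T0 on, which vanish along all paths of Z, so that their pairings
with X have mean zero. *)
Lemma discretize (A : R.-ker Omega ~> R) (r : R) (mu : FM)
    (An : nat -> R.-ker Omega ~> R) (Jn : nat -> Omega' -> \bar R) : (0 <= r)%R ->
  additive_functional F P A -> calA2_approx Z F P An A ->
  (forall k, J_functional1 Z X (An k) (Jn k)) ->
  exists T0 M l, discretization A r T0 M l /\
    forall k, {ae PX r \d_mu, forall w, Jn k w = (pair_sum (l k) w)%:E}.
Proof.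
move=> r0 hA [_ cvA [T0 [T00 AT [M AM]]]] hJ.
pose keep n (t : 'I_n -> R) i := (r <= t i < T0)%R.
have /choice[l hl] k : exists l : atoms,
  [/\ atoms_after r l, all (fun p => p.1 < T0)%R l,
      forall w, (path_sum l w <= M)%R,
      forall w (q : R), (r <= q)%R ->
        (path_sum [seq p <- l | (q <= p.1)%R] w)%:E = An k w `[q, +oo[%classic &
      {ae PX r \d_mu, forall w, Jn k w = (pair_sum l w)%:E}].
  have [n [t [f [Af JE]]]] := hJ k; have [tf AE] := Af.
  have f0 i y : (0 <= f i y)%R by exact: (simple_ge0 tf).
  (* the value on [T0, +oo[ is 0, hence so is each of its nonnegative terms *)
  have late i w : (T0 <= t i)%R -> f i (Z (t i) w) = 0%R.
    move=> Tt; have := simple_tail Af (ltW T00) (AT k w); rewrite AT => -[].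
    move=> /esym/eqP; rewrite psumr_eq0//.
    by move=> /allP/(_ i (mem_index_enum _)); rewrite Tt => /eqP.
  exists (atoms_of t f (keep n t)); split.
  - by apply: (atoms_of_after tf) => i /andP[].
  - by rewrite /atoms_of all_map; apply/allP => i; rewrite mem_filter => /andP[/andP[]].
  - move=> w; rewrite -lee_fin; apply: le_trans (AM k w).
    rewrite AE; last by rewrite lexx ltW.
    rewrite sumEFin lee_fin path_sumE.
    have -> : atoms_of t f (keep n t) = [seq p <- atoms_of t f (keep n t) | predT p.1].
      by rewrite filter_predT.
    rewrite (big_atoms_of t f (keep n t) predT) big_mkcond [leRHS]big_mkcond/=.
    apply: ler_sum => i _; rewrite /keep andbT.
    case: ifPn => [/andP[rt tT]|_]; last by case: ifP.
    by rewrite (le_trans r0 rt) (ltW tT).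
  - move=> w q rq; rewrite (simple_tail Af (le_trans r0 rq) (AT k w)).
    rewrite path_sumE (big_atoms_of t f (keep n t) (fun u => q <= u)%R).
    congr (_%:E)%R; rewrite big_mkcond [RHS]big_mkcond; apply: eq_bigr => i _ /=.
    rewrite /keep; have [qt|_] := boolP (q <= t i)%R; last by rewrite andbF.
    rewrite (le_trans rq qt) andbT /=; case: ltP => // Tt.
    by rewrite late.
  - have null i : ~~ keep n t i -> {ae PX r \d_mu, forall w, \int[X (t i) w]_y (f i y)%:E = 0}.
      rewrite negb_and -ltNge -leNgt.
      have [tr _|rt /= Tt] := ltP (t i) r.
        have tr' : (0 <= t i < r)%R by rewrite (simple_time_ge0 tf).
        apply: filterS (super_null hX mu tr') => w Mw.
        have mf := simple_measurable tf i.
        by apply: null_set_integral; [exact: measurableT|exact/measurable_EFinP|exact: Mw].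
      have rt' : (0 <= r <= t i)%R by rewrite r0.
      have bf := bounded_data tf i.
      have E := mean_pairing hZ hX hgamma hbeta mu rt' bf.
      have tr0 : rint mu (tr r (t i) (f i)) = 0%R.
        have -> : tr r (t i) (f i) = fun=> 0%R.
          apply/funext => y; rewrite /transition.
          by under eq_fun do rewrite late//; rewrite rint_cst mul0r.
        by rewrite rint_cst mul0r.
      rewrite tr0 in E.
      have mpr := measurable_pairing_process hX (le_trans r0 rt) (simple_measurable tf i) (f0 i).
      have mpr' : measurable_fun setT (fun w => (pr (t i) (f i) w)%:E) by exact/measurable_EFinP.
      have := (ae_eq_integral_abs (PX r \d_mu) measurableT mpr').1.
      have -> : \int[PX r \d_mu]_w `|(pr (t i) (f i) w)%:E| = 0.
        apply: (etrans _ E); apply: eq_integral => w _; rewrite gee0_abs// lee_fin.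
        exact: pairing_ge0.
      move=> /(_ erefl); apply: filterS => w /(_ I).
      by rewrite (rintE _ bf).
    have : {ae PX r \d_mu, forall w, forall i, ~~ keep n t i -> \int[X (t i) w]_y (f i y)%:E = 0}.
      apply: filter_forall => i; have [ki|ki] := boolP (keep n t i).
        by apply: nearW.
      by apply: filterS (null i ki).
    apply: filterS => w hw; rewrite JE.
    have -> : atoms_of t f (keep n t) = [seq p <- atoms_of t f (keep n t) | predT p.1].
      by rewrite filter_predT.
    rewrite pair_sumE (big_atoms_of t f (keep n t) predT) -sumEFin big_mkcond [RHS]big_mkcond/=.
    apply: eq_bigr => i _; rewrite andbT; case: ifPn => [_|ki]; last exact: hw.
    by rewrite (rintE _ (bounded_data tf i)).
exists T0, M, l; split; last by move=> k; case: (hl k).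
split; try by move=> k; case: (hl k).
move=> s q y rs sq; have s0 := le_trans r0 rs; have q0 := le_trans s0 sq.
have E k w : (path_sum [seq p <- l k | (q <= p.1)%R] w)%:E = An k w `[q, +oo[%classic.
  by case: (hl k) => _ _ _ + _; apply; exact: le_trans sq.
have H := (@additive_functional_transfer _ _ _ _ _ _ _ hZ A
  (fun k w => (path_sum [seq p <- l k | (q <= p.1)%R] w)%:E) s q y hA s0 sq). refine (H _ _ _); clear H.
- move=> k; apply/measurable_EFinP.
  have [la _ _ _ _] := hl k.
  have := atoms_after_filter_ge q la; elim: [seq p <- l k | _] => [|p l' ih] /=.
    by move=> _; rewrite path_sum_nil.
  move=> [qp [mf _ _] pl].
  have H : measurable_fun [set: g_sigma_algebraType (F `[q, +oo[)]
      (fun w => p.2 (Z p.1 w) + path_sum l' w)%R.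
    apply: measurable_funD; last by apply: ih; exact: atoms_after_le pl.
    apply: (adapted_comp hZ) => //; first exact: time_interval_cy.
    by rewrite /= in_itv/= qp.
  by apply: eq_measurable_fun H => w _; rewrite path_sum_cons.
- by move=> k w; rewrite E measure_ge0.
- move=> x; apply: filterS (cvA q x q0) => w.
  by rewrite (_ : (fun k => An k w `[q, +oo[%classic) =
    fun k => (path_sum [seq p <- l k | (q <= p.1)%R] w)%:E)//; apply/funext => k; rewrite E.
Qed.

End simple_functionals.

(** * Means of cells *)

Section cells.
Context {R : realType} {d d' : measure_display}.
Context {Omega : measurableType d} {Omega' : measurableType d'}.
Context {S : ptopologicalType}.
Variables (Z : R -> Omega -> S) (F : set R -> set (set Omega)).
Variable P : R -> probability (borel S) R -> probability Omega R.
Variables (gamma beta : R).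
Variables (X : R -> Omega' -> finmeas (borel S) R).
Variable G : set R -> set (set Omega').
Variable PX : R -> probability (finmeas (borel S) R) R -> probability Omega' R.
Hypothesis hZ : @markov_process R d _ Omega (borel S) Z F P.
Hypothesis hX : superprocess Z P gamma beta X G PX.
Hypothesis hgamma : (0 < gamma)%R.
Hypothesis hbeta : (0 < beta <= 1)%R.

Local Notation atoms := (seq (R * (borel S -> R))).
Local Notation path_sum l w := (@path_sum R d Omega S Z l w).
Local Notation mean_sum s l := (@mean_sum R d Omega S Z P s l).
Local Notation discretization A r T0 M l := (@discretization R d Omega S Z P A r T0 M l).
Local Notation cell delta l s := (@cell R d Omega S Z P delta l s).

Definition tail (A : R.-ker Omega ~> R) (s q : R) (y : borel S) : R :=
  fine (\int[P s \d_y]_w A w `[q, +oo[%classic).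

Definition kernel_cell (A : R.-ker Omega ~> R) (delta s : R) (y : borel S) : R :=
  fine (\int[P s \d_y]_w A w `[s, (s + delta)%R[%classic).

Lemma mean_sum_cat s l1 l2 y :
  mean_sum s (l1 ++ l2) y = (mean_sum s l1 y + mean_sum s l2 y)%R.
Proof. exact: big_cat. Qed.

Section one_functional.
Variables (A : R.-ker Omega ~> R) (r T0 M : R) (l : nat -> atoms).
Hypothesis r0 : (0 <= r)%R.
Hypothesis D : discretization A r T0 M l.

Let M0 : (0 <= M)%R.
Proof. exact: le_trans (path_sum_ge0 Z point (disc_after D 0%N)) (disc_bound D 0%N point). Qed.

(** Bounded convergence: the path sums are bounded by M, hence so is, almost
surely, their limit. *)
Lemma mean_tail (s q : R) y : (r <= s)%R -> (s <= q)%R ->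
  [/\ \int[P s \d_y]_w A w `[q, +oo[%classic = (tail A s q y)%:E,
      (0 <= tail A s q y <= M)%R &
      mean_sum s [seq p <- l k | (q <= p.1)%R] y @[k --> \oo] --> tail A s q y].
Proof.
move=> rs sq; have s0 := le_trans r0 rs; have q0 := le_trans s0 sq.
pose f w := Num.min (fine (A w `[q, +oo[%classic)) M.
have mA : measurable_fun setT (fun w => A w `[q, +oo[%classic).
  exact: measurable_kernel.
have bf : bounded_nneg f.
  split.
  - have mfA : measurable_fun setT (fun w => fine (A w `[q, +oo[%classic)).
      by apply: measurableT_comp; [exact: fine_measurable|exact: mA].
    exact: measurable_minr.
  - by move=> w; rewrite /f le_min M0 fine_ge0.
  - by exists M => w; rewrite /f ge_min lexx orbT.
pose g k w := path_sum [seq p <- l k | (q <= p.1)%R] w.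
have ha k : atoms_after q [seq p <- l k | (q <= p.1)%R].
  exact: atoms_after_filter_ge (disc_after D k).
have bg k : bounded_nneg (g k) by apply: (bounded_path_sum hZ q0); exact: ha.
have gM k w : (g k w <= M)%R.
  by apply: le_trans (disc_bound D k w); exact: path_sum_filter (disc_after D k).
have ae1 : {ae P s \d_y, forall w, A w `[q, +oo[%classic = (f w)%:E /\
    g k w @[k --> \oo] --> f w}.
  apply: filterS (disc_cvg D y rs sq) => w cw.
  have AM : A w `[q, +oo[%classic <= M%:E.
    rewrite -(cvg_lim _ cw)//; apply: lime_le; first by apply/cvg_ex; eexists; exact: cw.
    by apply: nearW => k; rewrite lee_fin; exact: gM.
  have Afin : A w `[q, +oo[%classic = (fine (A w `[q, +oo[%classic))%:E.
    rewrite fineK// ge0_fin_numE ?measure_ge0//; exact: le_lt_trans AM (ltry _).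
  have fE : f w = fine (A w `[q, +oo[%classic).
    by rewrite /f min_l// -lee_fin -Afin.
  rewrite fE; split => //.
  have : (g k w)%:E @[k --> \oo] --> (fine (A w `[q, +oo[%classic))%:E by rewrite -Afin.
  by move=> /fine_cvg.
have E : \int[P s \d_y]_w A w `[q, +oo[%classic = (rint (P s \d_y) f)%:E.
  rewrite -rintE//; apply: ge0_ae_eq_integral => //.
  - by case: bf => mf _ _; exact/measurable_EFinP.
  - by move=> w _; rewrite lee_fin; case: bf.
  - by apply: filterS ae1 => w [].
have tE : tail A s q y = rint (P s \d_y) f by rewrite /tail E.
split.
- by rewrite E tE.
- rewrite tE rint_ge0 /=; last by case: bf.
  by apply: rint_bound => // w; rewrite /f ge_min lexx orbT.
- rewrite tE; under eq_fun do rewrite (mean_sumE hZ s0 q0 (ha _)).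
  by apply: (rint_cvg bg bf gM); apply: filterS ae1 => w [].
Qed.

Lemma measurable_tail (s q : R) : (r <= s)%R -> (s <= q)%R ->
  measurable_fun setT (tail A s q).
Proof.
move=> rs sq; have s0 := le_trans r0 rs.
apply: (@measurable_fun_cvg _ _ _ _ (fun k => mean_sum s [seq p <- l k | (q <= p.1)%R])).
  move=> k; have h := atoms_after_filter_ge q (disc_after D k).
  by have [] := bounded_mean_sum hZ s0 (atoms_after_le sq h).
by move=> y _; case: (mean_tail y rs sq).
Qed.

(** Tails are finite in mean, so cells are differences of tails and inherit
their convergence. *)
Lemma kernel_cellE (delta s : R) y : (r <= s)%R -> (0 <= delta)%R ->
  \int[P s \d_y]_w A w `[s, (s + delta)%R[%classic = (kernel_cell A delta s y)%:E /\
  kernel_cell A delta s y = (tail A s s y - tail A s (s + delta) y)%R.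
Proof.
move=> rs d0; have sd : (s <= s + delta)%R by rewrite lerDl.
have [E1 /andP[t1 _] _] := mean_tail y rs (lexx s).
have [E2 /andP[t2 _] _] := mean_tail y rs sd.
have mA (I : set R) : measurable I -> measurable_fun setT (fun w => A w I).
  by move=> mI; exact: measurable_kernel.
have : \int[P s \d_y]_w A w `[s, +oo[%classic =
    \int[P s \d_y]_w A w `[s, (s + delta)%R[%classic +
    \int[P s \d_y]_w A w `[(s + delta)%R, +oo[%classic.
  rewrite -integralD_ge0; [| exact: mA | by move=> w; exact: measure_ge0
    | exact: mA | by move=> w; exact: measure_ge0].
  apply: eq_integral => w _.
  have -> : `[s, +oo[%classic =
      `[s, (s + delta)%R[%classic `|` `[(s + delta)%R, +oo[%classic :> set R.
    apply/seteqP; split => x /=; rewrite !in_itv/= !andbT.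
      by move=> sx; have [xd|dx] := ltP x (s + delta)%R; [left; rewrite sx|right].
    by case=> [/andP[]//|dx]; exact: le_trans sd dx.
  apply: measureU => //; apply/seteqP; split => x //= [] /=.
  by rewrite !in_itv/= andbT => /andP[_ xs] sx; have := lt_le_trans xs sx; rewrite ltxx.
rewrite E1 E2 => E3.
have fin : \int[P s \d_y]_w A w `[s, (s + delta)%R[%classic = (kernel_cell A delta s y)%:E.
  rewrite fineK// ge0_fin_numE; last by apply: integral_ge0 => w _; exact: measure_ge0.
  apply: (@le_lt_trans _ _ (tail A s s y)%:E); last exact: ltry.
  by rewrite E3 leeDl.
split => //; move: E3; rewrite fin -EFinD => -[->]; ring.
Qed.

Lemma cvg_cell (delta s : R) y : (r <= s)%R -> (0 <= delta)%R ->
  cell delta (l k) s y @[k --> \oo] --> kernel_cell A delta s y.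
Proof.
move=> rs d0; have sd : (s <= s + delta)%R by rewrite lerDl.
have [_ ->] := kernel_cellE y rs d0.
have [_ _ c1] := mean_tail y rs (lexx s); have [_ _ c2] := mean_tail y rs sd.
have -> : (fun k => cell delta (l k) s y) = (fun k =>
    mean_sum s [seq p <- l k | (s <= p.1)%R] y -
    mean_sum s [seq p <- l k | (s + delta <= p.1)%R] y)%R.
  apply/funext => k; rewrite (filter_split sd (disc_after D k)).
  by rewrite mean_sum_cat addrK.
exact: cvgB.
Qed.

Lemma bounded_kernel_cell (delta s : R) : (r <= s)%R -> (0 <= delta)%R ->
  bounded_nneg (kernel_cell A delta s).
Proof.
move=> rs d0; have sd : (s <= s + delta)%R by rewrite lerDl.
split.
- rewrite (_ : kernel_cell A delta s = fun y => tail A s s y - tail A s (s + delta) y)%R; last first.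
    by apply/funext => y; case: (kernel_cellE y rs d0).
  by apply: measurable_funB; exact: measurable_tail.
- by move=> y; apply: fine_ge0; apply: integral_ge0 => w _; exact: measure_ge0.
- exists M => y; have [_ ->] := kernel_cellE y rs d0.
  have [_ /andP[_ t1] _] := mean_tail y rs (lexx s).
  have [_ /andP[t2 _] _] := mean_tail y rs sd.
  by rewrite lerBlDr; apply: le_trans t1 _; rewrite lerDl.
Qed.

End one_functional.
End cells.

(** * Comparison of Laplace transforms *)

Section laplace_comparison.
Context {R : realType} {d d' : measure_display}.
Context {Omega : measurableType d} {Omega' : measurableType d'}.
Context {S : ptopologicalType}.
Variables (Z : R -> Omega -> S) (F : set R -> set (set Omega)).
Variable P : R -> probability (borel S) R -> probability Omega R.
Variables (gamma beta : R).
Variables (X : R -> Omega' -> finmeas (borel S) R).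
Variable G : set R -> set (set Omega').
Variable PX : R -> probability (finmeas (borel S) R) R -> probability Omega' R.
Hypothesis hZ : @markov_process R d _ Omega (borel S) Z F P.
Hypothesis hX : superprocess Z P gamma beta X G PX.
Hypothesis hgamma : (0 < gamma)%R.
Hypothesis hbeta : (0 < beta <= 1)%R.

Local Notation FM := (finmeas (borel S) R).

Let hXm : markov_process X G PX := super_markov hX.

Local Notation atoms := (seq (R * (borel S -> R))).
Local Notation pair_sum l w := (@pair_sum R d' Omega' S X l w).
Local Notation path_sum l w := (@path_sum R d Omega S Z l w).
Local Notation mean_sum s l := (@mean_sum R d Omega S Z P s l).
Local Notation value s l := (@value R d' Omega' S X PX s l).
Local Notation discretization A r T0 M l := (@discretization R d Omega S Z P A r T0 M l).
Local Notation cell delta l s := (@cell R d Omega S Z P delta l s).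
Local Notation grid delta c n s := (@grid R S delta c n s).
Local Notation tail A s q y := (@tail R d Omega S P A s q y).
Local Notation kernel_cell A delta s := (@kernel_cell R d Omega S P A delta s).

Definition scale (e : R) (l : atoms) : atoms :=
  [seq (p.1, fun y => e * p.2 y)%R | p <- l].

Lemma scale_after (e : R) l : (0 <= e)%R -> forall s : R,
  atoms_after s l -> atoms_after s (scale e l).
Proof.
move=> e0; elim: l => [//|p l ih] s /= [sp bp pl]; split => //; last exact: ih.
exact: bounded_nnegZ.
Qed.

Lemma scale_filter (e : R) (l : atoms) (b : pred R) :
  [seq p <- scale e l | b p.1] = scale e [seq p <- l | b p.1].
Proof. by rewrite /scale filter_map. Qed.

Lemma pair_sum_scale (e : R) (l : atoms) s w : (0 <= e)%R -> atoms_after s l ->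
  pair_sum (scale e l) w = (e * pair_sum l w)%R.
Proof.
move=> e0; elim: l s => [|p l ih] s /=; first by rewrite !pair_sum_nil mulr0.
move=> [sp bp pl]; rewrite !pair_sum_cons (ih _ pl) mulrDr; congr (_ + _)%R.
by rewrite /pairing rintZ.
Qed.

Lemma path_sum_scale (e : R) (l : atoms) w :
  path_sum (scale e l) w = (e * path_sum l w)%R.
Proof.
elim: l => [|p l ih]; first by rewrite !path_sum_nil mulr0.
by rewrite !path_sum_cons ih mulrDr.
Qed.

Lemma mean_sum_scale (e : R) (l : atoms) (q s : R) y : (0 <= e)%R ->
  (0 <= q)%R -> atoms_after q l -> mean_sum s (scale e l) y = (e * mean_sum s l y)%R.
Proof.
move=> e0; elim: l q => [|p l ih] q q0 /=; first by rewrite !mean_sum_nil mulr0.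
move=> [qp bp pl]; have p0 := le_trans q0 qp.
by rewrite !mean_sum_cons (ih _ p0 pl) mulrDr (transitionZ hZ s p0 y e0 bp).
Qed.

Lemma cell_scale (e delta : R) (l : atoms) (q s : R) y : (0 <= e)%R -> (0 <= q)%R ->
  atoms_after q l -> cell delta (scale e l) s y = (e * cell delta l s y)%R.
Proof.
move=> e0 q0 hl; rewrite !cell_mean (scale_filter e l (fun u => s <= u < s + delta)%R).
by apply: (mean_sum_scale (q := q)) => //; exact: atoms_after_filter.
Qed.

Lemma cell_bound (delta q s M : R) (l : atoms) y : (0 <= s)%R -> (0 <= q)%R ->
  atoms_after q l -> (forall w, path_sum l w <= M)%R -> (cell delta l s y <= M)%R.
Proof.
move=> s0 q0 hl lM; apply: (mean_sum_bound hZ y s0 q0 (atoms_after_filter _ hl)) => w.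
exact: le_trans (path_sum_filter _ _ _ hl) (lM w).
Qed.

Lemma atoms_after_filter_id (l : atoms) : forall s : R,
  atoms_after s l -> [seq p <- l | (s <= p.1)%R] = l.
Proof.
move=> s; suff H u : (s <= u)%R -> atoms_after u l -> [seq p <- l | (s <= p.1)%R] = l.
  exact: H.
elim: l u => [//|p l ih] u su /= [up _ pl]; rewrite (le_trans su up).
by rewrite (ih p.1 (le_trans su up) pl).
Qed.

Lemma rint_exp_pair_sum (s : R) (l : atoms) z : (0 <= s)%R -> atoms_after s l ->
  rint (PX s \d_(\d_z : FM)) (fun w => expR (- pair_sum l w))%R = expR (- value s l z)%R.
Proof.
move=> s0 hl; have [bv -> _ _] := value_spec hZ hX hgamma s0 hl.
by rewrite rint_dirac//; case: bv.
Qed.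

Lemma bounded_exp_pair_sum_process (s : R) (l : atoms) : (0 <= s)%R ->
  atoms_after s l -> bounded_nneg (fun w => expR (- pair_sum l w))%R.
Proof.
move=> s0 hl; apply: (adapted_bounded hXm (time_interval_cy s0)).
exact: (bounded_exp_pair_sum hX s0 hl).
Qed.

Section grids.
Variables (s0 delta : R) (mu : probability FM R).
Hypotheses (hs0 : (0 <= s0)%R) (d0 : (0 <= delta)%R).

Lemma pair_sum_grid_cvg (c_ : nat -> R -> borel S -> R) (c : R -> borel S -> R) (C : R) n w :
  (forall k t, (s0 <= t)%R -> bounded_nneg (c_ k t)) ->
  (forall t, (s0 <= t)%R -> bounded_nneg (c t)) ->
  (forall k t y, (s0 <= t)%R -> c_ k t y <= C)%R ->
  (forall t y, (s0 <= t)%R -> c_ k t y @[k --> \oo] --> c t y) ->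
  forall s, (s0 <= s)%R ->
  pair_sum (grid delta (c_ k) n s) w @[k --> \oo] --> pair_sum (grid delta c n s) w.
Proof.
move=> bc_ bc cC cc; elim: n => [|n ih] s ss /=.
  by rewrite pair_sum_nil; exact: cvg_cst.
rewrite pair_sum_cons; under eq_fun do rewrite pair_sum_cons.
apply: cvgD; last by apply: ih; apply: le_trans ss _; rewrite lerDl.
have ae_c : {ae X s w, forall y, c_ k s y @[k --> \oo] --> c s y}.
  by apply: aeW => y; exact: cc.
exact: (@rint_cvg _ _ _ (X s w) (fun k => c_ k s) (c s) C (fun k => bc_ k s ss)
  (bc s ss) (fun k y => cC k s y ss) ae_c).
Qed.

(** On a fixed grid only finitely many terminal values are involved, and they
converge boundedly. *)
Lemma laplace_grid_cvg (c_ : nat -> R -> borel S -> R) (c : R -> borel S -> R) (C : R) n :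
  (forall k t, (s0 <= t)%R -> bounded_nneg (c_ k t)) ->
  (forall t, (s0 <= t)%R -> bounded_nneg (c t)) ->
  (forall k t y, (s0 <= t)%R -> c_ k t y <= C)%R ->
  (forall t y, (s0 <= t)%R -> c_ k t y @[k --> \oo] --> c t y) ->
  rint (PX s0 mu) (fun w => expR (- pair_sum (grid delta (c_ k) n s0) w))%R @[k --> \oo] -->
  rint (PX s0 mu) (fun w => expR (- pair_sum (grid delta c n s0) w))%R.
Proof.
move=> bc_ bc cC cc.
have ga k := grid_after n d0 (bc_ k); have gb := grid_after n d0 bc.
have e1 k w : (expR (- pair_sum (grid delta (c_ k) n s0) w) <= 1)%R.
  by rewrite -[leRHS]expR0 ler_expR oppr_le0; exact: pair_sum_ge0 (ga k).
have ae_c : {ae PX s0 mu, forall w,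
    expR (- pair_sum (grid delta (c_ k) n s0) w)%R @[k --> \oo] -->
    expR (- pair_sum (grid delta c n s0) w)%R}.
  apply: aeW => w; have H := @pair_sum_grid_cvg c_ c C n w bc_ bc cC cc s0 (lexx s0).
  have H' : (- pair_sum (grid delta (c_ k) n s0) w)%R @[k --> \oo] -->
      (- pair_sum (grid delta c n s0) w)%R by exact: cvgN.
  exact: (cvg_comp _ _ H' (@continuous_expR R _)).
exact: (rint_cvg (fun k => bounded_exp_pair_sum_process hs0 (ga k))
  (bounded_exp_pair_sum_process hs0 gb) e1 ae_c).
Qed.

Lemma laplace_grid_le (c c' : R -> borel S -> R) n :
  (forall t, (s0 <= t)%R -> bounded_nneg (c t)) ->
  (forall t, (s0 <= t)%R -> bounded_nneg (c' t)) ->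
  (forall t y, (s0 <= t)%R -> c t y <= c' t y)%R ->
  (rint (PX s0 mu) (fun w => expR (- pair_sum (grid delta c' n s0) w)) <=
   rint (PX s0 mu) (fun w => expR (- pair_sum (grid delta c n s0) w)))%R.
Proof.
move=> bc bc' cc'.
have ga := grid_after n d0 bc; have gb := grid_after n d0 bc'.
apply: rint_le; [exact: bounded_exp_pair_sum_process hs0 gb
  |exact: bounded_exp_pair_sum_process hs0 ga|move=> w].
rewrite ler_expR lerN2; suff H s : (s0 <= s)%R ->
    (pair_sum (grid delta c n s) w <= pair_sum (grid delta c' n s) w)%R by exact: H.
elim: n s {ga gb} => [|n ih] s ss /=; first by rewrite !pair_sum_nil.
rewrite !pair_sum_cons; apply: lerD.
  exact: (rint_le (X s w) (bc s ss) (bc' s ss) (fun y => cc' s y ss)).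
by apply: ih; apply: le_trans ss _; rewrite lerDl.
Qed.

End grids.

Let lower_arith (th K de e m : R) : (th * (((1 - K * de) * e) * m) =
  th * e * m * (1 - K * de))%R.
Proof. by ring. Qed.

(** The atoms of l' are moved to a grid of step delta. As k tends to infinity,
the conditional means of the cells converge to those of A', which dominate
those of A; the comparison is then run backwards for l. For the atoms of l
themselves value_sandwich over the whole interval gives the explicit bound.
Finally delta tends to 0. *)
Lemma laplace_lower (A A' : R.-ker Omega ~> R) (r T0 T0' M M' e L : R) z l l' :
  (0 <= r)%R -> discretization A r T0 M l -> discretization A' r T0' M' l' ->
  (forall w (s t : R), (r <= s)%R -> (s <= t)%R ->
    A w `[s, t[%classic <= A' w `[s, t[%classic) ->
  (0 <= e)%R ->
  (gamma * (1 + beta) * (e * M + e * M) `^ beta * (Num.max r T0 - r) <= 1)%R ->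
  rint (PX r \d_(\d_z : FM)) (fun w => expR (- (e * pair_sum (l' k) w)))%R
    @[k --> \oo] --> L ->
  (L <= expR (- ((1 - gamma * (1 + beta) * (e * M + e * M) `^ beta * (Num.max r T0 - r)) *
                e * tail A r r z)))%R.
Proof.
move=> r0 D D' AA' e0 kap1 cL.
have hd k : atoms_after r (l k) := disc_after D k.
have hd' k : atoms_after r (l' k) := disc_after D' k.
pose m := Num.max M M'.
have Mm : (M <= m)%R by rewrite le_max lexx.
have Mm' : (M' <= m)%R by rewrite le_max lexx orbT.
pose K := (gamma * (1 + beta) * (e * m + e * m) `^ beta)%R.
have b0 : (0 <= 1 + beta)%R by case/andP: hbeta => ? _; lra.
have K0 : (0 <= K)%R by rewrite /K mulr_ge0 ?powR_ge0// mulr_ge0// ltW.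
set kap := (gamma * (1 + beta) * (e * M + e * M) `^ beta)%R in kap1 *.
have kap0 : (0 <= kap)%R by rewrite /kap mulr_ge0 ?powR_ge0// mulr_ge0// ltW.
set T1 := Num.max r T0 in kap1 *.
have rT1 : (r <= T1)%R by rewrite /T1 le_max lexx.
have T1_ge0 := le_trans r0 rT1.
pose th := (1 - kap * (T1 - r))%R.
have th0 : (0 <= th)%R by rewrite subr_ge0.
have step (delta : R) : (0 < delta)%R -> (K * delta <= 1)%R ->
    (L <= expR (- (th * e * tail A r r z * (1 - K * delta))))%R.
  move=> d0 Kd; have d0' := ltW d0.
  have u0 : (0 <= 1 - K * delta)%R by rewrite subr_ge0.
  have u1 : (1 - K * delta <= 1)%R by rewrite gerBl mulr_ge0.
  pose e1 := ((1 - K * delta) * e)%R.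
  have e10 : (0 <= e1)%R by rewrite mulr_ge0.
  have e1e : (e1 <= e)%R by rewrite ler_piMl.
  pose c_ k s y := ((1 - K * delta) * cell delta (scale e (l' k)) s y)%R.
  pose b_ k s y := cell delta (scale e1 (l k)) s y.
  pose c s y := (e1 * kernel_cell A' delta s y)%R.
  pose b s y := (e1 * kernel_cell A delta s y)%R.
  have bc t : (r <= t)%R -> bounded_nneg (c t).
    by move=> rt; apply: bounded_nnegZ => //; exact: (bounded_kernel_cell hZ r0 D' rt d0').
  have bb t : (r <= t)%R -> bounded_nneg (b t).
    by move=> rt; apply: bounded_nnegZ => //; exact: (bounded_kernel_cell hZ r0 D rt d0').
  have sc k : atoms_after r (scale e (l' k)) by exact: scale_after.
  have sb k : atoms_after r (scale e1 (l k)) by exact: scale_after.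
  have bc_ k t : (r <= t)%R -> bounded_nneg (c_ k t).
    by move=> rt; apply: bounded_nnegZ => //; apply: (bounded_cell hZ) (sc k); exact: le_trans rt.
  have bb_ k t : (r <= t)%R -> bounded_nneg (b_ k t).
    by move=> rt; apply: (bounded_cell hZ) (sb k); exact: le_trans rt.
  have cE k t y : c_ k t y = (e1 * cell delta (l' k) t y)%R.
    by rewrite /c_ (cell_scale delta t y e0 r0 (hd' k)) mulrA.
  have bE k t y : b_ k t y = (e1 * cell delta (l k) t y)%R.
    exact: (cell_scale delta t y e10 r0 (hd k)).
  have lM k w : (path_sum (l k) w <= m)%R := le_trans (disc_bound D k w) Mm.
  have lM' k w : (path_sum (l' k) w <= m)%R := le_trans (disc_bound D' k w) Mm'.
  have m0 : (0 <= m)%R := le_trans (path_sum_ge0 Z point (hd 0%N)) (lM 0%N point).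
  have pM' k w : (path_sum (scale e (l' k)) w <= e * m)%R.
    by rewrite path_sum_scale; apply: ler_wpM2l => //; exact: lM'.
  have pM k w : (path_sum (scale e1 (l k)) w <= e * m)%R.
    rewrite path_sum_scale; apply: (@le_trans _ _ (e1 * m)%R).
      by apply: ler_wpM2l => //; exact: lM.
    by apply: ler_wpM2r.
  have [n hn] : exists n : nat, (Num.max T1 T0' <= r + n%:R * delta)%R.
    exists (Num.bound `|(Num.max T1 T0' - r) / delta|%R).
    rewrite -lerBlDl -ler_pdivrMr//; apply: (le_trans (ler_norm _)).
    exact/ltW/(archi_boundP (normr_ge0 _)).
  have before k : all (fun p => p.1 < r + n%:R * delta)%R (scale e1 (l k)).
    rewrite /scale all_map; apply: sub_all (disc_before D k) => p /= pT.
    by apply: lt_le_trans pT _; apply: le_trans hn; rewrite !le_max lexx !orbT.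
  have before' k : all (fun p => p.1 < r + n%:R * delta)%R (scale e (l' k)).
    rewrite /scale all_map; apply: sub_all (disc_before D' k) => p /= pT.
    by apply: lt_le_trans pT _; apply: le_trans hn; rewrite !le_max lexx !orbT.
  have gc_ k : atoms_after r (grid delta (c_ k) n r) by apply: grid_after => //; exact: bc_.
  have gb_ k : atoms_after r (grid delta (b_ k) n r) by apply: grid_after => //; exact: bb_.
  have up k : (rint (PX r \d_(\d_z : FM)) (fun w => expR (- (e * pair_sum (l' k) w))) <=
      rint (PX r \d_(\d_z : FM)) (fun w => expR (- pair_sum (grid delta (c_ k) n r) w)))%R.
    have := grid_comparison hZ hX hgamma hbeta erefl r0 d0' Kd (sc k) (pM' k) z
      (lexx r) (before' k).
    rewrite (atoms_after_filter_id (sc k)) => /andP[lo _].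
    under eq_fun do rewrite -(pair_sum_scale _ e0 (hd' k)).
    by rewrite (rint_exp_pair_sum z r0 (sc k)) (rint_exp_pair_sum z r0 (gc_ k)) ler_expR lerN2.
  have low k : (rint (PX r \d_(\d_z : FM)) (fun w => expR (- pair_sum (grid delta (b_ k) n r) w)) <=
      expR (- (th * (e1 * mean_sum r (l k) z))))%R.
    have := grid_comparison hZ hX hgamma hbeta erefl r0 d0' Kd (sb k) (pM k) z
      (lexx r) (before k).
    rewrite (atoms_after_filter_id (sb k)) => /andP[_ hi].
    rewrite (rint_exp_pair_sum z r0 (gb_ k)) ler_expR lerN2; apply: le_trans hi.
    have v0 q : (value T1 [::] q <= e * M)%R.
      have [_ _ -> _] := value_spec hZ hX hgamma (l := [::]) T1_ge0 I.
      rewrite mulr_ge0//.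
      exact: le_trans (path_sum_ge0 Z point (hd 0%N)) (disc_bound D 0%N point).
    have pM1 w : (path_sum (scale e1 (l k)) w <= e * M)%R.
      have M0 := le_trans (path_sum_ge0 Z point (hd 0%N)) (disc_bound D 0%N point).
      rewrite path_sum_scale; apply: (@le_trans _ _ (e1 * M)%R).
        by apply: ler_wpM2l => //; exact: (disc_bound D).
      by apply: ler_wpM2r.
    have le1 : all (fun p => p.1 <= T1)%R (scale e1 (l k)).
      rewrite /scale all_map; apply: sub_all (disc_before D k) => p /= pT.
      by apply/ltW/(lt_le_trans pT); rewrite /T1 le_max lexx orbT.
    have := value_sandwich hZ hX hgamma hbeta (l2 := [::]) erefl I v0 z r0 rT1 kap1 (sb k) le1 pM1.
    rewrite cats0 => /andP[+ _]; apply: le_trans.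
    rewrite (mean_sum_scale r z e10 r0 (hd k)) lerDl.
    by rewrite -(value_flow hZ hX hgamma (l := [::]) r0 rT1 I);
      have [[_ ? _] _ _ _] := value_spec hZ hX hgamma (l := [::]) r0 I.
  have Mp k t y : (r <= t)%R -> (c_ k t y <= e1 * m)%R.
    move=> rt; rewrite cE; apply: ler_wpM2l => //.
    exact: cell_bound (le_trans r0 rt) r0 (hd' k) (lM' k).
  have Mp' k t y : (r <= t)%R -> (b_ k t y <= e1 * m)%R.
    move=> rt; rewrite bE; apply: ler_wpM2l => //.
    exact: cell_bound (le_trans r0 rt) r0 (hd k) (lM k).
  have lim1 : rint (PX r \d_(\d_z : FM)) (fun w => expR (- pair_sum (grid delta (c_ k) n r) w))%R
      @[k --> \oo] --> rint (PX r \d_(\d_z : FM)) (fun w => expR (- pair_sum (grid delta c n r) w))%R.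
    apply: (@laplace_grid_cvg r delta (dirac (\d_z : FM)) r0 d0' c_ c _ n bc_ bc Mp) => t y rt.
    under eq_fun do rewrite cE.
    by apply: cvgMr; exact: (cvg_cell hZ r0 D' rt d0').
  have lim2 : rint (PX r \d_(\d_z : FM)) (fun w => expR (- pair_sum (grid delta (b_ k) n r) w))%R
      @[k --> \oo] --> rint (PX r \d_(\d_z : FM)) (fun w => expR (- pair_sum (grid delta b n r) w))%R.
    apply: (@laplace_grid_cvg r delta (dirac (\d_z : FM)) r0 d0' b_ b _ n bb_ bb Mp') => t y rt.
    under eq_fun do rewrite bE.
    by apply: cvgMr; exact: (cvg_cell hZ r0 D rt d0').
  have lim3 : expR (- (th * (e1 * mean_sum r (l k) z)))%R @[k --> \oo] -->
      expR (- (th * (e1 * tail A r r z)))%R.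
    have [_ _ cm] := mean_tail hZ r0 D z (lexx r) (lexx r).
    have cm' : (- (th * (e1 * mean_sum r (l k) z)))%R @[k --> \oo] -->
        (- (th * (e1 * tail A r r z)))%R.
      apply: cvgN; apply: cvgMr; apply: cvgMr.
      by under eq_fun do rewrite -{1}(atoms_after_filter_id (hd _)).
    exact: (cvg_comp _ _ cm' (@continuous_expR R _)).
  have h1 : (L <= rint (PX r \d_(\d_z : FM)) (fun w => expR (- pair_sum (grid delta c n r) w)))%R.
    by apply: (ler_cvg_to cL lim1); apply: nearW; exact: up.
  have h2 : (rint (PX r \d_(\d_z : FM)) (fun w => expR (- pair_sum (grid delta b n r) w)) <=
      expR (- (th * (e1 * tail A r r z))))%R.
    by apply: (ler_cvg_to lim2 lim3); apply: nearW; exact: low.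
  have cells_le t y : (r <= t)%R -> (b t y <= c t y)%R.
    move=> rt; apply: ler_wpM2l => //.
    have [E1 _] := kernel_cellE hZ r0 D y rt d0'.
    have [E2 _] := kernel_cellE hZ r0 D' y rt d0'.
    rewrite -lee_fin -E1 -E2; apply: integral_le_ge0.
    - exact: measurable_kernel.
    - by move=> w; exact: measure_ge0.
    - exact: measurable_kernel.
    - by move=> w; apply: AA' => //; rewrite lerDl.
  have h3 := @laplace_grid_le r delta (dirac (\d_z : FM)) r0 d0' b c n bb bc cells_le.
  apply: (le_trans h1); apply: (le_trans h3); apply: (le_trans h2).
  by rewrite lower_arith.
have cst : (- (th * e * tail A r r z * (1 - harmonic n)))%R @[n --> \oo] -->
    (- (th * e * tail A r r z * (1 - 0)))%R.
  apply: cvgN; apply: cvgMr; apply: cvgB; first exact: cvg_cst.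
  exact: cvg_harmonic.
have cst' : expR (- (th * e * tail A r r z * (1 - harmonic n)))%R @[n --> \oo] -->
    expR (- (th * e * tail A r r z * (1 - 0)))%R.
  exact: (cvg_comp _ _ cst (@continuous_expR R _)).
rewrite -(_ : th * e * tail A r r z * (1 - 0) = th * e * tail A r r z)%R; last first.
  by rewrite subr0 mulr1.
have K1 : (0 < K + 1)%R by lra.
apply: (ler_cvg_to (cvg_cst L) cst'); apply: nearW => n.
have hn := @harmonic_gt0 R n.
have dn : (0 < harmonic n / (K + 1) :> R)%R by rewrite divr_gt0.
have Kn : (K * (harmonic n / (K + 1)) <= harmonic n)%R.
  by rewrite mulrA ler_pdivrMr// [leRHS]mulrC ler_wpM2r//; [exact: ltW|lra].
have h1 : (harmonic n <= 1 :> R)%R by rewrite /harmonic/= invf_le1// ler1n.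
apply: (le_trans (step _ dn (le_trans Kn h1))).
rewrite ler_expR lerN2; apply: ler_wpM2l; last by rewrite lerB.
have [_ /andP[t0 _] _] := mean_tail hZ r0 D z (lexx r) (lexx r).
by rewrite !mulr_ge0.
Qed.

End laplace_comparison.

(** * Stieltjes integrals *)

Section stieltjes_sums.
Context {R : realType}.
Local Open Scope ring_scope.
Implicit Types (phi F : R -> R) (r I : R).

(** I is the Stieltjes integral of phi against - dF on [r, +oo[, expressed by
the error bound for Riemann sums; this form passes to pointwise limits in F. *)
Definition stieltjes r phi F I : Prop :=
  forall (eta delta : R) (n : nat), 0 <= eta -> 0 < delta ->
    (forall s t : R, r <= s -> s <= t -> t <= r + n%:R * delta -> t - s <= delta ->
      `|phi t - phi s| <= eta) ->
    `|I - \sum_(j < n) phi (r + j%:R * delta) *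
        (F (r + j%:R * delta) - F (r + j.+1%:R * delta))| <=
    eta * F r + F (r + n%:R * delta).

(** The local error bounds add up over the cells, and what lies beyond the
last node is bounded by the tail F. *)
Lemma stieltjes_of_cells r phi F (I : R -> R) :
  (forall s, r <= s -> `|I s| <= F s) ->
  (forall s t eta, r <= s -> s <= t ->
    (forall u, s <= u <= t -> `|phi u - phi s| <= eta) ->
    `|I s - I t - phi s * (F s - F t)| <= eta * (F s - F t)) ->
  stieltjes r phi F (I r).
Proof.
move=> IF cell eta delta n eta0 d0 mod_.
pose s_ j : R := r + j%:R * delta.
have s_ge j : r <= s_ j by rewrite lerDl mulr_ge0// ltW.
have claim m : (m <= n)%N -> `|I r - \sum_(j < m) phi (s_ j) * (F (s_ j) - F (s_ j.+1))
    - I (s_ m)| <= eta * (F r - F (s_ m)).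
  elim: m => [_|m ih mn].
    by rewrite big_ord0 subr0 /s_ mul0r addr0 !subrr normr0 mulr0.
  have {ih} := ih (ltnW mn).
  have ss : s_ m <= s_ m.+1 by rewrite lerD2l ler_wpM2r ?(ltW d0)// ler_nat.
  have := cell (s_ m) (s_ m.+1) eta (s_ge m) ss.
  rewrite big_ord_recr/= => /(_ _) H1 H2.
  have {H1}H1 := H1 ltac:(move=> u /andP[su ut]; apply: mod_ => //;
    [by apply: le_trans ut _; rewrite lerD2l ler_wpM2r ?(ltW d0)// ler_nat
    |by rewrite lerBlDl; apply: le_trans ut _; rewrite /s_ -natr1 mulrDl mul1r addrA]).
  have := ler_normD (I r - \sum_(j < m) phi (s_ j) * (F (s_ j) - F (s_ j.+1)) - I (s_ m))
    (I (s_ m) - I (s_ m.+1) - phi (s_ m) * (F (s_ m) - F (s_ m.+1))).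
  set a := (X in `|X| <= _ -> _); set b := (X in _ -> `|X| <= _).
  have -> : a = b by rewrite /a /b; ring.
  move=> H3; apply: (le_trans H3).
  have -> : eta * (F r - F (s_ m.+1)) =
    eta * (F r - F (s_ m)) + eta * (F (s_ m) - F (s_ m.+1)) by ring.
  exact: lerD.
have := claim n (leqnn n); have := IF _ (s_ge n).
have Fn : 0 <= F (s_ n) := le_trans (normr_ge0 _) (IF _ (s_ge n)).
move=> H1 H2.
have := ler_normD (I r - \sum_(j < n) phi (s_ j) * (F (s_ j) - F (s_ j.+1)) - I (s_ n)) (I (s_ n)).
rewrite subrK => H3; apply: (le_trans H3).
have H4 : 0 <= eta * F (s_ n) by rewrite mulr_ge0.
by rewrite /s_ in H1 H2 H4 *; move: H1 H2 H4; lra.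
Qed.

Lemma stieltjes_cvg r phi (F_ : nat -> R -> R) F (I_ : nat -> R) I :
  (forall k, stieltjes r phi (F_ k) (I_ k)) ->
  (forall s, r <= s -> F_ k s @[k --> \oo] --> F s) -> I_ k @[k --> \oo] --> I ->
  stieltjes r phi F I.
Proof.
move=> st cF cI eta delta n eta0 d0 mod_.
have s_ge j : r <= r + j%:R * delta by rewrite lerDl mulr_ge0// ltW.
have sums m : \sum_(j < m) phi (r + j%:R * delta) *
      (F_ k (r + j%:R * delta) - F_ k (r + j.+1%:R * delta)) @[k --> \oo] -->
    \sum_(j < m) phi (r + j%:R * delta) *
      (F (r + j%:R * delta) - F (r + j.+1%:R * delta)).
  elim: m => [|m ih].
    by under eq_fun do rewrite big_ord0; rewrite big_ord0; exact: cvg_cst.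
  under eq_fun do rewrite big_ord_recr/=; rewrite big_ord_recr/=.
  apply: cvgD; first exact: ih.
  by apply: cvgMr; apply: cvgB; exact: cF.
have lhs : `|I_ k - \sum_(j < n) phi (r + j%:R * delta) *
      (F_ k (r + j%:R * delta) - F_ k (r + j.+1%:R * delta))| @[k --> \oo] -->
    `|I - \sum_(j < n) phi (r + j%:R * delta) *
      (F (r + j%:R * delta) - F (r + j.+1%:R * delta))|.
  by apply: cvg_norm; apply: cvgB => //; exact: sums.
have rhs : eta * F_ k r + F_ k (r + n%:R * delta) @[k --> \oo] -->
    eta * F r + F (r + n%:R * delta).
  by apply: cvgD; [apply: cvgMr|]; exact: cF.
apply: (ler_cvg_to lhs rhs); apply: nearW => k.
exact: st.
Qed.

(** Two integrals with the same error bounds differ by at most twice the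
bound, which is arbitrarily small once phi is uniformly continuous and F
vanishes beyond T. *)
Lemma stieltjes_unique r T phi F I I' : r <= T ->
  (forall B eta, 0 < eta -> exists2 delta, 0 < delta & forall s t, r <= s -> s <= t ->
    t <= B -> t - s <= delta -> `|phi t - phi s| <= eta) ->
  0 <= F r -> (forall s, T < s -> F s = 0) ->
  stieltjes r phi F I -> stieltjes r phi F I' -> I = I'.
Proof.
move=> rT mod_ F0 FT st st'; apply/eqP; rewrite -subr_eq0 -normr_le0.
apply/ler_addgt0Pr => e e0; rewrite add0r.
have F1 : 0 < F r + 1 by lra.
have eta0 : 0 < e / 2 / (F r + 1) by rewrite !divr_gt0.
have [delta0 d00 hd] := mod_ (T + 1) _ eta0.
pose delta := Num.min delta0 1.
have d0 : 0 < delta by rewrite lt_min d00 ltr01.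
have d1 : delta <= 1 by rewrite ge_min lexx orbT.
have dd : delta <= delta0 by rewrite ge_min lexx.
have q0 : 0 <= (T - r) / delta by rewrite divr_ge0 ?subr_ge0// ltW.
pose n := (Num.truncn ((T - r) / delta)).+1.
have nT : T < r + n%:R * delta.
  by rewrite -ltrBlDl -ltr_pdivrMr// /n truncnS_gt.
have nT1 : r + n%:R * delta <= T + 1.
  have : (Num.truncn ((T - r) / delta))%:R <= (T - r) / delta by rewrite truncn_le.
  rewrite ler_pdivlMr// => H; have -> : n%:R = (Num.truncn ((T - r) / delta))%:R + 1 :> R by rewrite natr1.
  by rewrite mulrDl mul1r; lra.
have mod1 s t : r <= s -> s <= t -> t <= r + n%:R * delta -> t - s <= delta ->
    `|phi t - phi s| <= e / 2 / (F r + 1).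
  by move=> rs st0 tn ts; apply: hd => //; [exact: le_trans nT1|exact: le_trans dd].
have := st _ _ n (ltW eta0) d0 mod1; have := st' _ _ n (ltW eta0) d0 mod1.
rewrite (FT _ nT) addr0; set G := \sum_(j < n) _ => H1 H2.
have -> : I - I' = (I - G) - (I' - G) by ring.
apply: (le_trans (ler_normB _ _)).
have : e / 2 / (F r + 1) * F r <= e / 2.
  by rewrite mulrAC ler_pdivrMr// ler_wpM2l//; lra.
lra.
Qed.

End stieltjes_sums.

(** * Weighted means of discrete functionals *)

Section weighted_means.
Context {R : realType} {d d' : measure_display}.
Context {Omega : measurableType d} {Omega' : measurableType d'}.
Context {S : ptopologicalType}.
Variables (Z : R -> Omega -> S) (F : set R -> set (set Omega)).
Variable P : R -> probability (borel S) R -> probability Omega R.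
Variables (gamma beta : R).
Variables (X : R -> Omega' -> finmeas (borel S) R).
Variable G : set R -> set (set Omega').
Variable PX : R -> probability (finmeas (borel S) R) R -> probability Omega' R.
Hypothesis hZ : @markov_process R d _ Omega (borel S) Z F P.
Hypothesis hX : superprocess Z P gamma beta X G PX.
Hypothesis hgamma : (0 < gamma)%R.
Hypothesis hbeta : (0 < beta <= 1)%R.

Local Notation FM := (finmeas (borel S) R).
Local Notation tr s t f := (@transition R d _ Omega (borel S) Z P s t f).
Local Notation pr t f w := (@pairing R d' Omega' S X t f w).
Local Notation tr_cst := (@transition_cst R d _ Omega (borel S) Z P).

Let hXm : markov_process X G PX := super_markov hX.

Local Notation atoms := (seq (R * (borel S -> R))).
Local Notation pair_sum l w := (@pair_sum R d' Omega' S X l w).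
Local Notation mean_sum s l := (@mean_sum R d Omega S Z P s l).
Local Notation mass_sum l w := (@mass_sum R d' Omega' S X l w).

Variables (r : R) (z : borel S) (nl : seq (R * R)).
Hypotheses (r0 : (0 <= r)%R) (hnl : sorted_after r nl).

Local Notation Q := (PX r \d_(\d_z : FM)).

(** The function phi_N of the weighted means, N being the mass sum of nl. *)
Definition mass_weight (t : R) : R :=
  fine (\int[Q]_w (mass (X t w) * expR (- mass_sum nl w))%:E).

Lemma mean_sum_sum s l y : mean_sum s l y = (\sum_(p <- l) tr s p.1 p.2 y)%R.
Proof. by []. Qed.

Lemma exp_mass_sum_bounds w : (0 <= expR (- mass_sum nl w) <= 1)%R.
Proof.
by rewrite expR_ge0 -[leRHS]expR0 ler_expR oppr_le0; exact: mass_sum_ge0 hnl.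
Qed.

Lemma measurable_exp_mass_sum : measurable_fun setT (fun w => expR (- mass_sum nl w))%R.
Proof.
by have [] := adapted_bounded hXm (time_interval_cy r0) (bounded_exp_mass_sum hX r0 hnl).
Qed.

(** The factor in mean_pairing_exp_sum is identified by taking f = 1. *)
Lemma weighted_mean (t : R) f : (r <= t)%R -> bounded_nneg f ->
  \int[Q]_w (pr t f w * expR (- mass_sum nl w))%:E = (mass_weight t * tr r t f z)%:E.
Proof.
move=> rt bf; have rt' : (0 <= r <= t)%R by rewrite r0.
have [a [k [_ _ _ H]]] := mean_pairing_exp_sum hZ hX hgamma hbeta rt' hnl.
have b1 : bounded_nneg (fun _ : borel S => 1%R : R) by exact: bounded_nneg_cst.
have E1 := H (\d_z : FM) _ b1; rewrite (H (\d_z : FM) f bf).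
have tr1 : tr r t (fun=> 1%R) = fun=> 1%R.
  by apply/funext => y; rewrite tr_cst.
rewrite tr1 rint_cst mass_dirac !mulr1 in E1.
have -> : mass_weight t = (k * expR (- a))%R.
  rewrite /mass_weight -[RHS]/(fine (k * expR (- a))%:E) -E1; congr fine.
  by apply: eq_integral => w _; rewrite /pairing rint_cst mul1r.
rewrite mass_dirac mulr1 rint_dirac//.
by have [] := bounded_nneg_transition hZ rt' bf.
Qed.

Lemma mass_weightE (t : R) : (r <= t)%R ->
  \int[Q]_w (mass (X t w) * expR (- mass_sum nl w))%:E = (mass_weight t)%:E.
Proof.
move=> rt; have b1 : bounded_nneg (fun _ : borel S => 1%R : R) by exact: bounded_nneg_cst.
have := weighted_mean rt b1; rewrite tr_cst mulr1 => <-.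
by apply: eq_integral => w _; rewrite /pairing rint_cst mul1r.
Qed.

Let mean1 (t : R) : (r <= t)%R -> \int[Q]_w (mass (X t w))%:E = 1.
Proof.
move=> rt; have rt' : (0 <= r <= t)%R by rewrite r0.
by rewrite (mean_mass hZ hX hgamma hbeta (\d_z : FM) rt') mass_dirac.
Qed.

Let mmass (t : R) : (r <= t)%R -> measurable_fun setT (fun w => (mass (X t w))%:E).
Proof.
by move=> rt; apply/measurable_EFinP; exact: (measurable_mass_process hX (le_trans r0 rt)).
Qed.

Let mwm (t : R) : (r <= t)%R ->
  measurable_fun setT (fun w => (mass (X t w) * expR (- mass_sum nl w))%:E).
Proof.
move=> rt; apply/measurable_EFinP; apply: measurable_funM; last exact: measurable_exp_mass_sum.
exact: (measurable_mass_process hX (le_trans r0 rt)).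
Qed.

Let wm_ge0 (t : R) w : 0 <= (mass (X t w) * expR (- mass_sum nl w))%:E.
Proof. by rewrite lee_fin mulr_ge0 ?mass_ge0 ?expR_ge0. Qed.

Lemma mass_weight_bounds (t : R) : (r <= t)%R -> (0 <= mass_weight t <= 1)%R.
Proof.
move=> rt; rewrite -!lee_fin -(mass_weightE rt); apply/andP; split.
  by apply: integral_ge0 => w _; exact: wm_ge0.
rewrite -(mean1 rt); apply: integral_le_ge0; [exact: mwm|exact: wm_ge0|exact: mmass|].
move=> w; rewrite lee_fin ler_piMr ?mass_ge0//.
by case/andP: (exp_mass_sum_bounds w).
Qed.

(** The weight exp (- N) is at most 1, so the modulus of continuity in mean of
the total mass is inherited. *)
Lemma mass_weight_modulus (B eta : R) : (0 < eta)%R ->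
  exists2 delta : R, (0 < delta)%R & forall s t : R, (r <= s)%R -> (s <= t)%R ->
    (t <= B)%R -> (t - s <= delta)%R -> (`|mass_weight t - mass_weight s| <= eta)%R.
Proof.
move=> eta0; have m1 := mass_dirac R z.
have [delta d0 hd] := @mass_L1_continuous _ _ _ _ _ _ _ _ _ _ _ _ _ _ hZ hX hgamma hbeta
  r B eta (\d_z : FM) r0 m1 eta0.
exists delta => // s t rs st tB ts; have rt := le_trans rs st.
have D := hd s t rs st tB ts.
pose dm w := (`|mass (X t w) - mass (X s w)|)%R.
have mdm : measurable_fun setT (fun w => (dm w)%:E).
  apply/measurable_EFinP; apply: measurableT_comp => //.
  by apply: measurable_funB; apply: (measurable_mass_process hX); exact: le_trans r0 _.
have dm0 w : 0 <= (dm w)%:E by rewrite lee_fin /dm normr_ge0.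
have half (u v : R) : (r <= u)%R -> (r <= v)%R ->
    (forall w, mass (X u w) <= mass (X v w) + dm w)%R ->
    (mass_weight u <= mass_weight v + eta)%R.
  move=> ru rv uv; rewrite -lee_fin EFinD -(mass_weightE ru) -(mass_weightE rv).
  apply: (@le_trans _ _ (\int[Q]_w ((mass (X v w) * expR (- mass_sum nl w))%:E + (dm w)%:E))).
    apply: integral_le_ge0; [exact: mwm|exact: wm_ge0| |move=> w].
      by apply: emeasurable_funD => //; exact: mwm.
    rewrite -EFinD lee_fin; have /andP[e0 e1] := exp_mass_sum_bounds w.
    apply: (@le_trans _ _ ((mass (X v w) + dm w) * expR (- mass_sum nl w))%R).
      by apply: ler_wpM2r.
    by rewrite mulrDl lerD2l ler_piMr// /dm normr_ge0.
  rewrite (integralD_ge0 Q (mwm rv) (wm_ge0 v) mdm dm0).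
  by apply: leeD.
have h1 := half t s rt rs; have h2 := half s t rs rt.
have {h1}h1 : (mass_weight t <= mass_weight s + eta)%R.
  by apply: h1 => w; rewrite -lerBlDl; exact: ler_norm.
have {h2}h2 : (mass_weight s <= mass_weight t + eta)%R.
  by apply: h2 => w; rewrite -lerBlDl /dm distrC; exact: ler_norm.
by rewrite ler_norml; apply/andP; split; lra.
Qed.

Lemma weighted_pair_sum (l : atoms) : forall s : R, (r <= s)%R -> atoms_after s l ->
  \int[Q]_w (pair_sum l w * expR (- mass_sum nl w))%:E =
  (\sum_(p <- l) mass_weight p.1 * tr r p.1 p.2 z)%:E%R.
Proof.
elim: l => [|p l ih] s rs.
  by move=> _; rewrite big_nil pair_sum_nil; under eq_integral do rewrite mul0r; rewrite integral0.
move=> /= [sp bp pl]; have rp := le_trans rs sp; have p0 := le_trans r0 rp.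
have me := measurable_exp_mass_sum.
have mp : measurable_fun setT (fun w => pr p.1 p.2 w).
  by case: bp => mf f0 _; exact: (measurable_pairing_process hX).
have ml : measurable_fun setT (fun w => pair_sum l w).
  exact: (adapted_measurable hXm (time_interval_cy p0) (adapted_pair_sum hX p0 (lexx _) pl)).
rewrite big_cons EFinD -(ih p.1)// -(weighted_mean rp bp) -integralD_ge0.
- by apply: eq_integral => w _; rewrite pair_sum_cons mulrDl EFinD.
- by apply/measurable_EFinP; exact: measurable_funM.
- by move=> w; rewrite lee_fin mulr_ge0 ?expR_ge0// pairing_ge0//; case: bp.
- by apply/measurable_EFinP; exact: measurable_funM.
- by move=> w; rewrite lee_fin mulr_ge0 ?expR_ge0//; exact: pair_sum_ge0 pl.
Qed.

Lemma atoms_bound (a : R -> R) (c : R) (q : pred R) (l : atoms) : forall s : R,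
  (r <= s)%R -> atoms_after s l -> all (fun p => q p.1) l ->
  (forall t, r <= t -> q t -> `|a t| <= c)%R ->
  (`|\sum_(p <- l) a p.1 * tr r p.1 p.2 z| <= c * mean_sum r l z)%R.
Proof.
elim: l => [|p l ih] s rs; first by rewrite big_nil mean_sum_nil mulr0 normr0.
move=> /= [sp [_ f0 _] pl] /andP[qp ql] ac; have rp := le_trans rs sp.
rewrite big_cons mean_sum_cons mulrDr; apply: (le_trans (ler_normD _ _)); apply: lerD.
  have t0 : (0 <= tr r p.1 p.2 z)%R by exact: transition_ge0.
  by rewrite normrM (ger0_norm t0); apply: ler_wpM2r => //; exact: ac.
exact: ih rp pl ql ac.
Qed.

(** The weighted mean of each atom is phi at its time multiplied by its mean,
and the tail of the means plays the role of the integrator. *)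
Lemma stieltjes_atoms (l : atoms) : atoms_after r l ->
  stieltjes r mass_weight (fun s => mean_sum r [seq p <- l | (s <= p.1)%R] z)
    (\sum_(p <- l) mass_weight p.1 * tr r p.1 p.2 z)%R.
Proof.
move=> hl.
pose I s := (\sum_(p <- [seq p <- l | (s <= p.1)%R]) mass_weight p.1 * tr r p.1 p.2 z)%R.
have -> : (\sum_(p <- l) mass_weight p.1 * tr r p.1 p.2 z)%R = I r.
  by rewrite /I (atoms_after_filter_id hl).
apply: stieltjes_of_cells => [s rs|s t eta rs st close].
  rewrite -[leRHS]mul1r; apply: (@atoms_bound _ _ predT _ s rs) => //.
  - exact: atoms_after_filter_ge hl.
  - by apply/allP.
  - by move=> t rt _; have /andP[w0 w1] := mass_weight_bounds rt; rewrite ger0_norm.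
rewrite /I (filter_split st hl) big_cat/= mean_sum_cat.
set l1 := [seq p <- l | (s <= p.1 < t)%R].
set I2 := (\sum_(p <- [seq p <- l | (t <= p.1)%R]) _)%R; set F2 := mean_sum r [seq p <- l | (t <= p.1)%R] z.
rewrite addrK addrK.
have -> : (\sum_(p <- l1) mass_weight p.1 * tr r p.1 p.2 z - mass_weight s * mean_sum r l1 z =
    \sum_(p <- l1) (mass_weight p.1 - mass_weight s) * tr r p.1 p.2 z)%R.
  rewrite mean_sum_sum mulr_sumr -sumrB; apply: eq_bigr => p _; ring.
apply: (@atoms_bound (fun u => mass_weight u - mass_weight s)%R _
  (fun u => s <= u < t)%R _ r (lexx r)).
- exact: atoms_after_filter.
- by rewrite /l1 all_filter; elim: (l) => //= p l' ->; rewrite andbT implybb.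
- by move=> u _ /andP[su /ltW ut]; apply: close; rewrite su.
Qed.

End weighted_means.

(** * Weighted means of limit functionals *)

Section limit_functionals.
Context {R : realType} {d d' : measure_display}.
Context {Omega : measurableType d} {Omega' : measurableType d'}.
Context {S : ptopologicalType}.
Variables (Z : R -> Omega -> S) (F : set R -> set (set Omega)).
Variable P : R -> probability (borel S) R -> probability Omega R.
Variables (gamma beta : R).
Variables (X : R -> Omega' -> finmeas (borel S) R).
Variable G : set R -> set (set Omega').
Variable PX : R -> probability (finmeas (borel S) R) R -> probability Omega' R.
Hypothesis hZ : @markov_process R d _ Omega (borel S) Z F P.
Hypothesis hX : superprocess Z P gamma beta X G PX.
Hypothesis hgamma : (0 < gamma)%R.
Hypothesis hbeta : (0 < beta <= 1)%R.

Local Notation FM := (finmeas (borel S) R).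
Local Notation tr s t f := (@transition R d _ Omega (borel S) Z P s t f).
Local Notation pr t f w := (@pairing R d' Omega' S X t f w).

Let hXm : markov_process X G PX := super_markov hX.

Local Notation atoms := (seq (R * (borel S -> R))).
Local Notation pair_sum l w := (@pair_sum R d' Omega' S X l w).
Local Notation mean_sum s l := (@mean_sum R d Omega S Z P s l).
Local Notation mass_sum l w := (@mass_sum R d' Omega' S X l w).

Variables (r : R) (z : borel S).
Hypothesis r0 : (0 <= r)%R.

Local Notation Q := (PX r \d_(\d_z : FM)).
Local Notation mass_weight nl := (@mass_weight R d' Omega' S X PX r z nl).

(** All that is used of a functional j whose underlying additive functional
has mean Fd s on [s, +oo[: no mean is lost at the starting time, and weighted
means are Stieltjes integrals. Both are preserved by limits that lose no mean.
*)
Definition mean_spec (j : Omega' -> R) (Fd : R -> R) : Prop :=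
  [/\ measurable_fun setT j, (forall w, 0 <= j w)%R,
      \int[Q]_w (j w)%:E = (Fd r)%:E &
      forall nl, sorted_after r nl ->
        stieltjes r (mass_weight nl) Fd
          (fine (\int[Q]_w ((j w)%:E * (expR (- mass_sum nl w))%:E)))].

Lemma measurable_pair_sum (l : atoms) (s : R) : (0 <= s)%R -> atoms_after s l ->
  measurable_fun setT (fun w => pair_sum l w).
Proof.
move=> s0 hl; exact: (adapted_measurable hXm (time_interval_cy s0) (adapted_pair_sum hX s0 (lexx _) hl)).
Qed.

Lemma mean_pair_sum (l : atoms) : forall s : R, (r <= s)%R -> atoms_after s l ->
  \int[Q]_w (pair_sum l w)%:E = (mean_sum r l z)%:E.
Proof.
elim: l => [|p l ih] s rs.
  by move=> _; rewrite mean_sum_nil pair_sum_nil integral0.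
move=> /= [sp bp pl]; have rp := le_trans rs sp; have p0 := le_trans r0 rp.
have mp : measurable_fun setT (fun w => pr p.1 p.2 w).
  by case: bp => mf f0 _; exact: (measurable_pairing_process hX).
have ml := measurable_pair_sum p0 pl.
have rp' : (0 <= r <= p.1)%R by rewrite r0.
have -> : mean_sum r (p :: l) z = (rint (\d_z : FM) (tr r p.1 p.2) + mean_sum r l z)%R.
  rewrite mean_sum_cons rint_dirac//.
  by have [] := bounded_nneg_transition hZ rp' bp.
rewrite EFinD -(ih p.1 rp pl) -(mean_pairing hZ hX hgamma hbeta (\d_z : FM) rp' bp) -integralD_ge0.
- by apply: eq_integral => w _; rewrite pair_sum_cons EFinD.
- exact/measurable_EFinP.
- by move=> w; rewrite lee_fin pairing_ge0//; case: bp.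
- exact/measurable_EFinP.
- by move=> w; rewrite lee_fin; exact: pair_sum_ge0 pl.
Qed.

Lemma mean_spec_pair_sum (l : atoms) : atoms_after r l ->
  mean_spec (fun w => pair_sum l w) (fun s => mean_sum r [seq p <- l | (s <= p.1)%R] z).
Proof.
move=> hl; split.
- exact: measurable_pair_sum hl.
- by move=> w; exact: pair_sum_ge0 hl.
- by rewrite (atoms_after_filter_id hl) (mean_pair_sum (lexx r) hl).
- move=> nl hnl.
  have -> : fine (\int[Q]_w ((pair_sum l w)%:E * (expR (- mass_sum nl w))%:E)) =
      (\sum_(p <- l) mass_weight nl p.1 * tr r p.1 p.2 z)%R.
    have := weighted_pair_sum hZ hX hgamma hbeta z r0 hnl (lexx r) hl.
    by move=> /(congr1 fine) /= <-.
  exact: (stieltjes_atoms hZ hX hgamma hbeta (z := z) r0 hnl hl).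
Qed.

(** Given the lower bound for the mean of the limit, Fatou's lemma gives
equality and Scheffe's lemma the convergence of all weighted means. The lower
bound is required of real versions of the limit only, finiteness being a
consequence of Fatou's lemma. *)
Lemma mean_spec_limit (g : nat -> Omega' -> R) (F_ : nat -> R -> R) (Fd : R -> R)
    (J : Omega' -> \bar R) :
  (forall k, mean_spec (g k) (F_ k)) ->
  (forall s : R, (r <= s)%R -> F_ k s @[k --> \oo] --> Fd s) ->
  measurable_fun setT J -> {ae Q, forall w, (g k w)%:E @[k --> \oo] --> J w} ->
  (forall j : Omega' -> R, measurable_fun setT j -> (forall w, 0 <= j w)%R ->
    {ae Q, forall w, g k w @[k --> \oo] --> j w} -> (Fd r)%:E <= \int[Q]_w (j w)%:E) ->
  exists j, [/\ {ae Q, forall w, J w = (j w)%:E},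
    {ae Q, forall w, g k w @[k --> \oo] --> j w} & mean_spec j Fd].
Proof.
move=> gF cF mJ cJ low.
pose Jp w := maxe (J w) 0.
have mJp : measurable_fun setT Jp by exact: measurable_maxe.
have Jp0 w : 0 <= Jp w by rewrite /Jp le_max lexx orbT.
have mg k : measurable_fun setT (fun w => (g k w)%:E).
  by apply/measurable_EFinP; case: (gF k).
have g0 k w : 0 <= (g k w)%:E by rewrite lee_fin; case: (gF k).
have JpE : {ae Q, forall w, J w = Jp w /\ ((g k w)%:E @[k --> \oo] --> Jp w)}.
  apply: filterS cJ => w cw; have Jw : 0 <= J w.
    rewrite -(cvg_lim _ cw)//; apply: lime_ge; first by apply/cvg_ex; eexists; exact: cw.
    by apply: nearW => k; exact: g0.
  by rewrite /Jp; have /max_idPl -> := Jw.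
have cJp : {ae Q, forall w, (g k w)%:E @[k --> \oo] --> Jp w}.
  by apply: filterS JpE => w [].
have fin : \int[Q]_w Jp w < +oo.
  rewrite ltNge; apply/negP => inf.
  have x : (Fd r + 1)%:E < \int[Q]_w Jp w by apply: lt_le_trans inf; exact: ltry.
  have [N hN] := fatou_ae mg mJp g0 Jp0 cJp x.
  have /cvgrPdist_lt/(_ _ (ltr01 : (0 < 1 :> R)%R))[N' _ hN'] := cF r (lexx r).
  have := hN _ (leq_maxl N N'); have := hN' _ (leq_maxr N N').
  have [_ _ -> _] := gF (maxn N N'); rewrite lee_fin ltr_norml => /andP[? ?] ?.
  by clear inf x; lra.
have iJp : Q.-integrable setT Jp.
  apply/integrableP; split => //.
  by under eq_integral do rewrite gee0_abs//.
have Jfin : {ae Q, forall w, Jp w \is a fin_num}.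
  by have := integrable_ae measurableT iJp; apply: filterS => w /(_ I).
pose j w := fine (Jp w).
have mj : measurable_fun setT j.
  by apply: measurableT_comp; [exact: fine_measurable|exact: mJp].
have j0 w : (0 <= j w)%R by exact: fine_ge0.
have jE : {ae Q, forall w, Jp w = (j w)%:E}.
  by apply: filterS Jfin => w ?; rewrite /j fineK.
have cj : {ae Q, forall w, g k w @[k --> \oo] --> j w}.
  apply: filterS2 jE cJp => w jw cw.
  have : (g k w)%:E @[k --> \oo] --> (j w)%:E by rewrite -jw.
  by move=> /fine_cvg.
exists j; split => //.
  by apply: filterS2 jE JpE => w <- [].
have mj' : measurable_fun setT (fun w => (j w)%:E) by exact/measurable_EFinP.
have j0' w : 0 <= (j w)%:E by rewrite lee_fin.
have cj' : {ae Q, forall w, (g k w)%:E @[k --> \oo] --> (j w)%:E}.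
  by apply: filterS2 jE cJp => w <-.
have Eg k : \int[Q]_w (g k w)%:E = (F_ k r)%:E by case: (gF k).
have lowj := low j mj j0 cj.
split => //.
- have b01 (w : Omega') : (0 <= (1 : R) <= 1)%R by rewrite ler01 lexx.
  by have [] := scheffe mg mj' g0 j0' (measurable_cst (1%R : R)) b01 cj' Eg (cF r (lexx r)) lowj.
- move=> nl hnl.
  have [_ cS] := scheffe mg mj' g0 j0' (measurable_exp_mass_sum hX r0 hnl)
    (exp_mass_sum_bounds X hnl) cj' Eg (cF r (lexx r)) lowj.
  apply: (stieltjes_cvg _ cF cS) => k.
  by have [_ _ _] := gF k; apply.
Qed.

Lemma laplace_limit (g : nat -> Omega' -> R) (j : Omega' -> R) (e : R) :
  (0 <= e)%R -> (forall k, measurable_fun setT (g k)) -> (forall k w, 0 <= g k w)%R ->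
  measurable_fun setT j -> (forall w, 0 <= j w)%R ->
  {ae Q, forall w, g k w @[k --> \oo] --> j w} ->
  rint Q (fun w => expR (- (e * g k w)))%R @[k --> \oo] -->
  rint Q (fun w => expR (- (e * j w)))%R.
Proof.
move=> e0 mg g0 mj j0 cj.
have b (h : Omega' -> R) : measurable_fun setT h -> (forall w, 0 <= h w)%R ->
    bounded_nneg (fun w => expR (- (e * h w)))%R.
  move=> mh h0; apply: bounded_nneg_expN; first exact: measurable_funM.
  by move=> w; rewrite mulr_ge0.
have e1 k w : (expR (- (e * g k w)) <= 1)%R.
  by rewrite -[leRHS]expR0 ler_expR oppr_le0 mulr_ge0.
have ce : {ae Q, forall w, expR (- (e * g k w))%R @[k --> \oo] --> expR (- (e * j w))%R}.
  apply: filterS cj => w cw.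
  have cw' : (- (e * g k w))%R @[k --> \oo] --> (- (e * j w))%R.
    by apply: cvgN; exact: cvgMr.
  exact: (cvg_comp _ _ cw' (@continuous_expR R _)).
exact: (rint_cvg (fun k => b _ (mg k) (g0 k)) (b _ mj j0) e1 ce).
Qed.

Let lower_step (x e c th : R) : (0 <= th)%R -> (th <= 1)%R -> (0 <= c)%R -> (0 < e)%R ->
  (th * e * c - (th * e * c) ^+ 2 <= e * x)%R -> (th * c - c ^+ 2 * e <= x)%R.
Proof.
move=> th0 th1 c0 e0 H.
have : (e * (th * c - (th * c) ^+ 2 * e) <= e * x)%R.
  by apply: le_trans H; rewrite le_eqVlt; apply/orP; left; apply/eqP; ring.
rewrite ler_pM2l//; apply: le_trans; rewrite lerD2l lerN2 ler_pM2r//.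
by rewrite exprMn ler_piMl ?sqr_ge0// expr_le1.
Qed.

(** From exp (- x) >= 1 - x, the mean of e j is at least 1 minus the
transform; divide by e and let e tend to 0. *)
Lemma mean_lower (j : Omega' -> R) (c k0 : R) : measurable_fun setT j ->
  (forall w, 0 <= j w)%R -> (0 <= c)%R -> (0 <= k0)%R ->
  (forall e : R, (0 < e)%R -> (k0 * e `^ beta <= 1)%R ->
    (rint Q (fun w => expR (- (e * j w))) <= expR (- ((1 - k0 * e `^ beta) * e * c)))%R) ->
  c%:E <= \int[Q]_w (j w)%:E.
Proof.
move=> mj j0 c0 k00 H.
have [beta0 _] := andP hbeta.
case: (leP +oo (\int[Q]_w (j w)%:E)) => [|fin]; first by apply: le_trans; exact: leey.
have jfin : \int[Q]_w (j w)%:E = (rint Q j)%:E.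
  rewrite fineK// ge0_fin_numE//; apply: integral_ge0 => w _.
  by rewrite lee_fin.
rewrite jfin lee_fin.
have c_pow : (k0 * (harmonic n : R) `^ beta)%R @[n --> \oo] --> (k0 * 0)%R.
  by apply: cvgMr; exact: cvg_harmonic_powR.
have lhs : ((1 - k0 * harmonic n `^ beta) * c - c ^+ 2 * harmonic n)%R @[n --> \oo] -->
    ((1 - k0 * 0) * c - c ^+ 2 * 0)%R.
  apply: cvgB; last by apply: cvgMr; exact: cvg_harmonic.
  by apply: cvgMl; apply: cvgB; [exact: cvg_cst|exact: c_pow].
have -> : (c = (1 - k0 * 0) * c - c ^+ 2 * 0)%R by ring.
apply: (ler_cvg_to lhs (cvg_cst _)).
have near1 : \forall n \near \oo, (k0 * (harmonic n : R) `^ beta < 1)%R.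
  by apply: (cvgr_lt (k0 * 0)%R c_pow); rewrite mulr0.
apply: filterS near1 => n; rewrite /= => /ltW small.
have e0 := @harmonic_gt0 R n; set e := harmonic n in e0 small *.
have th0 : (0 <= 1 - k0 * e `^ beta)%R by rewrite subr_ge0.
have th1 : (1 - k0 * e `^ beta <= 1)%R by rewrite gerBl mulr_ge0// powR_ge0.
apply: (lower_step th0 th1 c0 e0).
have u0 : (0 <= (1 - k0 * e `^ beta) * e * c)%R by rewrite !mulr_ge0// ltW.
have /andP[lo _] := expN_bounds u0.
apply: (le_trans lo); apply: (@le_trans _ _ (1 - rint Q (fun w => expR (- (e * j w))))%R).
  by rewrite lerD2l lerN2; exact: H.
have be : bounded_nneg (fun w => expR (- (e * j w)))%R.
  apply: bounded_nneg_expN; first exact: measurable_funM.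
  by move=> w; rewrite mulr_ge0// ltW.
have one : rint Q (fun=> 1%R) = 1%R by rewrite rint_cst mass_probability mulr1.
rewrite lerBlDr -one -lee_fin -rintE; last exact: bounded_nneg_cst.
have mj' : measurable_fun setT (fun w => (j w)%:E) by exact/measurable_EFinP.
have j0' w : 0 <= (j w)%:E by rewrite lee_fin.
have mej : measurable_fun setT (fun w => e%:E * (j w)%:E) by exact: measurable_funeM.
have ej0 w : 0 <= e%:E * (j w)%:E by rewrite mule_ge0// lee_fin ltW.
have mb : measurable_fun setT (fun w => (expR (- (e * j w)))%:E).
  by case: be => m _ _; exact/measurable_EFinP.
have b0 w : 0 <= (expR (- (e * j w)))%:E by rewrite lee_fin expR_ge0.
rewrite EFinD EFinM -jfin -(rintE _ be) -(integralZ_ge0 Q (ltW e0) mj' j0').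
rewrite -(integralD_ge0 Q mej ej0 mb b0).
apply: integral_le_ge0 => [|w||w].
- exact: measurable_cst.
- by rewrite lee_fin.
- exact: emeasurable_funD.
- rewrite -EFinM -EFinD lee_fin.
  have /andP[_ up] := expN_bounds (mulr_ge0 (ltW e0) (j0 w)).
  by rewrite -lerBlDr.
Qed.

End limit_functionals.

Section functional_means.
Context {R : realType} {d d' : measure_display}.
Context {Omega : measurableType d} {Omega' : measurableType d'}.
Context {S : ptopologicalType}.
Variables (Z : R -> Omega -> S) (F : set R -> set (set Omega)).
Variable P : R -> probability (borel S) R -> probability Omega R.
Variables (gamma beta : R).
Variables (X : R -> Omega' -> finmeas (borel S) R).
Variable G : set R -> set (set Omega').
Variable PX : R -> probability (finmeas (borel S) R) R -> probability Omega' R.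
Hypothesis hZ : @markov_process R d _ Omega (borel S) Z F P.
Hypothesis hX : superprocess Z P gamma beta X G PX.
Hypothesis hgamma : (0 < gamma)%R.
Hypothesis hbeta : (0 < beta <= 1)%R.

Local Notation FM := (finmeas (borel S) R).
Local Notation lap s mu t f := (@laplace R d' Omega' S X PX s mu t f).

Let hXm : markov_process X G PX := super_markov hX.

Local Notation pair_sum l w := (@pair_sum R d' Omega' S X l w).
Local Notation discretization A r T0 M l := (@discretization R d Omega S Z P A r T0 M l).
Local Notation tail A s q y := (@tail R d Omega S P A s q y).

Variables (r : R) (z : borel S).
Hypothesis r0 : (0 <= r)%R.

Local Notation Q := (PX r \d_(\d_z : FM)).
Local Notation mean_spec j Fd := (@mean_spec R d' Omega' S X PX r z j Fd).

Lemma measurable_J_functional1 (A : R.-ker Omega ~> R) (J : Omega' -> \bar R) :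
  J_functional1 Z X A J -> measurable_fun setT J.
Proof.
move=> [n [t [f [[tf _] JE]]]].
rewrite (_ : J = fun w => \sum_(i < n) \int[X (t i) w]_y (f i y)%:E); last exact/funext.
apply: emeasurable_sum => i _.
have mf : measurable_fun setT (fun y => (f i y)%:E).
  by apply/measurable_EFinP; exact: (simple_measurable tf).
have f0 y : 0 <= (f i y)%:E by rewrite lee_fin; exact: (simple_ge0 tf).
apply: (measurableT_comp (measurable_finmeas_integral mf f0)).
exact: (measurable_process hXm (simple_time_ge0 tf i)).
exact: measurableT.
Qed.

Let kappa (e M D : R) : (0 <= e)%R -> (0 <= M)%R ->
  (gamma * (1 + beta) * (e * M + e * M) `^ beta * D =
   gamma * (1 + beta) * (M + M) `^ beta * D * e `^ beta)%R.
Proof.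
move=> e0 M0; rewrite -mulrDr powRM//; last by rewrite addr_ge0.
by ring.
Qed.

Let kappa_ge0 (M D : R) : (0 <= D)%R ->
  (0 <= gamma * (1 + beta) * (M + M) `^ beta * D)%R.
Proof.
move=> D0; have b0 : (0 <= 1 + beta)%R by case/andP: hbeta => ? _; lra.
by rewrite mulr_ge0// mulr_ge0 ?powR_ge0// mulr_ge0// ltW.
Qed.

Lemma disc_bound_ge0 (A : R.-ker Omega ~> R) (T0 M : R) l :
  discretization A r T0 M l -> (0 <= M)%R.
Proof.
move=> D; exact: le_trans (path_sum_ge0 Z point (disc_after D 0%N)) (disc_bound D 0%N point).
Qed.

Lemma discretization_subseq (A : R.-ker Omega ~> R) (T0 M : R) l (u : nat -> nat) :
  (forall k, (k <= u k)%N) -> discretization A r T0 M l ->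
  discretization A r T0 M (fun k => l (u k)).
Proof.
move=> hu [h1 h2 h3 h4]; split=> // s q y rs sq.
by apply: filterS (h4 s q y rs sq) => w; exact: cvg_subseq.
Qed.

(** The hypothesis of mean_lower, with the mean of A as the lower bound. *)
Definition bounded_laplace (A : R.-ker Omega ~> R) (j : Omega' -> R) (k0 : R) : Prop :=
  forall e : R, (0 < e)%R -> (k0 * e `^ beta <= 1)%R ->
    (rint Q (fun w => expR (- (e * j w))) <=
     expR (- ((1 - k0 * e `^ beta) * e * tail A r r z)))%R.

(** The comparison constant for e A is proportional to e^beta, which is why
small e recover the whole mean. *)
Lemma bounded_laplace_discretization (A A' : R.-ker Omega ~> R) (T0 T0' M M' : R) l l' j :
  discretization A r T0 M l -> discretization A' r T0' M' l' ->
  (forall w (s t : R), (r <= s)%R -> (s <= t)%R ->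
    A w `[s, t[%classic <= A' w `[s, t[%classic) ->
  (forall e : R, (0 <= e)%R ->
    rint Q (fun w => expR (- (e * pair_sum (l' k) w)))%R @[k --> \oo] -->
    rint Q (fun w => expR (- (e * j w)))%R) ->
  bounded_laplace A j (gamma * (1 + beta) * (M + M) `^ beta * (Num.max r T0 - r)).
Proof.
move=> D D' AA' cj e e0 small; have M0 := disc_bound_ge0 D.
have K := kappa (Num.max r T0 - r)%R (ltW e0) M0.
rewrite -K in small *.
exact: (laplace_lower hZ hX hgamma hbeta r0 D D' AA' (ltW e0) small (cj e (ltW e0))).
Qed.

(** The lower bound for the mean of the limit is the comparison of A with
itself. *)
Lemma mean_level2 (A : R.-ker Omega ~> R) (J : Omega' -> \bar R) :
  additive_functional F P A -> J_functional2 Z P X F Q A J ->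
  exists j T0 M l, [/\ discretization A r T0 M l, {ae Q, forall w, J w = (j w)%:E},
    mean_spec j (fun s => tail A r s z) &
    forall e : R, (0 <= e)%R ->
      rint Q (fun w => expR (- (e * pair_sum (l k) w)))%R @[k --> \oo] -->
      rint Q (fun w => expR (- (e * j w)))%R].
Proof.
move=> hA [mJ [An [Jn [hA2 hJ1 cJ]]]].
have [T0 [M [l [D JE]]]] := discretize hZ hX hgamma hbeta (\d_z : FM) r0 hA hA2 hJ1.
have [u hu cu] := cvg_probability_subseq (fun n => measurable_J_functional1 (hJ1 n)) mJ cJ.
have D' := discretization_subseq hu D.
pose g k w := pair_sum (l (u k)) w.
have hg k : atoms_after r (l (u k)) := disc_after D' k.
have cg : {ae Q, forall w, (g k w)%:E @[k --> \oo] --> J w}.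
  have : {ae Q, forall w, forall k, Jn k w = (pair_sum (l k) w)%:E} by exact/ae_foralln.
  apply: filterS2 cu => w cw Ew.
  by rewrite (_ : (fun k => (g k w)%:E) = fun k => Jn (u k) w)//; apply/funext => k; rewrite Ew.
have mg k : measurable_fun setT (g k) by exact: (measurable_pair_sum hX r0 (hg k)).
have g0 k w : (0 <= g k w)%R by exact: pair_sum_ge0 (hg k).
have spec k := mean_spec_pair_sum hZ hX hgamma hbeta z r0 (hg k).
have tails (s : R) : (r <= s)%R ->
    mean_sum Z P r [seq p <- l (u k) | (s <= p.1)%R] z @[k --> \oo] --> tail A r s z.
  by move=> rs; have [_ _] := mean_tail hZ r0 D' z (lexx r) rs.
have [|j [jE cj js]] := mean_spec_limit hX r0 spec tails mJ cg.
  move=> j mj j0 cj.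
  have lap (e : R) (e0 : (0 <= e)%R) := laplace_limit e0 mg g0 mj j0 cj.
  have BL := bounded_laplace_discretization D' D' (fun w s t _ _ => lexx _) lap.
  have [_ /andP[t0 _] _] := mean_tail hZ r0 D' z (lexx r) (lexx r).
  apply: (mean_lower hbeta mj j0 t0 _ BL); apply: kappa_ge0.
  by rewrite subr_ge0 le_max lexx.
exists j, T0, M, (fun k => l (u k)); split => // e e0.
have [mj j0 _ _] := js.
exact: laplace_limit e0 mg g0 mj j0 cj.
Qed.

End functional_means.

Section functionals_of_A.
Context {R : realType} {d d' : measure_display}.
Context {Omega : measurableType d} {Omega' : measurableType d'}.
Context {S : ptopologicalType}.
Variables (Z : R -> Omega -> S) (F : set R -> set (set Omega)).
Variable P : R -> probability (borel S) R -> probability Omega R.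
Variables (gamma beta : R).
Variables (X : R -> Omega' -> finmeas (borel S) R).
Variable G : set R -> set (set Omega').
Variable PX : R -> probability (finmeas (borel S) R) R -> probability Omega' R.
Hypothesis hZ : @markov_process R d _ Omega (borel S) Z F P.
Hypothesis hX : superprocess Z P gamma beta X G PX.
Hypothesis hgamma : (0 < gamma)%R.
Hypothesis hbeta : (0 < beta <= 1)%R.

Local Notation FM := (finmeas (borel S) R).
Local Notation lap s mu t f := (@laplace R d' Omega' S X PX s mu t f).

Local Notation atoms := (seq (R * (borel S -> R))).
Local Notation pair_sum l w := (@pair_sum R d' Omega' S X l w).
Local Notation discretization A r T0 M l := (@discretization R d Omega S Z P A r T0 M l).
Local Notation tail A s q y := (@tail R d Omega S P A s q y).

Variables (r T : R) (z : borel S).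
Hypotheses (r0 : (0 <= r)%R) (rT : (r <= T)%R).

Local Notation Q := (PX r \d_(\d_z : FM)).
Local Notation mean_spec j Fd := (@mean_spec R d' Omega' S X PX r z j Fd).

(** As A has no mass after T, every tail is bounded by the value on [r, T],
whose mean is finite. *)
Lemma tail_calAT1 (A : R.-ker Omega ~> R) : calAT1 Z F P T A ->
  (forall s : R, (r <= s)%R -> \int[P r \d_z]_w A w `[s, +oo[%classic = (tail A r s z)%:E) /\
  (forall s : R, (T < s)%R -> tail A r s z = 0%R).
Proof.
move=> [_ hT]; have [fin aeT] := hT r z (introT andP (conj r0 rT)).
have mA (I : set R) : measurable I -> measurable_fun setT (fun w => A w I).
  by move=> mI; exact: measurable_kernel.
split=> s hs.
  rewrite fineK// ge0_fin_numE; last by apply: integral_ge0 => w _; exact: measure_ge0.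
  apply: le_lt_trans fin; apply: ae_ge0_le_integral => //.
  - exact: mA.
  - exact: mA.
  apply: filterS aeT => w A0 _.
  apply: (@le_trans _ _ (A w (`[r, T]%classic `|` `]T, +oo[%classic))).
    apply: le_measure; rewrite ?inE//; first exact: measurableU.
    move=> x /=; rewrite !in_itv/= !andbT => sx.
    by have [xT|Tx] := leP x T; [left; rewrite (le_trans hs sx)|right].
  apply: (le_trans (measureU2 (A w) _ _)) => //.
  by rewrite -[leRHS]adde0; apply: leeD => //; rewrite le_eqVlt; apply/orP; left; apply/eqP; exact: A0.
rewrite -[LHS]/(fine (\int[P r \d_z]_w A w `[s, +oo[%classic)).
suff -> : \int[P r \d_z]_w A w `[s, +oo[%classic = 0 by [].
apply/eqP; rewrite eq_le integral_ge0 ?andbT; last by move=> w _; exact: measure_ge0.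
rewrite -[leRHS](integral0 (P r \d_z) setT); apply: ae_ge0_le_integral => //.
- exact: mA.
apply: filterS aeT => w A0 _; rewrite -A0; apply: le_measure; rewrite ?inE//.
by move=> x /=; rewrite !in_itv/= !andbT; exact: lt_le_trans.
Qed.

(** Means of tails converge since A_n increases to A. The lower bound for the
mean of the limit comes from comparing a fixed A_m with later terms of the
sequence and then letting m tend to infinity. *)
Lemma mean_functional (A : R.-ker Omega ~> R) (J : Omega' -> \bar R) :
  calAT1 Z F P T A -> J_functional Z P X F Q A J ->
  exists j, {ae Q, forall w, J w = (j w)%:E} /\ mean_spec j (fun s => tail A r s z).
Proof.
move=> hA [mJ [An [Jn [[hA2 mon] hJ2 cJ]]]].
have [tailE _] := tail_calAT1 hA.
have /choice[p hp] n : exists p : (Omega' -> R) * (R * R * (nat -> atoms)),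
    [/\ discretization (An n) r p.2.1.1 p.2.1.2 p.2.2,
      {ae Q, forall w, Jn n w = (p.1 w)%:E},
      mean_spec p.1 (fun s => tail (An n) r s z) &
      forall e : R, (0 <= e)%R ->
        rint Q (fun w => expR (- (e * pair_sum (p.2.2 k) w)))%R @[k --> \oo] -->
        rint Q (fun w => expR (- (e * p.1 w)))%R].
  have [hadd _] := hA2 n.
  have [j [T0 [M [l H]]]] := mean_level2 hZ hX hgamma hbeta r0 hadd (hJ2 n).
  by exists (j, (T0, M, l)).
pose j_ n := (p n).1.
have [u hu cu] := cvg_probability_subseq (fun n => (hJ2 n).1) mJ cJ.
have spec k : mean_spec (j_ (u k)) (fun s => tail (An (u k)) r s z) by case: (hp (u k)).
have cg : {ae Q, forall w, (j_ (u k) w)%:E @[k --> \oo] --> J w}.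
  have : {ae Q, forall w, forall n, Jn n w = (j_ n w)%:E}.
    by apply/ae_foralln => n; case: (hp n).
  apply: filterS2 cu => w cw Ew.
  by rewrite (_ : (fun k => (j_ (u k) w)%:E) = fun k => Jn (u k) w)//; apply/funext => k; rewrite Ew.
have tails (s : R) : (r <= s)%R -> tail (An n) r s z @[n --> \oo] --> tail A r s z.
  move=> rs; have s0 := le_trans r0 rs.
  have sub : `[s, +oo[%classic `<=` (`[0%R, +oo[%classic : set R).
    by move=> x /=; rewrite !in_itv/= !andbT; exact: le_trans.
  have cA w := mon _ (measurable_itv _) sub w.
  have le_A n w : An n w `[s, +oo[%classic <= A w `[s, +oo[%classic.
    have [nd cv] := cA w; rewrite -(cvg_lim _ cv)//.
    apply: lime_ge; first by apply/cvg_ex; eexists; exact: cv.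
    by apply: filterS (nbhs_infty_ge n) => k nk; exact: nd.
  have : \int[P r \d_z]_w An n w `[s, +oo[%classic @[n --> \oo] -->
      \int[P r \d_z]_w A w `[s, +oo[%classic.
    apply: integral_cvg_below.
    - by move=> n; exact: measurable_kernel.
    - exact: measurable_kernel.
    - by move=> n w; rewrite measure_ge0 le_A.
    - by move=> w; case: (cA w).
  by rewrite (tailE s rs) => /fine_cvg.
have [|j [jE _ js]] := mean_spec_limit hX r0 spec
  (fun s rs => cvg_subseq hu (tails s rs)) mJ cg; last by exists j.
move=> j mj j0 cj.
(* from some rank on, An m lies below An (u k), so the transforms of the
   sequence, and that of their limit, obey the bound for An m *)
have low m : (tail (An m) r r z)%:E <= \int[Q]_w (j w)%:E.
  have [Dm _ _ _] := hp m.
  have [_ /andP[t0 _] _] := mean_tail hZ r0 Dm z (lexx r) (lexx r).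
  pose k0 := (gamma * (1 + beta) * ((p m).2.1.2 + (p m).2.1.2) `^ beta *
    (Num.max r (p m).2.1.1 - r))%R.
  have k00 : (0 <= k0)%R.
    have b0 : (0 <= 1 + beta)%R by case/andP: hbeta => ? _; lra.
    have D0 : (0 <= Num.max r (p m).2.1.1 - r)%R by rewrite subr_ge0 le_max lexx.
    by rewrite /k0 mulr_ge0// mulr_ge0 ?powR_ge0// mulr_ge0// ltW.
  apply: (mean_lower hbeta mj j0 t0 k00) => e e0 small.
  have mg k : measurable_fun setT (j_ (u k)) by case: (spec k).
  have g0 k w : (0 <= j_ (u k) w)%R by case: (spec k).
  have lap := laplace_limit (ltW e0) mg g0 mj j0 cj.
  apply: (ler_cvg_to lap (cvg_cst _)).
  apply: filterS (nbhs_infty_ge m) => k mk.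
  have [Dk _ _ lk] := hp (u k).
  have le_A w (s t : R) : (r <= s)%R -> (s <= t)%R ->
      An m w `[s, t[%classic <= An (u k) w `[s, t[%classic.
    move=> rs st; have sub : `[s, t[%classic `<=` (`[0%R, +oo[%classic : set R).
      move=> x /=; rewrite !in_itv/= andbT => /andP[sx _].
      exact: le_trans (le_trans r0 rs) sx.
    have [nd _] := mon _ (measurable_itv _) sub w.
    by apply: nd; exact: leq_trans (hu k).
  exact: (bounded_laplace_discretization hZ hX hgamma hbeta r0 Dm Dk le_A lk e0 small).
have cE : (tail (An m) r r z)%:E @[m --> \oo] --> (tail A r r z)%:E.
  by apply: cvg_EFin; [exact: nearW|exact: tails].
rewrite -(cvg_lim _ cE)//; apply: lime_le; first by apply/cvg_ex; eexists; exact: cE.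
exact: nearW.
Qed.

End functionals_of_A.

(** * The averaged total mass *)

Section averaged_mass.
Context {R : realType} {d d' : measure_display}.
Context {Omega : measurableType d} {Omega' : measurableType d'}.
Context {S : ptopologicalType}.
Variables (Z : R -> Omega -> S) (F : set R -> set (set Omega)).
Variable P : R -> probability (borel S) R -> probability Omega R.
Variables (gamma beta : R).
Variables (X : R -> Omega' -> finmeas (borel S) R).
Variable G : set R -> set (set Omega').
Variable PX : R -> probability (finmeas (borel S) R) R -> probability Omega' R.
Hypothesis hZ : @markov_process R d _ Omega (borel S) Z F P.
Hypothesis hX : superprocess Z P gamma beta X G PX.
Hypothesis hgamma : (0 < gamma)%R.
Hypothesis hbeta : (0 < beta <= 1)%R.

Local Notation FM := (finmeas (borel S) R).

Variables (r T : R) (z : borel S) (alpha : {finite_measure set R -> \bar R}).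
Hypotheses (r0 : (0 <= r)%R) (rT : (r <= T)%R).

Local Notation Q := (PX r \d_(\d_z : FM)).

Definition averaged_mass (w : Omega') : \bar R :=
  \int[alpha]_(t in `[r, T]) total_mass X t w.

(** The total mass is jointly measurable for nonnegative times only, whereas
Fubini's theorem is applied over the whole line: times are first moved into
[r, T]. *)
Definition clamp (t : R) : R := Num.max r (Num.min t T).

Lemma clamp_id (t : R) : `[r, T]%classic t -> clamp t = t.
Proof.
by rewrite /= in_itv/= => /andP[rt tT]; rewrite /clamp min_l// max_r.
Qed.

Lemma measurable_clamped : measurable_fun setT
  (fun p : R * Omega' => total_mass X (clamp p.1) p.2).
Proof.
apply: (@measurable_comp _ _ _ _ _ _ ([set s : R | 0 <= s]%R `*` [set: Omega'])
  (fun tw : R * Omega' => total_mass X tw.1 tw.2) setT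
  (fun p : R * Omega' => (clamp p.1, p.2))).
- apply: measurableX => //.
  by rewrite -set_itvcy; exact: measurable_itv.
- move=> _ [[t w] _ <-]; split => //=; apply: le_trans r0 _.
  by rewrite /clamp le_max lexx.
- exact: (super_mass_measurable hX).
- apply/measurable_fun_pairP; split => /=; last exact: measurable_snd.
  apply: measurable_maxr => //; apply: measurable_minr => //.
Qed.

Let kernel_fun (b : Omega' -> R) (p : R * Omega') : \bar R :=
  (\1_(`[r, T]%classic : set R) p.1)%:E * (total_mass X (clamp p.1) p.2 * (b p.2)%:E).

Let mkernel (b : Omega' -> R) : measurable_fun setT b -> measurable_fun setT (kernel_fun b).
Proof.
move=> mb; apply: emeasurable_funM.
  have m1 : measurable_fun setT (\1_(`[r, T]%classic : set R) : R -> R).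
    by apply/measurable_indicP; exact: measurable_itv.
  by apply/measurable_EFinP; exact: (measurableT_comp m1 measurable_fst).
apply: emeasurable_funM; first exact: measurable_clamped.
by apply/measurable_EFinP; exact: (measurableT_comp mb measurable_snd).
Qed.

Let kernel_ge0 (b : Omega' -> R) p : (forall w, 0 <= b w)%R -> 0 <= kernel_fun b p.
Proof.
move=> b0; rewrite /kernel_fun mule_ge0 ?lee_fin//.
by rewrite mule_ge0 ?lee_fin//; exact: measure_ge0.
Qed.

Let mtime w : measurable_fun setT (fun t => total_mass X (clamp t) w).
Proof. exact: (measurableT_comp measurable_clamped (pair2_measurable w)). Qed.

Let inner_time (b : Omega' -> R) w : (forall w, 0 <= b w)%R ->
  \int[alpha]_t kernel_fun b (t, w) = averaged_mass w * (b w)%:E.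
Proof.
move=> b0; rewrite /kernel_fun/=.
rewrite (@integral_indicM _ _ _ alpha `[r, T]%classic
  (fun t => total_mass X (clamp t) w * (b w)%:E)).
rewrite ge0_integralZr//.
- congr (_ * _); apply: eq_integral => t; rewrite inE => ht.
  by rewrite clamp_id.
- apply: (measurable_funS measurableT) => //; exact: mtime.
- by rewrite lee_fin.
Qed.

Let inner_space (b : Omega' -> R) t : measurable_fun setT b -> (forall w, 0 <= b w)%R ->
  \int[Q]_w kernel_fun b (t, w) = (\1_(`[r, T]%classic : set R) t)%:E *
    \int[Q]_w (total_mass X (clamp t) w * (b w)%:E).
Proof.
move=> mb b0; rewrite /kernel_fun/=.
have mg : measurable_fun setT (fun w => total_mass X (clamp t) w * (b w)%:E).
  apply: emeasurable_funM; last exact/measurable_EFinP.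
  exact: (measurableT_comp measurable_clamped (pair1_measurable t)).
have g0 w : 0 <= total_mass X (clamp t) w * (b w)%:E.
  by rewrite mule_ge0 ?lee_fin//; exact: measure_ge0.
have i0 : (0 <= \1_(`[r, T]%classic : set R) t :> R)%R by [].
exact: (integralZ_ge0 Q i0 mg g0).
Qed.

Lemma measurable_averaged_mass : measurable_fun setT averaged_mass.
Proof.
have H := measurable_fun_fubini_tonelli_G (m1 := alpha) (kernel_fun (fun=> 1%R))
  (mkernel (measurable_cst (1%R : R))) (fun p => kernel_ge0 p (fun=> ler01)).
rewrite (_ : averaged_mass = fubini_G alpha (kernel_fun (fun=> 1%R)))//.
by apply/funext => w; rewrite /fubini_G inner_time// mule1.
Qed.

Lemma averaged_mass_fubini (b : Omega' -> R) : measurable_fun setT b ->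
  (forall w, 0 <= b w)%R ->
  \int[Q]_w (averaged_mass w * (b w)%:E) =
  \int[alpha]_(t in `[r, T]) \int[Q]_w (total_mass X t w * (b w)%:E).
Proof.
move=> mb b0.
have := fubini_tonelli (m1 := alpha) (m2 := Q) (kernel_fun b) (mkernel mb)
  (fun p => kernel_ge0 p b0).
under eq_integral do rewrite inner_space//.
under [in RHS]eq_integral do rewrite inner_time//.
move=> <-; rewrite (@integral_indicM _ _ _ alpha `[r, T]%classic).
by apply: eq_integral => t; rewrite inE => ht; rewrite clamp_id.
Qed.

Lemma measurable_weighted_mass (b : Omega' -> R) : measurable_fun setT b ->
  (forall w, 0 <= b w)%R ->
  measurable_fun `[r, T] (fun t => \int[Q]_w (total_mass X t w * (b w)%:E)).
Proof.
move=> mb b0.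
have H := measurable_fun_fubini_tonelli_F (m2 := Q) (kernel_fun b) (mkernel mb)
  (fun p => kernel_ge0 p b0).
have H' : measurable_fun `[r, T]%classic (fubini_F Q (kernel_fun b)).
  exact: measurable_funS H.
apply: eq_measurable_fun H' => t; rewrite inE => ht.
rewrite /fubini_F inner_space//.
by rewrite indicE mem_set// mul1e clamp_id.
Qed.

End averaged_mass.

Section averaged_mass_mean.
Context {R : realType} {d d' : measure_display}.
Context {Omega : measurableType d} {Omega' : measurableType d'}.
Context {S : ptopologicalType}.
Variables (Z : R -> Omega -> S) (F : set R -> set (set Omega)).
Variable P : R -> probability (borel S) R -> probability Omega R.
Variables (gamma beta : R).
Variables (X : R -> Omega' -> finmeas (borel S) R).
Variable G : set R -> set (set Omega').
Variable PX : R -> probability (finmeas (borel S) R) R -> probability Omega' R.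
Hypothesis hZ : @markov_process R d _ Omega (borel S) Z F P.
Hypothesis hX : superprocess Z P gamma beta X G PX.
Hypothesis hgamma : (0 < gamma)%R.
Hypothesis hbeta : (0 < beta <= 1)%R.

Local Notation FM := (finmeas (borel S) R).

Local Notation mass_sum l w := (@mass_sum R d' Omega' S X l w).
Local Notation tail A s q y := (@tail R d Omega S P A s q y).

Variables (r T : R) (z : borel S) (alpha : {finite_measure set R -> \bar R}).
Variable A : R.-ker Omega ~> R.
Hypotheses (r0 : (0 <= r)%R) (rT : (r <= T)%R).
Hypothesis hA : calAT1 Z F P T A.
Hypothesis halpha : is_mean_measure (P r \d_z) A r T alpha.

Local Notation Q := (PX r \d_(\d_z : FM)).
Local Notation mean_spec j Fd := (@mean_spec R d' Omega' S X PX r z j Fd).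
Local Notation mass_weight nl := (@mass_weight R d' Omega' S X PX r z nl).
Local Notation averaged_mass w := (@averaged_mass R d' Omega' S X r T alpha w).

Let ind (s : R) : R -> R := \1_(`[s, T]%classic : set R).

Let bind s : bounded_nneg (ind s).
Proof.
split => [|t|]; [by apply/measurable_indicP; exact: measurable_itv|by []|].
by exists 1%R => t; rewrite /ind indicE; case: (_ \in _).
Qed.

Let indE s t : ind s t = (if (s <= t <= T)%R then 1 else 0)%R.
Proof.
rewrite /ind indicE; case: ifPn => h; first by rewrite mem_set//= in_itv.
by rewrite memNset//= in_itv/=; apply/negP.
Qed.

(** The defining property of the mean measure for indicators of [s, T]. *)
Lemma mean_measure_tail (s : R) : (r <= s)%R -> alpha `[s, T]%classic = (tail A r s z)%:E.
Proof.
move=> rs; have [tailE tail0] := tail_calAT1 z r0 rT hA.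
have [sT|Ts] := leP s T; last first.
  by rewrite set_itv_ge ?measure0 ?tail0// bnd_simp -ltNge.
have mI : measurable (`[s, T]%classic : set R) by exact: measurable_itv.
have mrT : measurable (`[r, T]%classic : set R) by exact: measurable_itv.
have m1 : measurable_fun `[r, T]%classic (ind s).
  by case: (bind s) => mi _ _; exact: measurable_funS mi.
have b1 : exists M : R, forall t : R, (r <= t <= T)%R -> (`|ind s t| <= M)%R.
  by exists 1%R => t _; rewrite indE; case: ifP; rewrite ?normr1 ?normr0.
have sub : `[s, T]%classic `&` `[r, T]%classic = `[s, T]%classic :> set R.
  apply/setIidl => x /=; rewrite !in_itv/= => /andP[sx ->].
  by rewrite (le_trans rs sx).
have := halpha m1 b1; rewrite /ind.
rewrite (integral_indic alpha mrT mI) sub.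
under eq_integral do rewrite (integral_indic _ mrT mI) sub.
move=> ->; rewrite -tailE//; apply: ge0_ae_eq_integral => //.
- exact: measurable_kernel.
- exact: measurable_kernel.
have [_ aeT] := hA.2 r z (introT andP (conj r0 rT)).
apply: filterS aeT => w A0 _.
have -> : `[s, +oo[%classic = `[s, T]%classic `|` `]T, +oo[%classic :> set R.
  apply/seteqP; split => x /=; rewrite !in_itv/= !andbT.
    by move=> sx; have [xT|Tx] := leP x T; [left; rewrite sx|right].
  by case=> [/andP[]//|Tx]; apply: le_trans sT _; exact: ltW.
apply/esym; apply: (etrans (measureU (A w) _ _ _)) => //; last first.
  by apply: (etrans (congr1 (fun x => _ + x) A0)); rewrite adde0.
apply/seteqP; split => x //= [] /=; rewrite !in_itv/= !andbT => /andP[_ xT] Tx.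
by have := lt_le_trans Tx xT; rewrite ltxx.
Qed.

Lemma integral_averaged_mass : \int[Q]_w averaged_mass w = (tail A r r z)%:E.
Proof.
have := averaged_mass_fubini hX T z alpha r0 (measurable_cst (1%R : R)) (fun=> ler01).
under eq_integral do rewrite mule1.
move=> ->; rewrite -(mean_measure_tail (lexx r)).
rewrite -[RHS]mul1e -integral_cst; last exact: measurable_itv.
apply: eq_integral => t; rewrite inE /= in_itv/= => /andP[rt _].
have rt' : (0 <= r <= t)%R by rewrite r0.
have := mean_mass hZ hX hgamma hbeta (\d_z : FM) rt'; rewrite mass_dirac => E.
apply: (etrans _ E); apply: eq_integral => w _.
by rewrite mule1 /total_mass massE.
Qed.

Let cell_upper (phis eta a b I : R) : (I <= (phis + eta) * (a - b) ->
  phis * (a - b) <= I + eta * (a - b) -> `|I - phis * (a - b)| <= eta * (a - b))%R.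
Proof. by move=> h1 h2; rewrite ler_norml; apply/andP; split; lra. Qed.

(** By Fubini's theorem the weighted mean is the integral of phi against
alpha, whose tail is that of the mean of A; alpha may have atoms, so cells are
compared through indicators. *)
Lemma mean_spec_averaged_mass :
  exists y, {ae Q, forall w, averaged_mass w = (y w)%:E} /\
    mean_spec y (fun s => tail A r s z).
Proof.
have mY := measurable_averaged_mass hX T alpha r0.
have Y0 w : 0 <= averaged_mass w.
  by apply: integral_ge0 => t _; exact: measure_ge0.
have iY : Q.-integrable setT (fun w => averaged_mass w).
  apply/integrableP; split => //.
  under eq_integral do rewrite gee0_abs//.
  by rewrite integral_averaged_mass ltry.
pose y w := fine (averaged_mass w).
have yE : {ae Q, forall w, averaged_mass w = (y w)%:E}.
  by have := integrable_ae measurableT iY; apply: filterS => w /(_ I) ?; rewrite /y fineK.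
have my : measurable_fun setT y.
  by apply: measurableT_comp; [exact: fine_measurable|exact: mY].
have y0 w : (0 <= y w)%R by exact: fine_ge0.
exists y; split => //; split => //.
  rewrite -integral_averaged_mass; apply: ge0_ae_eq_integral => //.
  - exact/measurable_EFinP.
  - by move=> w _; rewrite lee_fin.
  - by apply: filterS yE => w -> _.
move=> nl hnl; have me := measurable_exp_mass_sum hX r0 hnl.
have e0 w : (0 <= expR (- mass_sum nl w))%R by exact: expR_ge0.
have mwb t : (r <= t)%R -> (0 <= mass_weight nl t <= 1)%R.
  exact: (mass_weight_bounds hZ hX hgamma hbeta z r0 hnl).
pose W t : R := (\1_(`[r, T]%classic : set R) t * mass_weight nl t)%R.
have WE t : (r <= t <= T)%R -> W t = mass_weight nl t.
  by move=> rt; rewrite /W indicE mem_set ?mul1r//= in_itv.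
have W0 t : ~~ (r <= t <= T)%R -> W t = 0%R.
  by move=> rt; rewrite /W indicE memNset ?mul0r//= in_itv/=; exact/negP.
have wE t : (r <= t)%R -> \int[Q]_w (total_mass X t w * (expR (- mass_sum nl w))%:E) =
    (mass_weight nl t)%:E.
  move=> rt; rewrite -(mass_weightE hZ hX hgamma hbeta z r0 hnl rt).
  by apply: eq_integral => w _; rewrite /total_mass massE -EFinM.
have bW : bounded_nneg W.
  split.
  - have H := measurable_weighted_mass (T := T) hX z r0 me e0.
    have H' : measurable_fun `[r, T]%classic (mass_weight nl).
      apply/measurable_EFinP; apply: eq_measurable_fun H => t; rewrite inE/= in_itv/=.
      by move=> /andP[rt _]; rewrite wE.
    have := (measurable_restrictT (mass_weight nl) (measurable_itv `[r, T])).1 H'.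
    apply: eq_measurable_fun => t _; rewrite patchE /W indicE.
    by case: ifPn => _; rewrite ?mul1r ?mul0r.
  - move=> t; have [rt|rt] := boolP (r <= t <= T)%R; last by rewrite W0.
    by rewrite WE//; case/andP: rt => /mwb/andP[].
  - exists 1%R => t; have [rt|rt] := boolP (r <= t <= T)%R; last by rewrite W0.
    by rewrite WE//; case/andP: rt => /mwb/andP[].
pose I s := rint alpha (fun t => ind s t * W t)%R.
have FE s : (r <= s)%R -> tail A r s z = rint alpha (ind s).
  move=> rs; rewrite /rint /ind (integral_indic alpha measurableT (measurable_itv _)) setIT.
  exact: esym (congr1 fine (mean_measure_tail rs)).
have -> : fine (\int[Q]_w ((y w)%:E * (expR (- mass_sum nl w))%:E)) = I r.
  have -> : \int[Q]_w ((y w)%:E * (expR (- mass_sum nl w))%:E) =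
      \int[Q]_w (averaged_mass w * (expR (- mass_sum nl w))%:E).
    apply: ge0_ae_eq_integral => //.
    - apply/measurable_EFinP; exact: measurable_funM.
    - by apply: emeasurable_funM; [exact: mY|exact/measurable_EFinP].
    - by move=> w _; rewrite mule_ge0 ?lee_fin.
    - by move=> w _; rewrite mule_ge0 ?lee_fin.
    - by apply: filterS yE => w -> _.
  rewrite (averaged_mass_fubini hX T z alpha r0 me e0) /I /rint; congr fine.
  rewrite -(integral_indicM alpha `[r, T]%classic).
  apply: eq_integral => t _ /=; rewrite EFinM -/(ind r).
  have [rt|rt] := boolP (r <= t <= T)%R.
    by rewrite WE//; case/andP: rt => rt _; rewrite wE.
  by rewrite /ind indicE memNset ?mul0e//= in_itv/=; exact/negP.
apply: stieltjes_of_cells => [s rs|s t eta rs st close].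
  rewrite (FE s rs) ger0_norm; last first.
    by apply: rint_ge0 => t; apply: mulr_ge0; [case: (bind s) => _ + _; exact|case: bW => _ + _; exact].
  apply: rint_le => [|//|t]; first exact: bounded_nnegM.
  rewrite ler_piMr//.
  have [rt|rt] := boolP (r <= t <= T)%R; last by rewrite W0.
  by rewrite WE//; case/andP: rt => /mwb/andP[].
have rt := le_trans rs st.
have eta0 : (0 <= eta)%R by apply: le_trans (close s _); rewrite ?normr_ge0// lexx.
have ind_le u : (ind t u <= ind s u)%R.
  rewrite !indE; case: ifP => [/andP[tu uT]|_]; last by case: ifP.
  by rewrite (le_trans st tu) uT.
pose c u := (ind s u - ind t u)%R.
have bc : bounded_nneg c.
  split.
  - by apply: measurable_funB; [case: (bind s)|case: (bind t)].
  - by move=> u; rewrite subr_ge0.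
  - by exists 1%R => u; rewrite /c !indE; case: ifP; case: ifP => _ _; lra.
have cF : (tail A r s z - tail A r t z = rint alpha c)%R.
  by rewrite (FE s rs) (FE t rt) -rintB.
have cI : (I s - I t = rint alpha (fun u => c u * W u))%R.
  rewrite /I -rintB; try exact: bounded_nnegM.
    by congr rint; apply/funext => u; rewrite mulrBl.
  by move=> u; apply: ler_wpM2r => //; case: bW.
have supp u : c u != 0%R -> (s <= u <= T)%R && (u <= t)%R.
  rewrite /c !indE; case hs: (s <= u <= T)%R; case ht: (t <= u <= T)%R => //=.
  - by rewrite subrr eqxx.
  - case/andP: hs => _ uT _; move: ht; rewrite uT andbT => /negbT.
    by rewrite -ltNge => /ltW.
  - by case/andP: ht => tu uT; move: hs; rewrite (le_trans st tu) uT.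
  - by rewrite subrr eqxx.
have Wu u : c u != 0%R -> (`|W u - mass_weight nl s| <= eta)%R.
  move=> /supp/andP[/andP[su uT] ut]; rewrite WE ?(le_trans rs su)//.
  by apply: close; rewrite su.
have ws0 : (0 <= mass_weight nl s)%R by case/andP: (mwb s rs).
have cu0 u : (0 <= c u)%R by case: bc.
have E1 : (rint alpha (fun u => c u * W u) <= (mass_weight nl s + eta) * rint alpha c)%R.
  have k0 : (0 <= mass_weight nl s + eta)%R by rewrite addr_ge0.
  rewrite -rintZ//; apply: rint_le => [||u]; [exact: bounded_nnegM|exact: bounded_nnegZ|].
  have [->|cn] := eqVneq (c u) 0%R; first by rewrite mul0r mulr0.
  rewrite mulrC; apply: ler_wpM2r => //.
  by have := Wu u cn; rewrite ler_norml => /andP[_]; rewrite lerBlDl.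
have E2 : (mass_weight nl s * rint alpha c <= rint alpha (fun u => c u * W u) + eta * rint alpha c)%R.
  rewrite -!rintZ// -rintD; [|exact: bounded_nnegM|exact: bounded_nnegZ].
  apply: rint_le => [||u]; [exact: bounded_nnegZ| |].
    by apply: bounded_nnegD; [exact: bounded_nnegM|exact: bounded_nnegZ].
  have [->|cn] := eqVneq (c u) 0%R; first by rewrite mul0r !mulr0 addr0.
  rewrite [(c u * W u)%R]mulrC -mulrDl; apply: ler_wpM2r => //.
  by have := Wu u cn; rewrite ler_norml => /andP[+ _]; rewrite lerBrDr -lerBlDr addrC.
by rewrite -cF -cI in E1 E2; apply: cell_upper.
Qed.

End averaged_mass_mean.

(** * Indicators from exponentials *)

Section thresholds.
Context {R : realType}.
Local Open Scope ring_scope.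

Lemma bernoulli_exp (u : R) (n : nat) : 0 <= u <= 1 ->
  1 - n%:R * u <= (1 - u) ^+ n <= expR (- (n%:R * u)).
Proof.
move=> /andP[u0 u1]; have v0 : 0 <= 1 - u by rewrite subr_ge0.
apply/andP; split.
  elim: n => [|n ih]; first by rewrite mul0r subr0 expr0.
  rewrite exprS -natr1; apply: (@le_trans _ _ ((1 - u) * (1 - n%:R * u))).
    have : 0 <= n%:R * u * u by rewrite !mulr_ge0.
    nra.
  exact: ler_wpM2l.
have -> : expR (- (n%:R * u)) = expR (- u) ^+ n by rewrite -expRM_natl mulrN.
apply: lerXn2r; rewrite ?nnegrE ?expR_ge0//.
by have := expR_ge1Dx (- u).
Qed.

(** The power grows faster than exp ((k + 1) theta), so that (1 - exp (- (k +
1) x)) ^ n tends to 0 when x < theta and still does when x = theta, because of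
the factor k + 1; but slowly enough to tend to 1 when x > theta. *)
Definition threshold_power (theta : R) (k : nat) : nat :=
  (k.+1 * (Num.truncn (expR (k.+1%:R * theta))).+1)%N.

Let decay (d : R) k : 0 < d ->
  k.+1%:R * expR (- (k.+1%:R * d)) <= 4 / d ^+ 2 * harmonic k.
Proof.
move=> d0; set m : R := k.+1%:R; have m0 : 0 < m by rewrite ltr0n.
have e1 : m * d / 2 <= expR (m * d / 2).
  by apply: le_trans (expR_ge1Dx _); lra.
have md : 0 < m * d / 2 by rewrite divr_gt0// mulr_gt0.
have e2 : (m * d / 2) ^+ 2 <= expR (m * d).
  have -> : expR (m * d) = expR (m * d / 2) ^+ 2.
    by rewrite expr2 -expRD; congr expR; lra.
  by rewrite lerXn2r// nnegrE ltW// (lt_le_trans md).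
rewrite expRN ler_pdivrMr ?expR_gt0//.
apply: (@le_trans _ _ (4 / d ^+ 2 * harmonic k * (m * d / 2) ^+ 2)).
  rewrite le_eqVlt; apply/orP; left; apply/eqP.
  by rewrite /harmonic/= -/m; field; rewrite !lt0r_neq0.
have h0 := @harmonic_gt0 R k.
by apply: ler_wpM2l => //; apply: mulr_ge0; [rewrite divr_ge0// sqr_ge0|exact: ltW].
Qed.

Lemma cvg_threshold (theta x : R) : 0 <= theta -> 0 <= x ->
  (1 - expR (- (k.+1%:R * x))) ^+ threshold_power theta k @[k --> \oo] -->
  (if theta < x then 1 else 0 : R).
Proof.
move=> t0 x0.
have u01 k : 0 <= expR (- (k.+1%:R * x)) <= 1.
  by rewrite expR_ge0 -[leRHS]expR0 ler_expR oppr_le0 mulr_ge0.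
have pow k : (threshold_power theta k)%:R =
    k.+1%:R * (Num.truncn (expR (k.+1%:R * theta))).+1%:R :> R by rewrite natrM.
have trunc_up k : (Num.truncn (expR (k.+1%:R * theta))).+1%:R <= expR (k.+1%:R * theta) + 1.
  by rewrite -natr1 lerD2r truncn_le expR_ge0.
have [tx|xt] := ltP theta x.
- have d0 : 0 < x - theta by rewrite subr_gt0.
  apply: (@cvg_dist_harmonic _ _ (fun=> 1) (2 * (4 / (x - theta) ^+ 2)) 0 1 1 ltr01); last exact: cvg_cst.
  move=> k; rewrite mul0r addr0.
  have /andP[lo _] := bernoulli_exp (threshold_power theta k) (u01 k).
  have /andP[v0 v1] := u01 k.
  have le1 : (1 - expR (- (k.+1%:R * x))) ^+ threshold_power theta k <= 1.
    by apply: exprn_ile1; [rewrite subr_ge0|rewrite gerBl].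
  rewrite distrC ger0_norm ?subr_ge0//.
  apply: (@le_trans _ _ ((threshold_power theta k)%:R * expR (- (k.+1%:R * x)))).
    by move: lo; lra.
  rewrite -mulrA; apply: (@le_trans _ _ (2 * (k.+1%:R * expR (- (k.+1%:R * (x - theta)))))); last first.
    by rewrite ler_pM2l//; exact: decay.
  rewrite pow -mulrA [leRHS]mulrCA ler_pM2l ?ltr0n//.
  have E : expR (- (k.+1%:R * (x - theta))) = expR (k.+1%:R * theta) * expR (- (k.+1%:R * x)).
    by rewrite -expRD; congr expR; ring.
  rewrite E mulrA; apply: ler_wpM2r => //.
  have := trunc_up k; have : 1 <= expR (k.+1%:R * theta).
    by rewrite -[leLHS]expR0 ler_expR mulr_ge0.
  lra.
- apply: (@cvg_dist_harmonic _ _ (fun=> 0) 1 0 1 0 ltr01); last exact: cvg_cst.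
  move=> k; rewrite mul0r addr0 mul1r subr0.
  have /andP[_ hi] := bernoulli_exp (threshold_power theta k) (u01 k).
  have /andP[v0 v1] := u01 k.
  rewrite ger0_norm; last by rewrite exprn_ge0// subr_ge0.
  apply: (le_trans hi).
  have K0 : 0 < k.+1%:R :> R by rewrite ltr0n.
  have nu : k.+1%:R <= (threshold_power theta k)%:R * expR (- (k.+1%:R * x)).
    rewrite pow -mulrA ler_peMr ?(ltW K0)//.
    have E : expR (k.+1%:R * theta) * expR (- (k.+1%:R * theta)) = 1.
      by rewrite -expRD subrr expR0.
    rewrite -[leLHS]E; apply: ler_pM; rewrite ?expR_ge0//.
      exact/ltW/truncnS_gt.
    by rewrite ler_expR lerN2 ler_wpM2l// ltW.
  apply: (@le_trans _ _ (expR (- k.+1%:R))); first by rewrite ler_expR lerN2.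
  rewrite expRN /harmonic/= lef_pV2 ?posrE ?expR_gt0//.
  by apply: le_trans (expR_ge1Dx _); lra.
Qed.

End thresholds.

(** * Equality of integrals over the mass sigma-algebra *)

Section agreement.
Context {R : realType} {d d' : measure_display}.
Context {Omega : measurableType d} {Omega' : measurableType d'}.
Context {S : ptopologicalType}.
Variables (Z : R -> Omega -> S) (F : set R -> set (set Omega)).
Variable P : R -> probability (borel S) R -> probability Omega R.
Variables (gamma beta : R).
Variables (X : R -> Omega' -> finmeas (borel S) R).
Variable G : set R -> set (set Omega').
Variable PX : R -> probability (finmeas (borel S) R) R -> probability Omega' R.
Hypothesis hZ : @markov_process R d _ Omega (borel S) Z F P.
Hypothesis hX : superprocess Z P gamma beta X G PX.
Hypothesis hgamma : (0 < gamma)%R.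
Hypothesis hbeta : (0 < beta <= 1)%R.

Local Notation FM := (finmeas (borel S) R).

Let hXm : markov_process X G PX := super_markov hX.

Local Notation mass_sum l w := (@mass_sum R d' Omega' S X l w).

Variables (r : R) (z : borel S) (j y : Omega' -> R) (c : R).
Hypothesis r0 : (0 <= r)%R.

Local Notation Q := (PX r \d_(\d_z : FM)).

Hypotheses (mj : measurable_fun setT j) (my : measurable_fun setT y).
Hypotheses (j0 : forall w, (0 <= j w)%R) (y0 : forall w, (0 <= y w)%R).
Hypotheses (jc : \int[Q]_w (j w)%:E = c%:E) (yc : \int[Q]_w (y w)%:E = c%:E).
Hypothesis agree_sorted : forall l, sorted_after r l ->
  \int[Q]_w (j w * expR (- mass_sum l w))%:E = \int[Q]_w (y w * expR (- mass_sum l w))%:E.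

Definition agree (f : Omega' -> R) : Prop :=
  \int[Q]_w (j w * f w)%:E = \int[Q]_w (y w * f w)%:E.

Definition unit_valued (f : Omega' -> R) : Prop :=
  measurable_fun setT f /\ forall w, (0 <= f w <= 1)%R.

Let mweight (h f : Omega' -> R) : measurable_fun setT h -> unit_valued f ->
  measurable_fun setT (fun w => (h w * f w)%:E).
Proof. by move=> mh [mf _]; apply/measurable_EFinP; exact: measurable_funM. Qed.

Let weight0 (h f : Omega' -> R) w : (forall w, 0 <= h w)%R -> unit_valued f ->
  0 <= (h w * f w)%:E.
Proof. by move=> h0 [_ f01]; rewrite lee_fin mulr_ge0//; case/andP: (f01 w). Qed.

Let integrable_of (h : Omega' -> R) : measurable_fun setT h -> (forall w, 0 <= h w)%R ->
  \int[Q]_w (h w)%:E = c%:E -> Q.-integrable setT (EFin \o h).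
Proof.
move=> mh h0 hc; apply/integrableP; split; first exact/measurable_EFinP.
have -> : \int[Q]_w `|(EFin \o h) w| = c%:E.
  by rewrite -hc; apply: eq_integral => w _; rewrite gee0_abs// lee_fin.
exact: ltry.
Qed.

Lemma unit_valuedM f g : unit_valued f -> unit_valued g ->
  unit_valued (fun w => f w * g w)%R.
Proof.
move=> [mf f01] [mg g01]; split; first exact: measurable_funM.
move=> w; have /andP[f0 f1] := f01 w; have /andP[g0 g1] := g01 w.
by rewrite mulr_ge0// mulr_ile1.
Qed.

(** Dominated convergence, j and y themselves being the dominating functions.
*)
Lemma agree_limit (f_ : nat -> Omega' -> R) (f : Omega' -> R) :
  (forall n, unit_valued (f_ n)) -> unit_valued f ->
  {ae Q, forall w, f_ n w @[n --> \oo] --> f w} ->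
  (forall n, agree (f_ n)) -> agree f.
Proof.
move=> uf_ uf cf af.
have lim (h : Omega' -> R) : measurable_fun setT h -> (forall w, 0 <= h w)%R ->
    \int[Q]_w (h w)%:E = c%:E ->
    \int[Q]_w (h w * f_ n w)%:E @[n --> \oo] --> \int[Q]_w (h w * f w)%:E.
  move=> mh h0 hc.
  have [|||||_ _ H] := @dominated_convergence _ _ _ Q setT measurableT
    (fun n w => (h w * f_ n w)%:E) (fun w => (h w * f w)%:E) (EFin \o h).
  - by move=> n; exact: mweight.
  - exact: mweight.
  - apply: filterS cf => w cw _; apply: cvg_EFin; first exact: nearW.
    by apply: cvgMr; exact: cw.
  - exact: integrable_of.
  - apply: aeW => w n _; have [_ f01] := uf_ n; have /andP[f0 f1] := f01 w.
    by rewrite gee0_abs ?lee_fin ?mulr_ge0//= ler_piMr.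
  exact: H.
rewrite /agree; apply: (@cvg_unique _ _ (\int[Q]_w (j w * f_ n w)%:E @[n --> \oo])) => //.
  exact: lim.
rewrite (_ : (fun n => _) = fun n => \int[Q]_w (y w * f_ n w)%:E); last first.
  by apply/funext => n; exact: af.
exact: lim.
Qed.

Definition admissible (l : seq (R * R)) : bool :=
  all (fun p => (r <= p.1)%R && (0 <= p.2)%R) l.

Lemma mass_sum_nil w : mass_sum [::] w = 0%R.
Proof. exact: big_nil. Qed.

(** The tilted means were computed for increasing times. *)
Lemma mass_sum_sort l : admissible l ->
  exists2 l', sorted_after r l' & forall w, mass_sum l' w = mass_sum l w.
Proof.
move=> al; pose le (p q : R * R) := (p.1 <= q.1)%R.
exists (sort le l); last first.
  by move=> w; apply: perm_mass_sum; rewrite perm_sort.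
split; last first.
  by rewrite all_sort; apply: sub_all al => p /andP[].
have le_tot : total le by move=> p q; exact: le_total.
have := sort_sorted le_tot l.
rewrite path_min_sorted; last first.
  by rewrite all_map all_sort; apply: sub_all al => p /andP[].
by rewrite sorted_map.
Qed.

Lemma measurable_mass_sum l : admissible l -> measurable_fun setT (fun w => mass_sum l w).
Proof.
move=> /mass_sum_sort[l' hl' E].
have := adapted_measurable hXm (time_interval_cy r0) (adapted_mass_sum hX r0 hl').
by apply: eq_measurable_fun => w _; rewrite E.
Qed.

Lemma mass_sum_admissible_ge0 l w : admissible l -> (0 <= mass_sum l w)%R.
Proof. by move=> /mass_sum_sort[l' hl' E]; rewrite -E; exact: mass_sum_ge0 hl'. Qed.

Lemma unit_valued_exp l : admissible l -> unit_valued (fun w => expR (- mass_sum l w))%R.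
Proof.
move=> al; split.
  by apply: measurableT_comp => //; apply: measurableT_comp => //; exact: measurable_mass_sum.
move=> w; rewrite expR_ge0 -[leRHS]expR0 ler_expR oppr_le0.
exact: mass_sum_admissible_ge0.
Qed.

(** Agreement against a product with every exponential, a form that is stable
under multiplication by further factors 1 - exp (- a M_t). *)
Definition test_weight (xi : Omega' -> R) : Prop :=
  unit_valued xi /\ forall l, admissible l ->
    agree (fun w => xi w * expR (- mass_sum l w))%R.

Lemma test_weight1 : test_weight (fun=> 1%R).
Proof.
split; first by split => // w; rewrite ler01 lexx.
move=> l /mass_sum_sort[l' hl' E]; rewrite /agree.
have H := agree_sorted hl'.
have {}H : \int[Q]_w (j w * expR (- mass_sum l w))%:E = \int[Q]_w (y w * expR (- mass_sum l w))%:E.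
  by under eq_integral do rewrite -E; under [RHS]eq_integral do rewrite -E.
transitivity (\int[Q]_w (j w * expR (- mass_sum l w))%:E).
  by apply: eq_integral => w _; rewrite mul1r.
by rewrite H; apply: eq_integral => w _; rewrite mul1r.
Qed.

Lemma test_weight_limit (f_ : nat -> Omega' -> R) (f : Omega' -> R) :
  unit_valued f -> (forall w, f_ n w @[n --> \oo] --> f w) ->
  (forall n, test_weight (f_ n)) -> test_weight f.
Proof.
move=> uf cf tf; split => // l al; have ue := unit_valued_exp al.
apply: (agree_limit (f_ := fun n w => f_ n w * expR (- mass_sum l w))%R).
- by move=> n; apply: unit_valuedM => //; case: (tf n).
- exact: unit_valuedM.
- by apply: aeW => w; apply: cvgMl; exact: cf.
- by move=> n; case: (tf n) => _; apply.
Qed.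

(** The product is a difference of two weights of the form xi times an
exponential, for both of which agreement is known; subtraction is legitimate
because the integrals are finite. *)
Lemma test_weight_factor xi (t a : R) : (r <= t)%R -> (0 <= a)%R -> test_weight xi ->
  test_weight (fun w => xi w * (1 - expR (- (a * mass (X t w)))))%R.
Proof.
move=> rt a0 [uxi txi].
have mm := measurable_mass_process hX (le_trans r0 rt).
have ue : unit_valued (fun w => expR (- (a * mass (X t w))))%R.
  split; first by apply: measurableT_comp => //; apply: measurableT_comp => //; exact: measurable_funM.
  by move=> w; rewrite expR_ge0 -[leRHS]expR0 ler_expR oppr_le0 mulr_ge0// mass_ge0.
have uc : unit_valued (fun w => 1 - expR (- (a * mass (X t w))))%R.
  have [me e01] := ue; split; first exact: measurable_funB.
  by move=> w; have /andP[? ?] := e01 w; apply/andP; split; lra.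
split; first exact: unit_valuedM.
move=> l al; have ul := unit_valued_exp al.
have al' : admissible ((t, a) :: l) by rewrite /admissible /= rt a0.
have A1 := txi l al; have A2 := txi _ al'.
pose u w := (xi w * (1 - expR (- (a * mass (X t w)))) * expR (- mass_sum l w))%R.
pose v w := (xi w * expR (- mass_sum ((t, a) :: l) w))%R.
have uu : unit_valued u by apply: unit_valuedM => //; exact: unit_valuedM.
have uv : unit_valued v by apply: unit_valuedM => //; exact: unit_valued_exp.
have E w : (xi w * expR (- mass_sum l w) = u w + v w)%R.
  rewrite /u /v mass_sum_cons opprD expRD /=; ring.
have dec (h : Omega' -> R) : measurable_fun setT h -> (forall w, 0 <= h w)%R ->
    \int[Q]_w (h w * (xi w * expR (- mass_sum l w)))%:E =
    \int[Q]_w (h w * u w)%:E + \int[Q]_w (h w * v w)%:E.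
  move=> mh h0; rewrite -integralD_ge0.
  - by apply: eq_integral => w _; rewrite E mulrDr EFinD.
  - exact: mweight.
  - by move=> w; exact: weight0.
  - exact: mweight.
  - by move=> w; exact: weight0.
rewrite /agree in A1 A2 *; rewrite (dec j mj j0) (dec y my y0) A2 in A1.
have fin : \int[Q]_w (y w * v w)%:E \is a fin_num.
  rewrite ge0_fin_numE; last by apply: integral_ge0 => w _; exact: weight0.
  apply: (@le_lt_trans _ _ c%:E); last exact: ltry.
  rewrite -yc; apply: integral_le_ge0.
  - exact: mweight.
  - by move=> w; exact: weight0.
  - exact/measurable_EFinP.
  - move=> w; rewrite lee_fin ler_piMr//.
    by case: uv => _ /(_ w)/andP[].
by move: A1; move/(congr1 (fun x => x - \int[Q]_w (y w * v w)%:E)); rewrite !addeK.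
Qed.

Lemma test_weight_threshold xi (t theta : R) : (r <= t)%R -> test_weight xi ->
  test_weight (fun w => xi w * (if theta < mass (X t w) then 1 else 0))%R.
Proof.
move=> rt txi.
have mm := measurable_mass_process hX (le_trans r0 rt).
wlog t0 : theta / (0 <= theta)%R => [H|].
  have [/H//|neg] := leP 0%R theta.
  rewrite (_ : (fun w => _) = xi)//; apply/funext => w.
  by rewrite (lt_le_trans neg (mass_ge0 _)) mulr1.
have uind : unit_valued (fun w => if (theta < mass (X t w))%R then 1 else 0)%R.
  split; last by move=> w; case: ifP => _; rewrite ?lexx ?ler01.
  apply: measurable_fun_ifT => //.
  by apply: measurable_fun_ltr => //; exact: measurable_cst.
have [uxi _] := txi.
apply: (test_weight_limit (f_ := fun k w => xi w *
    (1 - expR (- (k.+1%:R * mass (X t w)))) ^+ threshold_power theta k)%R).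
- exact: unit_valuedM.
- by move=> w; apply: cvgMr; apply: cvg_threshold => //; exact: mass_ge0.
move=> k; elim: (threshold_power theta k) => [|n ih].
  by rewrite (_ : (fun w => _) = xi)//; apply/funext => w; rewrite expr0 mulr1.
rewrite (_ : (fun w => _) = (fun w => xi w * (1 - expR (- (k.+1%:R * mass (X t w)))) ^+ n *
    (1 - expR (- (k.+1%:R * mass (X t w)))))%R); last first.
  by apply/funext => w; rewrite exprSr mulrA.
exact: test_weight_factor.
Qed.

Definition threshold_set (l : seq (R * R)) : set Omega' :=
  [set w | all (fun p => p.2 < mass (X p.1 w))%R l].

Definition threshold_sets : set (set Omega') :=
  [set C | exists2 l, all (fun p => r <= p.1)%R l & C = threshold_set l].

Lemma threshold_sets_closed : setI_closed threshold_sets.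
Proof.
move=> _ _ [l hl ->] [l' hl' ->]; exists (l ++ l'); first by rewrite all_cat hl.
by apply/seteqP; split => w; rewrite /threshold_set /= all_cat; [move=> [-> ->]|move=> /andP].
Qed.

Lemma test_weight_threshold_set l : all (fun p => r <= p.1)%R l ->
  test_weight (\1_(threshold_set l) : Omega' -> R).
Proof.
elim: l => [_|p l ih /= /andP[rp hl]].
  rewrite (_ : \1_(threshold_set [::]) = fun=> 1%R); first exact: test_weight1.
  by apply/funext => w; rewrite indicE mem_set.
have := test_weight_threshold p.2 rp (ih hl).
rewrite (_ : (fun w => _) = (\1_(threshold_set (p :: l)) : Omega' -> R))//.
apply/funext => w; rewrite !indicE; case: ifPn => pw.
  rewrite mulr1; congr (_%:R); congr (nat_of_bool _).
  by apply/idP/idP; rewrite !inE /threshold_set /= pw.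
rewrite mulr0 memNset//= /threshold_set /= (negbTE pw).
by [].
Qed.

Lemma measurable_threshold_sets : <<s threshold_sets >> `<=` measurable.
Proof.
apply: smallest_sub; first exact: sigma_algebra_measurable.
move=> _ [l hl ->]; have [[m _] _] := test_weight_threshold_set hl.
exact: (measurable_indicP R (threshold_set l)).2 m.
Qed.

(** Threshold sets are stable under intersection, and agreement is stable
under complements because the total integrals are equal and finite: Dynkin's
theorem applies. *)
Lemma agree_threshold_sets C : <<s threshold_sets >> C ->
  \int[Q]_(w in C) (j w)%:E = \int[Q]_(w in C) (y w)%:E.
Proof.
pose TT := g_sigma_algebraType threshold_sets.
have mT (B : set TT) : measurable B -> @measurable _ Omega' B.
  exact: measurable_threshold_sets.
have mj' : measurable_fun setT (fun w => (j w)%:E) by exact/measurable_EFinP.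
have my' : measurable_fun setT (fun w => (y w)%:E) by exact/measurable_EFinP.
apply: (@dynkin_induction _ TT threshold_sets
  (fun C => \int[Q]_(w in C) (j w)%:E = \int[Q]_(w in C) (y w)%:E)) => //.
- exact: threshold_sets_closed.
- by rewrite jc yc.
- move=> _ [l hl ->]; have [_ tw] := test_weight_threshold_set hl.
  have := tw [::] isT; rewrite /agree => H.
  rewrite -[LHS]integral_indicM -[RHS]integral_indicM.
  transitivity (\int[Q]_w (j w * (\1_(threshold_set l) w * expR (- mass_sum [::] w)))%:E).
    apply: eq_integral => w _; rewrite mass_sum_nil oppr0 expR0 mulr1 /= -EFinM.
    by rewrite mulrC.
  rewrite H; apply: eq_integral => w _; rewrite mass_sum_nil oppr0 expR0 mulr1 /= -EFinM.
  by rewrite mulrC.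
- move=> B /mT mB EB.
  have split_ (h : Omega' -> R) : measurable_fun setT h -> (forall w, 0 <= h w)%R ->
      \int[Q]_w (h w)%:E = \int[Q]_(w in B) (h w)%:E + \int[Q]_(w in ~` B) (h w)%:E.
    move=> mh h0; rewrite -ge0_integral_setU//; first by rewrite setUCr.
    - exact: measurableC.
    - by rewrite setUCr; exact/measurable_EFinP.
    - by move=> w _; rewrite lee_fin.
    - by rewrite disj_set2E setICr.
  have := split_ j mj j0; rewrite jc -yc (split_ y my y0) EB.
  have fin : \int[Q]_(w in B) (y w)%:E \is a fin_num.
    rewrite ge0_fin_numE; last by apply: integral_ge0 => w _; rewrite lee_fin.
    apply: (@le_lt_trans _ _ c%:E); last exact: ltry.
    rewrite -yc; apply: ge0_subset_integral => //.
    by move=> w _; rewrite lee_fin.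
  rewrite [X in X = _ -> _]addeC [X in _ = X -> _]addeC => E.
  by have := congr1 (fun x => x - \int[Q]_(w in B) (y w)%:E) E; rewrite !addeK.
- move=> B mB tB EB.
  rewrite !ge0_integral_bigcup//; first by apply: eq_eseriesr => n _; exact: EB.
  + by move=> n; exact: mT.
  + exact: measurable_funTS.
  + by move=> w _; rewrite lee_fin.
  + by move=> n; exact: mT.
  + exact: measurable_funTS.
  + by move=> w _; rewrite lee_fin.
Qed.

Lemma measurable_mass_thresholds (t : R) : (r <= t)%R ->
  measurable_fun [set: g_sigma_algebraType threshold_sets] (fun w => total_mass X t w).
Proof.
move=> rt.
have : measurable_fun [set: g_sigma_algebraType threshold_sets] (fun w => mass (X t w)).
  apply: (measurability _ (RGenOInfty.measurableE R)) => _ [_ [a ->] <-].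
  rewrite setTI; apply: sub_gen_smallest; exists [:: (t, a)]; first by rewrite /= rt.
  by apply/seteqP; split => w /=; rewrite /threshold_set /= in_itv/= !andbT.
move=> /measurable_EFinP; apply: eq_measurable_fun => w _.
by rewrite /total_mass massE.
Qed.

Lemma mass_sigma_algebra_thresholds (T : R) :
  mass_sigma_algebra X r T `<=` <<s threshold_sets >>.
Proof.
apply: smallest_sub; first exact: smallest_sigma_algebra.
move=> _ [t [B [/andP[rt _] mB ->]]].
by have := measurable_mass_thresholds rt measurableT mB; rewrite setTI.
Qed.

End agreement.

(** * Riemann sums of the averaged mass *)

Section riemann_sums.
Context {R : realType} {d d' : measure_display}.
Context {Omega : measurableType d} {Omega' : measurableType d'}.
Context {S : ptopologicalType}.
Variables (Z : R -> Omega -> S) (F : set R -> set (set Omega)).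
Variable P : R -> probability (borel S) R -> probability Omega R.
Variables (gamma beta : R).
Variables (X : R -> Omega' -> finmeas (borel S) R).
Variable G : set R -> set (set Omega').
Variable PX : R -> probability (finmeas (borel S) R) R -> probability Omega' R.
Hypothesis hZ : @markov_process R d _ Omega (borel S) Z F P.
Hypothesis hX : superprocess Z P gamma beta X G PX.
Hypothesis hgamma : (0 < gamma)%R.
Hypothesis hbeta : (0 < beta <= 1)%R.

Local Notation FM := (finmeas (borel S) R).

Local Notation mass_sum l w := (@mass_sum R d' Omega' S X l w).

Variables (r T : R) (z : borel S) (alpha : {finite_measure set R -> \bar R}).
Hypotheses (r0 : (0 <= r)%R) (rT : (r <= T)%R).

Local Notation Q := (PX r \d_(\d_z : FM)).
Local Notation averaged_mass w := (@averaged_mass R d' Omega' S X r T alpha w).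
Local Notation m t w := (mass (X t w)).
Local Notation clamp t := (@clamp R r T t).

Let measurable_m : measurable_fun setT (fun p : R * Omega' => m (clamp p.1) p.2).
Proof.
have H : measurable_fun setT (fun p : R * Omega' => fine (total_mass X (clamp p.1) p.2)).
  apply: measurableT_comp; first exact: fine_measurable.
  exact: (measurable_clamped hX T r0).
exact: H.
Qed.

Let mw (s : R) : (r <= s)%R -> measurable_fun setT (fun w => m s w).
Proof. by move=> rs; exact: (measurable_mass_process hX (le_trans r0 rs)). Qed.

Let gap (I : set R) (s : R) (w : Omega') : \bar R :=
  \int[alpha]_(t in I) (`|m (clamp t) w - m s w|)%:E.

Let mgap (s : R) : (r <= s)%R ->
  measurable_fun setT (fun p : R * Omega' => (`|m (clamp p.1) p.2 - m s p.2|)%:E).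
Proof.
move=> rs; apply/measurable_EFinP; apply: measurableT_comp => //.
apply: measurable_funB; first exact: measurable_m.
exact: (measurableT_comp (mw rs) measurable_snd).
Qed.

Let mind (I : set R) : measurable I ->
  measurable_fun setT (fun p : R * Omega' => (\1_I p.1 : R)%:E).
Proof.
move=> mI; have m1 : measurable_fun setT (\1_I : R -> R) by apply/measurable_indicP.
by apply/measurable_EFinP; exact: (measurableT_comp m1 measurable_fst).
Qed.

(** Fubini's theorem and the continuity in mean of the total mass. *)
Lemma gap_spec (I : set R) (s eta : R) : measurable I -> (r <= s)%R -> (0 <= eta)%R ->
  I `<=` `[r, T]%classic ->
  (forall t, I t -> \int[Q]_w (`|m t w - m s w|)%:E <= eta%:E) ->
  measurable_fun setT (gap I s) /\ \int[Q]_w gap I s w <= eta%:E * alpha I.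
Proof.
move=> mI rs eta0 sub close.
pose K (p : R * Omega') := (\1_I p.1)%:E * (`|m (clamp p.1) p.2 - m s p.2|)%:E : \bar R.
have mK : measurable_fun setT K by apply: emeasurable_funM; [exact: mind|exact: mgap].
have K0 p : 0 <= K p by rewrite /K mule_ge0 ?lee_fin.
have gapE w : gap I s w = \int[alpha]_t K (t, w).
  by rewrite /gap -(integral_indicM alpha I).
split.
  have := measurable_fun_fubini_tonelli_G (m1 := alpha) K mK K0.
  by apply: eq_measurable_fun => w _; rewrite /fubini_G gapE.
under eq_integral do rewrite gapE.
rewrite -(fubini_tonelli (m1 := alpha) (m2 := Q) K mK K0).
have ma (t : R) : measurable_fun setT (fun w => (`|m (clamp t) w - m s w|)%:E).
  exact: (measurableT_comp (mgap rs) (pair1_measurable t)).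
apply: (@le_trans _ _ (\int[alpha]_t ((\1_I t)%:E * eta%:E))); last first.
  rewrite (integral_indicM alpha I (fun=> eta%:E)).
  by rewrite integral_cst.
apply: ge0_le_integral => //.
- by move=> t _; apply: integral_ge0.
- exact: (measurable_fun_fubini_tonelli_F (m2 := Q) K mK K0).
- apply: emeasurable_funM => //.
  by apply/measurable_EFinP/measurable_indicP.
move=> t _; rewrite /K /=.
have i0 : (0 <= \1_I t :> R)%R by [].
have a0 w : 0 <= (`|m (clamp t) w - m s w|)%:E by rewrite lee_fin.
rewrite (integralZ_ge0 Q i0 (ma t) a0) indicE.
have [It|It] := boolP (t \in I); last by rewrite !mul0e.
rewrite !mul1e; have It' : I t by rewrite inE in It.
by rewrite (clamp_id (sub _ It')); exact: close.
Qed.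

Let mtime (w : Omega') (I : set R) : I `<=` `[r, T]%classic -> measurable I ->
  measurable_fun I (fun t => total_mass X t w).
Proof.
move=> sub mI.
have H : measurable_fun setT (fun t => total_mass X (clamp t) w).
  exact: (measurableT_comp (measurable_clamped hX T r0) (pair2_measurable w)).
have H' : measurable_fun I (fun t => total_mass X (clamp t) w) by exact: measurable_funS H.
by apply: eq_measurable_fun H' => t; rewrite inE => It; rewrite (clamp_id (sub _ It)).
Qed.

Let cell_estimate (I : set R) (s : R) w : measurable I -> (r <= s)%R ->
  I `<=` `[r, T]%classic ->
  \int[alpha]_(t in I) total_mass X t w <= (fine (alpha I) * m s w)%:E + gap I s w /\
  (fine (alpha I) * m s w)%:E <= \int[alpha]_(t in I) total_mass X t w + gap I s w.
Proof.
move=> mI rs sub.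
have ma : measurable_fun I (fun t => (`|m (clamp t) w - m s w|)%:E).
  apply: (measurable_funS measurableT) => //.
  exact: (measurableT_comp (mgap rs) (pair2_measurable w)).
have E : (fine (alpha I) * m s w)%:E = \int[alpha]_(t in I) (m s w)%:E.
  by rewrite integral_cst// muleC EFinM fineK// fin_num_measure.
have tE t : I t -> total_mass X t w = (m (clamp t) w)%:E.
  by move=> It; rewrite (clamp_id (sub _ It)) /total_mass massE.
rewrite E /gap; split; rewrite -ge0_integralD//.
- apply: ge0_le_integral => //.
  + exact: mtime.
  + exact: emeasurable_funD.
  + move=> t It; rewrite tE// -EFinD lee_fin -lerBlDl; exact: ler_norm.
- by move=> t _; rewrite lee_fin mass_ge0.
- apply: ge0_le_integral => //.
  + by move=> t _; rewrite lee_fin mass_ge0.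
  + by apply: emeasurable_funD => //; exact: mtime.
  + move=> t It; rewrite tE// -EFinD lee_fin -lerBlDl distrC; exact: ler_norm.
- exact: mtime.
Qed.

Definition mass_times (l : seq (R * R)) : bool :=
  all (fun p => (r <= p.1 <= T)%R && (0 <= p.2)%R) l.

(** Cells are short enough for the mass to vary little in mean. The error is
stated by two one-sided inequalities because the averaged mass is not known to
be finite everywhere. *)
Lemma averaged_mass_approx (eps : R) : (0 < eps)%R -> exists l D,
  [/\ mass_times l, measurable_fun setT D, forall w, 0 <= D w,
      \int[Q]_w D w <= eps%:E &
      forall w, averaged_mass w <= (mass_sum l w)%:E + D w /\
        (mass_sum l w)%:E <= averaged_mass w + D w].
Proof.
move=> eps0.
have a1 : (0 < mass alpha + 1)%R by have := mass_ge0 alpha; lra.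
(* the errors of the cells add up to eta times the mass of alpha *)
pose eta := (eps / (mass alpha + 1))%R.
have eta0 : (0 < eta)%R by rewrite divr_gt0.
have [delta d0 close] := mass_L1_continuous hZ hX hgamma hbeta T r0 (mass_dirac R z) eta0.
pose Y s w := \int[alpha]_(t in `[s, T]) total_mass X t w.
have claim n (s : R) : (r <= s)%R -> (T < s + n%:R * delta)%R -> exists l D,
    [/\ mass_times l, measurable_fun setT D, forall w, 0 <= D w,
      \int[Q]_w D w <= eta%:E * alpha `[s, T]%classic &
      forall w, Y s w <= (mass_sum l w)%:E + D w /\ (mass_sum l w)%:E <= Y s w + D w].
  have empty (u : R) : (T < u)%R -> exists l D,
      [/\ mass_times l, measurable_fun setT D, forall w, 0 <= D w,
      \int[Q]_w D w <= eta%:E * alpha `[u, T]%classic &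
      forall w, Y u w <= (mass_sum l w)%:E + D w /\ (mass_sum l w)%:E <= Y u w + D w].
    move=> Tu; exists [::], (fun=> 0); rewrite /Y.
    rewrite (_ : `[u, T]%classic = set0 :> set R); last by rewrite set_itv_ge// bnd_simp -ltNge.
    rewrite measure0 mule0 integral0; split => // w.
    by rewrite integral_set0 mass_sum_nil adde0 lexx.
  elim: n s => [|n ih] s rs; first by rewrite mul0r addr0; exact: empty.
  move=> hn; have [sT|] := leP s T; last exact: empty.
  have rs' : (r <= s + delta)%R by rewrite (le_trans rs)// lerDl ltW.
  have hn' : (T < s + delta + n%:R * delta)%R.
    by move: hn; rewrite -natr1 mulrDl mul1r [(n%:R * delta + delta)%R]addrC addrA.
  have [l [D [h1 h2 h3 h4 h5]]] := ih _ rs' hn'.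
  pose I : set R := `[s, T]%classic `&` `[s, (s + delta)%R[%classic.
  have mI : measurable I by apply: measurableI; exact: measurable_itv.
  have mJ : measurable (`[(s + delta)%R, T]%classic : set R) by exact: measurable_itv.
  have IJ : `[s, T]%classic = I `|` `[(s + delta)%R, T]%classic :> set R.
    apply/seteqP; split => x; rewrite /I /=; rewrite !in_itv/=.
      move=> /andP[sx xT]; have [xd|dx] := ltP x (s + delta)%R.
        by left; rewrite sx xT.
      by right; rewrite xT.
    case=> [[]//|/andP[dx ->]]; rewrite andbT.
    by apply: le_trans dx; rewrite lerDl ltW.
  have dIJ : I `&` `[(s + delta)%R, T]%classic = set0.
    apply/seteqP; split => x //; rewrite /I /= !in_itv/= => -[[_ /andP[_ xd]] /andP[dx _]].
    by have := lt_le_trans xd dx; rewrite ltxx.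
  have subI : I `<=` `[r, T]%classic.
    by move=> x; rewrite /I /= !in_itv/= => -[/andP[sx ->] _]; rewrite (le_trans rs sx).
  have subJ : `[(s + delta)%R, T]%classic `<=` (`[r, T]%classic : set R).
    by move=> x /=; rewrite !in_itv/= => /andP[sx ->]; rewrite (le_trans rs' sx).
  have closeI t : I t -> \int[Q]_w (`|m t w - m s w|)%:E <= eta%:E.
    rewrite /I /= !in_itv/= => -[/andP[st tT] /andP[_ td]].
    by apply: close => //; rewrite lerBlDl ltW.
  have [mg gi] := gap_spec mI rs (ltW eta0) subI closeI.
  have g0 w : 0 <= gap I s w by apply: integral_ge0 => t _; rewrite lee_fin.
  exists ((s, fine (alpha I)) :: l), (fun w => gap I s w + D w); split.
  - by rewrite /mass_times /= rs sT fine_ge0.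
  - exact: emeasurable_funD.
  - by move=> w; rewrite adde_ge0.
  - rewrite (integralD_ge0 Q mg g0 h2 h3) IJ.
    rewrite [X in _ <= _ * X](_ : _ = alpha I + alpha `[(s + delta)%R, T]%classic); last exact: measureU.
    by rewrite muleDr ?fin_num_adde_defr ?fin_num_measure//; apply: leeD.
  - move=> w; have [c1 c2] := cell_estimate w mI rs subI; have [k1 k2] := h5 w.
    have YE : Y s w = \int[alpha]_(t in I) total_mass X t w + Y (s + delta)%R w.
      rewrite /Y IJ ge0_integral_setU//.
      + by rewrite -IJ; apply: mtime => //; move=> x /=; rewrite !in_itv/= => /andP[sx ->];
          rewrite (le_trans rs sx).
      + by rewrite disj_set2E dIJ.
    rewrite YE mass_sum_cons /= EFinD; split.
      by rewrite [leRHS]addeACA; apply: leeD; [exact: c1|exact: k1].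
    by rewrite [leRHS]addeACA; apply: leeD; [exact: c2|exact: k2].
have [n hn] : exists n : nat, (T < r + n%:R * delta)%R.
  exists (Num.truncn ((T - r) / delta)).+1.
  by rewrite -ltrBlDl -ltr_pdivrMr// truncnS_gt.
have [l [D [h1 h2 h3 h4 h5]]] := claim n r (lexx r) hn.
exists l, D; split => //; apply: (le_trans h4).
apply: (@le_trans _ _ (eta%:E * (mass alpha)%:E)).
  apply: lee_wpmul2l; first by rewrite lee_fin ltW.
  by rewrite -massE; apply: le_measure; rewrite ?inE.
rewrite -EFinM lee_fin /eta mulrAC ler_pdivrMr// ler_wpM2l//; first exact: ltW.
by rewrite lerDl.
Qed.

End riemann_sums.

(** * The conditional expectation and the inequality *)

(** Markov's inequality and the Borel-Cantelli lemma. *)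
Lemma ae_eventually_le d (T : measurableType d) (R : realType) (Q : probability T R)
    (D : nat -> T -> \bar R) : (forall k, measurable_fun setT (D k)) ->
  (forall k w, 0 <= D k w) ->
  (forall k, \int[Q]_w D k w <= (harmonic k * (1 / (2 ^ k.+1)%:R))%:E) ->
  {ae Q, forall w, exists K, forall k, (K <= k)%N -> D k w <= (harmonic k)%:E}.
Proof.
move=> mD D0 ID; pose bad k := [set w | (harmonic k : R)%:E < D k w].
have mbad k : measurable (bad k).
  rewrite -[X in measurable X]setTI; exact: emeasurable_fun_o_infty.
have Qbad k : Q (bad k) <= (1 / (2 ^ k.+1)%:R)%:E.
  have h0 : (0 < harmonic k :> R)%R := @harmonic_gt0 R k.
  rewrite -(@lee_pmul2l _ (harmonic k)%:E)// ?lte_fin// -EFinM.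
  apply: le_trans (ID k).
  rewrite -[in leLHS](setIT (bad k)) -(integral_indic Q measurableT (mbad k)).
  rewrite -integralZ_ge0.
  - apply: integral_le_ge0.
    + apply: measurable_funeM; apply/measurable_EFinP; exact/measurable_indicP.
    + by move=> w; rewrite mule_ge0 ?lee_fin// ltW.
    + exact: mD.
    + move=> w; rewrite indicE; have [wb|_] := boolP (w \in bad k).
        by rewrite mule1 ltW//; move: wb; rewrite inE.
      by rewrite mule0.
  - exact: ltW.
  - apply/measurable_EFinP; exact/measurable_indicP.
  - by move=> w; rewrite lee_fin.
exists (lim_sup_set bad); split.
- by apply: bigcap_measurable => // n _; apply: bigcup_measurable => // k _; exact: mbad.
- apply: lim_sup_set_cvg0 => //; apply: (@le_lt_trans _ _ 1%:E); last exact: ltry.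
  apply: le_trans (epsilon_trick0 xpredT (ler01 : (0 <= 1 :> R)%R)).
  by apply: lee_nneseries => // k _; exact: Qbad.
move=> w /= nw n _; apply: contrapT => H; apply: nw; exists n => k nk.
by rewrite leNgt; apply/negP => b; apply: H; exists k.
Qed.

Lemma expN_tangent (R : realType) (a b : R) :
  (expR (- b) + b * expR (- b) <= expR (- a) + a * expR (- b))%R.
Proof.
have -> : expR (- a) = (expR (- b) * expR (b - a))%R by rewrite -expRD; congr expR; ring.
have e0 := expR_gt0 (- b); have := expR_ge1Dx (b - a) => h.
rewrite -subr_ge0.
have -> : (expR (- b) * expR (b - a) + a * expR (- b) - (expR (- b) + b * expR (- b)) =
  expR (- b) * (expR (b - a) - (1 + (b - a))))%R by ring.
by rewrite mulr_ge0 ?subr_ge0// ltW.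
Qed.

Lemma dist_le (R : realType) (a b e : R) :
  (a <= b + e -> b <= a + e -> `|a - b| <= e)%R.
Proof. by move=> h1 h2; rewrite ler_norml; apply/andP; split; lra. Qed.

Section conditional_expectation.
Context {R : realType} {d d' : measure_display}.
Context {Omega : measurableType d} {Omega' : measurableType d'}.
Context {S : ptopologicalType}.
Variables (Z : R -> Omega -> S) (F : set R -> set (set Omega)).
Variable P : R -> probability (borel S) R -> probability Omega R.
Variables (gamma beta : R).
Variables (X : R -> Omega' -> finmeas (borel S) R).
Variable G : set R -> set (set Omega').
Variable PX : R -> probability (finmeas (borel S) R) R -> probability Omega' R.
Hypothesis hZ : @markov_process R d _ Omega (borel S) Z F P.
Hypothesis hX : superprocess Z P gamma beta X G PX.
Hypothesis hgamma : (0 < gamma)%R.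
Hypothesis hbeta : (0 < beta <= 1)%R.

Local Notation FM := (finmeas (borel S) R).

Local Notation mass_sum l w := (@mass_sum R d' Omega' S X l w).
Local Notation tail A s q y := (@tail R d Omega S P A s q y).

Variables (r T : R) (z : borel S) (alpha : {finite_measure set R -> \bar R}).
Variable A : R.-ker Omega ~> R.
Variable J : Omega' -> \bar R.
Hypotheses (r0 : (0 <= r)%R) (rT : (r <= T)%R).
Hypothesis hA : calAT1 Z F P T A.
Hypothesis halpha : is_mean_measure (P r \d_z) A r T alpha.

Local Notation Q := (PX r \d_(\d_z : FM)).
Local Notation averaged_mass w := (@averaged_mass R d' Omega' S X r T alpha w).
Local Notation mean_spec j Fd := (@mean_spec R d' Omega' S X PX r z j Fd).
Local Notation H := (mass_sigma_algebra X r T).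

(** Both weighted means are Stieltjes integrals of the same function against
the same tail. *)
Lemma mean_spec_agree (j y : Omega' -> R) :
  mean_spec j (fun s => tail A r s z) -> mean_spec y (fun s => tail A r s z) ->
  forall l, sorted_after r l ->
  \int[Q]_w (j w * expR (- mass_sum l w))%:E = \int[Q]_w (y w * expR (- mass_sum l w))%:E.
Proof.
move=> [mj j0 jE js] [my y0 yE ys] l hl.
have [tailE tail0] := tail_calAT1 z r0 rT hA.
have F0 : (0 <= tail A r r z)%R.
  by rewrite -lee_fin -jE; apply: integral_ge0 => w _; rewrite lee_fin.
have := stieltjes_unique rT (mass_weight_modulus hZ hX hgamma hbeta z r0 hl) F0 tail0
  (js l hl) (ys l hl).
have fin (h : Omega' -> R) : measurable_fun setT h -> (forall w, 0 <= h w)%R ->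
    \int[Q]_w (h w)%:E = (tail A r r z)%:E ->
    \int[Q]_w ((h w)%:E * (expR (- mass_sum l w))%:E) \is a fin_num.
  move=> mh h0 hE; rewrite ge0_fin_numE; last first.
    by apply: integral_ge0 => w _; rewrite mule_ge0 ?lee_fin ?expR_ge0.
  apply: (@le_lt_trans _ _ (tail A r r z)%:E); last exact: ltry.
  rewrite -hE; apply: integral_le_ge0.
  - apply: emeasurable_funM; first exact/measurable_EFinP.
    by apply/measurable_EFinP; exact: (measurable_exp_mass_sum hX r0 hl).
  - by move=> w; rewrite mule_ge0 ?lee_fin ?expR_ge0.
  - exact/measurable_EFinP.
  - move=> w; rewrite -EFinM lee_fin ler_piMr//.
    by have /andP[] := exp_mass_sum_bounds X hl w.
move=> E; have E' : \int[Q]_w ((j w)%:E * (expR (- mass_sum l w))%:E) =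
    \int[Q]_w ((y w)%:E * (expR (- mass_sum l w))%:E).
  by rewrite -[LHS]fineK ?fin// -[RHS]fineK ?fin// E.
transitivity (\int[Q]_w ((j w)%:E * (expR (- mass_sum l w))%:E)).
  by apply: eq_integral => w _; rewrite EFinM.
by rewrite E'; apply: eq_integral => w _; rewrite EFinM.
Qed.

Lemma measurable_mass_sum_H l : mass_times r T l ->
  measurable_fun [set: g_sigma_algebraType
    [set C | exists (t : R) (B : set (\bar R)),
       [/\ (r <= t <= T)%R, measurable B & C = total_mass X t @^-1` B]]]
    (fun w => mass_sum l w).
Proof.
elim: l => [_|p l ih /= /andP[/andP[pT p0] hl]].
  rewrite (_ : (fun w => _) = fun=> 0%R); first exact: measurable_cst.
  by apply/funext => w; rewrite mass_sum_nil.
rewrite (_ : (fun w => _) = fun w => p.2 * mass (X p.1 w) + mass_sum l w)%R; last first.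
  by apply/funext => w; rewrite mass_sum_cons.
apply: measurable_funD; last exact: ih.
apply: measurable_funM; first exact: measurable_cst.
have mt : measurable_fun [set: g_sigma_algebraType
    [set C | exists (t : R) (B : set (\bar R)),
       [/\ (r <= t <= T)%R, measurable B & C = total_mass X t @^-1` B]]]
    (fun w => total_mass X p.1 w).
  move=> _ B mB; rewrite setTI; apply: sub_gen_smallest.
  by exists p.1, B.
have : measurable_fun [set: g_sigma_algebraType
    [set C | exists (t : R) (B : set (\bar R)),
       [/\ (r <= t <= T)%R, measurable B & C = total_mass X t @^-1` B]]]
    (fun w => fine (total_mass X p.1 w)).
  by apply: measurableT_comp; [exact: fine_measurable|exact: mt].
by [].
Qed.

Hypothesis hJ : J_functional Z P X F Q A J.

Lemma averaged_mass_cond_exp :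
  is_cond_exp Q H J (fun w => averaged_mass w) /\
  \int[Q]_w expeR (- averaged_mass w) <= \int[Q]_w expeR (- J w).
Proof.
have [j [jE js]] := mean_functional hZ hX hgamma hbeta r0 rT hA hJ.
have [y [yE ys]] := mean_spec_averaged_mass hZ hX hgamma hbeta r0 rT hA halpha.
have agr := mean_spec_agree js ys.
have [mj j0 jc _] := js; have [my y0 yc _] := ys.
have mJ : measurable_fun setT J by case: hJ.
have mY := measurable_averaged_mass hX T alpha r0.
have mj' : measurable_fun setT (fun w => (j w)%:E) by exact/measurable_EFinP.
have my' : measurable_fun setT (fun w => (y w)%:E) by exact/measurable_EFinP.
have e0 k : (0 < harmonic k * (1 / (2 ^ k.+1)%:R) :> R)%R.
  by rewrite mulr_gt0 ?harmonic_gt0// divr_gt0// ltr0n expn_gt0.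
have /choice[p hp] k := averaged_mass_approx hZ hX hgamma hbeta T z alpha r0 (e0 k).
have /choice[D hD] k := hp k; pose N k w := mass_sum (p k) w.
have cN : {ae Q, forall w, N k w @[k --> \oo] --> y w}.
  have aeD := ae_eventually_le (fun k => let: And5 _ h _ _ _ := hD k in h)
    (fun k => let: And5 _ _ h _ _ := hD k in h) (fun k => let: And5 _ _ _ h _ := hD k in h).
  apply: filterS2 yE aeD => w yw [K hK].
  apply/cvgrPdist_le => e e_gt0.
  have /cvgrPdist_le/(_ _ e_gt0)[K' _ hK'] := @cvg_harmonic R.
  exists (maxn K K') => // k /=; rewrite geq_max => /andP[Kk Kk'].
  have [_ _ _ _ /(_ w)[h1 h2]] := hD k; have Dk := hK k Kk.
  have := hK' k Kk'; rewrite sub0r normrN ger0_norm; last exact/ltW/harmonic_gt0.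
  apply: le_trans.
  have h1' : (y w <= N k w + harmonic k)%R.
    by rewrite -lee_fin -yw EFinD; apply: (le_trans h1); exact: leeD2l.
  have h2' : (N k w <= y w + harmonic k)%R.
    by rewrite -lee_fin EFinD -yw; apply: (le_trans h2); exact: leeD2l.
  exact: dist_le h1' h2'.
have adm k : admissible r (p k).
  by have [h _ _ _ _] := hD k; apply: sub_all h => q /andP[/andP[-> _] ->].
(* exp (- y) is not an exponential of a mass sum but an almost sure limit of
   such *)
have aexp : \int[Q]_w (j w * expR (- y w))%:E = \int[Q]_w (y w * expR (- y w))%:E.
  apply: (@agree_limit _ _ _ _ _ _ _ j y _ mj my j0 y0 jc yc (fun k w => expR (- N k w))%R
    (fun w => expR (- y w))%R).
  - by move=> k; exact: (unit_valued_exp hX r0 (adm k)).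
  - split; first by apply: measurableT_comp => //; exact: measurableT_comp.
    by move=> w; rewrite expR_ge0 -[leRHS]expR0 ler_expR oppr_le0 y0.
  - apply: filterS cN => w cw.
    have cw' : (- N k w)%R @[k --> \oo] --> (- y w)%R by exact: cvgN.
    exact: (cvg_comp _ _ cw' (@continuous_expR R _)).
  - move=> k; have [l' hl' E] := mass_sum_sort X (adm k).
    rewrite /agree; have := agr l' hl'.
    by under eq_integral do rewrite E; under [RHS]eq_integral do rewrite E.
split; [split|].
- apply/integrableP; split => //.
  have -> : \int[Q]_w `|J w| = (tail A r r z)%:E.
    rewrite -jc; apply: ge0_ae_eq_integral => //.
    + by apply: measurableT_comp.
    + by move=> w _; rewrite lee_fin.
    + by apply: filterS jE => w -> _; rewrite gee0_abs// lee_fin.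
  exact: ltry.
(* the upper limit is measurable whether or not the Riemann sums converge *)
- exists (fun w => limn_esup (fun k => (N k w)%:E)).
    move=> B mB.
    pose GT := g_sigma_algebraType [set C | exists (t : R) (B : set (\bar R)),
       [/\ (r <= t <= T)%R, measurable B & C = total_mass X t @^-1` B]].
    have m : measurable_fun [set: GT] (fun w => limn_esup (fun k => (N k w)%:E)).
      apply: (@measurable_fun_limn_esup _ GT R setT (fun k (w : GT) => (N k w)%:E)) => k.
      by apply/measurable_EFinP; apply: measurable_mass_sum_H; case: (hD k).
    by have := m measurableT B mB; rewrite setTI.
  apply: filterS2 yE cN => w -> cw.
  have cw' : (N k w)%:E @[k --> \oo] --> (y w)%:E by apply: cvg_EFin; [exact: nearW|].
  by rewrite (cvg_limn_einf_sup cw').2.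
- move=> C HC.
  have TC := @mass_sigma_algebra_thresholds _ _ _ _ X r T C HC.
  have mC : measurable C.
    exact: (measurable_threshold_sets hX r0 mj my j0 y0 jc yc agr TC).
  have E := agree_threshold_sets hX r0 mj my j0 y0 jc yc agr TC.
  transitivity (\int[Q]_(w in C) (y w)%:E).
    apply: ae_eq_integral => //; [exact: measurable_funTS|exact: measurable_funTS|].
    by apply: filterS yE => w -> _.
  rewrite -E; apply: ae_eq_integral => //; [exact: measurable_funTS|exact: measurable_funTS|].
  by apply: filterS jE => w -> _.
- have expE (K : Omega' -> \bar R) (k : Omega' -> R) :
      measurable_fun setT k -> (forall w, 0 <= k w)%R ->
      {ae Q, forall w, K w = (k w)%:E} ->
      \int[Q]_w expeR (- K w) = (rint Q (fun w => expR (- k w)))%:E.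
    move=> mk k0 KE; have be : bounded_nneg (fun w => expR (- k w))%R by exact: bounded_nneg_expN.
    apply: (etrans _ (rintE Q be)).
    apply: ge0_ae_eq_integral_nonmeas.
    + by case: be => mb _ _; exact/measurable_EFinP.
    + by move=> w; rewrite expeR_ge0.
    + by move=> w; rewrite lee_fin expR_ge0.
    + by apply: filterS KE => w ->.
  rewrite (expE _ _ my y0 yE) (expE _ _ mj j0 jE) lee_fin.
  have be (k : Omega' -> R) : measurable_fun setT k -> (forall w, 0 <= k w)%R ->
      bounded_nneg (fun w : Omega' => expR (- k w))%R by move=> *; exact: bounded_nneg_expN.
  have mexp (k : Omega' -> R) : measurable_fun setT k ->
      measurable_fun setT (fun w => (expR (- k w))%:E).
    by move=> mk; apply/measurable_EFinP; apply: measurableT_comp => //; exact: measurableT_comp.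
  have mprod (k : Omega' -> R) : measurable_fun setT k ->
      measurable_fun setT (fun w => (k w * expR (- y w))%:E).
    move=> mk; apply/measurable_EFinP; apply: measurable_funM => //.
    by apply: measurableT_comp => //; exact: measurableT_comp.
  have pos (k : Omega' -> R) w : (forall w, 0 <= k w)%R -> 0 <= (k w * expR (- y w))%:E.
    by move=> k0; rewrite lee_fin mulr_ge0 ?expR_ge0.
  have ineq : \int[Q]_w ((expR (- y w))%:E + (y w * expR (- y w))%:E) <=
      \int[Q]_w ((expR (- j w))%:E + (j w * expR (- y w))%:E).
    apply: integral_le_ge0.
    + by apply: emeasurable_funD; [exact: mexp|exact: mprod].
    + by move=> w; rewrite adde_ge0 ?pos// lee_fin expR_ge0.
    + by apply: emeasurable_funD; [exact: mexp|exact: mprod].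
    + by move=> w; rewrite -!EFinD lee_fin; exact: expN_tangent.
  have pe (k : Omega' -> R) w : 0 <= (expR (- k w))%:E by rewrite lee_fin expR_ge0.
  rewrite (integralD_ge0 Q (mexp y my) (pe y) (mprod y my) (fun w => pos y w y0)) in ineq.
  rewrite (integralD_ge0 Q (mexp j mj) (pe j) (mprod j mj) (fun w => pos j w j0)) in ineq.
  rewrite aexp (rintE Q (be y my y0)) (rintE Q (be j mj j0)) in ineq.
  have fin : \int[Q]_w (y w * expR (- y w))%:E \is a fin_num.
    rewrite ge0_fin_numE; last by apply: integral_ge0 => w _; exact: pos.
    apply: (@le_lt_trans _ _ (tail A r r z)%:E); last exact: ltry.
    rewrite -yc; apply: integral_le_ge0 => //; [exact: mprod|by move=> w; exact: pos|].
    by move=> w; rewrite lee_fin ler_piMr// -[leRHS]expR0 ler_expR oppr_le0.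
  by move: ineq; rewrite -(fineK fin) -!EFinD lee_fin lerD2r.
Qed.

End conditional_expectation.

Unset Implicit Arguments.

Theorem theorem3p4 (R : realType) (d d' : measure_display)
    (Omega : measurableType d) (Omega' : measurableType d')
    (S : ptopologicalType)
    (Z : R -> Omega -> S) (F : set R -> set (set Omega))
    (P : R -> probability (borel S) R -> probability Omega R)
    (gamma beta T : R)
    (X : R -> Omega' -> finmeas (borel S) R) (G : set R -> set (set Omega'))
    (PX : R -> probability (finmeas (borel S) R) R -> probability Omega' R)
    (A : R.-ker Omega ~> R)
    (r : R) (z : borel S)
    (alpha : {finite_measure set R -> \bar R})
    (J : Omega' -> \bar R)
    (hS : metrizable_luzin R S)
    (hZ : @markov_process R d _ Omega (borel S) Z F P)
    (hZr : right_process Z P)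
    (hT : (0 < T)%R) (hgamma : (0 < gamma)%R) (hbeta : (0 < beta <= 1)%R)
    (hX : superprocess Z P gamma beta X G PX)
    (hA : calAT1 Z F P T A)
    (hr : (0 <= r <= T)%R)
    (halpha : is_mean_measure (P r \d_z) A r T alpha)
    (hJ : J_functional Z P X F (PX r \d_(\d_z : finmeas (borel S) R)) A J) :
  is_cond_exp (PX r \d_(\d_z : finmeas (borel S) R))
    (mass_sigma_algebra X r T)
    J (fun w => \int[alpha]_(t in `[r, T]) total_mass X t w) /\
  \int[PX r \d_(\d_z : finmeas (borel S) R)]_w
      expeR (- \int[alpha]_(t in `[r, T]) total_mass X t w) <=
    \int[PX r \d_(\d_z : finmeas (borel S) R)]_w expeR (- J w).
Proof.
have /andP[r0 rT] := hr.
exact: (averaged_mass_cond_exp hZ hX hgamma hbeta r0 rT hA halpha hJ).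
Qed.
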